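(* Let $L,s>0$. Assume that $Q(\alpha|x)$ is in $\mathcal C_q(L,s)$ and $\lfloor s+1\rfloor\le p$. Suppose that assumptions (X), (F) and (K) stated in the context hold, with deterministic bandwidths $h=h_n>0$ and $h_q=h_{q,n}>0$ such that $h=O(h_q)$, $h_q\to0$ and $(\log n)/(nh^d)\to0$, and that the signed measure $K_q$ satisfies the conditions of the context. Then for any $x\in\mathcal X_0$ and $\alpha\in(\underline\alpha,\overline\alpha)$, $$\widehat q(\alpha|x)=q(\alpha|x)+O_{\mathbb P}\left(h_q^s+\frac1{(nh^dh_q)^{1/2}}\right)+\frac{\log^{3/4}n}{(nh^dh_q^2)^{1/4}}\,O_{\mathbb P}\left(\frac1{(nh_qh^d)^{1/2}}\right).$$
   Context: Data. $(X,Y)$ is a random pair with $X\in\mathbb R^d$ and $Y\in\mathbb R$; $(X_1,Y_1),\dots,(X_n,Y_n)$ are i.i.d. copies of $(X,Y)$. $F(y|x)$ is the conditional c.d.f. of $Y$ given $X=x$, $Q(\alpha|x)=\inf\{y:F(y|x)\ge\alpha\}$, and $q(\alpha|x)=\partial Q(\alpha|x)/\partial\alpha=1/f(Q(\alpha|x)|x)$ is the conditional quantile density function. $[\underline\alpha,\overline\alpha]\subset(0,1)$ is a fixed interval. $\|\cdot\|$ is the Euclidean norm. Assumption (X). $X$ has a Lebesgue density $f(\cdot)$ that is strictly positive and continuously differentiable over the compact support $\mathcal X$ of $X$. $\mathcal X_0$ is a compact subset of the interior of $\mathcal X$. Assumption (F). $F(\cdot|\cdot)$ has a continuous conditional density $f(y|x)$,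 strictly positive for $y\in\mathbb R$, $x\in\mathcal X$. The partial derivative $\partial F(y|x)/\partial x$ is continuous over $\mathbb R\times\mathcal X$. There is $L_0>0$ with $|f(y|x)-f(y'|x')|\le L_0\|(x,y)-(x',y')\|$ for all $(x,y),(x',y')\in\mathcal X\times\mathbb R$. Assumption (K). The nonnegative kernel $K:\mathbb R^d\to\mathbb R$ is Lipschitz, has compact support $\mathcal K$, satisfies $\int K(z)dz=1$ and, for some $\underline K>0$, $K(z)\ge\underline K\,\mathbb I(\|z\|\le1)$. The bandwidth $h$ lies in $[\underline h_n,\overline h_n]$ with $0<\underline h_n\le\overline h_n<\infty$, $\lim_n\overline h_n=0$, $\lim_n(\log n)/(n\underline h_n^d)=0$. Notation. For $\mathbf v\in\mathbb N^d$: $|\mathbf v|=v_1+\cdots+v_d$, $\mathbf v!=\prod_i v_i!$, $z^{\mathbf v}=\prod_i z_i^{v_i}$. $p$ is the (fixed) order of the local polynomial, $P$ is the number of $\mathbf v\in\mathbb N^d$ with $|\mathbf v|\le p$ (ordered lexicographically), $\mathbf U(z)=(z^{\mathbf v}/\mathbf v!,\ |\mathbf v|\le p)^T\in\mathbb R^P$. The loss is $\ell_\alpha(q)=|q|+(2\alpha-1)q=2q(\alpha-\mathbb I(q\le0))$. Local polynomial estimator: $\widehat{\mathbf b}(\alpha;h,x)$ is a minimizer over $\mathbf b\in\mathbb R^P$ of $\frac1{nh^d}\sum_{i=1}^n\ell_\alpha(Y_i-\mathbf U(X_i-x)^T\mathbf b)K(\frac{X_i-x}h)$, and $\widehat Q_h(\alpha|x)=\widehat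 b_{\mathbf 0}(\alpha;h,x)$. Quantile density estimator: $$\widehat q(\alpha|x)=\frac1{h_q}\int\widehat Q_h(\alpha+h_qt|x)\,dK_q(t)$$ (well defined for $n$ large), where $K_q$ is a signed measure over $\mathbb R$ with compact support such that $$\int|dK_q(t)|<\infty,\quad\int dK_q(t)=0,\quad\int t\,dK_q(t)=1,\quad\int t^j\,dK_q(t)=0\ \text{ for } j=2,\dots,\lfloor s\rfloor+1 .$$ Smoothness classes. $\lfloor s\rfloor$ denotes the lowest integer part of $s$: the unique integer with $\lfloor s\rfloor<s\le\lfloor s\rfloor+1$ (strict inequality on the left; in particular $\lfloor s+1\rfloor=\lfloor s\rfloor+1$). Put $b_{\mathbf v}(\alpha|x)=\partial^{|\mathbf v|}Q(\alpha|x)/\partial x_1^{v_1}\cdots\partial x_d^{v_d}$. $Q\in\mathcal C(L,\sigma)$ means: for all $\alpha\in[\underline\alpha,\overline\alpha]$, $x\mapsto Q(\alpha|x)$ is $\lfloor\sigma\rfloor$ times continuously differentiable over $\mathcal X$; and for all $|\mathbf v|=\lfloor\sigma\rfloor$, all $\alpha\in[\underline\alpha,\overline\alpha]$, all $x,x'\in\mathcal X$, $|b_{\mathbf v}(\alpha|x)-b_{\mathbf v}(\alpha|x')|\le L\|x-x'\|^{\sigma-\lfloor\sigma\rfloor}$. $Q\in\mathcal C_q(L,s)$ means: (1) $Q\in\mathcal C(L,s+1)$; (2) for each $x\in\mathcal X$, $\alpha\in[\underline\alpha,\overline\alpha]\mapsto q(\alpha|x)$ is $\lfloor s\rfloor$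 times differentiable; (3) for each $x\in\mathcal X$ and all $\alpha,\alpha'\in[\underline\alpha,\overline\alpha]$, $\left|\frac{\partial^{\lfloor s\rfloor}q(\alpha|x)}{\partial\alpha^{\lfloor s\rfloor}}-\frac{\partial^{\lfloor s\rfloor}q(\alpha'|x)}{\partial\alpha^{\lfloor s\rfloor}}\right|\le L|\alpha-\alpha'|^{s-\lfloor s\rfloor}$. *)

(* Defs.v *)
From HB Require Import structures.
From mathcomp Require Import all_boot all_order all_algebra.
From mathcomp Require Import finmap.
From mathcomp Require Import all_classical all_reals all_analysis measurable_realfun.
Set Implicit Arguments. Unset Strict Implicit. Unset Printing Implicit Defensive.
Import Order.TTheory GRing.Theory Num.Theory.
Import numFieldNormedType.Exports.
Local Open Scope classical_set_scope.
Local Open Scope ring_scope.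

(* 'rV[R]_d carrying its Borel sigma-algebra; as a topological and normed
   space it remains 'rV[R]_d, to which this alias is convertible. *)
Definition borel_rV (R : realType) (d : nat) :=
  g_sigma_algebraType (@open 'rV[R]_d).

Definition row_of_tuple (R : realType) d (t : d.-tuple R) : borel_rV R d :=
  \row_i tnth t i.

Definition cons_pair (R : realType) d (z : measurableTypeR R * d.-tuple R) :
    d.+1.-tuple R :=
  [tuple of z.1 :: z.2].

Lemma sigma_finite_product d1 d2 (T1 : measurableType d1)
    (T2 : measurableType d2) (R : realType)
    (m1 : {sigma_finite_measure set T1 -> \bar R})
    (m2 : {sigma_finite_measure set T2 -> \bar R}) :
  sigma_finite [set: T1 * T2] (m1 \x m2)%E.
Proof.
have /sigma_finiteP[F [TF ndF Foo]] := sigma_finiteT m1.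
have /sigma_finiteP[G [TG ndG Goo]] := sigma_finiteT m2.
exists (fun n => F n `*` G n).
  rewrite -setXTT TF TG predeqE => -[x y]; split=> [[/= [n _ Fnx] [k _ Gky]]|].
    exists (maxn n k) => //; split.
    - by move: x Fnx; exact/subsetPset/ndF/leq_maxl.
    - by move: y Gky; exact/subsetPset/ndG/leq_maxr.
  by move=> [n _ [/= ? ?]]; split; exists n.
move=> k; have [? ?] := Foo k; have [? ?] := Goo k.
split; first exact: measurableX.
by rewrite product_measure1E// lte_mul_pinfty// ge0_fin_numE.
Qed.

Section lebesgue_rV.
Variable R : realType.

Lemma measurable_row_of_tuple d :
  measurable_fun [set: d.-tuple R] (@row_of_tuple R d).
Proof.
have mball (c : 'rV[R]_d) (e : R) :
    measurable [set t : d.-tuple R | forall i, `|c 0 i - tnth t i| < e].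
  rewrite [X in measurable X](_ : _ = \bigcap_(i in [set: 'I_d])
      ((fun t => tnth t i) @^-1` [set y : R | `|c 0 i - y| < e])); last first.
    by apply/seteqP; split=> t /= H i; [move=> _|]; exact: H.
  apply: fin_bigcap_measurable => [|i _]; first exact: finite_finset.
  rewrite -[X in measurable X]setTI; apply: measurable_tnth => //.
  exact: measurable_ball.
apply: (measurability (@open 'rV[R]_d : set (set (borel_rV R d))))=> //.
move=> A [U oU <-]; rewrite setTI.
pose V (q : 'rV[rat]_d * nat) : set (d.-tuple R) :=
  [set t | forall i, `|ratr (q.1 0 i) - tnth t i| < q.2.+1%:R^-1].
pose good : set ('rV[rat]_d * nat) := [set q : 'rV[rat]_d * nat | forall v : 'rV[R]_d,
  (forall i, `|ratr (q.1 0 i) - v 0 i| < q.2.+1%:R^-1) -> U v].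
rewrite [X in measurable X](_ : _ = \bigcup_(q in good) V q).
  rewrite bigcup_mkcond; apply: countable_bigcupT_measurable => [|q].
    exact: countableP.
  case: ifP => // _.
  have := mball (map_mx ratr q.1) q.2.+1%:R^-1.
  by congr measurable; apply/seteqP; split=> t /= H i; have := H i; rewrite mxE.
apply/seteqP; split => [t Ut|t [q gq Vt]] /=; last first.
  by apply: gq => i; rewrite mxE; exact: Vt.
have := oU; rewrite openE => /(_ _ Ut)/nbhs_ballP[e /= e0 eU].
have [k ke] : exists k : nat, k.+1%:R^-1 < e / 2.
  have e20 : 0 < e / 2 by rewrite divr_gt0.
  exists (Num.truncn (e / 2)^-1).
  by rewrite invf_plt ?posrE// truncnS_gt.
have qE (i : 'I_d) : {q : rat | `|ratr q - tnth t i| < k.+1%:R^-1}.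
  apply: cid.
  have [] := @dense_rat R (ball (tnth t i) k.+1%:R^-1).
  - by exists (tnth t i); apply: ballxx; rewrite invr_gt0.
  - exact: ball_open.
  - by move=> x [/= bx [q _ qx]]; exists q; rewrite qx distrC.
exists (\row_i sval (qE i), k) => /=; last first.
  by move=> i /=; rewrite mxE; exact: svalP (qE i).
move=> v /= vq; apply: eU; split => // i j; rewrite ord1 /ball /= mxE.
have := vq j; rewrite mxE => vqj.
rewrite (le_lt_trans (ler_distD (ratr (sval (qE j))) _ _))//.
rewrite (splitr e) ltrD// ?(lt_trans vqj)//.
by rewrite distrC (lt_trans (svalP (qE j))).
Qed.

Lemma measurable_cons_pair d :
  measurable_fun [set: measurableTypeR R * d.-tuple R] (@cons_pair R d).
Proof. exact: measurable_cons. Qed.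

Section cons_measure.
Variables (d : nat) (m1 : {sigma_finite_measure set (measurableTypeR R) -> \bar R}).
Variable m2 : {sigma_finite_measure set (d.-tuple R) -> \bar R}.

Definition cons_measure : set (d.+1.-tuple R) -> \bar R :=
  pushforward (m1 \x m2)%E (@cons_pair R d).

Let cons_measure0 : cons_measure set0 = 0%E.
Proof. by have mf := @measurable_cons_pair d; exact: measure0. Qed.

Let cons_measure_ge0 A : (0 <= cons_measure A)%E.
Proof. by have mf := @measurable_cons_pair d; exact: measure_ge0. Qed.

Let cons_measure_sigma_additive : semi_sigma_additive cons_measure.
Proof.
by have mf := @measurable_cons_pair d; exact: measure_semi_sigma_additive.
Qed.

HB.instance Definition _ := isMeasure.Build _ _ _ cons_measure
  cons_measure0 cons_measure_ge0 cons_measure_sigma_additive.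

Lemma cons_measure_sigma_finite : sigma_finite [set: d.+1.-tuple R] cons_measure.
Proof.
have [F FT Foo] := sigma_finite_product m1 m2.
pose g (t : d.+1.-tuple R) := (thead t, [tuple of behead t]).
have mg : measurable_fun setT g.
  by apply: measurable_fun_pair; [exact: measurable_tnth|exact: measurable_behead].
have gK z : g (cons_pair z) = z.
  by case: z => a t; rewrite /g /cons_pair /= theadE; congr pair; apply/val_inj.
exists (fun n => g @^-1` F n).
  by rewrite -preimage_bigcup -FT preimage_setT.
move=> n; have [mF Fn] := Foo n; split.
  by rewrite -[X in measurable X]setTI; exact: mg.
rewrite /cons_measure /pushforward -comp_preimage.
by rewrite (_ : g \o _ = id)// funeqE.
Qed.

HB.instance Definition _ := Measure_isSigmaFinite.Build _ _ _ cons_measure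
  cons_measure_sigma_finite.
End cons_measure.

Fixpoint lebesgue_tuple (d : nat) : {sigma_finite_measure set (d.-tuple R) -> \bar R} :=
  match d return {sigma_finite_measure set (d.-tuple R) -> \bar R} with
  | 0%N => dirac ([tuple] : 0.-tuple R)
  | d'.+1 => cons_measure (@lebesgue_measure R) (lebesgue_tuple d')
  end.

(* Lebesgue measure on R^d: the d-fold product of the one-dimensional Lebesgue
   measure, transported from d-tuples to row vectors; see lebesgue_rV_box. *)
Section lebesgue_rV_measure.
Variable d : nat.

Definition lebesgue_rV : set (borel_rV R d) -> \bar R :=
  pushforward (lebesgue_tuple d) (@row_of_tuple R d).

Let lebesgue_rV0 : lebesgue_rV set0 = 0%E.
Proof. by have mf := @measurable_row_of_tuple d; exact: measure0. Qed.

Let lebesgue_rV_ge0 A : (0 <= lebesgue_rV A)%E.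
Proof. by have mf := @measurable_row_of_tuple d; exact: measure_ge0. Qed.

Let lebesgue_rV_sigma_additive : semi_sigma_additive lebesgue_rV.
Proof.
by have mf := @measurable_row_of_tuple d; exact: measure_semi_sigma_additive.
Qed.

HB.instance Definition _ := isMeasure.Build _ _ _ lebesgue_rV
  lebesgue_rV0 lebesgue_rV_ge0 lebesgue_rV_sigma_additive.
End lebesgue_rV_measure.

Lemma lebesgue_rV_box d (a b : 'rV[R]_d) : (forall i, a 0 i <= b 0 i) ->
  lebesgue_rV [set v : 'rV[R]_d | forall i, v 0 i \in `[a 0 i, b 0 i]] =
  (\prod_i (b 0 i - a 0 i))%:E.
Proof.
rewrite /lebesgue_rV /pushforward => ab.
have -> : row_of_tuple (d:=d) @^-1`
      [set v : 'rV[R]_d | forall i, v 0 i \in `[a 0 i, b 0 i]] =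
    [set t | forall i, tnth t i \in `[a 0 i, b 0 i]].
  by apply/seteqP; split=> t /= H i; have := H i; rewrite mxE.
elim: d a b ab => [|d IH] a b ab /=.
  by rewrite big_ord0 diracE mem_set//= => -[].
rewrite /cons_measure /pushforward.
pose a' : 'rV[R]_d := \row_i a 0 (lift ord0 i).
pose b' : 'rV[R]_d := \row_i b 0 (lift ord0 i).
set C := [set t | _].
have -> : cons_pair (d:=d) @^-1` C =
    `[a 0 ord0, b 0 ord0]%classic `*`
    [set t | forall i, tnth t i \in `[a' 0 i, b' 0 i]].
  apply/seteqP; split => [[x t] /= H|[x t] /= [H1 H2] i].
    split; first by have := H ord0; rewrite tnth0.
    by move=> i; have := H (lift ord0 i); rewrite tnthS !mxE.
  case: (unliftP ord0 i) => [j ->|->]; last by rewrite tnth0.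
  by have := H2 j; rewrite tnthS !mxE.
rewrite product_measure1E//=; last first.
  rewrite [X in measurable X](_ : _ = \bigcap_(i in [set: 'I_d])
      ((fun t => tnth t i) @^-1` `[a' 0 i, b' 0 i]%classic)); last first.
    by apply/seteqP; split=> t /= H i; [move=> _|]; exact: H.
  apply: fin_bigcap_measurable => [|i _]; first exact: finite_finset.
  by rewrite -[X in measurable X]setTI; apply: measurable_tnth.
rewrite IH => [|i]; last by rewrite !mxE.
rewrite lebesgue_measure_itv/= lte_fin big_ord_recl EFinM.
congr (_ * _)%E; last by congr (_%:E); apply: eq_bigr => i _; rewrite !mxE.
by case: ltgtP (ab ord0) => //= ->; rewrite subrr.
Qed.
End lebesgue_rV.

Definition enorm (R : realType) (d : nat) (x : 'rV[R]_d) : R :=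
  Num.sqrt (\sum_(i < d) x 0 i ^+ 2).

(* The integer k with k < s <= k + 1 (so sfloor 1 = 0), for 0 < s. *)
Definition sfloor (R : realType) (s : R) : nat := (absz (Num.ceil s)).-1.

Lemma sfloorP (R : realType) (s : R) : 0 < s ->
  (sfloor s)%:R < s <= (sfloor s).+1%:R.
Proof.
move=> s0; rewrite /sfloor.
have c0 : 0 < Num.ceil s by rewrite ceil_gt0.
have [n nE] : exists n : nat, Num.ceil s = n.+1%:Z.
  by case: (Num.ceil s) c0 => [[|n]|n]// _; exists n.
have := ceil_itv s; rewrite nE intrB /= => /andP[h1 h2].
by rewrite (le_trans h2)// andbT (le_lt_trans _ h1)// -pmulrn -natr1 addrK.
Qed.

Section smoothness.
Variables (R : realType) (d : nat).
Implicit Types (A : set 'rV[R]_d) (v : {ffun 'I_d -> nat}).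

Definition mdeg v : nat := (\sum_(i < d) v i)%N.

Definition mincr v (i : 'I_d) : {ffun 'I_d -> nat} :=
  [ffun j => (v j + (j == i))%N].

(* g is k times continuously differentiable over A with partial derivatives
   b v = d^|v| g / dx^v, |v| <= k: differentiation takes place in the interior
   of A, and the derivatives extend continuously to A. *)
Definition is_partials A (k : nat) (g : 'rV[R]_d -> R)
    (b : {ffun 'I_d -> nat} -> 'rV[R]_d -> R) : Prop :=
  [/\ {in A, b [ffun=> 0%N] =1 g},
      forall v, (mdeg v <= k)%N -> {within A, continuous (b v)} &
      forall v i x, (mdeg v < k)%N -> interior A x ->
        is_derive x (delta_mx 0 i : 'rV[R]_d) (b v) (b (mincr v i) x)].

Definition in_C A (alo ahi L sigma : R) (Q : R -> 'rV[R]_d -> R) : Prop :=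
  forall alpha, alo <= alpha <= ahi -> exists2 b,
    is_partials A (sfloor sigma) (Q alpha) b &
    forall v x x', mdeg v = sfloor sigma -> A x -> A x' ->
      `|b v x - b v x'| <= L * enorm (x - x') `^ (sigma - (sfloor sigma)%:R).

(* D j is the j-th derivative of g over [a, b], j <= k, one-sided at a and b. *)
Definition is_derivatives_itv (a b : R) (k : nat) (g : R -> R)
    (D : nat -> R -> R) : Prop :=
  {in `[a, b], D 0%N =1 g} /\
  forall j t, (j < k)%N -> t \in `[a, b] ->
    (D j u - D j t) / (u - t) @[u --> within `[a, b]%classic t^'] --> D j.+1 t.

Definition quantile_density (Q : R -> 'rV[R]_d -> R) (alpha : R) (x : 'rV[R]_d) : R :=
  derive1 (Q ^~ x) alpha.

Definition in_Cq A (alo ahi L s : R) (Q : R -> 'rV[R]_d -> R) : Prop :=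
  in_C A alo ahi L (s + 1) Q /\
  forall x, A x -> exists2 D,
    is_derivatives_itv alo ahi (sfloor s) (quantile_density Q ^~ x) D &
    forall a a', a \in `[alo, ahi] -> a' \in `[alo, ahi] ->
      `|D (sfloor s) a - D (sfloor s) a'|
        <= L * `|a - a'| `^ (s - (sfloor s)%:R).

End smoothness.

Section signed_measure.
Context (R : realType) (nu : {charge set R -> \bar R}).

Lemma hahn_exists : exists PN : set R * set R, hahn_decomposition nu PN.1 PN.2.
Proof. by have [P [N h]] := Hahn_decomposition nu; exists (P, N). Qed.

Definition hahn := projT2 (cid hahn_exists).

Definition charge_integral (f : R -> R) : R :=
  \int[jordan_pos hahn]_t f t - \int[jordan_neg hahn]_t f t.

Definition charge_tv : set R -> \bar R := charge_variation hahn.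

(* Finite total variation is automatic, charges being finite-valued. *)
Definition assumption_Kq (s : R) : Prop :=
  [/\ exists T : R, charge_tv (~` `[- T, T]) = 0%E,
      (charge_tv setT < +oo)%E,
      charge_integral (cst 1) = 0,
      charge_integral id = 1 &
      forall j : nat, (2 <= j <= (sfloor s).+1)%N ->
        charge_integral (fun t => t ^+ j) = 0].

End signed_measure.

Section model.
Context (R : realType) (d : nat) (disp : measure_display).
Context (Omega : measurableType disp) (P : probability Omega R).
Local Notation Rd := (borel_rV R d).

Definition law_support (mu : set Rd -> \bar R) : set 'rV[R]_d :=
  [set x | forall U : set 'rV[R]_d, open U -> U x -> (0 < mu U)%E].

(* Mutual independence of the pairs (Xs i, Ys i), each with the law of (X, Y). *)
Definition iid_copies (X : {RV P >-> Rd}) (Y : {RV P >-> R})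
    (Xs : nat -> {RV P >-> Rd}) (Ys : nat -> {RV P >-> R}) : Prop :=
  (forall i (C : set (Rd * R)), measurable C ->
     P [set w | C (Xs i w, Ys i w)] = P [set w | C (X w, Y w)]) /\
  (forall (J : {fset nat}) (C : nat -> set (Rd * R)),
     (forall i, measurable (C i)) ->
     P (\bigcap_(i in [set` J]) [set w | C i (Xs i w, Ys i w)]) =
     (\prod_(i <- J) P [set w | C i (Xs i w, Ys i w)])%E).

(* k x is the conditional law of Y given X = x. *)
Definition cond_law (X : {RV P >-> Rd}) (Y : {RV P >-> R})
    (k : R.-pker Rd ~> R) : Prop :=
  forall (A : set Rd) (B : set R), measurable A -> measurable B ->
    P [set w | A (X w) /\ B (Y w)] = (\int[distribution P X]_(x in A) k x B)%E.

Definition cond_cdf (k : R.-pker Rd ~> R) (y : R) (x : 'rV[R]_d) : R :=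
  fine (k x `]-oo, y]%classic).

Definition cond_quantile (F : R -> 'rV[R]_d -> R) (alpha : R) (x : 'rV[R]_d) : R :=
  inf [set y | alpha <= F y x].

Definition assumption_X (X : {RV P >-> Rd}) (f : Rd -> R)
    (X0 : set 'rV[R]_d) : Prop :=
  let S := law_support (distribution P X) in
  [/\ compact S,
      [/\ measurable_fun setT f, (forall x, 0 <= f x) &
          forall A : set Rd, measurable A ->
            P (X @^-1` A) = (\int[@lebesgue_rV R d]_(x in A) (f x)%:E)%E],
      (forall x, S x -> 0 < f x) /\ (exists b, is_partials S 1 f b),
      compact X0 &
      X0 `<=` interior S].

Definition assumption_F (S : set 'rV[R]_d) (F f : R -> 'rV[R]_d -> R) : Prop :=
  [/\ forall x y, S x ->
        (F y x)%:E = (\int[lebesgue_measure]_(u in `]-oo, y]) (f u x)%:E)%E,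
      {within [set: R] `*` S, continuous (fun z : R * 'rV[R]_d => f z.1 z.2)} /\
      (forall y x, S x -> 0 < f y x),
      exists dF : 'I_d -> R -> 'rV[R]_d -> R, forall i,
        {within [set: R] `*` S,
          continuous (fun z : R * 'rV[R]_d => dF i z.1 z.2)} /\
        (forall y x, interior S x ->
          is_derive x (delta_mx 0 i : 'rV[R]_d) (F y) (dF i y x)) &
      exists2 L0 : R, 0 < L0 & forall y y' x x', S x -> S x' ->
        `|f y x - f y' x'|
          <= L0 * Num.sqrt (enorm (x - x') ^+ 2 + (y - y') ^+ 2)].

Definition assumption_K (K : 'rV[R]_d -> R) (hlo hhi : nat -> R) : Prop :=
  [/\ (forall z, 0 <= K z) /\
        (exists C : R, forall z z', `|K z - K z'| <= C * enorm (z - z')),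
      compact (closure [set z | K z != 0]),
      (\int[@lebesgue_rV R d]_z (K z)%:E = 1)%E,
      exists2 Klo : R, 0 < Klo & forall z, Klo * \1_[set u | enorm u <= 1] z <= K z &
      [/\ forall n, 0 < hlo n <= hhi n, hhi @ \oo --> (0 : R) &
        (fun n : nat => ln n%:R / (n%:R * hlo n ^+ d)) @ \oo --> (0 : R)]].

(* Z n = O_P(a n). The event is only required to contain a measurable event of
   large probability, so that Z n need not be assumed measurable; see
   OP_measurable. *)
Definition OP (Z : nat -> Omega -> R) (a : nat -> R) : Prop :=
  forall eps : R, 0 < eps -> exists M : R, \forall n \near \oo,
    exists A : set Omega, [/\ measurable A, (P A >= (1 - eps)%:E)%E &
      forall w, A w -> `|Z n w| <= M * a n].

Lemma OP_measurable (Z : nat -> Omega -> R) (a : nat -> R) :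
  (forall n, measurable_fun setT (Z n)) ->
  OP Z a <-> forall eps : R, 0 < eps -> exists M : R, \forall n \near \oo,
    (P [set w | (`|Z n w| <= M * a n)%R] >= (1 - eps)%:E)%E.
Proof.
move=> mZ.
have mE M n : measurable [set w | `|Z n w| <= M * a n].
  rewrite [X in measurable X](_ : _ =
      (fun w => `|Z n w|) @^-1` `]-oo, M * a n]%classic); last first.
    by apply/seteqP; split=> w /=; rewrite in_itv.
  by rewrite -[X in measurable X]setTI; apply: measurableT_comp.
split=> H e /H[M HM]; exists M; near=> n.
  have [A [mA PA HA]] : exists A : set Omega, [/\ measurable A,
    (P A >= (1 - e)%:E)%E & forall w, A w -> `|Z n w| <= M * a n] by near: n.
  by apply: (le_trans PA); apply: le_measure; rewrite ?inE.
by exists [set w | `|Z n w| <= M * a n]; split => //; near: n.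
Unshelve. all: by end_near. Qed.

End model.

Section estimators.
Variables (R : realType) (d p : nat).

(* The multi-indices v in N^d with |v| <= p; R^P is {ffun mindex -> R}, with
   coordinates indexed by the multi-indices themselves. *)
Definition mindex : Type :=
  {v : {ffun 'I_d -> 'I_p.+1} | (\sum_(i < d) v i <= p)%N}.

Lemma mindex0_subproof : (\sum_(i < d) [ffun=> ord0 : 'I_p.+1] i <= p)%N.
Proof. by rewrite big1// => i _; rewrite ffunE. Qed.

Definition mindex0 : mindex := Sub [ffun=> ord0] mindex0_subproof.

Definition monomials (z : 'rV[R]_d) : {ffun mindex -> R} :=
  [ffun v : mindex =>
    (\prod_(i < d) z 0 i ^+ val v i) / (\prod_(i < d) (val v i)`!)%:R].

Definition loss (alpha q : R) : R := `|q| + (2 * alpha - 1) * q.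

Definition objective (K : 'rV[R]_d -> R) (n : nat) (xs : nat -> 'rV[R]_d)
    (ys : nat -> R) (alpha h : R) (x : 'rV[R]_d) (b : {ffun mindex -> R}) : R :=
  (n%:R * h ^+ d)^-1 * \sum_(i < n)
    loss alpha (ys i - \sum_v monomials (xs i - x) v * b v) *
    K (h^-1 *: (xs i - x)).

Context (disp : measure_display) (Omega : measurableType disp).
Context (P : probability Omega R).

(* bhat n alpha h x w selects a minimizer; the selection depends measurably on
   alpha, so that the integral defining q_hat makes sense. Nothing is assumed on
   the selection for alpha outside ]0, 1[ besides measurability. *)
Definition is_local_polynomial (K : 'rV[R]_d -> R)
    (Xs : nat -> {RV P >-> borel_rV R d}) (Ys : nat -> {RV P >-> R})
    (bhat : nat -> R -> R -> 'rV[R]_d -> Omega -> {ffun mindex -> R}) : Prop :=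
  forall n h x w, 0 < h ->
    (forall alpha, 0 < alpha < 1 -> forall b,
      objective K n (Xs ^~ w) (Ys ^~ w) alpha h x (bhat n alpha h x w)
        <= objective K n (Xs ^~ w) (Ys ^~ w) alpha h x b) /\
    (forall v, measurable_fun [set: R] (fun alpha => bhat n alpha h x w v)).

Definition Q_hat (bhat : nat -> R -> R -> 'rV[R]_d -> Omega -> {ffun mindex -> R})
    (n : nat) (h alpha : R) (x : 'rV[R]_d) (w : Omega) : R :=
  bhat n alpha h x w mindex0.

Definition q_hat (Kq : {charge set R -> \bar R})
    (bhat : nat -> R -> R -> 'rV[R]_d -> Omega -> {ffun mindex -> R})
    (n : nat) (h hq alpha : R) (x : 'rV[R]_d) (w : Omega) : R :=
  hq^-1 * charge_integral Kq (fun t => Q_hat bhat n h (alpha + hq * t) x w).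

End estimators.

(* Main.v *)
Require Import Defs.
From HB Require Import structures.
From mathcomp Require Import all_boot all_order all_algebra.
From mathcomp Require Import finmap.
From mathcomp Require Import all_classical all_reals all_analysis measurable_realfun.
From mathcomp Require Import ring lra.
Set Implicit Arguments.
Unset Strict Implicit.
Unset Printing Implicit Defensive.
Import Order.TTheory GRing.Theory Num.Theory.
Import numFieldNormedType.Exports.
Local Open Scope classical_set_scope.
Local Open Scope ring_scope.

(** The quantile density estimator integrates the local polynomial quantile
    estimator against a charge that reproduces a first derivative. Its error is
    therefore governed by the way the quantile estimator fluctuates as a process
    in the level, and the proof rests on a Bahadur representation that is uniform
    in the level ([bahadur], [local_bahadur]). With N = n h^d and
    r = sqrt (ln n / N), the error of the quantile estimator at level a is

      - W(a) / (f(Q(a|x)|x) N) + O(r^(3/2) + h^(s+1)) + small terms,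

    where W(a) is a sum of independent centred variables: a linear combination of
    the kernel weights times 1(F(Y|X) <= a) - a.

    Under the integral with step hq, Kq annihilates the constant W(alpha) and only
    the increments of W remain. As F(Y|X) is uniform given X, those over a distance
    hq have standard deviation sqrt (N hq), and after division by N hq they
    contribute (N hq)^(-1/2). The remainder contributes r^(3/2) / hq, which is
    the product of the logarithmic factor with (N hq)^(-1/2) ([rate_identity]).
    The Taylor expansion of Q in the level ([level_taylor]) contributes hq^s, and
    so does the bias h^(s+1) / hq, because h = O(hq).

    For the representation, the objective is convex and its subgradient is the
    score, a sum of indicators 1(Y <= polynomial). Three facts are combined.
    The mean score is strongly monotone in the coefficients
    ([score_strongly_monotone]): the density is bounded below, and a polynomial
    is bounded below by its coefficients on a set of positive volume
    ([peval_lower]). The centred score has a uniform modulus of continuity of order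
    sqrt (N rho ln n) over distances rho ([modulus], from [bernstein] on a grid).
    The mean score is linear up to the variation of the density
    ([score_linearization]). Monotonicity places the minimizer within r of the
    Taylor polynomial of Q ([rate]); at that distance the modulus is N r^(3/2),
    and the linearized first order condition is solved for the intercept with the
    dual vector of the design matrix ([design_dual]).

    The Taylor polynomials are those of [taylor_remainder], with coefficients
    bounded uniformly in the level ([taylor_coefs]). The events have probability
    1 - O(1/n), and the increments of W are bounded by Markov's inequality
    ([quantile_density_error]). *)

(** * Integrals of bounded measurable functions *)

Section bounded_measurable.
Context d (T : measurableType d) (R : realType).
Implicit Types f g : T -> R.

(** Every integrand below is a bounded measurable function integrated against a
    finite measure, so that integrability is never an issue. *)
Definition bmf f := measurable_fun setT f /\ exists b, forall t, `|f t| <= b.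

Lemma bmf_meas f : bmf f -> measurable_fun setT f. Proof. by case. Qed.

Lemma bmf_cst (r : R) : bmf (fun=> r).
Proof. by split=> //; exists `|r|. Qed.

Lemma bmfD f g : bmf f -> bmf g -> bmf (fun t => f t + g t).
Proof.
move=> [mf [b fb]] [mg [c gc]]; split; first exact: measurable_funD.
by exists (b + c) => t; rewrite (le_trans (ler_normD _ _))// lerD.
Qed.

Lemma bmfM f g : bmf f -> bmf g -> bmf (fun t => f t * g t).
Proof.
move=> [mf [b fb]] [mg [c gc]]; split; first exact: measurable_funM.
by exists (b * c) => t; rewrite normrM ler_pM.
Qed.

Lemma bmfZ (r : R) f : bmf f -> bmf (fun t => r * f t).
Proof. by move=> bf; apply: bmfM => //; exact: bmf_cst. Qed.

Lemma bmfB f g : bmf f -> bmf g -> bmf (fun t => f t - g t).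
Proof.
move=> bf bg; have := bmfD bf (bmfZ (-1) bg).
by under eq_fun do rewrite mulN1r.
Qed.

Lemma bmf_norm f : bmf f -> bmf (fun t => `|f t|).
Proof.
move=> [mf [b fb]]; split; first exact: measurableT_comp.
by exists b => t; rewrite normr_id.
Qed.

Lemma bmf_indic (A : set T) : measurable A -> bmf (\1_A : T -> R).
Proof.
move=> mA; split; first exact: measurable_indic.
by exists 1 => t; rewrite indicE; case: (_ \in _); rewrite ?normr1 ?normr0.
Qed.

Lemma measurable_le_set f g : measurable_fun setT f -> measurable_fun setT g ->
  measurable [set t | f t <= g t].
Proof.
move=> mf mg; rewrite -[X in measurable X]setTI.
have -> : [set t | f t <= g t] = (fun t => g t - f t) @^-1` `[0, +oo[%classic.
  by apply/seteqP; split => t /=; rewrite in_itv/= andbT subr_ge0.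
have mgf : measurable_fun setT (fun t => g t - f t) by exact: measurable_funB.
exact: mgf.
Qed.

Lemma bmf_le f g : measurable_fun setT f -> measurable_fun setT g ->
  bmf (fun t => (f t <= g t)%R%:R).
Proof.
move=> mf mg; have := bmf_indic (measurable_le_set mf mg).
congr bmf; apply/funext => t; rewrite indicE.
by congr (nat_of_bool _)%:R; apply/idP/idP; rewrite inE.
Qed.

Lemma bmf_sum I (s : seq I) (Q : pred I) (F : I -> T -> R) :
  (forall i, bmf (F i)) -> bmf (fun t => \sum_(i <- s | Q i) F i t).
Proof.
move=> bF; elim: s => [|i s IH].
  by under eq_fun do rewrite big_nil; exact: bmf_cst.
under eq_fun do rewrite big_cons.
by case: (Q i) => //; exact: bmfD.
Qed.

Lemma bmf_prod I (s : seq I) (Q : pred I) (F : I -> T -> R) :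
  (forall i, bmf (F i)) -> bmf (fun t => \prod_(i <- s | Q i) F i t).
Proof.
move=> bF; elim: s => [|i s IH].
  by under eq_fun do rewrite big_nil; exact: bmf_cst.
under eq_fun do rewrite big_cons.
by case: (Q i) => //; exact: bmfM.
Qed.

Lemma bmf_expR f : bmf f -> bmf (fun t => expR (f t)).
Proof.
move=> [mf [b fb]]; split; first exact: (measurableT_comp (@measurable_expR R) mf).
exists (expR b) => t; rewrite ger0_norm ?expR_ge0// ler_expR.
exact: le_trans (ler_norm _) (fb t).
Qed.

End bounded_measurable.

Lemma bmf_comp d d' (T : measurableType d) (T' : measurableType d') (R : realType)
    (f : T' -> R) (phi : T -> T') :
  measurable_fun setT phi -> bmf f -> bmf (fun t => f (phi t)).
Proof.
move=> mphi [mf [b fb]]; split; first exact: (measurableT_comp mf mphi).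
by exists b.
Qed.

Section bounded_integral.
Context d (T : measurableType d) (R : realType).
Variable mu : {finite_measure set T -> \bar R}.
Implicit Types f g : T -> R.

Definition Ex f : R := \int[mu]_t f t.

Lemma bmf_integrable f : bmf f -> mu.-integrable setT (EFin \o f).
Proof.
move=> [mf [b fb]]; apply: measurable_bounded_integrable => //.
  by rewrite ltey_eq fin_num_measure.
exists b; split; first exact: num_real.
by move=> c bc t _ /=; rewrite (le_trans _ (ltW bc)).
Qed.

Lemma eq_Ex f g : f =1 g -> Ex f = Ex g.
Proof. by move=> fg; congr Ex; apply/funext. Qed.

Lemma ExD f g : bmf f -> bmf g -> Ex (fun t => f t + g t) = Ex f + Ex g.
Proof. by move=> bf bg; apply: RintegralD => //; exact: bmf_integrable. Qed.

Lemma ExB f g : bmf f -> bmf g -> Ex (fun t => f t - g t) = Ex f - Ex g.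
Proof. by move=> bf bg; apply: RintegralB => //; exact: bmf_integrable. Qed.

Lemma ExZ r f : bmf f -> Ex (fun t => r * f t) = r * Ex f.
Proof. by move=> bf; apply: RintegralZl => //; exact: bmf_integrable. Qed.

Lemma Ex_sum I (s : seq I) (Q : pred I) (F : I -> T -> R) :
  (forall i, bmf (F i)) ->
  Ex (fun t => \sum_(i <- s | Q i) F i t) = \sum_(i <- s | Q i) Ex (F i).
Proof.
move=> bF; elim: s => [|i s IH].
  rewrite big_nil (eq_Ex (g := fun=> 0)); last by move=> t; rewrite big_nil.
  by rewrite /Ex /Rintegral integral0.
rewrite big_cons -IH; case: ifP => Qi.
  rewrite -ExD//; last exact: bmf_sum.
  by apply: eq_Ex => t; rewrite big_cons Qi.
by apply: eq_Ex => t; rewrite big_cons Qi.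
Qed.

Lemma le_Ex f g : bmf f -> bmf g -> (forall t, f t <= g t) -> Ex f <= Ex g.
Proof. by move=> bf bg fg; apply: le_Rintegral => //; exact: bmf_integrable. Qed.

Lemma Ex_ge0 f : (forall t, 0 <= f t) -> 0 <= Ex f.
Proof. by move=> f0; apply: Rintegral_ge0. Qed.

Lemma Ex_norm f : bmf f -> `|Ex f| <= Ex (fun t => `|f t|).
Proof. by move=> bf; apply: le_normr_Rintegral => //; exact: bmf_integrable. Qed.

Lemma Ex_indic A : measurable A -> Ex \1_A = fine (mu A).
Proof. by move=> mA; rewrite /Ex /Rintegral integral_indic// setIT. Qed.

Lemma Ex_cst r : Ex (fun=> r) = r * fine (mu setT).
Proof. by rewrite /Ex Rintegral_cst. Qed.

Lemma Ex_markov f a : bmf f -> (forall t, 0 <= f t) -> 0 < a ->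
  fine (mu [set t | a <= f t]) <= Ex f / a.
Proof.
move=> bf f0 a0.
have mA : measurable [set t | a <= f t] by apply: measurable_le_set => //; case: bf.
rewrite -Ex_indic// ler_pdivlMr// mulrC -ExZ; last exact: bmf_indic.
apply: le_Ex => //; first exact/bmfZ/bmf_indic.
move=> t; rewrite indicE; case: (boolP (t \in _)) => [/set_mem/= H|_].
  by rewrite mulr1.
by rewrite mulr0.
Qed.

End bounded_integral.

(** * Functionals determined by their values on indicators *)

Lemma trunc_count (R : realType) (y : R) (N : nat) : 0 <= y ->
  \sum_(j < N) (j.+1%:R <= y)%R%:R = (minn N (Num.truncn y))%:R :> R.
Proof.
move=> y0; elim: N => [|N IH]; first by rewrite big_ord0 min0n.
rewrite big_ord_recr /= IH -truncn_ge_nat//.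
have [h|h] := leqP N.+1 (Num.truncn y).
  by rewrite (minn_idPl (ltnW h)) natr1.
by rewrite addr0 (minn_idPr _).
Qed.

(** A nonnegative number is, up to one step, the step times the number of levels
    below it. *)
Lemma layer_approx (R : realType) (a : R) (m N : nat) : 0 <= a ->
  a * m.+1%:R <= N%:R ->
  `|a - \sum_(j < N) m.+1%:R^-1 * (j.+1%:R <= a * m.+1%:R)%R%:R|
    <= m.+1%:R^-1.
Proof.
move=> a0 aN; set y := a * m.+1%:R.
have y0 : 0 <= y by rewrite mulr_ge0.
rewrite -big_distrr/= trunc_count//.
have /andP[h1 h2] := truncn_itv y0.
have -> : minn N (Num.truncn y) = Num.truncn y.
  by apply/minn_idPr; rewrite -(ler_nat R) (le_trans h1).
have -> : a = m.+1%:R^-1 * y by rewrite mulrC mulfK.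
rewrite -mulrBr normrM ger0_norm ?invr_ge0// ler_piMr ?invr_ge0//.
rewrite ger0_norm ?subr_ge0// lerBlDl ltW// (lt_le_trans h2)//.
by rewrite -natr1.
Qed.

Section layer.
Context d d' (T : measurableType d) (T' : measurableType d') (R : realType).
Context d2 (T2 : measurableType d2).
Variables (mu : {finite_measure set T -> \bar R}).
Variables (mu2 : {finite_measure set T2 -> \bar R}).
Variables (phi1 : T -> T') (phi2 : T2 -> T') (H1 : T -> R) (H2 : T2 -> R).
Hypotheses (mphi1 : measurable_fun setT phi1) (mphi2 : measurable_fun setT phi2).
Hypotheses (bH1 : bmf H1) (bH2 : bmf H2).
Hypothesis H12 : forall C, measurable C ->
  Ex mu (fun t => H1 t * \1_C (phi1 t)) = Ex mu2 (fun t => H2 t * \1_C (phi2 t)).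

(** Slicing a bounded function at the levels j/m turns it, up to a uniform error
    1/m, into a combination of indicators, for which the equality is assumed. *)
Lemma layer (g : T' -> R) : bmf g ->
  Ex mu (fun t => H1 t * g (phi1 t)) = Ex mu2 (fun t => H2 t * g (phi2 t)).
Proof.
move=> bg; have [mg [b gb]] := bg.
have b0 : 0 <= b by apply: le_trans (gb (phi2 point)).
pose C m j := [set z | j.+1%:R <= (g z + b) * m.+1%:R].
have mC m j : measurable (C m j).
  apply: measurable_le_set => //.
  by apply: measurable_funM => //; exact: measurable_funD.
pose N m := (Num.truncn (2 * b * m.+1%:R)).+1.
pose gm m z := - b + \sum_(j < N m) m.+1%:R^-1 * \1_(C m j) z.
have gmE m z : `|g z - gm m z| <= m.+1%:R^-1.
  have -> : g z - gm m z = (g z + b) - \sum_(j < N m) m.+1%:R^-1 *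
     (j.+1%:R <= (g z + b) * m.+1%:R)%R%:R.
    rewrite /gm opprD opprK addrA; congr (_ - _); apply: eq_bigr => j _.
    by rewrite indicE /C; congr (_ * (nat_of_bool _)%:R); apply/idP/idP; rewrite inE.
  have := gb z; rewrite ler_norml => /andP[h1 h2].
  apply: layer_approx; first by rewrite -lerBlDr sub0r.
  apply: le_trans (_ : 2 * b * m.+1%:R <= _); last first.
    by rewrite ltW// truncnS_gt.
  by rewrite ler_wpM2r// mulr_natl mulr2n lerD2r.
have bgm m : bmf (gm m).
  apply: bmfD; first exact: bmf_cst.
  by apply: bmf_sum => j; exact/bmfZ/bmf_indic.
have key0 dS (TS : measurableType dS)
    (nu : {finite_measure set TS -> \bar R}) (phi : TS -> T') (H : TS -> R) m :
    measurable_fun setT phi -> bmf H ->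
    Ex nu (fun t => H t * gm m (phi t)) = - b * Ex nu (fun t => H t * \1_setT (phi t)) +
    \sum_(j < N m) m.+1%:R^-1 * Ex nu (fun t => H t * \1_(C m j) (phi t)).
  move=> mphi bH.
  have b1 j : bmf (fun t => H t * \1_(C m j) (phi t)).
    by apply: bmfM => //; apply: bmf_comp => //; exact: bmf_indic.
  have b2 : bmf (fun t => H t * (\1_setT : _ -> R) (phi t)).
    by apply: bmfM => //; apply: bmf_comp => //; exact: bmf_indic.
  rewrite -ExZ//.
  under eq_bigr do rewrite -ExZ//.
  rewrite -Ex_sum; last by move=> j; exact: bmfZ.
  rewrite -ExD; [|exact: bmfZ|by apply: bmf_sum => j; exact: bmfZ].
  apply: eq_Ex => t; rewrite /gm mulrDr indicT/= mulr1 mulrC mulr_sumr.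
  by congr (_ + _); apply: eq_bigr => j _; rewrite mulrCA.
have key m : Ex mu (fun t => H1 t * gm m (phi1 t)) = Ex mu2 (fun t => H2 t * gm m (phi2 t)).
  rewrite (key0 _ _ mu _ _ m mphi1 bH1) (key0 _ _ mu2 _ _ m mphi2 bH2).
  congr (_ * _ + _); first exact: H12.
  by apply: eq_bigr => j _; congr (_ * _); exact: H12.
have close dS (TS : measurableType dS)
    (nu : {finite_measure set TS -> \bar R}) (phi : TS -> T') (H : TS -> R) m :
    measurable_fun setT phi -> bmf H ->
    `|Ex nu (fun t => H t * g (phi t)) - Ex nu (fun t => H t * gm m (phi t))| <=
     Ex nu (fun t => `|H t|) / m.+1%:R.
  move=> mphi bH.
  have ? : bmf (fun t => H t * g (phi t)) by apply: bmfM => //; exact: bmf_comp.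
  have ? : bmf (fun t => H t * gm m (phi t)) by apply: bmfM => //; exact: bmf_comp.
  rewrite -ExB// (le_trans (Ex_norm _ _))//; first exact: bmfB.
  rewrite mulrC -ExZ; last exact: bmf_norm.
  apply: le_Ex.
  - exact/bmf_norm/bmfB.
  - exact/bmfZ/bmf_norm.
  - by move=> t; rewrite -mulrBr normrM mulrC ler_wpM2r.
set a := Ex mu _; set c := Ex mu2 _.
pose K := Ex mu (fun t => `|H1 t|) + Ex mu2 (fun t => `|H2 t|).
have acK m : `|a - c| <= K / m.+1%:R.
  have := close _ _ mu phi1 H1 m mphi1 bH1.
  have := close _ _ mu2 phi2 H2 m mphi2 bH2.
  rewrite -key -/a -/c; set u := Ex mu _ => h1 h2.
  rewrite (le_trans (ler_distD u _ _))// /K mulrDl lerD//.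
  by rewrite distrC.
apply/eqP; rewrite -subr_eq0 -normr_le0 leNgt; apply/negP => ac.
have K0 : 0 < K.
  have := acK 0%N; rewrite divr1; exact: lt_le_trans.
have := acK (Num.truncn (K / `|a - c|)).
apply/negP; rewrite -ltNge ltr_pdivrMr// mulrC -ltr_pdivrMr//.
exact: truncnS_gt.
Qed.

End layer.

(** * Sums of independent bounded variables *)

Lemma expR_quad (R : realType) (u : R) : `|u| <= 1 / 2 ->
  expR u <= 1 + u + 2 * u ^+ 2.
Proof.
rewrite ler_norml => /andP[u1 u2].
have h := expR_ge1Dx (- u).
have e0 := expR_gt0 u.
rewrite expRN in h.
have h2 : (1 - u) * expR u <= 1.
  by rewrite -ler_pdivlMr// div1r.
rewrite -(@ler_pM2l _ (1 - u)); last by lra.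
apply: (le_trans h2); nra.
Qed.

Section iid.
Context d dV (Omega : measurableType d) (V : measurableType dV) (R : realType).
Variables (P : probability Omega R) (Z : Omega -> V) (Zs : nat -> Omega -> V).
Hypotheses (mZ : measurable_fun setT Z) (mZs : forall i, measurable_fun setT (Zs i)).
Hypothesis same_law : forall i (C : set V), measurable C ->
  P [set w | C (Zs i w)] = P [set w | C (Z w)].
Hypothesis indep : forall (J : {fset nat}) (C : nat -> set V),
  (forall i, measurable (C i)) ->
  P (\bigcap_(i in [set` J]) [set w | C i (Zs i w)]) =
  (\prod_(i <- J) P [set w | C i (Zs i w)])%E.

Lemma Ex_comp_indic (phi : Omega -> V) (C : set V) : measurable_fun setT phi ->
  measurable C ->
  Ex P (fun w => \1_C (phi w)) = fine (P [set w | C (phi w)]).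
Proof.
move=> mphi mC; rewrite -Ex_indic//.
by rewrite -[X in measurable X]setTI; exact: mphi.
Qed.

Let Ex_prod_indic n (C : nat -> set V) : (forall i, measurable (C i)) ->
  Ex P (fun w => \prod_(i < n) \1_(C i) (Zs i w)) =
  \prod_(i < n) Ex P (fun w => \1_(C i) (Z w)).
Proof.
move=> mC; pose J := [fset x in iota 0 n]%fset.
have pJ : perm_eq (enum_fset J) (index_iota 0 n).
  apply: uniq_perm; rewrite ?fset_uniq ?iota_uniq// => i.
  by rewrite /J in_fset/= /index_iota subn0.
have mB i : measurable [set w | C i (Zs i w)].
  by rewrite -[X in measurable X]setTI; exact: mZs.
have mI : measurable (\bigcap_(i in [set` J]) [set w | C i (Zs i w)]).
  by apply: fin_bigcap_measurable => //; exact: finite_fset.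
transitivity (Ex P (\1_(\bigcap_(i in [set` J]) [set w | C i (Zs i w)]))).
  apply: eq_Ex => w; rewrite indicE.
  case: (boolP (w \in _)) => [|wn].
    move=> /set_mem/= h; rewrite big1// => i _; rewrite indicE mem_set//.
    by apply: h => /=; rewrite /J in_fset/= mem_iota ltn_ord.
  have [i /not_implyP[iJ nCi]] : exists i, ~ ([set` J] i -> C i (Zs i w)).
    by apply/existsNP => h; move/negP: wn; apply; apply/mem_set => i /h.
  have iN : (i < n)%N by move: iJ; rewrite /= /J in_fset/= mem_iota.
  by rewrite (bigD1 (Ordinal iN))//= indicE memNset// mul0r.
transitivity (fine (P (\bigcap_(i in [set` J]) [set w | C i (Zs i w)]))).
  exact: Ex_indic.
rewrite indep// (perm_big _ pJ)/= big_mkord.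
rewrite (eq_bigr (fun i : 'I_n => (fine (P [set w | C i (Z w)]))%:E)); last first.
  by move=> i _; rewrite same_law// fineK// fin_num_measure//
    -[X in measurable X]setTI; exact: mZ.
rewrite -(big_morph EFin EFinM (erefl _))/=.
by apply: eq_bigr => i _; rewrite Ex_comp_indic.
Qed.

(** The product rule passes from indicators to bounded functions one factor at a
    time, the other factors playing the role of a weight. *)
Lemma Ex_prod n (F : nat -> V -> R) : (forall i, bmf (F i)) ->
  Ex P (fun w => \prod_(i < n) F i (Zs i w)) =
  \prod_(i < n) Ex P (fun w => F i (Z w)).
Proof.
suff main k (G : nat -> V -> R) : (forall i, bmf (G i)) ->
    (forall i, (k <= i)%N -> exists2 C, measurable C & G i = \1_C) ->
    Ex P (fun w => \prod_(i < n) G i (Zs i w)) =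
    \prod_(i < n) Ex P (fun w => G i (Z w)).
  move=> bF.
  pose G i := if (i < n)%N then F i else \1_set0.
  have bG i : bmf (G i).
    by rewrite /G; case: ifP => // _; exact: bmf_indic.
  have := main n G bG.
  under eq_Ex do under eq_bigr => i _ do rewrite /G ltn_ord.
  under eq_bigr => i _ do rewrite /G ltn_ord.
  apply => i ni; exists set0 => //.
  by rewrite /G ltnNge ni.
elim: k G => [|k IH] G bG GC.
  have /choice[C HC] : forall i, exists C, measurable C /\ G i = \1_C.
    by move=> i; have [C mC GE] := GC i (leq0n i); exists C.
  under eq_Ex do under eq_bigr => i _ do rewrite (HC i).2.
  under eq_bigr => i _ do rewrite (HC i).2.
  by apply: Ex_prod_indic => i; exact: (HC i).1.
have [kn|nk] := ltnP k n; last first.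
  pose G' i := if (i < n)%N then G i else \1_set0.
  have := IH G'.
  under eq_Ex do under eq_bigr => i _ do rewrite /G' ltn_ord.
  under eq_bigr => i _ do rewrite /G' ltn_ord.
  apply => i; first by rewrite /G'; case: ifP => // _; exact: bmf_indic.
  by move=> ki; exists set0; rewrite // /G' ltnNge (leq_trans nk ki).
pose ko := Ordinal kn.
pose H w := \prod_(i < n | i != ko) G i (Zs i w).
pose c := \prod_(i < n | i != ko) Ex P (fun w => G i (Z w)).
have bH : bmf H by apply: bmf_prod => i; exact: bmf_comp.
have := @layer _ _ _ _ _ _ _ P P (Zs k) Z H (fun=> c) (mZs k) mZ bH
  (bmf_cst _ c) _ (G k) (bG k).
rewrite (@eq_Ex _ _ _ P _ (fun w => \prod_(i < n) G i (Zs i w))); last first.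
  by move=> w; rewrite [RHS](bigD1 ko)//= mulrC.
rewrite ExZ; last exact: bmf_comp.
rewrite mulrC [X in _ -> _ = X](bigD1 ko)//=.
apply => C mC.
pose G' i := if i == k then \1_C else G i.
have bG' i : bmf (G' i).
  by rewrite /G'; case: ifP => // _; exact: bmf_indic.
have G'C i : (k <= i)%N -> exists2 C, measurable C & G' i = \1_C.
  rewrite leq_eqVlt => /orP[/eqP <-|ki]; first by exists C => //; rewrite /G' eqxx.
  by have [C' mC' GE] := GC i ki; exists C' => //; rewrite /G' gtn_eqF.
have := IH G' bG' G'C.
rewrite (@eq_Ex _ _ _ P _ (fun w => H w * \1_C (Zs k w))); last first.
  move=> w; rewrite (bigD1 ko)//= {1}/G' eqxx mulrC; congr (_ * _).
  apply: eq_bigr => i /negP ik; rewrite /G' ifF//.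
  by apply/negP => /eqP ik'; apply: ik; apply/eqP/val_inj.
move=> ->; rewrite (bigD1 ko)//= {1}/G' eqxx mulrC ExZ; last first.
  by apply: bmf_comp => //; exact: bmf_indic.
congr (_ * _); apply: eq_bigr => i /negP ik; rewrite /G' ifF//.
by apply/negP => /eqP ik'; apply: ik; apply/eqP/val_inj.
Qed.

(** Centred sum of [psi] over the first [n] observations. *)
Definition dev n (psi : V -> R) w :=
  \sum_(i < n) psi (Zs i w) - n%:R * Ex P (fun w => psi (Z w)).

Lemma bmf_dev n psi : bmf psi -> bmf (dev n psi).
Proof.
move=> bpsi; apply: bmfB; last exact: bmf_cst.
by apply: bmf_sum => i; exact: bmf_comp.
Qed.

Lemma Ex1 (r : R) : Ex P (fun=> r) = r.
Proof.
transitivity (r * fine (P setT)); first exact: Ex_cst.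
by rewrite probability_setT mulr1.
Qed.

(** By independence the exponential moment is a product. In each factor the
    quadratic bound for the exponential leaves the variance only, since the linear
    term cancels against the centring. *)
Lemma laplace n (psi : V -> R) b v lam : bmf psi ->
  (forall z, `|psi z| <= b) -> Ex P (fun w => psi (Z w) ^+ 2) <= v ->
  `|lam| * b <= 1 / 2 ->
  Ex P (fun w => expR (lam * dev n psi w)) <= expR (2 * n%:R * lam ^+ 2 * v).
Proof.
move=> bpsi pb Ev lb; set m := Ex P (fun w => psi (Z w)).
pose g z := expR (lam * (psi z - m)).
have bg : bmf g.
  by apply/bmf_expR/bmfZ; apply: bmfB => //; exact: bmf_cst.
rewrite (@eq_Ex _ _ _ P _ (fun w => \prod_(i < n) g (Zs i w))); last first.
  move=> w; rewrite /dev -/m /g -expR_sum; congr expR.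
  rewrite -mulr_sumr; congr (_ * _); rewrite sumrB; congr (_ - _).
  by rewrite sumr_const card_ord mulr_natl.
rewrite (Ex_prod n (F := fun=> g))//= prodr_const card_ord.
have bpZ : bmf (fun w => psi (Z w)) by exact: bmf_comp.
have bpZ2 : bmf (fun w => psi (Z w) ^+ 2).
  by under eq_fun do rewrite expr2; exact: bmfM.
have Eg : Ex P (fun w => g (Z w)) <= expR (2 * lam ^+ 2 * v).
  apply: (@le_trans _ _ (Ex P (fun w => expR (- (lam * m)) *
    (1 + (lam * psi (Z w) + 2 * lam ^+ 2 * psi (Z w) ^+ 2))))).
    apply: le_Ex.
    - exact: bmf_comp.
    - apply/bmfZ/bmfD; first exact: bmf_cst.
      by apply: bmfD; exact: bmfZ.
    - move=> w; rewrite /g mulrBr expRD mulrC ler_pM2l ?expR_gt0//.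
      apply: le_trans (expR_quad _) _; last by rewrite exprMn mulrA addrA.
      by rewrite normrM (le_trans _ lb)// ler_wpM2l.
  rewrite ExZ; last first.
    by apply: bmfD; [exact: bmf_cst|apply: bmfD; exact: bmfZ].
  rewrite ExD//; [|exact: bmf_cst|by apply: bmfD; exact: bmfZ].
  rewrite ExD ?ExZ//; [|exact: bmfZ|exact: bmfZ].
  rewrite Ex1 -/m mulrC.
  rewrite -ler_pdivlMr ?expR_gt0// -expRN opprK -expRD.
  apply: le_trans (expR_ge1Dx _).
  rewrite lerD2l addrC lerD2r ler_wpM2l//.
  by rewrite mulr_ge0// sqr_ge0.
apply: le_trans (_ : expR (2 * lam ^+ 2 * v) ^+ n <= _).
  rewrite lerXn2r// nnegrE ?expR_ge0//.
  by apply: Ex_ge0 => w; exact: expR_ge0.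
by rewrite -expRM_natl le_eqVlt; apply/orP; left; apply/eqP; congr expR; ring.
Qed.

Lemma le_expR_norm (x : R) : expR `|x| <= expR x + expR (- x).
Proof.
by case: (ger0P x) => _; rewrite ?lerDl ?lerDr expR_ge0.
Qed.

(** One exponential moment controls every deviation; the variance bound is
    inflated so that the exponent stays in the range of the quadratic bound. *)
Lemma bernstein n (J : finType) (psi : J -> V -> R) b v l kappa :
  (forall j, bmf (psi j)) -> (forall j z, `|psi j z| <= b) ->
  (forall j, Ex P (fun w => psi j (Z w) ^+ 2) <= v) ->
  0 < b -> 0 <= v -> 0 < l -> 0 <= kappa -> (0 < n)%N ->
  exists A, [/\ measurable A,
    fine (P A) >= 1 - 2 * #|J|%:R * expR ((2 - kappa) * l) &
    forall w, A w -> forall j,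
     `|dev n (psi j) w| <= kappa * Num.sqrt (n%:R * v * l + 4 * b ^+ 2 * l ^+ 2)].
Proof.
move=> bpsi pb Ev b0 v0 l0 k0 n0.
have n0' : 0 < n%:R :> R by rewrite ltr0n.
set D := n%:R * v * l + _.
have D0 : 0 < D.
  rewrite /D ltr_wpDl//; first by rewrite !mulr_ge0// ltW.
  by rewrite !mulr_gt0// exprn_gt0.
pose lam := l / Num.sqrt D.
have sD : 0 < Num.sqrt D by rewrite sqrtr_gt0.
have lam0 : 0 < lam by rewrite divr_gt0.
have lb : lam * b <= 1 / 2.
  rewrite /lam mulrAC ler_pdivrMr//.
  suff : 2 * (l * b) <= Num.sqrt D by lra.
  rewrite -(@ger0_norm _ (2 * (l * b))); last by rewrite !mulr_ge0// ltW.
  rewrite -sqrtr_sqr ler_sqrt; last exact: ltW.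
  have -> : (2 * (l * b)) ^+ 2 = 4 * b ^+ 2 * l ^+ 2 by ring.
  by rewrite /D lerDr !mulr_ge0// ltW.
have lam2 : n%:R * lam ^+ 2 * v <= l.
  rewrite /lam expr_div_n sqr_sqrtr; last exact: ltW.
  rewrite mulrAC mulrA ler_pdivrMr// /D mulrDr.
  rewrite ler_wpDr//; last by rewrite expr2; lra.
  by rewrite !mulr_ge0// ?sqr_ge0// ltW.
pose B j := [set w | expR (kappa * l) <= expR (lam * `|dev n (psi j) w|)].
have bB j : bmf (fun w => expR (lam * `|dev n (psi j) w|)).
  by apply/bmf_expR/bmfZ/bmf_norm/bmf_dev.
have mB j : measurable (B j) by apply: measurable_le_set => //; apply: bmf_meas.
have PB j : fine (P (B j)) <= 2 * expR ((2 - kappa) * l).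
  apply: (le_trans (Ex_markov P (bB j) _ _)) => //.
    by rewrite expR_gt0.
  rewrite ler_pdivrMr ?expR_gt0// -mulrA -expRD -mulrDl subrK.
  have bL c : bmf (fun w => expR (c * dev n (psi j) w)).
    by apply/bmf_expR/bmfZ/bmf_dev.
  apply: (@le_trans _ _ (Ex P (fun w => expR (lam * dev n (psi j) w) +
      expR (- lam * dev n (psi j) w)))).
    apply: le_Ex => //; first exact: bmfD.
    move=> w; rewrite mulNr -{1}(gtr0_norm lam0) -normrM.
    exact: le_expR_norm.
  rewrite ExD//.
  have L c : `|c| = lam -> Ex P (fun w => expR (c * dev n (psi j) w)) <= expR (2 * l).
    move=> cl; apply: (le_trans (laplace (b := b) (v := v) _ _ _ _ _)) => //.
      by rewrite cl.
    have c2 : c ^+ 2 = lam ^+ 2 by rewrite -cl -normrX ger0_norm ?sqr_ge0.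
    by rewrite ler_expR c2; lra.
  by rewrite mulrDl mul1r lerD// L// ?normrN gtr0_norm.
exists (~` \bigcup_(j in [set: J]) B j).
have mU : measurable (\bigcup_(j in [set: J]) B j).
  by apply: fin_bigcup_measurable => //; exact: finite_finset.
split.
- exact: measurableC.
- rewrite probability_setC// fineB ?fin_num_measure//= lerD2l lerN2.
  apply: (@le_trans _ _ (Ex P (\1_(\bigcup_(j in [set: J]) B j)))).
    by rewrite le_eqVlt; apply/orP; left; apply/eqP/esym; exact: Ex_indic.
  apply: (@le_trans _ _ (Ex P (fun w => \sum_(j : J) \1_(B j) w))).
    apply: le_Ex; first exact: bmf_indic.
      by apply: bmf_sum => j; exact: bmf_indic.
    move=> w; rewrite indicE; case: (boolP (w \in _)) => [/set_mem [j _ Bj]|_].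
      by rewrite (bigD1 j)//= indicE mem_set// lerDl sumr_ge0.
    by rewrite sumr_ge0.
  rewrite Ex_sum; last by move=> j; exact: bmf_indic.
  apply: (@le_trans _ _ (\sum_(j : J) (2 * expR ((2 - kappa) * l)))).
    by apply: ler_sum => j _; apply: le_trans (PB j); rewrite le_eqVlt; apply/orP; left; apply/eqP; exact: Ex_indic.
  by rewrite sumr_const -[X in X <= _]mulr_natr mulrAC.
- move=> w Aw j; rewrite leNgt; apply/negP => h; apply: Aw; exists j => //.
  rewrite /B /= ler_expR.
  rewrite -ler_pdivrMl//; apply: le_trans (ltW h).
  rewrite /lam invf_div mulrCA ler_wpM2l//.
  by rewrite mulrAC -mulrA mulfV ?mulr1// gt_eqF.
Qed.

(** [laplace] at the inverse of the bound on the standard deviation, through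
    lam |x| <= exp (lam |x|). *)
Lemma mean_dev n (psi : V -> R) b v : bmf psi -> (forall z, `|psi z| <= b) ->
  Ex P (fun w => psi (Z w) ^+ 2) <= v -> 0 < b -> 0 <= v ->
  Ex P (fun w => `|dev n psi w|) <= 2 * expR 2 * Num.sqrt (n%:R * v + 4 * b ^+ 2).
Proof.
move=> bpsi pb Ev b0 v0; set D := n%:R * v + _.
have D0 : 0 < D.
  by rewrite /D ltr_wpDl// ?mulr_ge0// mulr_gt0// exprn_gt0.
have sD : 0 < Num.sqrt D by rewrite sqrtr_gt0.
pose lam := (Num.sqrt D)^-1.
have lam0 : 0 < lam by rewrite invr_gt0.
have lb : lam * b <= 1 / 2.
  rewrite /lam mulrC ler_pdivrMr//.
  suff : 2 * b <= Num.sqrt D by lra.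
  rewrite -(@ger0_norm _ (2 * b)); last by rewrite !mulr_ge0// ltW.
  rewrite -sqrtr_sqr ler_sqrt; last exact: ltW.
  have -> : (2 * b) ^+ 2 = 4 * b ^+ 2 by ring.
  by rewrite /D lerDr !mulr_ge0// ltW.
have lam2 : n%:R * lam ^+ 2 * v <= 1.
  rewrite /lam exprVn sqr_sqrtr; last exact: ltW.
  by rewrite mulrAC ler_pdivrMr// mul1r /D lerDl !mulr_ge0// ltW.
have bL c : bmf (fun w => expR (c * dev n psi w)).
  by apply/bmf_expR/bmfZ/bmf_dev.
have L c : `|c| = lam -> Ex P (fun w => expR (c * dev n psi w)) <= expR 2.
  move=> cl; apply: (le_trans (laplace (b := b) (v := v) _ _ _ _ _)) => //.
    by rewrite cl.
  have c2 : c ^+ 2 = lam ^+ 2 by rewrite -cl -normrX ger0_norm ?sqr_ge0.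
  by rewrite ler_expR c2; lra.
have -> : 2 * expR 2 * Num.sqrt D = Num.sqrt D * (expR 2 + expR 2) by ring.
apply: (@le_trans _ _ (Ex P (fun w => Num.sqrt D * (expR (lam * dev n psi w) +
    expR (- lam * dev n psi w))))); last first.
  rewrite ExZ; last exact: bmfD.
  by rewrite ler_pM2l// ExD// lerD// L// ?normrN gtr0_norm.
apply: le_Ex => //; first exact/bmf_norm/bmf_dev.
  exact/bmfZ/bmfD.
move=> w; rewrite -ler_pdivrMl// mulNr.
apply: le_trans (le_expR_norm _).
rewrite normrM gtr0_norm//.
apply: (le_trans _ (expR_ge1Dx _)).
by rewrite lerDr.
Qed.

End iid.

(** * Disintegration of the joint law along a kernel *)

Section disintegration.
Context d d1 d2 (Omega : measurableType d) (T1 : measurableType d1)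
  (T2 : measurableType d2) (R : realType).
Variables (P : probability Omega R) (X : {mfun Omega >-> T1}) (Y : {mfun Omega >-> T2}).
Variable k : R.-pker T1 ~> T2.

Section joint.
Local Open Scope ereal_scope.

Definition kjoint (C : set (T1 * T2)) : \bar R :=
  \int[distribution P X]_x k x (xsection C x).

Let kjoint0 : kjoint set0 = 0.
Proof. by rewrite [LHS]integral0_eq// => x/= _; rewrite xsection0. Qed.

Let kjoint_ge0 A : 0 <= kjoint A.
Proof. by apply: integral_ge0. Qed.

Lemma measurable_ksection C : measurable C ->
  measurable_fun setT (fun x => k x (xsection C x)).
Proof. by move=> mC; apply: measurable_fun_xsection_finite_kernel; rewrite inE. Qed.

Let kjoint_sigma_additive : semi_sigma_additive kjoint.
Proof.
move=> F mF tF mUF.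
rewrite [X in _ --> X](_ : _ = \sum_(n <oo) kjoint (F n)).
  by apply/cvg_closeP; split; [exact: is_cvg_nneseries|rewrite closeE].
rewrite -integral_nneseries//; last by move=> n; exact: measurable_ksection.
apply: eq_integral => x _; apply/esym/cvg_lim => //=; rewrite xsection_bigcup.
apply: (measure_sigma_additive _ (trivIset_xsection tF)) => ?.
exact: measurable_xsection.
Qed.

HB.instance Definition _ := isMeasure.Build _ _ _ kjoint
  kjoint0 kjoint_ge0 kjoint_sigma_additive.

End joint.

Let XY w : T1 * T2 := (X w, Y w).

Lemma measurable_pair_fun : measurable_fun setT XY.
Proof. by apply: measurable_fun_pair; exact: measurable_funPT. Qed.

Hypothesis kP : forall (A : set T1) (B : set T2), measurable A -> measurable B ->
  P [set w | A (X w) /\ B (Y w)] = (\int[distribution P X]_(x in A) k x B)%E.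

Lemma joint_lawE C : measurable C -> P [set w | C (X w, Y w)] = kjoint C.
Proof.
move=> mC.
pose G : set (set (T1 * T2)) :=
  [set C | exists A, measurable A /\ exists B, measurable B /\ C = A `*` B].
have GI : setI_closed G.
  move=> /= _ _ [X1 [mX1 [X2 [mX2 ->]]]] [Y1 [mY1 [Y2 [mY2 ->]]]].
  rewrite -setXI; exists (X1 `&` Y1); split; first exact: measurableI.
  by exists (X2 `&` Y2); split => //; exact: measurableI.
have GT : G setT.
  by exists setT; split => //; exists setT; split => //; rewrite setXTT.
have Gk C' : G C' -> pushforward P XY C' = kjoint C'.
  move=> [A [mA [B [mB ->]]]].
  rewrite /pushforward /kjoint.
  transitivity (P [set w | A (X w) /\ B (Y w)]) => //.
  rewrite kP// [LHS]integral_mkcond; apply: eq_integral => x _.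
  rewrite patchE; case: ifPn => xA; first by rewrite in_xsectionX.
  by rewrite notin_xsectionX// measure0.
have mXY := measurable_pair_fun.
have mf := mXY.
apply: (@measure_unique _ _ _ G (fun=> setT) _ GI _ _
  (pushforward P XY) kjoint Gk) => //.
- rewrite measurable_prod_measurableType //; congr (<<s _ >>).
  rewrite predeqE; split => [[A mA [B mB <-]]|[A [mA [B [mB ->]]]]].
    by exists A; split => //; exists B.
  by exists A => //; exists B.
- by apply: bigcup_const; exists 0%N.
- move=> _; apply: (@le_lt_trans _ _ (P setT)); first exact: lexx.
  by rewrite probability_setT ltry.
Qed.

Definition ksec (C : set (T1 * T2)) (x : T1) : R := fine (k x (xsection C x)).

Lemma bmf_ksec C : measurable C -> bmf (ksec C).
Proof.
move=> mC; split.
  by apply: measurableT_comp => //; exact: measurable_ksection.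
exists 1 => x; rewrite ger0_norm ?fine_ge0// -lee_fin fineK.
  apply: (@le_trans _ _ (k x setT)); last by rewrite prob_kernel.
  by apply: le_measure; rewrite ?inE//; exact: measurable_xsection.
apply: finite_kernel_measure; exact: measurable_xsection.
Qed.

(** The kernel gives the equality when the weight is an indicator; [layer] extends
    it to bounded weights. *)
Lemma disintegration (om : T1 -> R) C : bmf om -> measurable C ->
  Ex P (fun w => om (X w) * \1_C (X w, Y w)) =
  Ex P (fun w => om (X w) * ksec C (X w)).
Proof.
move=> bom mC.
have mX : measurable_fun setT X by exact: measurable_funPT.
have b1 : bmf (fun w => \1_C (X w, Y w) : R).
  by apply: (bmf_comp measurable_pair_fun); exact: bmf_indic.
have b2 : bmf (fun w => ksec C (X w)).
  by apply: bmf_comp => //; exact: bmf_ksec.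
have C1 f g : Ex P (fun w => f w * g w) = Ex P (fun w => g w * f w).
  by apply: eq_Ex => w; rewrite mulrC.
rewrite C1 [RHS]C1.
apply: (@layer _ _ _ _ _ _ _ P P X X _ _ mX mX b1 b2 _ om bom) => A mA.
pose CA := C `&` (A `*` setT).
have mCA : measurable CA by apply: measurableI => //; exact: measurableX.
transitivity (fine (P [set w | CA (X w, Y w)])).
  rewrite -(Ex_comp_indic P measurable_pair_fun mCA).
  apply: eq_Ex => w; rewrite /CA indicI/= [X in _ * X = _]indicE; congr (_ * _).
  by rewrite indicE; congr (nat_of_bool _)%:R; apply/idP/idP; rewrite !inE => // -[].
rewrite joint_lawE// /kjoint ge0_integral_pushforward//=; last first.
  exact: measurable_ksection.
rewrite preimage_setT /Ex /Rintegral; congr fine; apply: eq_integral => w _ /=.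
rewrite /ksec EFinM fineK; last first.
  by apply: finite_kernel_measure; exact: measurable_xsection.
rewrite /CA xsectionI indicE; case: (boolP (X w \in A)) => h.
  by rewrite in_xsectionX// setIT mule1.
by rewrite notin_xsectionX// setI0 measure0 mule0.
Qed.

End disintegration.

(** * Distribution functions with a density, and their quantiles *)

Section cdf_density.
Context (R : realType).
Variables (g G : R -> R) (L0 : R).
Hypothesis L00 : 0 < L0.
Hypothesis g0 : forall y, 0 < g y.
Hypothesis gL : forall y y', `|g y - g y'| <= L0 * `|y - y'|.
Hypothesis GE : forall y,
  (G y)%:E = (\int[lebesgue_measure]_(u in `]-oo, y]) (g u)%:E)%E.

Lemma lipschitz_continuous : continuous g.
Proof.
move=> y; apply/cvgrPdist_lt => e e0; near=> u.
apply: (le_lt_trans (gL _ _)).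
rewrite mulrC -ltr_pdivlMr//.
near: u; apply/nbhs_ballP; exists (e / L0) => //=.
exact: divr_gt0.
Unshelve. all: by end_near. Qed.

Let mg : measurable_fun [set: R] g.
Proof. by apply: continuous_measurable_fun; exact: lipschitz_continuous. Qed.

Let incr y y' : y <= y' ->
  (G y' - G y)%:E = (\int[lebesgue_measure]_(u in `]y, y']) (g u)%:E)%E.
Proof.
move=> yy'; rewrite EFinB !GE.
have -> : `]-oo, y']%classic = `]-oo, y] `|` `]y, y'] :> set R.
  by apply: itv_bndbnd_setU; rewrite bnd_simp.
rewrite ge0_integral_setU//=.
- by rewrite addeAC subee ?add0e// -GE.
- by apply: (measurable_funTS (D := _ `|` _)); exact/measurable_EFinP.
- by move=> u _; rewrite lee_fin ltW.
- rewrite disj_set2E; apply/eqP; rewrite -subset0 => u [] /=.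
  by rewrite !in_itv/= => uy /andP[]; rewrite ltNge uy.
Qed.

Lemma cdf_incr_le y y' M : y <= y' -> (forall u, y <= u <= y' -> g u <= M) ->
  G y' - G y <= M * (y' - y).
Proof.
move=> yy' gM; rewrite -lee_fin incr//.
apply: (@le_trans _ _ (\int[lebesgue_measure]_(u in `]y, y']) M%:E)%E).
  apply: ge0_le_integral => //=.
  - by move=> u _; rewrite lee_fin ltW.
  - by apply/measurable_EFinP; exact: measurable_funTS.
  - by move=> u; rewrite in_itv/= => /andP[yu uy]; rewrite lee_fin gM// (ltW yu).
rewrite integral_cst//= lebesgue_measure_itv/= lte_fin.
case: ltP => [_|h]; first by rewrite -EFinB -EFinM.
by rewrite mule0 lee_fin (@le_anti _ _ y y') ?yy'// subrr mulr0.
Qed.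

Lemma cdf_incr_ge y y' m : y <= y' -> (forall u, y <= u <= y' -> m <= g u) ->
  m * (y' - y) <= G y' - G y.
Proof.
move=> yy' gm; rewrite -lee_fin incr//.
apply: (@le_trans _ _ (\int[lebesgue_measure]_(u in `]y, y']) (Num.max 0 m)%:E)%E).
  rewrite integral_cst//= lebesgue_measure_itv/= lte_fin.
  case: ltP => [_|h].
    by rewrite -EFinB -EFinM lee_fin ler_wpM2r ?subr_ge0// le_max lexx orbT.
  by rewrite mule0 lee_fin (@le_anti _ _ y y') ?yy'// subrr mulr0.
apply: ge0_le_integral => //=.
- by move=> u _; rewrite lee_fin le_max lexx.
- by apply/measurable_EFinP; exact: measurable_funTS.
- move=> u; rewrite in_itv/= => /andP[yu uy]; rewrite lee_fin ge_max ltW//=.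
  by rewrite gm// (ltW yu).
Qed.

Lemma cdf_le : {homo G : y y' / y <= y'}.
Proof.
move=> y y' yy'; rewrite -subr_ge0 -[leLHS](mul0r (y' - y)).
by apply: cdf_incr_ge => // u _; exact: ltW.
Qed.

(** Over a short interval the density is at least half its value at the left
    end, by the Lipschitz bound. *)
Lemma cdf_lt : {homo G : y y' / y < y'}.
Proof.
move=> y y' yy'.
pose t := Num.min (y' - y) (g y / (2 * L0)).
have t0 : 0 < t.
  by rewrite lt_min subr_gt0 yy'/= divr_gt0// mulr_gt0.
have h : g y / 2 * (y + t - y) <= G (y + t) - G y.
  apply: cdf_incr_ge; first by rewrite lerDl ltW.
  move=> u /andP[yu ut].
  have : `|g y - g u| <= g y / 2.
    apply: (le_trans (gL _ _)).
    have : `|y - u| <= g y / (2 * L0).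
      rewrite distrC ger0_norm ?subr_ge0//.
      by rewrite (@le_trans _ _ t)// ?ge_min ?lexx ?orbT// lerBlDl.
    move=> /(ler_wpM2l (ltW L00)) /le_trans; apply.
    by rewrite le_eqVlt; apply/orP; left; apply/eqP; field; rewrite gt_eqF.
  rewrite ler_norml => /andP[_ h]; lra.
apply: (@lt_le_trans _ _ (G (y + t))); last first.
  by apply: cdf_le; rewrite -lerBrDl ge_min lexx.
rewrite -subr_gt0; apply: lt_le_trans h.
by rewrite mulr_gt0 ?divr_gt0// addrAC subrr add0r.
Qed.

Lemma cdf_ltE y y' : (G y < G y') = (y < y').
Proof.
apply/idP/idP => [h|]; last exact: cdf_lt.
by rewrite ltNge; apply/negP => /cdf_le; rewrite leNgt h.
Qed.

Lemma cdf_leE y y' : (G y <= G y') = (y <= y').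
Proof. by rewrite leNgt cdf_ltE -leNgt. Qed.

Lemma cdf_continuous : continuous G.
Proof.
move=> y; apply/cvgrPdist_lt => e e0.
pose M := g y + L0.
have M0 : 0 < M by rewrite addr_gt0.
have h (a b : R) : a <= b -> `|a - y| <= 1 -> `|b - y| <= 1 -> `|G a - G b| <= M * `|a - b|.
  move=> ab ha hb.
  have /andP[a1 a2] : y - 1 <= a <= y + 1 by rewrite -ler_distl.
  have /andP[b1 b2] : y - 1 <= b <= y + 1 by rewrite -ler_distl.
  rewrite distrC (distrC a) ger0_norm ?subr_ge0 ?cdf_le// ger0_norm ?subr_ge0//.
  apply: cdf_incr_le => // v /andP[av vb].
  rewrite /M -lerBlDl (le_trans (ler_norm _))//.
  rewrite (le_trans (gL _ _))// ger_pMr//.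
  by rewrite ler_distl; apply/andP; split; lra.
near=> u.
have uy1 : `|u - y| <= 1.
  near: u; apply/nbhs_ballP; exists 1 => //= v vy.
  by rewrite distrC; exact: ltW vy.
have uy : `|y - u| < e / M.
  near: u; apply/nbhs_ballP; exists (e / M) => //=.
  exact: divr_gt0.
have yy : `|y - y| <= 1 by rewrite subrr normr0.
apply: (@le_lt_trans _ _ (M * `|y - u|)).
  have [yu|/ltW uy'] := leP y u; first exact: h.
  by rewrite distrC (distrC y) h.
by rewrite mulrC -ltr_pdivlMr.
Unshelve. all: by end_near. Qed.

Hypothesis Glo : forall e : R, 0 < e -> exists y, G y < e.
Hypothesis Ghi : forall e : R, 0 < e -> exists y, 1 - e < G y.

Lemma quantile_exists a : 0 < a < 1 -> exists q, G q = a.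
Proof.
move=> /andP[a0 a1].
have [y1 y1a] := Glo a0.
have [y2 y2a] : exists y, a < G y.
  have [|y] := Ghi (e := 1 - a); first by rewrite subr_gt0.
  by rewrite opprB addrC subrK; exists y.
have y12 : y1 <= y2.
  by rewrite -cdf_leE ltW// (lt_trans y1a).
have [||q _ qa] := IVT (f := G) (v := a) y12.
- by apply: continuous_subspaceT; exact: cdf_continuous.
- have h := lt_trans y1a y2a.
  by rewrite (min_idPl (ltW h)) (max_idPr (ltW h)) !ltW.
- by exists q.
Qed.

Let quant a := inf [set y | a <= G y].

Lemma quantileE q : quant (G q) = q.
Proof.
rewrite /quant; have -> : [set y | G q <= G y] = [set` `[q, +oo[%R].
  by apply/seteqP; split => y /=; rewrite in_itv/= andbT cdf_leE.
by rewrite inf_itv.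
Qed.

Lemma cdf_quantile a : 0 < a < 1 -> G (quant a) = a.
Proof. by move=> /quantile_exists[q <-]; rewrite quantileE. Qed.

Lemma quantile_leP a y : 0 < a < 1 -> (y <= quant a) = (G y <= a).
Proof. by move=> a01; rewrite -[LHS]cdf_leE cdf_quantile. Qed.

(** First-order expansion of the distribution function, with the Lipschitz bound
    on the density as modulus. *)
Lemma cdf_expand c e y y' : 0 <= e -> 0 <= c ->
  (forall u, Num.min y y' <= u <= Num.max y y' -> `|g u - c| <= e) ->
  `|G y' - G y - c * (y' - y)| <= e * `|y' - y|.
Proof.
move=> e0 c0.
wlog yy' : y y' / y <= y'.
  move=> H hu; have [yy'|/ltW yy'] := leP y y'; first exact: H.
  have := H y' y yy'; rewrite minC maxC => /(_ hu).
  have -> : G y - G y' - c * (y - y') = - (G y' - G y - c * (y' - y)) by ring.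
  by rewrite normrN (distrC y).
rewrite (min_idPl yy') (max_idPr yy') => hu.
rewrite [X in _ <= _ * X]ger0_norm ?subr_ge0//.
rewrite ler_distl -mulrBl -mulrDl; apply/andP; split.
  apply: cdf_incr_ge => // u /hu; rewrite ler_distl => /andP[h _].
  exact: h.
apply: cdf_incr_le => // u /hu; rewrite ler_distl => /andP[_ h].
exact: h.
Qed.

(** By inversion of the distribution function. *)
Lemma quantile_derivable (a : R) : 0 < a < 1 ->
  is_derive a (1 : R) quant (g (quant a))^-1.
Proof.
move=> a01; rewrite -{1}(cdf_quantile a01).
set q := quant a.
apply: (@is_derive_inverse _ G quant (g q) q).
- by near=> z; exact: quantileE.
- by near=> z; exact: cdf_continuous.
- apply/is_derive1_caratheodory.
  exists (fun z => if z == q then g q else (G z - G q) / (z - q)); split.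
  + move=> z; case: eqVneq => [->|zq]; first by rewrite !subrr mulr0.
    by rewrite divfK// subr_eq0.
  + apply/cvgrPdist_le => e e0; near=> z; rewrite eqxx.
    case: eqVneq => [_|zq]; first by rewrite subrr normr0 ltW.
    have zq0 : z - q != 0 by rewrite subr_eq0.
    rewrite distrC.
    have -> : (G z - G q) / (z - q) - g q = (G z - G q - g q * (z - q)) / (z - q).
      by field.
    rewrite normrM normfV ler_pdivrMr ?normr_gt0//.
    apply: cdf_expand; [exact: ltW|exact: ltW|].
    move=> u uzq; apply: (le_trans (gL _ _)).
    have zqe : `|q - z| < e / L0.
      near: z; apply/nbhs_ballP; exists (e / L0) => //=.
      exact: divr_gt0.
    rewrite mulrC -ler_pdivlMr//; apply: le_trans (ltW zqe).
    have [qz|/ltW zq'] := leP q z.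
      move: uzq; rewrite (min_idPl qz) (max_idPr qz) => /andP[qu uz].
      by rewrite ger0_norm ?subr_ge0// distrC ger0_norm ?subr_ge0// lerD2r.
    move: uzq; rewrite (min_idPr zq') (max_idPl zq') => /andP[zu uq].
    by rewrite distrC ger0_norm ?subr_ge0// ger0_norm ?subr_ge0// lerD2l lerN2.
  + by rewrite eqxx.
- by rewrite gt_eqF.
Unshelve. all: by end_near. Qed.

End cdf_density.

(** * The covariate space *)

Section covariates.
Variables (R : realType) (d : nat).
Local Notation Rd := (borel_rV R d).

Lemma continuous_borel_measurable (g : 'rV[R]_d -> R) : continuous g ->
  measurable_fun [set: Rd] (g : Rd -> R).
Proof.
move=> cg; apply: (measurability _ (RGenOInfty.measurableE R)) => //.
move=> _ [_ [a ->] <-]; rewrite setTI; apply: sub_sigma_algebra.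
by apply: (open_comp (f := g)) => //; move=> x _; exact: cg.
Qed.

Definition box (c : 'rV[R]_d) (e : R) : set 'rV[R]_d :=
  [set v | forall i, `|v 0 i - c 0 i| <= e].

Lemma boxE c e : box c e = [set v : 'rV[R]_d | forall i, v 0 i \in
  `[(c - const_mx e) 0 i, (c + const_mx e) 0 i]].
Proof.
apply/seteqP; split => v /= h i; have := h i.
  by rewrite !mxE in_itv/= ler_distl.
by rewrite !mxE in_itv/= ler_distl.
Qed.

Lemma measurable_box c e : measurable (box c e : set Rd).
Proof.
rewrite (_ : box c e = \bigcap_(i in [set: 'I_d])
    ((fun v : Rd => `|v 0 i - c 0 i|) @^-1` [set y | y <= e])); last first.
  by apply/seteqP; split => v /= h i; [move=> _|]; exact: h.
apply: fin_bigcap_measurable => [|i _]; first exact: finite_finset.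
rewrite -[X in measurable X]setTI.
have mf : measurable_fun [set: Rd] (fun v : Rd => `|v 0 i - c 0 i|).
  apply: (continuous_borel_measurable (g := fun v : 'rV[R]_d => `|v 0 i - c 0 i|)).
  move=> v; apply: (continuous_comp (f := fun v : 'rV[R]_d => v 0 i - c 0 i)).
    apply: continuousB; last exact: cst_continuous.
    exact: coord_continuous.
  exact: norm_continuous.
rewrite (_ : [set y : R | y <= e] = `]-oo, e]%classic); first exact: mf.
by apply/seteqP; split => y /=; rewrite in_itv.
Qed.

Lemma lebesgue_box c e : 0 <= e ->
  @lebesgue_rV R d (box c e) = ((2 * e) ^+ d)%:E.
Proof.
move=> e0; rewrite boxE lebesgue_rV_box; last first.
  by move=> i; rewrite !mxE lerD2l; exact: le_trans e0 _ || lra.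
congr (_%:E); rewrite (eq_bigr (fun=> 2 * e)).
  by rewrite prodr_const card_ord.
by move=> i _; rewrite !mxE; lra.
Qed.

Lemma interior_box (S : set 'rV[R]_d) x : interior S x ->
  exists2 e, 0 < e & box x e `<=` S.
Proof.
move=> /nbhs_ballP[e /= e0 eS]; exists (e / 2); first by rewrite divr_gt0.
move=> v xv; apply: eS; split => // i j; rewrite ord1 /ball/= distrC.
by apply: (le_lt_trans (xv j)); lra.
Qed.

Lemma enorm_box (v : 'rV[R]_d) e : 0 <= e -> (forall i, `|v 0 i| <= e) ->
  enorm v <= d%:R * e.
Proof.
move=> e0 h; rewrite -[leRHS]ger0_norm ?mulr_ge0// -sqrtr_sqr /enorm.
apply: ler_wsqrtr; apply: (@le_trans _ _ (\sum_(i < d) e ^+ 2)).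
  by apply: ler_sum => i _; rewrite -real_normK ?num_real// lerXn2r// nnegrE.
rewrite sumr_const card_ord -[leLHS]mulr_natl exprMn ler_wpM2r ?sqr_ge0//.
rewrite -natrX ler_nat; case: (d) => // n; rewrite expnS expn1.
by rewrite leq_pmulr.
Qed.

Lemma enorm_ge0 (v : 'rV[R]_d) : 0 <= enorm v.
Proof. exact: sqrtr_ge0. Qed.

Lemma coord_le_enorm (v : 'rV[R]_d) i : `|v 0 i| <= enorm v.
Proof.
rewrite -sqrtr_sqr /enorm; apply: ler_wsqrtr.
by rewrite (bigD1 i)//= lerDl sumr_ge0// => j _; rewrite sqr_ge0.
Qed.

Lemma within_continuous_box (S : set 'rV[R]_d) (g : 'rV[R]_d -> R) x eps :
  {within S, continuous g} -> interior S x -> 0 < eps ->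
  exists2 e, 0 < e & forall v, box x e v -> `|g v - g x| < eps.
Proof.
move=> cg Sx eps0.
have Sx' : S x by exact: nbhs_singleton.
have := cg x; rewrite /continuous_at.
rewrite -nbhs_subspace_interior// => /cvgrPdist_lt /(_ _ eps0).
move=> /nbhs_ballP[e /= e0 he]; exists (e / 2); first by rewrite divr_gt0.
move=> v xv; rewrite distrC; apply: he; split => // i j; rewrite ord1 /ball/= distrC.
by apply: (le_lt_trans (xv j)); lra.
Qed.

End covariates.

Section law_on_boxes.
Context (R : realType) (d : nat) (disp : measure_display).
Context (Omega : measurableType disp) (P : probability Omega R).
Variables (X : Omega -> borel_rV R d) (f : borel_rV R d -> R).
Hypothesis mf : measurable_fun setT f.
Hypothesis f0 : forall x, 0 <= f x.
Hypothesis fP : forall A : set (borel_rV R d), measurable A ->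
  P (X @^-1` A) = (\int[@lebesgue_rV R d]_(x in A) (f x)%:E)%E.

Lemma law_box_le c e M : 0 <= e -> 0 <= M -> (forall v, box c e v -> f v <= M) ->
  (P (X @^-1` box c e) <= (M * (2 * e) ^+ d)%:E)%E.
Proof.
move=> e0 M0 h; have mB := measurable_box c e; rewrite fP//.
apply: (@le_trans _ _ (\int[@lebesgue_rV R d]_(x in box c e) M%:E)%E).
  apply: ge0_le_integral => //=.
  - by move=> v _; rewrite lee_fin.
  - by apply/measurable_EFinP; exact: measurable_funTS.
by rewrite integral_cst//= lebesgue_box// -EFinM.
Qed.

Lemma law_box_ge c e m : 0 <= e -> 0 <= m -> (forall v, box c e v -> m <= f v) ->
  ((m * (2 * e) ^+ d)%:E <= P (X @^-1` box c e))%E.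
Proof.
move=> e0 m0 h; have mB := measurable_box c e; rewrite fP//.
apply: (@le_trans _ _ (\int[@lebesgue_rV R d]_(x in box c e) m%:E)%E).
  by rewrite integral_cst//= lebesgue_box// -EFinM.
apply: ge0_le_integral => //=.
by apply/measurable_EFinP; exact: measurable_funTS.
Qed.

End law_on_boxes.

Section probability_kernel_cdf.
Context d (T : measurableType d) (R : realType).
Variables (k : R.-pker T ~> R) (x : T).
Let G y : R := fine (k x `]-oo, y]%classic).

Let GE y : (G y)%:E = k x `]-oo, y]%classic.
Proof. by rewrite fineK//; apply: finite_kernel_measure. Qed.

Lemma kernel_cdf_hi e : 0 < e -> exists y, 1 - e < G y.
Proof.
move=> e0; pose A n : set R := `]-oo, n%:R]%classic.
have mA n : measurable (A n) by exact: measurable_itv.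
have : k x (A n) @[n --> \oo] --> k x (\bigcup_n A n).
  apply: nondecreasing_cvg_mu => //; first by apply: bigcup_measurable.
  move=> n m nm; apply/subsetPset => y; rewrite /A/= !in_itv/= => /le_trans.
  by apply; rewrite ler_nat.
have -> : \bigcup_n A n = setT.
  rewrite -subTset => y _; exists (Num.truncn y).+1 => //=.
  by rewrite /A/= in_itv/= ltW// truncnS_gt.
rewrite prob_kernel => h.
have : (fine \o (fun n => k x (A n))) @ \oo --> (1 : R) by exact/fine_cvg.
move=> /cvgrPdist_lt/(_ _ e0)[N _ /(_ N (leqnn N))/=].
rewrite ltr_distlC => /andP[hN _]; exists N%:R; exact: hN.
Qed.

Lemma kernel_cdf_lo e : 0 < e -> exists y, G y < e.
Proof.
move=> e0; pose A n : set R := `]-oo, - n%:R]%classic.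
have mA n : measurable (A n) by exact: measurable_itv.
have : k x (A n) @[n --> \oo] --> k x (\bigcap_n A n).
  apply: nonincreasing_cvg_mu => //=.
  - by rewrite -ge0_fin_numE//; apply: finite_kernel_measure.
  - by apply: bigcap_measurable; first by exists 0%N.
  move=> n m nm; apply/subsetPset => y; rewrite /A/= !in_itv/= => /le_trans.
  by apply; rewrite lerN2 ler_nat.
have -> : \bigcap_n A n = set0.
  rewrite -subset0 => y /(_ (Num.truncn `|y|).+1 I).
  rewrite /A/= in_itv/= leNgt => /negP; apply.
  have := truncnS_gt `|y|; have := ler_norm (- y); rewrite normrN => h1 h2.
  by rewrite ltrNl; apply: le_lt_trans h2.
rewrite measure0 => h.
have : (fine \o (fun n => k x (A n))) @ \oo --> (0 : R) by exact/fine_cvg.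
move=> /cvgrPdist_lt/(_ _ e0)[N _ /(_ N (leqnn N))/=].
rewrite ltr_distlC => /andP[_ hN]; exists (- N%:R).
by rewrite add0r in hN; exact: hN.
Qed.

End probability_kernel_cdf.

(** * Taylor expansion in several variables *)

Lemma is_derive_affine (R : realType) (V : normedModType R) (f : V -> R) (a v : V) (c : R) :
  (forall h : R, f (h *: v + a) = f a + h * c) -> is_derive a v f c.
Proof.
move=> fE.
have h : (fun h => h^-1 *: ((f \o shift a) (h *: v) - f a)) @ 0^' --> c.
  apply/cvgrPdist_le => e e0; near=> h.
  rewrite /= fE addrAC subrr add0r /GRing.scale/= mulKf ?subrr ?normr0 ?ltW//.
  by near: h; exact: nbhs_dnbhs_neq.
by apply: DeriveDef; [exact: cvgP h|exact/cvg_lim].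
Unshelve. all: by end_near. Qed.

Lemma is_derive_line (R : realType) (V : normedModType R) (f : V -> R) (a v : V) (t D : R) :
  is_derive (a + t *: v) v f D -> is_derive t (1 : R) (fun s : R => f (a + s *: v)) D.
Proof.
move=> [df dfE].
have E : (fun h : R => h^-1 *: (((fun s : R => f (a + s *: v)) \o shift t) (h *: (1 : R)) - f (a + t *: v)))
  = (fun h : R => h^-1 *: ((f \o shift (a + t *: v)) (h *: v) - f (a + t *: v))).
  apply/funext => h /=; congr (_ *: (f _ - _)).
  have -> : h *: (1 : R) = h by rewrite /GRing.scale/= mulr1.
  by rewrite scalerDl addrCA.
apply: DeriveDef; first by rewrite /derivable E.
by rewrite -dfE /derive E.
Qed.

Lemma bounded_derivative (R : realType) (f df : R -> R) (s M : R) :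
  (forall t, Num.min 0 s <= t <= Num.max 0 s -> is_derive t (1 : R) f (df t)) ->
  (forall t, Num.min 0 s <= t <= Num.max 0 s -> `|df t| <= M) ->
  `|f s - f 0| <= M * `|s|.
Proof.
move=> fd dM.
have H a b : a <= b -> (forall t, a <= t <= b -> Num.min 0 s <= t <= Num.max 0 s) ->
    `|f b - f a| <= M * `|b - a|.
  move=> ab hab.
  have [||c cab ->] := MVT_segment (f := f) (df := df) ab.
  - move=> x; rewrite in_itv/= => /andP[/ltW ax /ltW xb].
    by apply/fd/hab; rewrite ax.
  - apply: derivable_within_continuous => x; rewrite in_itv/= => xab.
    by have [] := fd x (hab x xab).
  by rewrite normrM ler_wpM2r// dM// hab//.
have [s0|/ltW s0] := leP 0 s.
  by rewrite -{2}(subr0 s) H// => t; rewrite (min_idPl s0) (max_idPr s0).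
rewrite distrC -{2}(subr0 s) (distrC s) H// => t.
by rewrite (min_idPr s0) (max_idPl s0).
Qed.

Section taylor.
Variables (R : realType) (d : nat).
Implicit Types (v : {ffun 'I_d -> nat}) (u : 'rV[R]_d).

Lemma mincrC v i j : mincr (mincr v i) j = mincr (mincr v j) i.
Proof. by apply/ffunP => l; rewrite !ffunE addnAC. Qed.

Lemma mdeg_incr v i : mdeg (mincr v i) = (mdeg v).+1.
Proof.
rewrite /mdeg (eq_bigr (fun l => v l + (l == i))%N); last by move=> l _; rewrite ffunE.
rewrite big_split/=.
have -> : (\sum_(l < d) (l == i) = 1)%N.
  by rewrite (bigD1 i)//= eqxx big1 ?addn0// => l /negbTE ->.
by rewrite addn1.
Qed.

Section polynomial.
Variable c : {ffun 'I_d -> nat} -> R.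

(** [tay_form j v u] is the j-th differential at the centre of the derivative of
    index v, applied to (u, ..., u). Summing over words of directions rather than
    over multi-indices makes differentiation a one-line recursion. *)
Fixpoint tay_form (j : nat) v u : R :=
  if j is j'.+1 then \sum_(i < d) u 0 i * tay_form j' (mincr v i) u else c v.

Definition tay_poly (m : nat) v u : R :=
  \sum_(j < m.+1) (j`!%:R)^-1 * tay_form j v u.

Lemma is_derive_coord u (i l : 'I_d) :
  is_derive u (delta_mx 0 i : 'rV[R]_d) (fun w : 'rV[R]_d => w 0 l) (l == i)%:R.
Proof.
apply: is_derive_affine => h; rewrite !mxE addrC eqxx/=; congr (_ + h * _%:R).
Qed.

Lemma is_derive_tay_form j v u i :
  is_derive u (delta_mx 0 i : 'rV[R]_d) (tay_form j v)
    (j%:R * tay_form j.-1 (mincr v i) u).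
Proof.
elim: j v => [|j IH] v; first by rewrite mul0r; exact: is_derive_cst.
have -> : tay_form j.+1 v = \sum_(l < d) ((fun w : 'rV[R]_d => w 0 l) * tay_form j (mincr v l)).
  by apply/funext => w; rewrite fct_sumE.
have H l : is_derive u (delta_mx 0 i : 'rV[R]_d)
    ((fun w : 'rV[R]_d => w 0 l) * tay_form j (mincr v l))
    (u 0 l *: (j%:R * tay_form j.-1 (mincr (mincr v l) i) u) +
     tay_form j (mincr v l) u *: (l == i)%:R).
  by apply: is_deriveM; exact: is_derive_coord.
apply: (is_derive_eq (is_derive_sum H)).
rewrite big_split/= -natr1 mulrDl mul1r; congr (_ + _).
  case: j {IH H} => [|j] /=.
    by rewrite mul0r big1// => l _; rewrite mul0r scaler0.
  rewrite mulr_sumr; apply: eq_bigr => l _.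
  by rewrite mincrC /GRing.scale/= mulrCA.
rewrite (bigD1 i)//= eqxx big1 ?addr0; first by rewrite /GRing.scale/= mulr1.
by move=> l /negbTE ->; rewrite scaler0.
Qed.

Lemma is_derive_tay_poly m v u i :
  is_derive u (delta_mx 0 i : 'rV[R]_d) (tay_poly m.+1 v) (tay_poly m (mincr v i) u).
Proof.
have -> : tay_poly m.+1 v = \sum_(j < m.+2) ((j`!%:R)^-1 \*: tay_form j v).
  by apply/funext => w; rewrite fct_sumE.
have H (j : 'I_m.+2) : is_derive u (delta_mx 0 i : 'rV[R]_d)
    ((j`!%:R)^-1 \*: tay_form j v) ((j`!%:R)^-1 *: (j%:R * tay_form j.-1 (mincr v i) u)).
  by apply: is_deriveZ; exact: is_derive_tay_form.
apply: (is_derive_eq (is_derive_sum H)).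
rewrite big_ord_recl/= mul0r scaler0 add0r; apply: eq_bigr => j _.
rewrite /GRing.scale/= /bump/= add1n mulrA; congr (_ * _).
rewrite factS natrM invfM mulrC mulrA mulrV ?mul1r//.
by rewrite unitfE pnatr_eq0.
Qed.

Lemma tay_poly0 m v : tay_poly m v 0 = c v.
Proof.
rewrite /tay_poly big_ord_recl/= fact0 invr1 mul1r big1 ?addr0// => j _.
by rewrite /= big1 ?mulr0// => i _; rewrite mxE mul0r.
Qed.

End polynomial.

(** Telescoping along a path parallel to the axes. *)
Lemma axis_path_bound (rho : 'rV[R]_d -> R) (D : 'I_d -> 'rV[R]_d -> R) (del M : R) :
  0 <= M -> 0 <= del ->
  (forall i u, (forall l, `|u 0 l| <= del) ->
     is_derive u (delta_mx 0 i : 'rV[R]_d) rho (D i u)) ->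
  (forall i u, (forall l, `|u 0 l| <= del) -> `|D i u| <= M) ->
  forall u, (forall l, `|u 0 l| <= del) -> `|rho u - rho 0| <= d%:R * (M * del).
Proof.
move=> M0 del0 rD DM u ud.
pose w (l : nat) : 'rV[R]_d := \row_i (if (i < l)%N then u 0 i else 0).
have wd l i : `|w l 0 i| <= del.
  by rewrite mxE; case: ifP => // _; rewrite normr0.
have w0 : w 0%N = 0 by apply/rowP => i; rewrite !mxE ltn0.
have wdd : w d = u by apply/rowP => i; rewrite !mxE ltn_ord.
have step (l : 'I_d) : `|rho (w l.+1) - rho (w l)| <= M * del.
  have wS : w l.+1 = w l + u 0 l *: delta_mx 0 l.
    apply/rowP => i; rewrite !mxE eqxx/= ltnS leq_eqVlt.
    have [->|il] := eqVneq i l; first by rewrite eqxx ltnn/= mulr1 add0r.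
    by rewrite -val_eqE in il; rewrite (negbTE il)/= mulr0 addr0.
  have wl : w l = w l + 0 *: delta_mx 0 l by rewrite scale0r addr0.
  have inbox t : Num.min 0 (u 0 l) <= t <= Num.max 0 (u 0 l) ->
      forall i, `|(w l + t *: delta_mx 0 l) 0 i| <= del.
    move=> tu i; rewrite !mxE eqxx/=.
    have [->|il] := eqVneq i l.
      rewrite ltnn add0r mulr1; apply: le_trans (ud l).
      have [u0|/ltW u0] := leP 0 (u 0 l).
        move: tu; rewrite (min_idPl u0) (max_idPr u0) => /andP[t0 tu].
        by rewrite !ger0_norm.
      move: tu; rewrite (min_idPr u0) (max_idPl u0) => /andP[tu t0].
      by rewrite !ler0_norm// lerN2.
    by rewrite mulr0 addr0; case: ifP => // _; rewrite normr0.
  rewrite wS {2}wl.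
  apply: (@le_trans _ _ (M * `|u 0 l|)); last by rewrite ler_wpM2l.
  apply: (@bounded_derivative _ (fun t : R => rho (w l + t *: delta_mx 0 l))
     (fun t => D l (w l + t *: delta_mx 0 l))) => t tu.
    by apply: is_derive_line; exact: rD (inbox t tu).
  by apply: DM; exact: inbox.
have -> : rho u - rho 0 = \sum_(l < d) (rho (w l.+1) - rho (w l)).
  rewrite -(big_mkord xpredT (fun l => rho (w l.+1) - rho (w l))).
  by rewrite telescope_sumr// w0 wdd.
apply: (le_trans (ler_norm_sum _ _ _)).
apply: (@le_trans _ _ (\sum_(l < d) (M * del))); first exact: ler_sum.
by rewrite sumr_const card_ord -[leLHS]mulr_natl.
Qed.

(** The remainder of order m has as partial derivatives the remainders of order
    m - 1 of the partial derivatives, so the bound propagates from the Hoelder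
    bound on the derivatives of top order. *)
Lemma taylor_remainder (A : set 'rV[R]_d) k g b x e L sigma :
  is_partials A k g b ->
  (forall v y y', mdeg v = k -> A y -> A y' ->
     `|b v y - b v y'| <= L * enorm (y - y') `^ (sigma - k%:R)) ->
  0 <= L -> k%:R < sigma ->
  box x e `<=` interior A ->
  forall m v del u, (mdeg v + m)%N = k -> 0 < del <= e -> (forall l, `|u 0 l| <= del) ->
  `|b v (x + u) - tay_poly (b ^~ x) m v u| <=
    L * (d%:R * del) `^ (sigma - k%:R) * (d%:R * del) ^+ m.
Proof.
move=> [_ _ bd] bH L0 ks xA m v del u + /andP[del0 dele]; move: m v u.
have inA u : (forall l, `|u 0 l| <= del) -> interior A (x + u).
  move=> ud; apply: xA => i; rewrite mxE (addrC (x 0 i)) addrK; exact: le_trans (ud i) dele.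
elim=> [|m IH] v u vk ud.
  rewrite addn0 in vk.
  rewrite /tay_poly big_ord1/= fact0 invr1 mul1r expr0 mulr1.
  have xA' : A x.
    by rewrite -[x]addr0; apply: nbhs_singleton; apply: inA => l; rewrite mxE normr0 ltW.
  have xuA : A (x + u) by apply: nbhs_singleton; exact: inA ud.
  apply: (le_trans (bH _ _ _ vk xuA xA')).
  rewrite ler_wpM2l//; apply: ge0_ler_powR.
  - by rewrite subr_ge0 ltW.
  - by rewrite nnegrE enorm_ge0.
  - by rewrite nnegrE mulr_ge0// ltW.
  - by apply: enorm_box; [exact: ltW|move=> i; rewrite !mxE (addrC (x 0 i)) addrK].
set M := L * _ * _ ^+ m in IH.
have M0 : 0 <= M by rewrite /M !mulr_ge0// ?powR_ge0// exprn_ge0// mulr_ge0// ltW.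
pose rho u := b v (x + u) - tay_poly (b ^~ x) m.+1 v u.
have -> : b v (x + u) - tay_poly (b ^~ x) m.+1 v u = rho u - rho 0.
  by rewrite /rho tay_poly0 addr0 subrr subr0.
apply: le_trans (_ : d%:R * (M * del) <= _); last first.
  by rewrite /M exprSr le_eqVlt; apply/orP; left; apply/eqP; ring.
apply: (@axis_path_bound rho
  (fun i u => b (mincr v i) (x + u) - tay_poly (b ^~ x) m (mincr v i) u)) => //.
- exact: ltW.
- move=> i w wd.
  have vk' : (mdeg v < k)%N by rewrite -vk addnS ltnS leq_addr.
  have d1 := bd v i (x + w) vk' (inA w wd).
  have d2 := is_derive_tay_poly (b ^~ x) m v w i.
  have d1' : is_derive w (delta_mx 0 i : 'rV[R]_d) (fun u => b v (x + u)) (b (mincr v i) (x + w)).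
    case: d1 => d1 d1E.
    have E : (fun h : R => h^-1 *: (((fun u => b v (x + u)) \o shift w) (h *: (delta_mx 0 i : 'rV[R]_d)) - b v (x + w)))
      = (fun h : R => h^-1 *: ((b v \o shift (x + w)) (h *: (delta_mx 0 i : 'rV[R]_d)) - b v (x + w))).
      by apply/funext => h /=; rewrite addrCA.
    apply: DeriveDef; first by rewrite /derivable E.
    by rewrite -d1E /derive E.
  exact: (is_deriveB d1' d2).
- by move=> i w wd; apply: IH => //; rewrite mdeg_incr addSnnS.
Qed.

End taylor.

(** * Polynomials of bounded degree in the monomial basis *)

Section peval.
Variables (R : realType) (d p : nat).
Local Notation coefs := {ffun mindex d p -> R}.
Implicit Types (b : coefs) (z u : 'rV[R]_d).

Definition peval z b : R := \sum_v monomials p z v * b v.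

Definition nrm b : R := \sum_v `|b v|.

Lemma nrm_ge0 b : 0 <= nrm b.
Proof. by apply: sumr_ge0. Qed.

Lemma coef_le_nrm b v : `|b v| <= nrm b.
Proof. by rewrite /nrm (bigD1 v)//= lerDl sumr_ge0. Qed.

Lemma nrm_le b m : (forall v, `|b v| <= m) -> nrm b <= #|{: mindex d p}|%:R * m.
Proof.
move=> h; rewrite /nrm; apply: (@le_trans _ _ (\sum_(v : mindex d p) m)).
  exact: ler_sum.
by rewrite sumr_const -[leLHS]mulr_natl.
Qed.

Lemma card_mindex_gt0 : (0 < #|{: mindex d p}|)%N.
Proof. by apply/card_gt0P; exists (mindex0 d p). Qed.

Definition wfact (v : mindex d p) : nat := (\prod_(i < d) (val v i)`!)%N.

Lemma wfact_gt0 v : (0 < wfact v)%N.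
Proof. by apply: prodn_gt0 => i; exact: fact_gt0. Qed.

Lemma monomialsE z v :
  monomials p z v = (\prod_(i < d) z 0 i ^+ val v i) / (wfact v)%:R.
Proof. by rewrite ffunE. Qed.

Lemma peval_linear z b1 b2 c :
  peval z [ffun v => b1 v + c * b2 v] = peval z b1 + c * peval z b2.
Proof.
rewrite /peval mulr_sumr -big_split/=; apply: eq_bigr => v _.
by rewrite [X in _ * X = _]ffunE; ring.
Qed.

Lemma pevalB z b1 b2 : peval z [ffun v => b1 v - b2 v] = peval z b1 - peval z b2.
Proof.
rewrite /peval -sumrB; apply: eq_bigr => v _; by rewrite [X in _ * X = _]ffunE mulrBr.
Qed.

(** Coefficients of the polynomial in the rescaled variable, see [peval_scale]. *)
Definition pscale (h : R) b : coefs :=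
  [ffun v : mindex d p => h ^+ (\sum_(i < d) val v i)%N * b v].

Lemma peval_scale h z b : peval (h *: z) b = peval z (pscale h b).
Proof.
rewrite /peval; apply: eq_bigr => v _; rewrite !monomialsE ffunE.
have -> : \prod_(i < d) (h *: z) 0 i ^+ val v i =
    h ^+ (\sum_(i < d) val v i)%N * \prod_(i < d) z 0 i ^+ val v i.
  rewrite expr_sum -big_split/=; apply: eq_bigr => i _.
  by rewrite mxE exprMn.
by ring.
Qed.

Lemma pscale0 h b : pscale h b (mindex0 d p) = b (mindex0 d p).
Proof.
by rewrite ffunE/= big1 ?expr0 ?mul1r// => i _; rewrite ffunE.
Qed.

Lemma peval0 b : peval 0 b = b (mindex0 d p).
Proof.
rewrite /peval (bigD1 (mindex0 d p))//= big1 ?addr0.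
  rewrite monomialsE /wfact !big1 ?divr1 ?mul1r//.
    by move=> i _; rewrite /= ffunE fact0.
  by move=> i _; rewrite /= ffunE expr0.
move=> v v0; rewrite monomialsE.
have [i vi] : exists i, val v i != ord0.
  apply/existsP; rewrite -negb_forall; apply: contra v0 => /forallP h.
  by apply/eqP/val_inj/ffunP => i; rewrite ffunE; exact/eqP.
by rewrite (bigD1 i)//= mxE expr0n -val_eqE/= in vi *; rewrite (negbTE vi) !mul0r.
Qed.

Definition expand q (f : 'rV[R]_d -> R) :=
  exists s : seq (R * {ffun 'I_d -> nat}),
    (forall t, t \in s -> (mdeg t.2 <= q)%N) /\
    forall u, f u = \sum_(t <- s) t.1 * \prod_(i < d) u 0 i ^+ t.2 i.

Lemma expand_cst q c : expand q (fun=> c).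
Proof.
exists [:: (c, [ffun=> 0%N])]; split.
  move=> t; rewrite inE => /eqP -> /=; rewrite /mdeg big1// => i _.
  by rewrite ffunE.
move=> u; rewrite big_seq1/= big1 ?mulr1// => i _; by rewrite ffunE expr0.
Qed.

Lemma expandD q f g : expand q f -> expand q g -> expand q (fun u => f u + g u).
Proof.
move=> [s [sq fs]] [s' [sq' gs]]; exists (s ++ s'); split.
  by move=> t; rewrite mem_cat => /orP[/sq|/sq'].
by move=> u; rewrite big_cat fs gs.
Qed.

Lemma expandZ q f c : expand q f -> expand q (fun u => c * f u).
Proof.
move=> [s [sq fs]]; exists [seq (c * t.1, t.2) | t <- s]; split.
  by move=> t /mapP[t' /sq ? ->].
by move=> u; rewrite fs big_map mulr_sumr; apply: eq_bigr => t _; rewrite mulrA.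
Qed.

Lemma expand_sum q (I : Type) (r : seq I) (f : I -> 'rV[R]_d -> R) :
  (forall i, expand q (f i)) -> expand q (fun u => \sum_(i <- r) f i u).
Proof.
move=> h; elim: r => [|i r IH].
  by under eq_fun do rewrite big_nil; exact: expand_cst.
by under eq_fun do rewrite big_cons; exact: expandD.
Qed.

Lemma expand_coord q f i : expand q f -> expand q.+1 (fun u => u 0 i * f u).
Proof.
move=> [s [sq fs]]; exists [seq (t.1, mincr t.2 i) | t <- s]; split.
  by move=> t /mapP[t' /sq ? ->] /=; rewrite mdeg_incr.
move=> u; rewrite fs big_map mulr_sumr; apply: eq_bigr => t _ /=.
rewrite mulrCA; congr (_ * _).
have -> : \prod_(j < d) u 0 j ^+ mincr t.2 i j =
    \prod_(j < d) (u 0 j ^+ t.2 j * u 0 j ^+ (j == i)).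
  by apply: eq_bigr => j _; rewrite ffunE exprD.
rewrite big_split/= mulrC; congr (_ * _).
rewrite (bigD1 i)//= eqxx expr1 big1 ?mulr1// => j /negbTE ->.
by rewrite expr0.
Qed.

Lemma expand_le q q' f : (q <= q')%N -> expand q f -> expand q' f.
Proof.
by move=> qq [s [sq fs]]; exists s; split => // t /sq h; exact: leq_trans h qq.
Qed.

Lemma expand_tay_form c j v : expand j (tay_form c j v).
Proof.
elim: j v => [|j IH] v; first exact: expand_cst.
by apply: expand_sum => i; apply: expand_coord.
Qed.

Lemma expand_tay_poly c m v : expand m (tay_poly c m v).
Proof.
apply: expand_sum => j; apply: expandZ; apply: expand_le (expand_tay_form c j v).
by rewrite -ltnS.
Qed.

Lemma expand_peval q f : (q <= p)%N -> expand q f -> exists b, forall u, f u = peval u b.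
Proof.
move=> qp [s [sq fs]]; have sp t : t \in s -> (mdeg t.2 <= p)%N.
  by move=> /sq h; exact: leq_trans h qp.
elim: s f fs {sq} sp => [|t s IH] f fs sp.
  exists [ffun=> 0] => u; rewrite fs big_nil /peval big1// => v _.
  by rewrite [X in _ * X]ffunE mulr0.
have [|t' t's|b hb] := IH (fun u => \sum_(t <- s) t.1 * \prod_(i < d) u 0 i ^+ t.2 i).
- by [].
- by apply: sp; rewrite inE t's orbT.
have tp : (mdeg t.2 <= p)%N by apply: sp; rewrite inE eqxx.
have tip i : (t.2 i < p.+1)%N.
  by rewrite ltnS (leq_trans _ tp)// /mdeg (bigD1 i)//= leq_addr.
have vP : (\sum_(i < d) [ffun i => inord (t.2 i) : 'I_p.+1] i <= p)%N.
  rewrite (eq_bigr (fun i => t.2 i))// => i _; by rewrite ffunE inordK.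
pose v : mindex d p := Sub [ffun i => inord (t.2 i)] vP.
pose b1 : coefs := [ffun w => if w == v then t.1 * (wfact v)%:R else 0].
exists [ffun w => b w + 1 * b1 w] => u; rewrite peval_linear mul1r -hb.
rewrite fs big_cons addrC; congr (_ + _).
rewrite /peval (bigD1 v)//= [X in _ = _ + X]big1 ?addr0; last first.
  by move=> w /= wv; rewrite [X in _ * X]ffunE (negbTE wv) mulr0.
rewrite monomialsE [X in _ = _ * X]ffunE eqxx [RHS]mulrCA mulfVK; last by rewrite pnatr_eq0 -lt0n wfact_gt0.
by congr (_ * _); apply: eq_bigr => i _; rewrite /v /= ffunE inordK.
Qed.

Section grid.
Hypothesis d0 : (0 < d)%N.

Definition node (a : 'I_p.+1) : R := a%:R / (2 * d%:R * p.+1%:R).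

Definition gridpt (j : {ffun 'I_d -> 'I_p.+1}) : 'rV[R]_d := \row_i node (j i).

Let D0 : 0 < 2 * d%:R * p.+1%:R :> R.
Proof. by rewrite !mulr_gt0// ltr0n. Qed.

Lemma node_bound a : 0 <= node a <= (2 * d%:R)^-1.
Proof.
rewrite /node (divr_ge0 (ler0n _ _) (ltW D0))/= ler_pdivrMr// mulrA mulVf ?mul1r; last first.
  by rewrite mulf_neq0// pnatr_eq0 -lt0n.
by rewrite ler_nat ltnW.
Qed.

Lemma node_inj : injective node.
Proof.
move=> a a' /(congr1 (fun t => t * (2 * d%:R * p.+1%:R))).
rewrite /node !divfK ?gt_eqF//.
by move=> /eqP; rewrite eqr_nat => /eqP/val_inj.
Qed.

(** Inverse of the Vandermonde matrix of the nodes. *)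
Lemma dual_weights : exists Lam : 'M[R]_p.+1, forall l k : 'I_p.+1,
  \sum_a node a ^+ l * Lam a k = (l == k)%:R.
Proof.
pose V : 'M[R]_p.+1 := Vandermonde p.+1 (\row_a node a).
have Vu : V \in unitmx.
  rewrite unitmxE det_Vandermonde unitfE.
  apply/prodf_neq0 => i _; apply/prodf_neq0 => j ij; rewrite !mxE subr_eq0.
  by apply/eqP => /node_inj E; rewrite E ltnn in ij.
exists (invmx V) => l k; have := mulmxV Vu.
move=> /matrixP/(_ l k); rewrite !mxE => <-; apply: eq_bigr => a _.
by rewrite !mxE.
Qed.

(** Tensor products of the one-dimensional dual weights read off the coefficients
    of a polynomial from its values on the grid. *)
Lemma grid_coef_bound : exists2 C : R, 0 < C & forall b m,
  (forall j, `|peval (gridpt j) b| <= m) -> forall v, `|b v| <= C * m.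
Proof.
have [Lam LamE] := dual_weights.
pose Lj (v : mindex d p) (j : {ffun 'I_d -> 'I_p.+1}) : R :=
  \prod_(i < d) Lam (j i) (val v i).
have dual (v w : mindex d p) :
    \sum_j Lj v j * \prod_(i < d) gridpt j 0 i ^+ val w i = (w == v)%:R.
  transitivity (\prod_(i < d) \sum_a node a ^+ val w i * Lam a (val v i)).
    rewrite bigA_distr_bigA/=; apply: eq_bigr => j _.
    rewrite /Lj -big_split/=; apply: eq_bigr => i _.
    by rewrite mxE mulrC.
  under eq_bigr do rewrite LamE.
  have [->|wv] := eqVneq w v; first by rewrite big1// => i _; rewrite eqxx.
  have [i wi] : exists i, val w i != val v i.
    apply/existsP; rewrite -negb_forall; apply: contra wv => /forallP h.
    by apply/eqP/val_inj/ffunP => i; exact/eqP.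
  by rewrite (bigD1 i)//= (negbTE wi) mul0r.
have coefE b v : b v = (wfact v)%:R * \sum_j Lj v j * peval (gridpt j) b.
  have nz w : (wfact w)%:R != 0 :> R by rewrite pnatr_eq0 -lt0n wfact_gt0.
  have -> : \sum_j Lj v j * peval (gridpt j) b =
     \sum_w b w / (wfact w)%:R * \sum_j Lj v j * \prod_(i < d) gridpt j 0 i ^+ val w i.
    under eq_bigr do rewrite mulr_sumr.
    rewrite exchange_big/=; apply: eq_bigr => w _; rewrite mulr_sumr.
    by apply: eq_bigr => j _; rewrite monomialsE; ring.
  under eq_bigr do rewrite dual.
  rewrite (bigD1 v)//= eqxx big1 ?addr0; last by move=> w /negbTE ->; rewrite mulr0.
  by rewrite mulr1 mulrCA mulfV// mulr1.
pose C := 1 + \sum_v (wfact v)%:R * \sum_j `|Lj v j|.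
have C0 v : 0 <= (wfact v)%:R * \sum_j `|Lj v j| by rewrite mulr_ge0// sumr_ge0.
exists C; first by rewrite /C ltr_wpDr// sumr_ge0.
move=> b m hm v.
have m0 : 0 <= m by apply: le_trans (hm [ffun=> ord0]).
rewrite coefE normrM ger0_norm//.
apply: (@le_trans _ _ (((wfact v)%:R * \sum_j `|Lj v j|) * m)).
  rewrite -mulrA ler_wpM2l// (le_trans (ler_norm_sum _ _ _))//.
  rewrite mulr_suml; apply: ler_sum => j _.
  by rewrite normrM ler_wpM2l.
rewrite ler_wpM2r// /C (bigD1 v)//= addrCA lerDl addr_ge0//.
by rewrite sumr_ge0.
Qed.

Lemma prod_lipschitz (I : Type) (r : seq I) (a b : I -> R) del :
  (forall i, `|a i| <= 1) -> (forall i, `|b i| <= 1) -> 0 <= del ->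
  (forall i, `|a i - b i| <= del) ->
  `|\prod_(i <- r) a i - \prod_(i <- r) b i| <= (size r)%:R * del.
Proof.
move=> a1 b1 del0 ab.
suff : `|\prod_(i <- r) a i - \prod_(i <- r) b i| <= (size r)%:R * del /\
    `|\prod_(i <- r) b i| <= 1 by case.
elim: r => [|i r [IH1 IH2]].
  by rewrite !big_nil subrr normr0 mul0r normr1.
rewrite !big_cons; split; last by rewrite normrM mulr_ile1.
have -> : a i * \prod_(j <- r) a j - b i * \prod_(j <- r) b j =
  a i * (\prod_(j <- r) a j - \prod_(j <- r) b j) + (a i - b i) * \prod_(j <- r) b j.
  by ring.
have -> : (size (i :: r))%:R * del = (size r)%:R * del + del.
  by rewrite /= -natr1 mulrDl mul1r.
apply: (le_trans (ler_normD _ _)).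
apply: lerD; rewrite normrM.
  exact: le_trans (ler_piMl (normr_ge0 _) (a1 i)) IH1.
exact: le_trans (ler_piMr (normr_ge0 _) IH2) (ab i).
Qed.

Lemma monomials_lipschitz z z' v del :
  (forall i, `|z 0 i| <= 1) -> (forall i, `|z' 0 i| <= 1) -> 0 <= del ->
  (forall i, `|z 0 i - z' 0 i| <= del) ->
  `|monomials p z v - monomials p z' v| <= d%:R * p%:R * del.
Proof.
move=> z1 z1' del0 zz.
have pow1 (a : R) n : `|a| <= 1 -> `|a ^+ n| <= 1.
  by move=> a1; rewrite normrX exprn_ile1.
rewrite !monomialsE -mulrBl normrM.
apply: (@le_trans _ _ `|\prod_(i < d) z 0 i ^+ val v i - \prod_(i < d) z' 0 i ^+ val v i|).
  rewrite ler_piMr// ger0_norm ?invr_ge0// invf_le1 ?ltr0n ?wfact_gt0//.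
  by rewrite ler1n wfact_gt0.
apply: (le_trans (prod_lipschitz (del := p%:R * del) _ _ _ _ _)).
- by move=> i; exact: pow1.
- by move=> i; exact: pow1.
- by rewrite mulr_ge0.
- move=> i; have powE (a : R) m : a ^+ m = \prod_(0 <= j < m) a.
    by rewrite prodr_const_nat subn0.
  rewrite !powE.
  apply: (le_trans (prod_lipschitz (del := del) _ _ _ _ _)) => //.
  by rewrite ler_wpM2r// ler_nat size_iota subn0 -ltnS ltn_ord.
- by rewrite /index_enum -enumT size_enum_ord mulrA.
Qed.

(** By [grid_coef_bound] a polynomial is large at some grid point, hence on a cube
    around it. The radius of the cubes does not depend on the polynomial, and the
    grid is so small that they stay where the kernel is bounded below. *)
Lemma peval_lower : exists e c : R, [/\ 0 < e, 0 < c,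
  (forall j z, box (gridpt j) e z -> enorm z <= 1) &
  forall b, exists j, forall z, box (gridpt j) e z -> c * nrm b <= `|peval z b|].
Proof.
have [C C0 hC] := grid_coef_bound.
pose N : R := #|{: mindex d p}|%:R.
have N0 : 0 < N by rewrite ltr0n card_mindex_gt0.
have dd0 : 0 < (2 * d%:R)^-1 :> R by rewrite invr_gt0 mulr_gt0// ltr0n.
pose c := (4 * N * C)^-1.
have c0 : 0 < c by rewrite invr_gt0 !mulr_gt0.
pose e := Num.min (2 * d%:R)^-1 (c / (d%:R * p%:R + 1)).
have L0 : 0 < d%:R * p%:R + 1 :> R by rewrite ltr_wpDl// mulr_ge0.
have e0 : 0 < e by rewrite lt_min dd0/= divr_gt0.
have gz j z i : box (gridpt j) e z -> `|z 0 i| <= d%:R^-1.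
  move=> /(_ i) zi; rewrite -(subrK (gridpt j 0 i) (z 0 i)).
  apply: (le_trans (ler_normD _ _)).
  have -> : d%:R^-1 = (2 * d%:R)^-1 + (2 * d%:R)^-1 :> R.
    by field; rewrite pnatr_eq0 -lt0n.
  rewrite lerD//; first by rewrite (le_trans zi)// ge_min lexx.
  by rewrite mxE; have /andP[h1 h2] := node_bound (j i); rewrite ger0_norm.
have d1 : d%:R^-1 <= 1 :> R by rewrite invf_le1 ?ltr0n// ler1n.
exists e, c; split => //.
- move=> j z jz; apply: (le_trans (enorm_box (e := d%:R^-1) _ _)).
  + by rewrite invr_ge0.
  + by move=> i; exact: gz jz.
  + by rewrite mulfV// pnatr_eq0 -lt0n.
- move=> b.
  have [j hj] : exists j, 2 * c * nrm b <= `|peval (gridpt j) b|.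
    apply: contrapT => /forallNP h.
    have h' j : `|peval (gridpt j) b| <= 2 * c * nrm b.
      by have /negP := h j; rewrite -ltNge => /ltW.
    have := nrm_le (hC _ _ h').
    have -> : #|{: mindex d p}|%:R * (C * (2 * c * nrm b)) = nrm b / 2.
      by rewrite -/N /c; field; rewrite !gt_eqF.
    move=> h2.
    have nb : nrm b = 0.
      by apply/eqP; rewrite eq_le nrm_ge0 andbT; lra.
    by apply: (h [ffun=> ord0]); rewrite nb mulr0.
  exists j => z jz.
  have jj : box (gridpt j) e (gridpt j).
    by move=> i; rewrite subrr normr0 ltW.
  have diff : `|peval z b - peval (gridpt j) b| <= c * nrm b.
    rewrite /peval -sumrB (le_trans (ler_norm_sum _ _ _))// /nrm mulr_sumr.
    apply: ler_sum => v _; rewrite -mulrBl normrM ler_wpM2r//.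
    apply: (le_trans (monomials_lipschitz v (del := e) _ _ _ _)).
    + by move=> i; rewrite (le_trans (gz j z i jz)).
    + by move=> i; rewrite (le_trans (gz j _ i jj)).
    + exact: ltW.
    + exact: jz.
    + apply: (@le_trans _ _ ((d%:R * p%:R + 1) * e)).
        by rewrite ler_wpM2r ?lerDl// ltW.
      by rewrite mulrC -ler_pdivlMr// ge_min lexx orbT.
  have := ler_distD (peval z b) 0 (peval (gridpt j) b).
  rewrite sub0r normrN sub0r normrN => h3.
  by lra.
Qed.

End grid.
End peval.

(** * Localized moments *)

Lemma sqrrD_le_twice (R : realFieldType) (a b : R) :
  (a + b) ^+ 2 <= 2 * (a ^+ 2 + b ^+ 2).
Proof.
have := sqr_ge0 (a - b); rewrite sqrrB sqrrD; lra.
Qed.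

Lemma mulr_le_half_sqr (R : realFieldType) (a b : R) :
  a * b <= (a ^+ 2 + b ^+ 2) / 2.
Proof.
have := sqr_ge0 (a - b); rewrite sqrrB; lra.
Qed.

Lemma chain_sum_le (R : realFieldType) (a D c e t : R) : 0 <= a -> 0 <= D ->
  0 <= c -> 0 <= e -> 1 <= t ->
  a * (D * t) + c + D * t + (a * (D * t) + c) <= (1 + e + 3 * (a + 1) * D + 2 * c) * t.
Proof.
move=> a0 D0 c0 e0 t1.
have t0 : 0 <= t := le_trans ler01 t1.
have := ler_wpM2l c0 t1; have := mulr_ge0 e0 t0; have := mulr_ge0 D0 t0.
have := mulr_ge0 a0 (mulr_ge0 D0 t0); lra.
Qed.

Section localized.
Context (R : realType) (d p : nat) (disp : measure_display).
Context (Omega : measurableType disp) (P : probability Omega R).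
Local Notation Rd := (borel_rV R d).
Local Notation coefs := {ffun mindex d p -> R}.
Implicit Types (b : coefs) (c : option (mindex d p)) (m h : R).
Variables (X : Omega -> Rd) (Y : Omega -> R).
Hypotheses (mX : measurable_fun setT X) (mY : measurable_fun setT Y).
Variables (x0 : 'rV[R]_d) (K : 'rV[R]_d -> R) (F : R -> 'rV[R]_d -> R).
Variables (M KB eta yb Cf CX : R).
Hypotheses (M1 : 1 <= M) (K0 : forall z, 0 <= K z) (KBP : forall z, K z <= KB).
Hypothesis cK : continuous K.
Hypothesis suppK : forall z, K z != 0 -> forall i, `|z 0 i| <= M.
Hypothesis bF : forall u : Rd -> R, measurable_fun setT u ->
  bmf (fun x : Rd => F (u x) x).
Hypothesis dis : forall om u : Rd -> R, bmf om -> measurable_fun setT u ->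
  Ex P (fun w => om (X w) * (Y w <= u (X w))%R%:R) =
  Ex P (fun w => om (X w) * F (u (X w)) (X w)).
Hypothesis Cf0 : 0 <= Cf.
Hypothesis F_le : forall x y y', box x0 eta x -> - yb <= y -> y <= y' -> y' <= yb ->
  0 <= F y' x - F y x <= Cf * (y' - y).
Hypothesis CX0 : 0 <= CX.
Hypothesis X_le : forall e, 0 <= e <= eta ->
  fine (P [set w | box x0 e (X w)]) <= CX * e ^+ d.

(** Covariate centred at [x0], in units of the bandwidth. *)
Definition zof (h : R) (x : 'rV[R]_d) : 'rV[R]_d := h^-1 *: (x - x0).

(** [Some v] is the weight of the score in coordinate [v]. The box [None] contains
    the supports of all of these, and serves to dominate them. *)
Definition wt (h : R) (c : option (mindex d p)) (x : Rd) : R :=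
  if c is Some v then monomials p (zof h x) v * K (zof h x)
  else \1_(box x0 (h * M)) x.

(** Bound for the monomials on the support of the kernel. *)
Definition CU : R := M ^+ p.

Lemma CU1 : 1 <= CU.
Proof. by rewrite /CU; apply: exprn_ege1. Qed.

Lemma CU0 : 0 < CU.
Proof. exact: lt_le_trans CU1. Qed.

Lemma monomials_le (z : 'rV[R]_d) v : (forall i, `|z 0 i| <= M) -> `|monomials p z v| <= CU.
Proof.
move=> zM; have M0 : 0 <= M by exact: le_trans M1.
rewrite monomialsE normrM normr_prod.
apply: (@le_trans _ _ (\prod_(i < d) M ^+ val v i)).
  apply: (@le_trans _ _ (\prod_(i < d) `|z 0 i ^+ val v i|)).
    rewrite ler_piMr// ?prodr_ge0// ger0_norm ?invr_ge0// invf_le1 ?ltr0n ?wfact_gt0//.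
    by rewrite ler1n wfact_gt0.
  by apply: ler_prod => i _; rewrite normr_ge0 normrX lerXn2r ?nnegrE.
rewrite -expr_sum /CU ler_weXn2l//.
exact: (valP v).
Qed.

Lemma peval_le (z : 'rV[R]_d) b : (forall i, `|z 0 i| <= M) -> `|peval (p := p) z b| <= CU * nrm b.
Proof.
move=> zM; rewrite /peval (le_trans (ler_norm_sum _ _ _))// /nrm mulr_sumr.
by apply: ler_sum => v _; rewrite normrM ler_wpM2r// monomials_le.
Qed.

Section h_fixed.
Variable h : R.
Hypotheses (h0 : 0 < h) (hM : h * M <= eta).

Lemma zof_boxP x : box x0 (h * M) x <-> forall i, `|zof h x 0 i| <= M.
Proof.
have E i : (`|zof h x 0 i| <= M) = (`|x 0 i - x0 0 i| <= h * M).
  by rewrite !mxE normrM normfV (gtr0_norm h0) ler_pdivrMl.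
by split=> H i; have := H i; rewrite E.
Qed.

Lemma wt_out c x : ~ box x0 (h * M) x -> wt h c x = 0.
Proof.
move=> nx; rewrite /wt; case: c => [v|]; last by rewrite indicE memNset.
have [->|Kz] := eqVneq (K (zof h x)) 0; first by rewrite mulr0.
by exfalso; apply: nx; apply/zof_boxP; exact: suppK Kz.
Qed.

(** Bound for all the weights. *)
Definition bw : R := 1 + CU * KB.

Lemma KB0 : 0 <= KB.
Proof. exact: le_trans (K0 0) (KBP 0). Qed.

Lemma bw1 : 1 <= bw.
Proof. by rewrite /bw lerDl mulr_ge0 ?KB0// ltW// CU0. Qed.

Lemma wtN01 x : 0 <= wt h None x <= 1.
Proof. by rewrite /wt indicE; case: (_ \in _); rewrite ?lexx ?ler01. Qed.

Lemma wt_le c x : `|wt h c x| <= bw * wt h None x.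
Proof.
have [xb|xb] := pselect (box x0 (h * M) x); last by rewrite !wt_out// normr0 mulr0.
rewrite {2}/wt indicE mem_set// mulr1 /wt; case: c => [v|].
  apply: (@le_trans _ _ (CU * KB)); last by rewrite /bw lerDr.
  rewrite normrM ler_pM//; first exact/monomials_le/zof_boxP.
  by rewrite ger0_norm//; exact: KBP.
by rewrite indicE mem_set// normr1 bw1.
Qed.

Lemma wt_le_bw c x : `|wt h c x| <= bw.
Proof.
apply: (le_trans (wt_le c x)); rewrite ler_piMr ?(le_trans _ bw1)//.
by have /andP[] := wtN01 x.
Qed.

Lemma continuous_zof : continuous (zof h).
Proof.
move=> x; apply: (continuous_comp (f := fun y : 'rV[R]_d => y - x0)
  (g := fun y : 'rV[R]_d => h^-1 *: y)); last exact: scaler_continuous.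
by apply: continuousB; [exact: cvg_id|exact: cst_continuous].
Qed.

Lemma measurable_zof i : measurable_fun setT (fun x : Rd => zof h x 0 i).
Proof.
apply: (continuous_borel_measurable (g := fun x : 'rV[R]_d => zof h x 0 i)).
move=> x; apply: (continuous_comp (f := zof h) (g := fun z : 'rV[R]_d => z 0 i)).
  exact: continuous_zof.
exact: coord_continuous.
Qed.

Lemma measurable_monomials v : measurable_fun setT (fun x : Rd => monomials p (zof h x) v).
Proof.
have -> : (fun x : Rd => monomials p (zof h x) v) =
    (fun x => (\prod_(i < d) zof h x 0 i ^+ val v i) * (wfact v)%:R^-1).
  by apply/funext => z; rewrite monomialsE.
apply: measurable_funM => //; apply: measurable_prod => i _.
by apply: measurable_funX; exact: measurable_zof.
Qed.

Lemma measurable_peval (b : coefs) : measurable_fun setT (fun x : Rd => peval (zof h x) b).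
Proof.
apply: measurable_sum => v; apply: measurable_funM => //.
exact: measurable_monomials.
Qed.

Lemma bmf_wt c : bmf (wt h c).
Proof.
split; last by exists bw; exact: wt_le_bw.
case: c => [v|]; last by apply: measurable_indic; exact: measurable_box.
apply: measurable_funM; first exact: measurable_monomials.
apply: (continuous_borel_measurable (g := fun x : 'rV[R]_d => K (zof h x))).
by move=> x; apply: continuous_comp; [exact: continuous_zof|exact: cK].
Qed.

Lemma Ex_wtN : Ex P (fun w => wt h None (X w)) <= CX * (h * M) ^+ d.
Proof.
rewrite (Ex_comp_indic P mX (measurable_box x0 (h * M))).
by apply: X_le; rewrite hM andbT mulr_ge0// ?(le_trans _ M1)// ltW.
Qed.

(** Mass of the box [None] in units of h^d. *)
Definition C0 : R := CX * M ^+ d.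

Lemma Ex_wtN_le : Ex P (fun w => wt h None (X w)) <= C0 * h ^+ d.
Proof. by rewrite (le_trans Ex_wtN)// exprMn /C0 mulrCA mulrC. Qed.

(** One factor of the bound is the conditional probability of the strip, the other
    the mass of the box that carries the weight. *)
Lemma between_le (u1 u2 : Rd -> R) m :
  measurable_fun setT u1 -> measurable_fun setT u2 ->
  (forall x, box x0 (h * M) x -> - yb <= u1 x /\ u1 x <= u2 x /\ u2 x <= yb) ->
  (forall x, box x0 (h * M) x -> u2 x - u1 x <= m) -> 0 <= m ->
  Ex P (fun w => wt h None (X w) * ((Y w <= u2 (X w))%R%:R - (Y w <= u1 (X w))%R%:R))
    <= C0 * Cf * m * h ^+ d.
Proof.
move=> mu1 mu2 hu hm m0.
have bN : bmf (wt h None) by exact: bmf_wt.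
have bI (u : Rd -> R) : measurable_fun setT u ->
    bmf (fun w => wt h None (X w) * (Y w <= u (X w))%R%:R).
  move=> mu; apply: bmfM; first exact: bmf_comp.
  by apply: bmf_le => //; exact: measurableT_comp.
have bFu (u : Rd -> R) : measurable_fun setT u ->
    bmf (fun w => wt h None (X w) * F (u (X w)) (X w)).
  move=> mu; apply: bmfM; first exact: bmf_comp.
  by apply: (bmf_comp (f := fun x => F (u x) x)) => //; exact: bF.
rewrite (@eq_Ex _ _ _ P _ (fun w => wt h None (X w) * (Y w <= u2 (X w))%R%:R -
  wt h None (X w) * (Y w <= u1 (X w))%R%:R)); last by move=> w; rewrite mulrBr.
rewrite (ExB P (bI _ mu2) (bI _ mu1)) (dis bN mu2) (dis bN mu1).
rewrite -(ExB P (bFu _ mu2) (bFu _ mu1)).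
apply: (@le_trans _ _ (Ex P (fun w => (Cf * m) * wt h None (X w)))).
  apply: le_Ex; first by apply: bmfB; exact: bFu.
    by apply/bmfZ/bmf_comp.
  move=> w; rewrite -mulrBr mulrC.
  have [xb|xb] := pselect (box x0 (h * M) (X w)); last by rewrite wt_out// !mulr0.
  apply: ler_wpM2r; first by have /andP[] := wtN01 (X w).
  have [a1 [a2 a3]] := hu _ xb.
  have xe : box x0 eta (X w) by move=> i; exact: le_trans (xb i) hM.
  have /andP[_ h2] := F_le xe a1 a2 a3.
  by rewrite (le_trans h2)// ler_wpM2l// hm.
rewrite ExZ; last exact: bmf_comp.
rewrite (le_trans (ler_wpM2l _ Ex_wtN_le))// ?mulr_ge0//.
by rewrite le_eqVlt; apply/orP; left; apply/eqP; ring.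
Qed.

(** Summand of the score at [b], up to a term that does not depend on [b]. *)
Definition psi c (b : coefs) (z : Rd * R) : R :=
  wt h c z.1 * (z.2 <= peval (zof h z.1) b)%R%:R.

Lemma bmf_psi c b : bmf (psi c b).
Proof.
apply: bmfM; first by apply: (bmf_comp (f := wt h c)) => //; exact: bmf_wt.
apply: bmf_le => //.
by apply: (measurableT_comp (f := fun x : Rd => peval (zof h x) b)) => //; exact: measurable_peval.
Qed.

End h_fixed.

Definition shift0 (b : coefs) (t : R) : coefs := [ffun v => b v + t * (v == mindex0 d p)%:R].

Lemma peval_shift0 z b t : peval z (shift0 b t) = peval z b + t.
Proof.
rewrite /peval (eq_bigr (fun v => monomials p z v * b v +
  t * (monomials p z v * (v == mindex0 d p)%:R))); last first.
  by move=> v _; rewrite [X in _ * X = _]ffunE; ring.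
rewrite big_split/=; congr (_ + _); rewrite -mulr_sumr (bigD1 (mindex0 d p))//=.
rewrite eqxx big1 ?addr0; last by move=> v /negbTE ->; rewrite mulr0.
rewrite monomialsE /wfact !big1 ?divr1 ?mulr1//.
  by move=> i _; rewrite /= ffunE fact0.
by move=> i _; rewrite /= ffunE expr0.
Qed.

Lemma indicator_between (y u u' m : R) : `|u - u'| <= m ->
  `|(y <= u)%R%:R - (y <= u')%R%:R| <=
    (y <= u' + m)%R%:R - (y <= u' - m)%R%:R :> R.
Proof.
rewrite ler_distl => /andP[h1 h2].
have [a1|a1] := leP y (u' - m).
  have a2 : y <= u by exact: le_trans h1.
  have m0 : 0 <= m by lra.
  have a3 : y <= u' by lra.
  have a4 : y <= u' + m by lra.
  by rewrite a2 a3 a4 !subrr normr0.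
have [a2|a2] := leP y (u' + m).
  rewrite subr0; case: (y <= u); case: (y <= u');
    by rewrite ?subrr ?subr0 ?sub0r ?normrN ?normr0 ?normr1.
have a3 : u < y by exact: le_lt_trans a2.
have a4 : u' < y by lra.
by rewrite (lt_geF a3) (lt_geF a4) !subrr normr0.
Qed.

Section coefficient_ball.
Variables (B : R).
Let Pn : R := #|{: mindex d p}|%:R.
Hypotheses (B0 : 0 < B) (yB : 8 * (CU * (Pn * B)) <= yb).

Lemma Pn1 : 1 <= Pn.
Proof. by rewrite /Pn ler1n card_mindex_gt0. Qed.

(** Mass of the strip of half-width [m] around the polynomial: it dominates the
    change of [psi] under a perturbation of the polynomial by at most [m]. *)
Definition bracket h (b : coefs) (m : R) (z : Rd * R) : R :=
  psi h None (shift0 b m) z - psi h None (shift0 b (- m)) z.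

Section bracket.
Variable h : R.
Hypotheses (h0 : 0 < h) (hM : h * M <= eta).

Lemma bmf_bracket b m : bmf (bracket h b m).
Proof. by apply: bmfB; exact: bmf_psi. Qed.

Lemma bracket_ge0 b m z : 0 <= m -> 0 <= bracket h b m z <= 1.
Proof.
move=> m0; rewrite /bracket /psi -mulrBr !peval_shift0.
have /andP[w0 w1] := wtN01 h z.1.
set u := peval _ _.
suff : 0 <= ((z.2 <= u + m)%R%:R - (z.2 <= u - m)%R%:R : R) /\
    ((z.2 <= u + m)%R%:R - (z.2 <= u - m)%R%:R : R) <= 1.
  by move=> [i0 i1]; rewrite mulr_ge0// mulr_ile1.
have [a1|a1] := leP z.2 (u - m).
  have a2 : z.2 <= u + m by lra.
  by rewrite a2 subrr.
by rewrite subr0; case: (z.2 <= u + m).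
Qed.

Lemma psi_bracket c b b' m z :
  (forall y : 'rV[R]_d, (forall i, `|y 0 i| <= M) -> `|peval y b - peval y b'| <= m) ->
  `|psi h c b z - psi h c b' z| <= bw * bracket h b' m z.
Proof.
move=> hb; rewrite /psi -mulrBr normrM /bracket /psi -mulrBr mulrA.
have [xb|xb] := pselect (box x0 (h * M) z.1); last first.
  by rewrite !wt_out// normr0 mulr0 !mul0r.
apply: ler_pM => //; first exact: wt_le.
rewrite !peval_shift0; apply: indicator_between; apply: hb.
by apply/zof_boxP.
Qed.

Lemma peval_diff_le b b' (y : 'rV[R]_d) : (forall i, `|y 0 i| <= M) ->
  `|peval y b - peval y b'| <= CU * nrm [ffun v => b v - b' v].
Proof. by move=> yM; rewrite -pevalB; exact: peval_le. Qed.

Lemma Ex_bracket b m : 0 <= m -> CU * nrm b + m <= yb ->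
  Ex P (fun w => bracket h b m (X w, Y w)) <= C0 * Cf * (2 * m) * h ^+ d.
Proof.
move=> m0 hm.
rewrite (@eq_Ex _ _ _ P _ (fun w => wt h None (X w) *
   ((Y w <= peval (zof h (X w)) (shift0 b m))%R%:R -
    (Y w <= peval (zof h (X w)) (shift0 b (- m)))%R%:R))); last first.
  by move=> w; rewrite /bracket /psi mulrBr.
apply: (between_le h0 hM (m := 2 * m)
  (u1 := fun x => peval (zof h x) (shift0 b (- m)))
  (u2 := fun x => peval (zof h x) (shift0 b m))).
- exact: measurable_peval.
- exact: measurable_peval.
- move=> x /zof_boxP -/(_ h0) xb; rewrite !peval_shift0.
  have := peval_le b xb; rewrite ler_norml => /andP[h1 h2].
  by split; [lra|split; lra].
- by move=> x _; rewrite !peval_shift0; lra.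
- by rewrite mulr_ge0.
Qed.

Lemma Ex_psi_lip c b b' m : 0 <= m -> CU * nrm b' + m <= yb ->
  (forall y : 'rV[R]_d, (forall i, `|y 0 i| <= M) -> `|peval y b - peval y b'| <= m) ->
  `|Ex P (fun w => psi h c b (X w, Y w)) - Ex P (fun w => psi h c b' (X w, Y w))| <=
  bw * (C0 * Cf * (2 * m) * h ^+ d).
Proof.
move=> m0 hm hb.
have mXY : measurable_fun setT (fun w => (X w, Y w)) by exact: measurable_fun_pair.
have b1 : bmf (fun w => psi h c b (X w, Y w)) by apply: (bmf_comp (f := psi h c b)) => //; exact: bmf_psi.
have b2 : bmf (fun w => psi h c b' (X w, Y w)) by apply: (bmf_comp (f := psi h c b')) => //; exact: bmf_psi.
have b3 : bmf (fun w => bracket h b' m (X w, Y w)).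
  by apply: (bmf_comp (f := bracket h b' m)) => //; exact: bmf_bracket.
rewrite -ExB// (le_trans (Ex_norm _ _))//; first exact: bmfB.
apply: (@le_trans _ _ (Ex P (fun w => bw * bracket h b' m (X w, Y w)))).
  apply: le_Ex; [exact/bmf_norm/bmfB|exact: bmfZ|].
  by move=> w; exact: psi_bracket.
rewrite ExZ// ler_wpM2l//; first by rewrite (le_trans _ bw1).
exact: Ex_bracket.
Qed.

Lemma Ex_psi_sq c b b' m : 0 <= m -> CU * nrm b' + m <= yb ->
  (forall y : 'rV[R]_d, (forall i, `|y 0 i| <= M) -> `|peval y b - peval y b'| <= m) ->
  Ex P (fun w => (psi h c b (X w, Y w) - psi h c b' (X w, Y w)) ^+ 2) <=
  bw ^+ 2 * (C0 * Cf * (2 * m) * h ^+ d).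
Proof.
move=> m0 hm hb.
have mXY : measurable_fun setT (fun w => (X w, Y w)) by exact: measurable_fun_pair.
have b1 : bmf (fun w => psi h c b (X w, Y w)) by apply: (bmf_comp (f := psi h c b)) => //; exact: bmf_psi.
have b2 : bmf (fun w => psi h c b' (X w, Y w)) by apply: (bmf_comp (f := psi h c b')) => //; exact: bmf_psi.
have b3 : bmf (fun w => bracket h b' m (X w, Y w)).
  by apply: (bmf_comp (f := bracket h b' m)) => //; exact: bmf_bracket.
apply: (@le_trans _ _ (Ex P (fun w => bw ^+ 2 * bracket h b' m (X w, Y w)))).
  apply: le_Ex; [|exact: bmfZ|].
    by under eq_fun do rewrite expr2; apply: bmfM; exact: bmfB.
  move=> w; have bd := psi_bracket c (X w, Y w) hb.
  have /andP[i0 i1] := bracket_ge0 b' (X w, Y w) m0.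
  have bw0 : 0 <= bw by rewrite (le_trans _ bw1).
  rewrite -real_normK ?num_real//.
  apply: (@le_trans _ _ ((bw * bracket h b' m (X w, Y w)) ^+ 2)).
    by rewrite lerXn2r// nnegrE// mulr_ge0.
  by rewrite exprMn ler_wpM2l ?sqr_ge0// expr2 ler_piMr.
rewrite ExZ// ler_wpM2l ?sqr_ge0//; exact: Ex_bracket.
Qed.

End bracket.

(** * Uniform deviations of the score *)

Variable Zs : nat -> Omega -> Rd * R.
Local Notation Z := (fun w => (X w, Y w)).
Hypothesis mZs : forall i, measurable_fun setT (Zs i).
Hypothesis same_law : forall i (C : set (Rd * R)), measurable C ->
  P [set w | C (Zs i w)] = P [set w | C (Z w)].
Hypothesis indep : forall (J : {fset nat}) (C : nat -> set (Rd * R)),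
  (forall i, measurable (C i)) ->
  P (\bigcap_(i in [set` J]) [set w | C i (Zs i w)]) =
  (\prod_(i <- J) P [set w | C i (Zs i w)])%E.

Let mZ : measurable_fun setT Z. Proof. exact: measurable_fun_pair. Qed.

Let bZ (f : Rd * R -> R) : bmf f -> bmf (fun w => f (Z w)).
Proof. by move=> bf; exact: (bmf_comp mZ bf). Qed.

Definition Dv n (f : Rd * R -> R) w := dev P Z Zs n f w.

Lemma DvB n (f g : Rd * R -> R) w : bmf f -> bmf g ->
  Dv n (fun z => f z - g z) w = Dv n f w - Dv n g w.
Proof.
move=> bf bg; rewrite /Dv /dev sumrB ExB; [ring|exact: bZ|exact: bZ].
Qed.

(** If [I] dominates the difference of [f] and [g], then the two centred sums differ
    by the sum of [I] plus the mean of the difference, and the sum of [I] is its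
    centred sum plus its mean. *)
Lemma Dv_dom n (f g I : Rd * R -> R) a w : bmf f -> bmf g -> bmf I -> 0 <= a ->
  (forall z, `|f z - g z| <= a * I z) ->
  `|Dv n f w - Dv n g w| <=
    a * `|Dv n I w| + 2 * (n%:R * (a * Ex P (fun w => I (Z w)))).
Proof.
move=> bf bg bI a0 fgI.
rewrite -DvB// /Dv /dev.
have h1 : `|\sum_(i < n) (f (Zs i w) - g (Zs i w))| <= a * \sum_(i < n) I (Zs i w).
  by rewrite (le_trans (ler_norm_sum _ _ _))// mulr_sumr ler_sum.
have bfg : bmf (fun z => f z - g z) by exact: bmfB.
have h2 : `|Ex P (fun w => f (Z w) - g (Z w))| <= a * Ex P (fun w => I (Z w)).
  rewrite (le_trans (Ex_norm _ _))//; first exact: (bZ bfg).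
  rewrite -ExZ; last exact: bZ.
  by apply: le_Ex; [exact/bmf_norm/(bZ bfg)|exact/bmfZ/bZ|move=> t; exact: fgI].
set S := \sum_(i < n) I _ in h1 *; set E := Ex P (fun w => I _) in h2 *.
have h3 : a * S <= a * `|S - n%:R * E| + n%:R * (a * E).
  have : S <= `|S - n%:R * E| + n%:R * E by rewrite -lerBlDr ler_norm.
  by move=> /(ler_wpM2l a0); rewrite mulrDr (mulrCA a n%:R).
have h4 : `|n%:R * Ex P (fun w => f (Z w) - g (Z w))| <= n%:R * (a * E).
  by rewrite normrM ger0_norm// ler_wpM2l.
apply: (le_trans (ler_normB _ _)).
apply: (le_trans (lerD (le_trans h1 h3) h4)).
lra.
Qed.

Definition nd b b' : R := nrm [ffun v => b v - b' v].

Lemma nd_le b b' m : (forall v, `|b v - b' v| <= m) -> nd b b' <= Pn * m.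
Proof. by move=> h; apply: nrm_le => v; rewrite ffunE. Qed.

Lemma nd_triangle b1 b2 b3 : nd b1 b3 <= nd b1 b2 + nd b2 b3.
Proof.
rewrite /nd /nrm -big_split/=; apply: ler_sum => v _; rewrite !ffunE.
exact: ler_distD.
Qed.

Lemma ndC b b' : nd b b' = nd b' b.
Proof. by rewrite /nd /nrm; apply: eq_bigr => v _; rewrite !ffunE distrC. Qed.

(** A mesh of order 1/n makes the means of the brackets around grid points
    summable to a constant, while the grid has polynomial size. *)
Definition mesh (n : nat) : R := B / n%:R.

Definition grid_coefs n (g : {ffun mindex d p -> 'I_(2 * n).+1}) : coefs :=
  [ffun v => mesh n * ((g v)%:R - n%:R)].

Lemma mesh_gt0 n : (0 < n)%N -> 0 < mesh n.
Proof. by move=> n0; rewrite divr_gt0// ltr0n. Qed.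

Lemma grid_coefs_bound n g v : (0 < n)%N -> `|@grid_coefs n g v| <= B.
Proof.
move=> n0; rewrite ffunE normrM gtr0_norm ?mesh_gt0//.
rewrite /mesh mulrAC ler_pdivrMr ?ltr0n// ler_pM2l// ler_distl subrr ler0n/=.
by rewrite -natrD ler_nat addnn -mul2n -ltnS.
Qed.

Lemma round_to_grid n b : (0 < n)%N -> (forall v, `|b v| <= B) ->
  exists g, forall v, `|b v - @grid_coefs n g v| <= mesh n.
Proof.
move=> n0 bB; have m0 := mesh_gt0 n0.
have nn : 0 < n%:R :> R by rewrite ltr0n.
pose t v := (b v + B) / mesh n.
have t0 v : 0 <= t v.
  apply: divr_ge0; last exact: ltW.
  by have := bB v; rewrite ler_norml => /andP[h _]; lra.
have t2 v : (Num.truncn (t v) < (2 * n).+1)%N.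
  have /andP[h1 _] := truncn_itv (t0 v).
  rewrite ltnS -(ler_nat R) (le_trans h1)// /t ler_pdivrMr//.
  have -> : (2 * n)%:R * mesh n = 2 * B.
    by rewrite natrM /mesh; field; rewrite gt_eqF.
  by have := bB v; rewrite ler_norml => /andP[_ h]; lra.
exists [ffun v => Ordinal (t2 v)] => v; rewrite !ffunE/=.
have -> : b v - mesh n * ((Num.truncn (t v))%:R - n%:R) =
    mesh n * (t v - (Num.truncn (t v))%:R).
  have E : mesh n * t v = b v + mesh n * n%:R.
    rewrite /t mulrC divfK ?gt_eqF//; congr (_ + _).
    by rewrite /mesh divfK ?gt_eqF.
  by rewrite !mulrBr E; ring.
have /andP[h1 h2] := truncn_itv (t0 v).
rewrite normrM gtr0_norm// ger_pMr// ger0_norm ?subr_ge0//.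
by rewrite lerBlDl ltW// natr1.
Qed.

Lemma expR_neg_ln (n m : nat) : (0 < n)%N -> expR (- (m%:R * ln n%:R)) = (n ^ m)%:R^-1 :> R.
Proof.
by move=> n0; rewrite expRN expRM_natl lnK ?posrE ?ltr0n// natrX.
Qed.

Lemma sqrtD_le (x y : R) : 0 <= x -> 0 <= y -> Num.sqrt (x + y) <= Num.sqrt x + Num.sqrt y.
Proof.
move=> xge yge; rewrite -[leRHS]ger0_norm ?addr_ge0 ?sqrtr_ge0// -sqrtr_sqr.
apply: ler_wsqrtr; rewrite sqrrD !sqr_sqrtr// addrAC lerDl.
by rewrite mulrn_wge0// mulr_ge0 ?sqrtr_ge0.
Qed.

Lemma grid_count (k n : nat) : (0 < k)%N -> (0 < n)%N ->
  2 * (k.+1 * ((2 * n).+1 ^ k * (2 * n).+1 ^ k) + (2 * n).+1 ^ k)%:R *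
    (n ^ (2 * k + 1))%:R^-1 <= 2 * ((k.+2)%:R * (3 ^ (2 * k))%:R) / n%:R :> R.
Proof.
move=> k0 n0.
have nn : 0 < n%:R :> R by rewrite ltr0n.
have nP : 0 < (n ^ (2 * k))%:R :> R by rewrite ltr0n expn_gt0 n0.
have cardJ : (k.+1 * ((2 * n).+1 ^ k * (2 * n).+1 ^ k) + (2 * n).+1 ^ k <=
    k.+2 * 3 ^ (2 * k) * n ^ (2 * k))%N.
  rewrite -!mulnA -(expnMn 3 n (2 * k)).
  have b1 : ((2 * n).+1 <= 3 * n)%N by rewrite (mulSn 2) -add1n leq_add2r.
  have b2 : ((2 * n).+1 ^ k * (2 * n).+1 ^ k <= (3 * n) ^ (2 * k))%N.
    by rewrite -expnD addnn -mul2n leq_exp2r// muln_gt0.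
  have b3 : ((2 * n).+1 ^ k <= (2 * n).+1 ^ k * (2 * n).+1 ^ k)%N.
    by rewrite leq_pmulr// expn_gt0.
  rewrite (mulSn k.+1) addnC; apply: leq_add; first exact: leq_trans b3 b2.
  by rewrite leq_mul2l b2 orbT.
have E (a D m : R) : D != 0 -> m != 0 -> 2 * (a * D) * (D * m)^-1 = 2 * a / m.
  by move=> D0 m0; field; rewrite D0 m0.
rewrite -[leRHS](E _ (n ^ (2 * k))%:R) ?gt_eqF//.
rewrite expnD expn1 (natrM _ (n ^ (2 * k)) n).
rewrite ler_wpM2r ?invr_ge0 ?mulr_ge0// ler_wpM2l//.
by rewrite -natrM -natrM ler_nat.
Qed.

Let Pk : nat := #|{: mindex d p}|.

(** Uniform modulus of continuity of the centred process. The exponential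
    inequality is applied to the increments between points of a grid of mesh B/n,
    polynomially many in n; general coefficients are squeezed between two
    translates of their nearest grid point. *)
Lemma modulus : exists2 C : R, 0 < C & forall h n rho,
  0 < h -> h * M <= eta -> h <= 1 -> (3 <= n)%N -> 1 <= ln n%:R :> R ->
  0 <= rho <= 2 * (Pn * B) ->
  exists A, [/\ measurable A, 1 - C / n%:R <= fine (P A) &
   forall w, A w -> forall c b b', (forall v, `|b v| <= B) -> (forall v, `|b' v| <= B) ->
     nd b b' <= rho ->
     `|Dv n (psi h c b) w - Dv n (psi h c b') w| <=
       C * (Num.sqrt (n%:R * h ^+ d * rho * ln n%:R) + ln n%:R)].
Proof.
have bw0 : 0 < bw by apply: lt_le_trans bw1.
have C00 : 0 <= C0 by rewrite /C0 mulr_ge0// exprn_ge0// (le_trans _ M1).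
have bwge := ltW bw0; have CUge := ltW CU0.
have Mdge : 0 <= M ^+ d by rewrite exprn_ge0// (le_trans _ M1).
have Pnge : 0 <= Pn by exact: ler0n.
have Bge := ltW B0.
pose Vc := bw ^+ 2 * (C0 * Cf * (2 * CU)).
have CU0' := CU0; have Pn1' := Pn1.
have Vc0 : 0 <= Vc by rewrite /Vc !mulr_ge0.
pose J n := ((option (mindex d p) * {ffun mindex d p -> 'I_(2 * n).+1} *
  {ffun mindex d p -> 'I_(2 * n).+1}) + {ffun mindex d p -> 'I_(2 * n).+1})%type.
have [kap kap0 [Cp Cp0 countJ]] : exists2 kap : R, 0 <= kap & exists2 Cp : R, 0 <= Cp &
    forall n, (0 < n)%N -> 2 * #|{: J n}|%:R * expR ((2 - kap) * ln n%:R) <= Cp / n%:R.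
  (* n^(2 Pk) pairs of grid points are beaten by n^(2 - kap), with a factor 1/n left *)
  exists (2 * Pk + 3)%:R; first exact: ler0n.
  exists (2 * ((Pk.+2)%:R * (3 ^ (2 * Pk))%:R)); first by rewrite !mulr_ge0.
  move=> n n0.
  have -> : (2 - (2 * Pk + 3)%:R) * ln n%:R = - ((2 * Pk + 1)%:R * ln n%:R) :> R.
    by rewrite !natrD; ring.
  rewrite expR_neg_ln//; have PkP : (0 < Pk)%N by exact: card_mindex_gt0.
  apply: le_trans (grid_count PkP n0).
  rewrite card_sum !card_prod card_option !card_ffun card_ord -/Pk.
  by rewrite -mulnA.
have [Ca CaE] : exists a : R, a = Num.sqrt Vc by exists (Num.sqrt Vc).
have [Cb CbE] : exists a : R, a = Num.sqrt (Vc * (2 * (Pn * B)) + 16 * bw ^+ 2) by eexists.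
have [Cc CcE] : exists a : R, a = 2 * (bw * (C0 * Cf * (2 * (CU * (Pn * B))))) by eexists.
pose C : R := 1 + Cp + 3 * (bw + 1) * kap * (Ca + Cb) + 2 * Cc.
have Ca0 : 0 <= Ca by rewrite CaE; exact: sqrtr_ge0.
have Cb0 : 0 <= Cb by rewrite CbE; exact: sqrtr_ge0.
have Cc0 : 0 <= Cc by rewrite CcE !mulr_ge0.
have Ck0 : 0 <= 3 * (bw + 1) * kap * (Ca + Cb).
  by rewrite mulr_ge0 ?(addr_ge0 Ca0 Cb0)// mulr_ge0// mulr_ge0// addr_ge0.
exists C; first by rewrite /C; do 3 ?[rewrite ltr_wpDr//]; exact: mulr_ge0.
move=> h n rho h0 hM h1 n3 l1 /andP[rho0 rhoB].
have n0 : (0 < n)%N by exact: leq_trans n3.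
have nn : 0 < n%:R :> R by rewrite ltr0n.
set l := ln n%:R in l1 *.
have m0 := mesh_gt0 n0.
have mge := ltW m0.
have mB : mesh n <= B by rewrite /mesh ler_pdivrMr// ler_peMr// ler1n.
pose mu := CU * (Pn * mesh n).
have mu0 : 0 <= mu by rewrite /mu !mulr_ge0.
have muB : mu <= CU * (Pn * B).
  by rewrite /mu ler_wpM2l// ler_wpM2l.
pose rho' := rho + 2 * (Pn * mesh n).
pose fam (j : J n) : Rd * R -> R := match j with
  | inl q => if nd (grid_coefs q.1.2) (grid_coefs q.2) <= rho'
             then (fun z => psi h q.1.1 (grid_coefs q.1.2) z - psi h q.1.1 (grid_coefs q.2) z)
             else (fun=> 0)
  | inr g => bracket h (grid_coefs g) mu
  end.
have bfam j : bmf (fam j).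
  case: j => [q|g] /=; last exact: bmf_bracket.
  by case: ifP => _; [apply: bmfB; exact: bmf_psi|exact: bmf_cst].
have nrmg (g : {ffun mindex d p -> 'I_(2 * n).+1}) : nrm (grid_coefs g) <= Pn * B.
  by apply: nrm_le => v; apply: (grid_coefs_bound g v n0).
have hge := ltW h0.
have hd0 : 0 <= h ^+ d by exact: exprn_ge0.
have hd1 : h ^+ d <= 1 by exact: exprn_ile1.
have rho'0 : 0 <= rho' by rewrite /rho' addr_ge0// !mulr_ge0.
have PnB0 : 0 < Pn * B by rewrite mulr_gt0// (lt_le_trans _ Pn1').
have CPB0 : 0 < CU * (Pn * B) by rewrite mulr_gt0.
pose v := Vc * rho' * h ^+ d.
have v0 : 0 <= v by rewrite /v !mulr_ge0.
have psib c b z : `|psi h c b z| <= bw.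
  rewrite /psi normrM -[leRHS]mulr1 ler_pM//; first exact: wt_le_bw.
  by case: (z.2 <= _); rewrite ?normr0 ?normr1.
have famb j z : `|fam j z| <= 2 * bw.
  case: j => [q|g] /=.
    case: ifP => _; last by rewrite normr0 mulr_ge0.
    by rewrite (le_trans (ler_normB _ _))// mulr_natl mulr2n lerD.
  have /andP[i0 i1] := bracket_ge0 h (grid_coefs g) z mu0.
  by rewrite ger0_norm// (le_trans i1)//; have := bw1; lra.
have Ebr (g : {ffun mindex d p -> 'I_(2 * n).+1}) : Ex P (fun w => bracket h (grid_coefs g) mu (Z w)) <= C0 * Cf * (2 * mu) * h ^+ d.
  apply: Ex_bracket => //; have := ler_wpM2l (ltW CU0') (nrmg g).
  by move: yB muB CPB0; lra.
have famv j : Ex P (fun w => fam j (Z w) ^+ 2) <= v.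
  case: j => [q|g].
    rewrite /fam; case: ifPn => hq; last first.
      rewrite (@eq_Ex _ _ _ P _ (fun=> 0)); last by move=> w; rewrite expr2 mul0r.
      by rewrite Ex1.
    apply: (le_trans (Ex_psi_sq (m := CU * rho') _ _ _ _ _ _)) => //.
    - by rewrite mulr_ge0.
    - have h2 : rho' <= 4 * (Pn * B).
        rewrite /rho'; have := ler_wpM2l (ltW (lt_le_trans ltr01 Pn1')) mB.
        by move: rhoB; lra.
      have := ler_wpM2l (ltW CU0') (nrmg q.2); have := ler_wpM2l (ltW CU0') h2.
      by move: yB CPB0; lra.
    - move=> y yM; apply: (le_trans (peval_diff_le _ _ yM)).
      by rewrite ler_wpM2l.
    - by rewrite le_eqVlt /v /Vc; apply/orP; left; apply/eqP; ring.
  have bw2 : 1 <= bw ^+ 2 by rewrite exprn_ege1// bw1.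
  apply: (@le_trans _ _ (Ex P (fun w => bracket h (grid_coefs g) mu (Z w)))).
    apply: le_Ex.
    - by under eq_fun do rewrite expr2; apply: bmfM; exact: (bZ (bfam (inr g))).
    - exact: (bZ (bfam (inr g))).
    - move=> w; have /andP[i0 i1] := bracket_ge0 h (grid_coefs g) (Z w) mu0.
      by rewrite /fam expr2 ler_piMr.
  apply: (le_trans (Ebr g)); rewrite /v /Vc.
  have -> : bw ^+ 2 * (C0 * Cf * (2 * CU)) * rho' * h ^+ d =
     bw ^+ 2 * (C0 * Cf * (2 * (CU * rho')) * h ^+ d) by ring.
  have step : C0 * Cf * (2 * mu) * h ^+ d <= C0 * Cf * (2 * (CU * rho')) * h ^+ d.
    rewrite ler_wpM2r// ler_wpM2l ?mulr_ge0// ler_wpM2l// /mu ler_wpM2l //.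
    rewrite /rho'; have : 0 <= Pn * mesh n by rewrite mulr_ge0.
    by move: rho0; lra.
  apply: (le_trans step); rewrite -[leLHS]mul1r ler_wpM2r//.
  by rewrite !mulr_ge0.
have bw20 : 0 < 2 * bw by rewrite mulr_gt0.
have l0 : 0 < l by exact: lt_le_trans l1.
have lge := ltW l0.
have [A [mA PA HA]] := bernstein mZ mZs same_law indep bfam famb famv bw20 v0 l0 kap0 n0.
exists A; split => //.
- apply: le_trans PA; rewrite lerD2l lerN2; apply: (le_trans (countJ n n0)).
  by rewrite ler_wpM2r ?invr_ge0// /C; lra.
- move=> w Aw c b b' bB b'B bb.
  set T := Num.sqrt (n%:R * h ^+ d * rho * l).
  have T0 : 0 <= T by exact: sqrtr_ge0.
  have DT j : `|Dv n (fam j) w| <= kap * (Ca + Cb) * (T + l).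
    apply: (le_trans (HA w Aw j)); rewrite -[leRHS]mulrA ler_wpM2l//.
    have -> : n%:R * v * l + 4 * (2 * bw) ^+ 2 * l ^+ 2 =
      Vc * (n%:R * h ^+ d * rho * l) +
      (Vc * (2 * (Pn * B)) * h ^+ d * l + 16 * bw ^+ 2 * l ^+ 2).
      by rewrite /v /rho' /mesh; field; rewrite gt_eqF.
    apply: (@le_trans _ _ (Num.sqrt (Vc * (n%:R * h ^+ d * rho * l)) +
       Num.sqrt ((Vc * (2 * (Pn * B)) + 16 * bw ^+ 2) * l ^+ 2))).
      apply: le_trans (sqrtD_le _ _).
      + have e : Vc * (2 * (Pn * B)) * h ^+ d * l <= Vc * (2 * (Pn * B)) * l ^+ 2.
          rewrite -[leLHS]mulrA ler_wpM2l//; first by rewrite mulr_ge0// mulr_ge0// mulr_ge0.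
          by rewrite (le_trans (ler_piMl (ltW l0) hd1))// expr2 ler_peMl// ltW.
        by apply: ler_wsqrtr; rewrite lerD2l [leRHS]mulrDl lerD2r.
      + by rewrite !mulr_ge0// ltW.
      + by rewrite mulr_ge0 ?sqr_ge0// addr_ge0// !mulr_ge0 ?sqr_ge0// ltW.
    rewrite sqrtrM// -CaE -/T sqrtrM; last first.
      by rewrite addr_ge0// !mulr_ge0 ?sqr_ge0// ltW.
    rewrite -CbE sqrtr_sqr gtr0_norm//.
    by rewrite mulrDl !mulrDr lerD// ?lerDl ?lerDr mulr_ge0// ltW.
  have near_grid c' b1 (g : {ffun mindex d p -> 'I_(2 * n).+1}) : (forall v, `|b1 v - grid_coefs g v| <= mesh n) ->
      `|Dv n (psi h c' b1) w - Dv n (psi h c' (grid_coefs g)) w| <=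
        bw * (kap * (Ca + Cb) * (T + l)) + Cc.
    move=> hg.
    have hp (y : 'rV[R]_d) : (forall i, `|y 0 i| <= M) -> `|peval y b1 - peval y (grid_coefs g)| <= mu.
      move=> yM; apply: (le_trans (peval_diff_le _ _ yM)).
      by rewrite ler_wpM2l //; exact: nd_le.
    apply: (le_trans (Dv_dom n w (bmf_psi h0 c' b1) (bmf_psi h0 c' (grid_coefs g))
      (bmf_bracket h0 (grid_coefs g) mu) (ltW bw0) (fun z => psi_bracket h0 c' z hp))).
    apply: lerD; first by rewrite ler_wpM2l //; exact: (DT (inr g)).
    rewrite CcE ler_wpM2l// mulrCA ler_wpM2l //.
    apply: (@le_trans _ _ (n%:R * (C0 * Cf * (2 * mu) * h ^+ d))).
      by rewrite ler_wpM2l//; exact: Ebr.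
    apply: (@le_trans _ _ (n%:R * (C0 * Cf * (2 * mu) * 1))).
      by rewrite ler_wpM2l// ler_wpM2l// !mulr_ge0.
    by rewrite le_eqVlt /mu /mesh; apply/orP; left; apply/eqP; field; rewrite gt_eqF.
  have [g hg] := round_to_grid n0 bB.
  have [g' hg'] := round_to_grid n0 b'B.
  have ndgg : nd (grid_coefs g) (grid_coefs g') <= rho'.
    apply: (le_trans (nd_triangle _ b _)); rewrite /rho'.
    have e1 : nd (grid_coefs g) b <= Pn * mesh n by rewrite ndC; exact: nd_le.
    have e2 : nd b' (grid_coefs g') <= Pn * mesh n by exact: nd_le.
    have -> : rho + 2 * (Pn * mesh n) = Pn * mesh n + (rho + Pn * mesh n) by ring.
    exact: lerD e1 (le_trans (nd_triangle b b' _) (lerD bb e2)).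
  have mid : `|Dv n (psi h c (grid_coefs g)) w - Dv n (psi h c (grid_coefs g')) w| <=
     kap * (Ca + Cb) * (T + l).
    have := DT (inl (c, g, g')); rewrite /fam /= ndgg DvB//; exact: bmf_psi.
  have e1 := near_grid c b g hg.
  have e2 := near_grid c b' g' hg'.
  set x1 := Dv n (psi h c b) w in e1 *; set x2 := Dv n (psi h c b') w in e2 *.
  set x3 := Dv n (psi h c (grid_coefs g)) w in e1 mid; set x4 := Dv n (psi h c (grid_coefs g')) w in e2 mid.
  have -> : x1 - x2 = (x1 - x3) + (x3 - x4) - (x2 - x4) by ring.
  apply: (le_trans (ler_normB _ _)); apply: (le_trans (lerD (ler_normD _ _) (lexx _))).
  apply: (le_trans (lerD (lerD e1 mid) e2)).
  have Tl : 1 <= T + l by rewrite ler_wpDl.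
  rewrite /C -[3 * (bw + 1) * kap * _]mulrA.
  by apply: chain_sum_le => //; rewrite mulr_ge0// addr_ge0.
Qed.

Lemma probability_setI_ge (A1 A2 : set Omega) (a1 a2 : R) :
  measurable A1 -> measurable A2 -> 1 - a1 <= fine (P A1) -> 1 - a2 <= fine (P A2) ->
  1 - (a1 + a2) <= fine (P (A1 `&` A2)).
Proof.
move=> mA1 mA2 h1 h2.
have mA12 : measurable (A1 `&` A2) by exact: measurableI.
have b1 := bmf_indic R mA1; have b2 := bmf_indic R mA2.
rewrite -(Ex_indic P mA12).
have e1 : 1 - a1 <= Ex P (\1_A1) by rewrite Ex_indic.
have e2 : 1 - a2 <= Ex P (\1_A2) by rewrite Ex_indic.
apply: (@le_trans _ _ (Ex P (fun w => \1_A1 w + (\1_A2 w - 1)))).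
  rewrite ExD//; last by apply: bmfB => //; exact: bmf_cst.
  by rewrite ExB ?Ex1//; [lra|exact: bmf_cst].
apply: le_Ex.
- by apply: bmfD => //; apply: bmfB => //; exact: bmf_cst.
- exact: bmf_indic.
move=> w; rewrite !indicE in_setI.
by case: (w \in A1); case: (w \in A2); rewrite /= ?mulr1n ?mulr0n; lra.
Qed.

Lemma Ex_wt_sq c h : 0 < h -> h * M <= eta ->
  Ex P (fun w => wt h c (X w) ^+ 2) <= bw ^+ 2 * (C0 * h ^+ d).
Proof.
move=> h0 hM; have bwge : 0 <= bw by apply: le_trans bw1.
have bwt c' : bmf (fun w => wt h c' (X w)) by apply: (bmf_comp mX); exact: bmf_wt.
apply: (@le_trans _ _ (Ex P (fun w => bw ^+ 2 * wt h None (X w)))).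
  apply: le_Ex; [|exact: bmfZ|].
    by under eq_fun do rewrite expr2; exact: bmfM.
  move=> w; have /andP[w0 w1] := wtN01 h (X w).
  rewrite -real_normK ?num_real//.
  apply: (@le_trans _ _ ((bw * wt h None (X w)) ^+ 2)).
    by rewrite lerXn2r// ?nnegrE ?mulr_ge0//; exact: wt_le.
  by rewrite exprMn ler_wpM2l ?sqr_ge0// expr2 ler_piMr.
by rewrite ExZ// ler_wpM2l ?sqr_ge0//; exact: Ex_wtN_le.
Qed.

Lemma sup_arith (c1 c2 q a w T l : R) : 0 <= c1 -> 0 <= c2 -> 0 <= q -> 0 <= T -> 0 <= l ->
  c1 * (q * T + l) + 3 * (a + 2 * w) * (T + l) <= (c1 + c2 + c1 * q + 3 * (a + 2 * w)) * (T + l).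
Proof.
move=> h1 h2 h3 h4 h5.
have e1 := mulr_ge0 h2 (addr_ge0 h4 h5); have e2 := mulr_ge0 (mulr_ge0 h1 h3) h5.
have e3 := mulr_ge0 h1 h4.
have -> : (c1 + c2 + c1 * q + 3 * (a + 2 * w)) * (T + l) =
  c1 * (q * T + l) + 3 * (a + 2 * w) * (T + l) + (c2 * (T + l) + c1 * q * l + c1 * T) by ring.
by rewrite lerDl !addr_ge0.
Qed.

(** [bernstein] at the zero vector, and [modulus] from there over the whole ball. *)
Lemma sup_deviation : exists2 C : R, 0 < C & forall h n,
  0 < h -> h * M <= eta -> h <= 1 -> (3 <= n)%N -> 1 <= ln n%:R :> R ->
  exists A, [/\ measurable A, 1 - C / n%:R <= fine (P A) &
   forall w, A w -> forall c,
     `|Dv n (fun z => wt h c z.1) w| <= C * (Num.sqrt (n%:R * h ^+ d * ln n%:R) + ln n%:R) /\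
     forall b, (forall v, `|b v| <= B) ->
     `|Dv n (psi h c b) w| <= C * (Num.sqrt (n%:R * h ^+ d * ln n%:R) + ln n%:R)].
Proof.
have [Cm Cm0 modP] := modulus.
have bw0 : 0 < bw by apply: lt_le_trans bw1.
have C00 : 0 <= C0 by rewrite /C0 mulr_ge0// exprn_ge0// (le_trans _ M1).
have bwge := ltW bw0; have CUge := ltW CU0.
have Pnge : 0 <= Pn by exact: ler0n.
have Bge := ltW B0.
pose b00 : coefs := [ffun=> 0].
have [q qE] : exists q : R, q = Num.sqrt (2 * (Pn * B)) by eexists.
have [a aE] : exists a : R, a = Num.sqrt (bw ^+ 2 * C0) by eexists.
have q0 : 0 <= q by rewrite qE; exact: sqrtr_ge0.
have a0 : 0 <= a by rewrite aE; exact: sqrtr_ge0.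
have [Cp CpE] : exists a : R, a = 2 * #|{: option (mindex d p) * bool}|%:R by eexists.
have Cp0 : 0 <= Cp by rewrite CpE; exact: mulr_ge0.
pose C : R := Cm + Cp + Cm * q + 3 * (a + 2 * bw).
have Cmq : 0 <= Cm * q by rewrite mulr_ge0// ltW.
exists C; first by rewrite /C; lra.
move=> h n h0 hM h1 n3 l1.
have n0 : (0 < n)%N by exact: leq_trans n3.
have nn : 0 < n%:R :> R by rewrite ltr0n.
set l := ln n%:R in l1 *.
have l0 : 0 < l by exact: lt_le_trans l1.
have hge := ltW h0.
have hd0 : 0 <= h ^+ d by exact: exprn_ge0.
set T := Num.sqrt _.
have T0 : 0 <= T by exact: sqrtr_ge0.
have rB : 0 <= 2 * (Pn * B) <= 2 * (Pn * B) by rewrite lexx andbT !mulr_ge0.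
have [A1 [mA1 PA1 HA1]] := modP h n _ h0 hM h1 n3 l1 rB.
pose fam (j : option (mindex d p) * bool) : Rd * R -> R :=
  if j.2 then psi h j.1 b00 else (fun z => wt h j.1 z.1).
have bwt c : bmf (fun z : Rd * R => wt h c z.1).
  by apply: (bmf_comp (f := wt h c)) => //; exact: bmf_wt.
have bfam j : bmf (fam j).
  by rewrite /fam; case: ifP => _ //; exact: bmf_psi.
have famw j z : `|fam j z| <= `|wt h j.1 z.1|.
  rewrite /fam; case: ifP => // _; rewrite /psi normrM ler_piMr//.
  by case: (z.2 <= _); rewrite ?normr0 ?normr1.
have famb j z : `|fam j z| <= bw by apply: (le_trans (famw j z)); exact: wt_le_bw.
have famv j : Ex P (fun w => fam j (Z w) ^+ 2) <= bw ^+ 2 * (C0 * h ^+ d).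
  apply: le_trans (Ex_wt_sq j.1 h0 hM); apply: le_Ex.
  - by under eq_fun do rewrite expr2; apply: bmfM; exact: (bZ (bfam j)).
  - by under eq_fun do rewrite expr2; apply: bmfM; exact: (bZ (bwt j.1)).
  - move=> w; rewrite -[leLHS]real_normK ?num_real// -[leRHS]real_normK ?num_real//.
    by rewrite lerXn2r// ?nnegrE//; exact: famw.
have v0 : 0 <= bw ^+ 2 * (C0 * h ^+ d) by rewrite mulr_ge0 ?sqr_ge0// mulr_ge0.
have [A2 [mA2 PA2 HA2]] := bernstein mZ mZs same_law indep bfam famb famv bw0 v0 l0
  (ler0n R 3) n0.
exists (A1 `&` A2); split; first exact: measurableI.
  have e2 : 1 - Cp / n%:R <= fine (P A2).
    apply: le_trans PA2; rewrite lerD2l lerN2 -CpE.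
    have -> : (2 - 3) * l = - (1%:R * l) by ring.
    by rewrite expR_neg_ln// expn1.
  apply: le_trans (probability_setI_ge mA1 mA2 PA1 e2).
  rewrite lerD2l lerN2 -mulrDl ler_wpM2r ?invr_ge0// /C; lra.
move=> w [A1w A2w] c.
have base j : `|Dv n (fam j) w| <= 3 * (a + 2 * bw) * (T + l).
  apply: (le_trans (HA2 w A2w j)); rewrite -[leRHS]mulrA ler_wpM2l//.
  have -> : n%:R * (bw ^+ 2 * (C0 * h ^+ d)) * l + 4 * bw ^+ 2 * l ^+ 2 =
    bw ^+ 2 * C0 * (n%:R * h ^+ d * l) + (2 * bw * l) ^+ 2 by ring.
  apply: (le_trans (sqrtD_le _ _)); rewrite ?sqr_ge0//.
    apply: mulr_ge0; first by apply: mulr_ge0 => //; exact: sqr_ge0.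
    by apply: mulr_ge0; [exact: mulr_ge0|exact: ltW].
  rewrite sqrtrM; last by apply: mulr_ge0 => //; exact: sqr_ge0.
  rewrite -aE -/T sqrtr_sqr ger0_norm; last by apply: mulr_ge0; [exact: mulr_ge0|exact: ltW].
  have -> : (a + 2 * bw) * (T + l) = a * T + 2 * bw * l + (a * l + 2 * (bw * T)) by ring.
  rewrite lerDl addr_ge0//; first by rewrite mulr_ge0// ltW.
  by rewrite mulr_ge0// mulr_ge0.
have Tl0 : 0 <= T + l by rewrite addr_ge0// ltW.
split.
  apply: (le_trans (base (c, false))); apply: ler_wpM2r => //; rewrite /C; lra.
move=> b bB.
have b00B v : `|b00 v| <= B by rewrite ffunE normr0.
have ndb : nd b b00 <= 2 * (Pn * B).
  apply: (@le_trans _ _ (Pn * B)).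
    by apply: nd_le => v; rewrite [b00 v]ffunE subr0.
  by rewrite ler_peMl ?mulr_ge0// ler1n.
have e1 := HA1 w A1w c b b00 bB b00B ndb.
have e2 := base (c, true); rewrite /fam/= in e2.
have e3 : Num.sqrt (n%:R * h ^+ d * (2 * (Pn * B)) * l) = q * T.
  rewrite qE /T -sqrtrM; last by rewrite !mulr_ge0.
  by congr Num.sqrt; ring.
rewrite e3 in e1.
rewrite -[Dv n (psi h c b) w](subrK (Dv n (psi h c b00) w)).
apply: (le_trans (ler_normD _ _)); apply: (le_trans (lerD e1 e2)).
by apply: sup_arith => //; exact: ltW.
Qed.

(** * Convexity and linearization of the mean score *)

Variables (cf cX Klo : R).
Hypotheses (d0 : (0 < d)%N) (cf0 : 0 < cf) (cX0 : 0 < cX) (Klo0 : 0 < Klo).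
Hypothesis F_ge : forall x y y', box x0 eta x -> - yb <= y -> y <= y' -> y' <= yb ->
  cf * (y' - y) <= F y' x - F y x.
Hypothesis X_ge : forall (x1 : 'rV[R]_d) e, 0 <= e -> box x1 e `<=` box x0 eta ->
  cX * e ^+ d <= fine (P [set w | box x1 e (X w)]).
Hypothesis K_ge : forall z, enorm z <= 1 -> Klo <= K z.

Lemma peval_yb b (y : 'rV[R]_d) : (forall v, `|b v| <= B) -> (forall i, `|y 0 i| <= M) ->
  - yb <= peval y b <= yb.
Proof.
move=> bB yM; have := peval_le b yM.
have nb : nrm b <= Pn * B by exact: nrm_le.
have := ler_wpM2l (ltW CU0) nb.
have : 0 <= CU * (Pn * B) by rewrite mulr_ge0 ?(ltW CU0)// mulr_ge0 ?ler0n// ltW.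
rewrite ler_norml => h1 h2 /andP[h3 h4]; apply/andP; move: yB; split; lra.
Qed.

Lemma bmf_le_ind (u : Rd -> R) : measurable_fun setT u ->
  bmf (fun w => (Y w <= u (X w))%R%:R : R).
Proof.
by move=> mu; apply: bmf_le => //; exact: measurableT_comp.
Qed.

Lemma peval_box h g e (x : 'rV[R]_d) : 0 < h ->
  box (x0 + h *: g) (h * e) x -> box g e (zof h x).
Proof.
move=> h0 xb i; have := xb i; rewrite !mxE => hx.
have -> : h^-1 * (x 0 i - x0 0 i) - g 0 i = h^-1 * (x 0 i - (x0 0 i + h * g 0 i)).
  by field; rewrite gt_eqF.
by rewrite normrM normfV (gtr0_norm h0) ler_pdivrMl.
Qed.

(** Along the segment between two coefficient vectors the integrand of the mean
    score is nonnegative, and on one of the cubes of [peval_lower] both factors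
    are bounded below by the distance of the two vectors. *)
Lemma score_strongly_monotone : exists2 c2 : R, 0 < c2 & forall h b b',
  0 < h -> h * M <= eta -> (forall v, `|b v| <= B) -> (forall v, `|b' v| <= B) ->
  c2 * h ^+ d * nd b b' ^+ 2 <=
  \sum_v (b v - b' v) * (Ex P (fun w => psi h (Some v) b (Z w)) -
                         Ex P (fun w => psi h (Some v) b' (Z w))).
Proof.
have [e [cl [e0 c0 unit_ball lower]]] := peval_lower R p d0.
exists (Klo * cl * cf * cl * (cX * e ^+ d)).
  by rewrite !mulr_gt0// exprn_gt0.
move=> h b b' h0 hM bB b'B.
pose del : coefs := [ffun v => b v - b' v].
have [j hj] := lower del.
pose u (x : Rd) : R := peval (zof h x) b; pose u' (x : Rd) : R := peval (zof h x) b'.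
have mu : measurable_fun setT u by exact: measurable_peval.
have mu' : measurable_fun setT u' by exact: measurable_peval.
have bp v b1 : bmf (fun w => psi h (Some v) b1 (Z w)).
  by apply: (bZ (f := psi h (Some v) b1)); exact: bmf_psi.
have -> : \sum_v (b v - b' v) * (Ex P (fun w => psi h (Some v) b (Z w)) -
     Ex P (fun w => psi h (Some v) b' (Z w))) =
  Ex P (fun w => K (zof h (X w)) * (u (X w) - u' (X w)) *
     ((Y w <= u (X w))%R%:R - (Y w <= u' (X w))%R%:R)).
  transitivity (Ex P (fun w => \sum_v (b v - b' v) *
      (psi h (Some v) b (Z w) - psi h (Some v) b' (Z w)))).
    rewrite Ex_sum; last by move=> v; apply/bmfZ/bmfB.
    apply: eq_bigr => v _; rewrite ExZ; last exact: bmfB.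
    by rewrite ExB.
  apply: eq_Ex => w; rewrite /u /u' -pevalB /peval mulr_sumr mulr_suml.
  by apply: eq_bigr => v _; rewrite [X in _ = _ * (_ * X) * _]ffunE /psi /=; ring.
pose Gb : set Rd := box (x0 + h *: gridpt R j) (h * e).
have mG : measurable Gb by exact: measurable_box.
have zG x : Gb x -> box (gridpt R j) e (zof h x) by exact: peval_box.
have GM x : Gb x -> box x0 (h * M) x.
  move=> Gx; apply/zof_boxP => // i; apply: le_trans M1.
  by apply: (le_trans (coord_le_enorm _ i)); exact: unit_ball (zG x Gx).
have Geta : Gb `<=` box x0 eta by move=> x /GM xb i; exact: le_trans (xb i) hM.
have PG := X_ge (mulr_ge0 (ltW h0) (ltW e0)) Geta.
pose s := nd b b'.
have s0 : 0 <= s by exact: nrm_ge0.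
pose mn x : R := Num.min (u x) (u' x); pose mx x : R := Num.max (u x) (u' x).
have mmn : measurable_fun setT mn by exact: measurable_minr.
have mmx : measurable_fun setT mx by exact: measurable_maxr.
have bG : bmf (\1_Gb : Rd -> R) by exact: bmf_indic.
have bGX : bmf (fun w => \1_Gb (X w) : R) by exact: (bmf_comp mX bG).
have bFu v : measurable_fun setT v -> bmf (fun w => \1_Gb (X w) * F (v (X w)) (X w)).
  move=> mv; apply: bmfM => //.
  by apply: (bmf_comp (f := fun x => F (v x) x)) => //; exact: bF.
have bIu v : measurable_fun setT v -> bmf (fun w => \1_Gb (X w) * (Y w <= v (X w))%R%:R : R).
  by move=> mv; apply: bmfM => //; exact: bmf_le_ind.
have bK : bmf (fun w => K (zof h (X w)) * (u (X w) - u' (X w)) *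
     ((Y w <= u (X w))%R%:R - (Y w <= u' (X w))%R%:R)).
  apply: bmfM; last by apply: bmfB; exact: bmf_le_ind.
  have -> : (fun w => K (zof h (X w)) * (u (X w) - u' (X w))) =
     (fun w => \sum_v del v * wt h (Some v) (X w)).
    apply/funext => w; rewrite /u /u' -pevalB -/del /peval mulr_sumr.
    by apply: eq_bigr => v _; rewrite /wt; ring.
  by apply: bmf_sum => v; apply: bmfZ; apply: (bmf_comp mX); exact: bmf_wt.
(* keep only the cube, where both factors have size at least c times the distance *)
apply: (@le_trans _ _ (Ex P (fun w => Klo * (cl * s) *
   (\1_Gb (X w) * (Y w <= mx (X w))%R%:R - \1_Gb (X w) * (Y w <= mn (X w))%R%:R)))).
  rewrite ExZ; last by apply: bmfB; exact: bIu.
  rewrite (ExB P (bIu _ mmx) (bIu _ mmn)) (dis bG mmx) (dis bG mmn).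
  rewrite -(ExB P (bFu _ mmx) (bFu _ mmn)).
  have -> : Klo * cl * cf * cl * (cX * e ^+ d) * h ^+ d * s ^+ 2 =
     Klo * (cl * s) * ((cf * (cl * s)) * (cX * (h * e) ^+ d)).
    by rewrite exprMn; ring.
  rewrite ler_wpM2l//; first by rewrite !mulr_ge0// ltW.
  apply: (@le_trans _ _ (Ex P (fun w => (cf * (cl * s)) * \1_Gb (X w)))).
    rewrite ExZ// ler_wpM2l//; first by rewrite !mulr_ge0// ltW.
    by rewrite (Ex_comp_indic P mX mG).
  apply: le_Ex; [exact: bmfZ|by apply: bmfB; exact: bFu|].
  move=> w; rewrite -mulrBr mulrC indicE.
  case: (boolP (X w \in Gb)) => [/set_mem Gw|_]; last by rewrite !mul0r.
  rewrite !mul1r.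
  have xM := (zof_boxP h0 (X w)).1 (GM _ Gw).
  have /andP[a1 a2] := peval_yb bB xM; have /andP[a3 a4] := peval_yb b'B xM.
  have F1 : cf * (mx (X w) - mn (X w)) <= F (mx (X w)) (X w) - F (mn (X w)) (X w).
    apply: F_ge; first exact: Geta.
    - by rewrite /mn le_min a1 a3.
    - by rewrite /mn /mx ge_min le_max lexx.
    - by rewrite /mx ge_max a2 a4.
  apply: le_trans F1; rewrite ler_wpM2l ?(ltW cf0)//.
  have := hj _ (zG _ Gw); rewrite /del pevalB -/(u (X w)) -/(u' (X w)) -/(nd b b') -/s.
  rewrite /mx /mn; case: (leP (u (X w)) (u' (X w))) => uu.
    by rewrite distrC ger0_norm// subr_ge0.
  by rewrite ger0_norm// subr_ge0 ltW.
apply: le_Ex => //; first by apply/bmfZ/bmfB; exact: bIu.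
move=> w; rewrite -mulrBr indicE.
have K00 := K0 (zof h (X w)).
have sgn_nonneg : 0 <= (u (X w) - u' (X w)) *
     ((Y w <= u (X w))%R%:R - (Y w <= u' (X w))%R%:R).
  have [h1|h1] := leP (Y w) (u (X w)); have [h2|h2] := leP (Y w) (u' (X w)).
  - by rewrite subrr mulr0.
  - by rewrite subr0 mulr1; lra.
  - by rewrite sub0r mulrN1; lra.
  - by rewrite subrr mulr0.
case: (boolP (X w \in Gb)) => [/set_mem Gw|_]; last first.
  by rewrite mul0r mulr0 -mulrA mulr_ge0.
rewrite mul1r -!mulrA.
have Kw : Klo <= K (zof h (X w)) by apply/K_ge/unit_ball/zG/Gw.
have := hj _ (zG _ Gw); rewrite /del pevalB -/(u (X w)) -/(u' (X w)) -/(nd b b') -/s => csu.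
apply: ler_pM => //; first exact: ltW.
  rewrite mulrA mulr_ge0 ?mulr_ge0 ?(ltW c0)//.
  rewrite /mx /mn; case: (leP (u (X w)) (u' (X w))) => uu.
    have [h1|h1] := leP (Y w) (u' (X w)); have [h2|h2] := leP (Y w) (u (X w)); rewrite ?subrr ?subr0 ?sub0r//.
    by exfalso; lra.
  have [h1|h1] := leP (Y w) (u (X w)); have [h2|h2] := leP (Y w) (u' (X w)); rewrite ?subrr ?subr0 ?sub0r//.
  by exfalso; lra.
rewrite mulrA; move: csu; rewrite /mx /mn; case: (leP (u (X w)) (u' (X w))) => uu.
  rewrite ler0_norm ?subr_le0// => csu.
  have [h1|h1] := leP (Y w) (u' (X w)); have [h2|h2] := leP (Y w) (u (X w)).
  - by rewrite !subrr !mulr0.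
  - by rewrite subr0 sub0r mulr1 mulrN1.
  - by exfalso; lra.
  - by rewrite !subrr !mulr0.
rewrite gtr0_norm ?subr_gt0// => csu.
have [h1|h1] := leP (Y w) (u (X w)); have [h2|h2] := leP (Y w) (u' (X w)).
- by rewrite !subrr !mulr0.
- by rewrite !subr0 !mulr1.
- by exfalso; lra.
- by rewrite !subrr !mulr0.
Qed.

(** The design matrix of the weighted least squares problem, as a bilinear form. *)
Definition gram h b b' : R :=
  Ex P (fun w => K (zof h (X w)) * peval (zof h (X w)) b * peval (zof h (X w)) b').

Lemma bmf_wt_peval h b : 0 < h -> h * M <= eta ->
  bmf (fun x : Rd => K (zof h x) * peval (zof h x) b).
Proof.
move=> h0 hM.
have -> : (fun x => K (zof h x) * peval (zof h x) b) =
   (fun x => \sum_v b v * wt h (Some v) x).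
  apply/funext => x; rewrite /peval mulr_sumr.
  by apply: eq_bigr => v _; rewrite /wt; ring.
by apply: bmf_sum => v; apply: bmfZ; exact: bmf_wt.
Qed.

Lemma bmf_wt_peval2 h b b' : 0 < h -> h * M <= eta ->
  bmf (fun x : Rd => K (zof h x) * peval (zof h x) b * peval (zof h x) b').
Proof.
move=> h0 hM; have [mb [m hm]] := bmf_wt_peval b h0 hM; split.
  by apply: measurable_funM => //; exact: measurable_peval.
exists (m * (CU * nrm b')) => x.
have [Kx|Kx] := eqVneq (K (zof h x)) 0.
  rewrite Kx !mul0r normr0 mulr_ge0 ?mulr_ge0 ?nrm_ge0 ?(ltW CU0)//.
  exact: le_trans (hm x).
by rewrite normrM ler_pM//; apply: peval_le; exact: suppK.
Qed.

(** The mass of the cube found by [peval_lower] is of order h^d. *)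
Lemma gram_coercive : exists2 c3 : R, 0 < c3 & forall h b, 0 < h -> h * M <= eta ->
  c3 * h ^+ d * nrm b ^+ 2 <= gram h b b.
Proof.
have [e [cl [e0 c0 unit_ball lower]]] := peval_lower R p d0.
exists (Klo * cl ^+ 2 * (cX * e ^+ d)).
  by rewrite !mulr_gt0// exprn_gt0.
move=> h b h0 hM; have [j hj] := lower b.
pose Gb : set Rd := box (x0 + h *: gridpt R j) (h * e).
have mG : measurable Gb by exact: measurable_box.
have zG x : Gb x -> box (gridpt R j) e (zof h x) by exact: peval_box.
have GM x : Gb x -> box x0 (h * M) x.
  move=> Gx; apply/zof_boxP => // i; apply: le_trans M1.
  by apply: (le_trans (coord_le_enorm _ i)); exact: unit_ball (zG x Gx).
have Geta : Gb `<=` box x0 eta by move=> x /GM xb i; exact: le_trans (xb i) hM.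
have PG := X_ge (mulr_ge0 (ltW h0) (ltW e0)) Geta.
have bG : bmf (fun w => \1_Gb (X w) : R) by apply: (bmf_comp mX); exact: bmf_indic.
have nb := nrm_ge0 b.
apply: (@le_trans _ _ (Ex P (fun w => Klo * (cl * nrm b) ^+ 2 * \1_Gb (X w)))).
  rewrite ExZ// (Ex_comp_indic P mX mG).
  have -> : Klo * cl ^+ 2 * (cX * e ^+ d) * h ^+ d * nrm b ^+ 2 =
    Klo * (cl * nrm b) ^+ 2 * (cX * (h * e) ^+ d) by rewrite !exprMn; ring.
  by rewrite ler_wpM2l// mulr_ge0 ?sqr_ge0// ltW.
apply: le_Ex; first exact: bmfZ.
  exact: (bmf_comp mX (bmf_wt_peval2 b b h0 hM)).
move=> w; rewrite -[leRHS]mulrA -expr2 indicE.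
case: (boolP (X w \in Gb)) => [/set_mem Gw|_]; last by rewrite mulr0 mulr_ge0// sqr_ge0.
rewrite mulr1 ler_pM ?sqr_ge0 ?(ltW Klo0)//; first exact/K_ge/unit_ball/zG/Gw.
rewrite -[leRHS]real_normK ?num_real// lerXn2r ?nnegrE ?mulr_ge0 ?(ltW c0)//.
exact: hj _ (zG _ Gw).
Qed.

Lemma gramE h b b' : 0 < h -> h * M <= eta ->
  gram h b b' = \sum_v \sum_w b v * b' w *
    Ex P (fun t => wt h (Some v) (X t) * monomials p (zof h (X t)) w).
Proof.
move=> h0 hM.
have bmm v w : bmf (fun t => wt h (Some v) (X t) * monomials p (zof h (X t)) w).
  apply: (bmf_comp mX (f := fun x => wt h (Some v) x * monomials p (zof h x) w)).
  have [mv [m hm]] := bmf_wt h0 (Some v); split.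
    by apply: measurable_funM => //; exact: measurable_monomials.
  exists (m * CU) => x; have [xb|xb] := pselect (box x0 (h * M) x).
    by rewrite normrM ler_pM//; apply: monomials_le; exact/zof_boxP.
  rewrite wt_out// mul0r normr0 mulr_ge0 ?(ltW CU0)//.
  exact: le_trans (hm x).
under eq_bigr => v _ do under eq_bigr => w _ do rewrite -ExZ//.
under eq_bigr => v _ do (rewrite -Ex_sum; last by move=> w; exact: bmfZ).
rewrite -Ex_sum; last by move=> v; apply: bmf_sum => w; exact: bmfZ.
apply: eq_Ex => t; rewrite /peval [K _ * _]mulr_sumr mulr_suml; apply: eq_bigr => v _.
rewrite mulr_sumr; apply: eq_bigr => w _; rewrite /wt; ring.
Qed.

(** A coercive matrix is invertible, and coercivity bounds the inverse. The vector
    [a] reads off the intercept, whose value is the estimated quantile. *)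
Lemma design_dual : exists2 Ca : R, 0 < Ca & forall h, 0 < h -> h * M <= eta ->
  exists a : coefs, nrm a <= Ca /\ forall b, gram h a b = h ^+ d * b (mindex0 d p).
Proof.
have [c3 c30 coer] := gram_coercive.
exists c3^-1; first by rewrite invr_gt0.
move=> h h0 hM; have hd0 : 0 < h ^+ d by exact: exprn_gt0.
pose n := #|{: mindex d p}|.
pose g v w := Ex P (fun t => wt h (Some v) (X t) * monomials p (zof h (X t)) w).
pose A : 'M[R]_n := \matrix_(i, j) g (enum_val i) (enum_val j).
pose cf_of (u : 'rV[R]_n) : coefs := [ffun v => u 0 (enum_rank v)].
have mulE (u : 'rV[R]_n) b : gram h (cf_of u) b = \sum_w (u *m A) 0 (enum_rank w) * b w.
  rewrite gramE// exchange_big/=; apply: eq_bigr => w _.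
  rewrite mxE mulr_suml (reindex_onto (@enum_val _ _) enum_rank)/=; last first.
    by move=> v _; rewrite enum_rankK.
  rewrite (eq_bigl predT); last by move=> i; rewrite enum_valK eqxx.
  apply: eq_bigr => i _; rewrite !mxE enum_rankK ffunE enum_valK /g.
  by ring.
have Au : A \in unitmx.
  rewrite -row_free_unit; apply: inj_row_free => u uA.
  have : gram h (cf_of u) (cf_of u) = 0.
    by rewrite mulE uA big1// => w _; rewrite mxE mul0r.
  have := coer h (cf_of u) h0 hM => + E; rewrite E.
  rewrite pmulr_rle0 ?mulr_gt0// => h2.
  have nu : nrm (cf_of u) = 0.
    by apply/eqP; rewrite -sqrf_eq0 eq_le h2 sqr_ge0.
  apply/rowP => i; rewrite mxE.
  have := coef_le_nrm (cf_of u) (enum_val i); rewrite nu ffunE enum_valK normr_le0.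
  by move/eqP.
pose u := (h ^+ d *: delta_mx 0 (enum_rank (mindex0 d p)) : 'rV[R]_n) *m invmx A.
have aE b : gram h (cf_of u) b = h ^+ d * b (mindex0 d p).
  rewrite mulE /u mulmxKV// (bigD1 (mindex0 d p))//= !mxE !eqxx mulr1 big1 ?addr0//.
  move=> w w0; rewrite !mxE eqxx/= (inj_eq enum_rank_inj) (negbTE w0).
  by rewrite mulr0 mul0r.
exists (cf_of u); split => //.
have [->|nu] := eqVneq (nrm (cf_of u)) 0; first by rewrite invr_ge0 ltW.
have nu0 : 0 < nrm (cf_of u) by rewrite lt_neqAle eq_sym nu nrm_ge0.
have := coer h (cf_of u) h0 hM; rewrite aE => h1.
have h2 : c3 * h ^+ d * nrm (cf_of u) ^+ 2 <= h ^+ d * nrm (cf_of u).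
  apply: (le_trans h1); rewrite ler_wpM2l ?(ltW hd0)//.
  by apply: (le_trans (ler_norm _)); exact: coef_le_nrm.
have : (c3 * nrm (cf_of u)) * (h ^+ d * nrm (cf_of u)) <= 1 * (h ^+ d * nrm (cf_of u)).
  by move: h2; rewrite mul1r; apply: le_trans; rewrite le_eqVlt; apply/orP; left; apply/eqP; ring.
rewrite ler_pM2r ?mulr_gt0// => h3.
by rewrite -[leRHS]mulr1 ler_pdivlMl.
Qed.

Variables (alo ahi L1 : R) (f0 : R -> R).
Hypothesis L10 : 0 <= L1.
Hypothesis F_exp : forall e x y y' q, 0 <= e <= eta -> box x0 e x ->
  `|F y' x - F y x - f0 q * (y' - y)| <= L1 * (e + `|y - q| + `|y' - q|) * `|y' - y|.

(** By [dis] the mean score involves increments of F, each of them the increment of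
    the polynomial times the density at (q, x0), up to the variation of the
    density. *)
Lemma score_linearization h (a : coefs) b b' q t : 0 < h -> h * M <= eta ->
  (forall y : 'rV[R]_d, (forall i, `|y 0 i| <= M) -> `|peval y b - q| <= t) ->
  (forall y : 'rV[R]_d, (forall i, `|y 0 i| <= M) -> `|peval y b' - q| <= t) ->
  `|\sum_v a v * (Ex P (fun w => psi h (Some v) b (Z w)) -
                  Ex P (fun w => psi h (Some v) b' (Z w)))
    - f0 q * gram h a [ffun v => b v - b' v]|
  <= KB * (CU * nrm a) * (L1 * (h * M + 2 * t) * (CU * nd b b')) * (C0 * h ^+ d).
Proof.
move=> h0 hM bq b'q.
pose u (x : Rd) : R := peval (zof h x) b; pose u' (x : Rd) : R := peval (zof h x) b'.
have mu : measurable_fun setT u by exact: measurable_peval.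
have mu' : measurable_fun setT u' by exact: measurable_peval.
pose om (x : Rd) : R := K (zof h x) * peval (zof h x) a.
have bom : bmf om by exact: bmf_wt_peval.
have bp v b1 : bmf (fun w => psi h (Some v) b1 (Z w)).
  by apply: (bZ (f := psi h (Some v) b1)); exact: bmf_psi.
have bFu v : measurable_fun setT v -> bmf (fun w => om (X w) * F (v (X w)) (X w)).
  move=> mv; apply: bmfM; first exact: (bmf_comp mX bom).
  by apply: (bmf_comp (f := fun x => F (v x) x)) => //; exact: bF.
have bIu v : measurable_fun setT v -> bmf (fun w => om (X w) * (Y w <= v (X w))%R%:R : R).
  by move=> mv; apply: bmfM; [exact: (bmf_comp mX bom)|exact: bmf_le_ind].
have -> : \sum_v a v * (Ex P (fun w => psi h (Some v) b (Z w)) -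
     Ex P (fun w => psi h (Some v) b' (Z w))) =
  Ex P (fun w => om (X w) * (F (u (X w)) (X w) - F (u' (X w)) (X w))).
  transitivity (Ex P (fun w => om (X w) * (Y w <= u (X w))%R%:R -
      om (X w) * (Y w <= u' (X w))%R%:R)).
    transitivity (Ex P (fun w => \sum_v a v *
        (psi h (Some v) b (Z w) - psi h (Some v) b' (Z w)))).
      rewrite Ex_sum; last by move=> v; apply/bmfZ/bmfB.
      apply: eq_bigr => v _; rewrite ExZ; last exact: bmfB.
      by rewrite ExB.
    apply: eq_Ex => w; rewrite -mulrBr /om /peval mulr_sumr mulr_suml.
    by apply: eq_bigr => v _; rewrite /psi /=; ring.
  rewrite (ExB P (bIu _ mu) (bIu _ mu')) (dis bom mu) (dis bom mu').
  rewrite -(ExB P (bFu _ mu) (bFu _ mu')).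
  by apply: eq_Ex => w; rewrite mulrBr.
have bg : bmf (fun w => om (X w) * peval (zof h (X w)) [ffun v => b v - b' v]).
  exact: (bmf_comp mX (bmf_wt_peval2 a [ffun v => b v - b' v] h0 hM)).
have bdF : bmf (fun w => om (X w) * (F (u (X w)) (X w) - F (u' (X w)) (X w))).
  by under eq_fun do rewrite mulrBr; apply: bmfB; exact: bFu.
rewrite /gram -ExZ// -ExB//; last exact: bmfZ.
rewrite (le_trans (Ex_norm _ _))//; first by apply: bmfB => //; exact: bmfZ.
set D := KB * _ * _.
have KB0' := KB0.
have t0 : 0 <= t by apply: le_trans (bq 0 _) => // i; rewrite mxE normr0 (le_trans _ M1).
have bN : bmf (fun w => wt h None (X w)) by apply: (bmf_comp mX); exact: bmf_wt.
have nab : 0 <= nd b b' by exact: nrm_ge0.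
have hM0 : 0 <= h * M by rewrite mulr_ge0 ?(le_trans _ M1)// ltW.
have D0 : 0 <= D.
  rewrite /D; apply: mulr_ge0; first by rewrite mulr_ge0// mulr_ge0 ?nrm_ge0 ?(ltW CU0).
  apply: mulr_ge0; last by rewrite mulr_ge0// (ltW CU0).
  by rewrite mulr_ge0// addr_ge0// mulr_ge0.
apply: (@le_trans _ _ (Ex P (fun w => D * wt h None (X w)))); last first.
  by rewrite ExZ// ler_wpM2l//; exact: Ex_wtN_le.
apply: le_Ex; [by apply/bmf_norm/bmfB => //; exact: bmfZ|exact: bmfZ|].
move=> w; rewrite -/(om (X w)) mulrCA -mulrBr.
have [xb|xb] := pselect (box x0 (h * M) (X w)); last first.
  have K00 : K (zof h (X w)) = 0.
    apply: contrapT => /eqP Kz; apply: xb; apply/zof_boxP => //; exact: suppK.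
  by rewrite wt_out// /om K00 !mul0r normr0 mulr0.
have xM := (zof_boxP h0 (X w)).1 xb.
rewrite /wt indicE mem_set// mulr1 normrM /D.
apply: ler_pM => //.
  rewrite /om normrM ler_pM//; first by rewrite ger0_norm.
  exact: peval_le.
rewrite pevalB -/(u (X w)) -/(u' (X w)).
have hMe : 0 <= h * M <= eta by rewrite hM0.
apply: (le_trans (F_exp (u' (X w)) (u (X w)) q hMe xb)).
apply: ler_pM => //.
- by rewrite mulr_ge0// !addr_ge0.
- by rewrite ler_wpM2l// -addrA lerD2l mulr_natl mulr2n lerD//; [exact: b'q|exact: bq].
- exact: peval_diff_le.
Qed.

(** * The first order term *)

Hypothesis mF2 : measurable_fun setT (fun z : Rd * R => F z.2 z.1).
Hypothesis disV : forall (om : Rd -> R) al, bmf om -> (forall x, ~ box x0 eta x -> om x = 0) ->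
  alo <= al <= ahi ->
  Ex P (fun w => om (X w) * (F (Y w) (X w) <= al)%R%:R) = al * Ex P (fun w => om (X w)).

(** The score term at the true quantile: Y <= Q(al|X) if and only if F(Y|X) <= al. *)
Definition wv h al c (z : Rd * R) : R := wt h c z.1 * ((F z.2 z.1 <= al)%R%:R - al).

Lemma bmf_Fle al : bmf (fun z : Rd * R => (F z.2 z.1 <= al)%R%:R : R).
Proof.
exact: bmf_le.
Qed.

Lemma bmf_wt1 h c : 0 < h -> bmf (fun z : Rd * R => wt h c z.1).
Proof. by move=> h0; apply: (bmf_comp (f := wt h c)) => //; exact: bmf_wt. Qed.

Lemma bmf_wv h al c : 0 < h -> bmf (wv h al c).
Proof.
move=> h0; apply: bmfM; first exact: bmf_wt1.
by apply: bmfB; [exact: bmf_Fle|exact: bmf_cst].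
Qed.

Lemma wt_out_eta h c x : 0 < h -> h * M <= eta -> ~ box x0 eta x -> wt h c x = 0.
Proof.
move=> h0 hM nx; apply: wt_out => // xb; apply: nx => i.
exact: le_trans (xb i) hM.
Qed.

Lemma Ex_wv h al c : 0 < h -> h * M <= eta -> alo <= al <= ahi ->
  Ex P (fun w => wv h al c (Z w)) = 0.
Proof.
move=> h0 hM hal.
have b1 : bmf (fun w => wt h c (X w)) by apply: (bmf_comp mX); exact: bmf_wt.
have b2 : bmf (fun w => wt h c (X w) * (F (Y w) (X w) <= al)%R%:R).
  by apply: bmfM => //; exact: (bZ (bmf_Fle al)).
rewrite (@eq_Ex _ _ _ P _ (fun w => wt h c (X w) * (F (Y w) (X w) <= al)%R%:R -
   al * wt h c (X w))); last by move=> w; rewrite /wv /=; ring.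
rewrite ExB//; last exact: bmfZ.
rewrite disV//; [by rewrite ExZ// subrr|exact: bmf_wt|by move=> x; exact: wt_out_eta].
Qed.

Lemma Dv_wv h al c n w : 0 < h -> h * M <= eta -> alo <= al <= ahi ->
  Dv n (wv h al c) w = \sum_(i < n) wv h al c (Zs i w).
Proof. by move=> h0 hM hal; rewrite /Dv /dev Ex_wv// mulr0 subr0. Qed.

Lemma wv_sq_le h al c z : 0 <= al <= 1 -> 0 < h -> wv h al c z ^+ 2 <= wt h c z.1 ^+ 2.
Proof.
move=> /andP[al0 al1] h0; rewrite /wv exprMn ler_piMr ?sqr_ge0//.
rewrite -real_normK ?num_real// exprn_ile1// ler_norml.
by case: (F z.2 z.1 <= al); rewrite /=; apply/andP; split; lra.
Qed.

Lemma mean_W h al c n : 0 < h -> h * M <= eta -> 0 <= al <= 1 ->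
  Ex P (fun w => `|Dv n (wv h al c) w|) <=
    2 * expR 2 * Num.sqrt (n%:R * (bw ^+ 2 * (C0 * h ^+ d)) + 4 * bw ^+ 2).
Proof.
move=> h0 hM hal; have bw0 : 0 < bw by apply: lt_le_trans bw1.
have C00 : 0 <= C0 by rewrite /C0 mulr_ge0// exprn_ge0// (le_trans _ M1).
apply: (mean_dev mZ mZs same_law indep n (bmf_wv al c h0)) => //.
- move=> z; rewrite -(ler_sqr (normr_ge0 _) (ltW bw0)) real_normK ?num_real//.
  apply: (le_trans (wv_sq_le c z hal h0)).
  rewrite -[leLHS]real_normK ?num_real// lerXn2r ?nnegrE// ?(ltW bw0)//.
  exact: wt_le_bw.
- apply: le_trans (Ex_wt_sq c h0 hM); apply: le_Ex.
  + by under eq_fun do rewrite expr2; apply: bmfM; exact: (bZ (bmf_wv al c h0)).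
  + by under eq_fun do rewrite expr2; apply: bmfM; exact: (bZ (bmf_wt1 c h0)).
  + by move=> w; exact: wv_sq_le.
- by rewrite mulr_ge0 ?sqr_ge0// mulr_ge0// exprn_ge0// ltW.
Qed.

Lemma square_arith (a W J S : R) : 0 <= W -> W <= 1 -> 0 <= J -> J <= 1 -> 0 <= S -> S <= 1 ->
  (a * W * (J + S)) ^+ 2 <= 2 * a ^+ 2 * (W * J) + 2 * a ^+ 2 * S * W.
Proof.
move=> w0 w1 j0 j1 s0 s1.
have W2 : W ^+ 2 <= W by rewrite expr2 ler_piMr.
have J2 : J ^+ 2 <= J by rewrite expr2 ler_piMr.
have S2 : S ^+ 2 <= S by rewrite expr2 ler_piMr.
have JS : (J + S) ^+ 2 <= 2 * (J + S) by have := sqr_ge0 (J - S); rewrite sqrrB sqrrD; lra.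
have -> : (a * W * (J + S)) ^+ 2 = a ^+ 2 * (W ^+ 2 * (J + S) ^+ 2) by ring.
have -> : 2 * a ^+ 2 * (W * J) + 2 * a ^+ 2 * S * W = a ^+ 2 * (W * (2 * (J + S))) by ring.
by rewrite ler_wpM2l ?sqr_ge0// ler_pM ?sqr_ge0.
Qed.

(** The indicators at two levels differ with conditional probability |al' - al|. *)
Lemma mean_W_increment h al al' c n : 0 < h -> h * M <= eta ->
  alo <= al <= ahi -> alo <= al' <= ahi -> 0 <= alo -> ahi <= 1 ->
  Ex P (fun w => `|Dv n (wv h al' c) w - Dv n (wv h al c) w|) <=
    2 * expR 2 * Num.sqrt (n%:R * (4 * bw ^+ 2 * (C0 * h ^+ d) * `|al' - al|)
                           + 16 * bw ^+ 2).
Proof.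
move=> h0 hM hal hal' alo0 ahi1; have bw0 : 0 < bw by apply: lt_le_trans bw1.
have C00 : 0 <= C0 by rewrite /C0 mulr_ge0// exprn_ge0// (le_trans _ M1).
have hd0 : 0 <= h ^+ d by rewrite exprn_ge0// ltW.
pose f (z : Rd * R) := wv h al' c z - wv h al c z.
have bf : bmf f by apply: bmfB; exact: bmf_wv.
rewrite (@eq_Ex _ _ _ P _ (fun w => `|Dv n f w|)); last first.
  by move=> w; rewrite DvB//; exact: bmf_wv.
have -> : 16 * bw ^+ 2 = 4 * (2 * bw) ^+ 2 :> R by ring.
have bw20 : 0 < 2 * bw by rewrite mulr_gt0.
have s1 : `|al' - al| <= 1.
  by move: hal hal' => /andP[h1 h2] /andP[h3 h4]; rewrite ler_norml; apply/andP; split; lra.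
pose I (z : Rd * R) : R := `|(F z.2 z.1 <= al')%R%:R - (F z.2 z.1 <= al)%R%:R|.
have I01 z : 0 <= I z <= 1.
  by rewrite /I; case: (F _ _ <= al'); case: (F _ _ <= al); rewrite ?subrr ?subr0 ?sub0r ?normrN ?normr0 ?normr1 ?lexx ler01.
have fE z : `|f z| <= bw * wt h None z.1 * (I z + `|al' - al|).
  have -> : f z = wt h c z.1 * (((F z.2 z.1 <= al')%R%:R - (F z.2 z.1 <= al)%R%:R) - (al' - al)).
    by rewrite /f /wv; ring.
  by rewrite normrM ler_pM//; [exact: wt_le|exact: ler_normB].
have bI : bmf I by apply/bmf_norm/bmfB; exact: bmf_Fle.
have bwI : bmf (fun w => wt h None (X w) * I (Z w)).
  by apply: bmfM; [exact: (bZ (bmf_wt1 None h0))|exact: (bZ bI)].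
have bN : bmf (fun w => wt h None (X w)) by exact: (bZ (bmf_wt1 None h0)).
have EI : Ex P (fun w => wt h None (X w) * I (Z w)) <= `|al' - al| * (C0 * h ^+ d).
  have bi al1 : bmf (fun w => wt h None (X w) * (F (Y w) (X w) <= al1)%R%:R : R).
    by apply: bmfM => //; exact: (bZ (bmf_Fle al1)).
  have Ei al1 : alo <= al1 <= ahi -> Ex P (fun w => wt h None (X w) * (F (Y w) (X w) <= al1)%R%:R) =
      al1 * Ex P (fun w => wt h None (X w)).
    by move=> hal1; apply: disV => //; [exact: bmf_wt|move=> x; exact: wt_out_eta].
  have wlog_ al1 al2 : alo <= al1 <= ahi -> alo <= al2 <= ahi -> al1 <= al2 ->
      Ex P (fun w => wt h None (X w) * `|(F (Y w) (X w) <= al2)%R%:R - (F (Y w) (X w) <= al1)%R%:R|)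
       <= `|al2 - al1| * (C0 * h ^+ d).
    move=> h1 h2 h12.
    rewrite (@eq_Ex _ _ _ P _ (fun w => wt h None (X w) * (F (Y w) (X w) <= al2)%R%:R -
       wt h None (X w) * (F (Y w) (X w) <= al1)%R%:R)); last first.
      move=> w; rewrite -mulrBr ger0_norm//.
      case: (leP (F (Y w) (X w)) al1) => a1; last by rewrite subr0 ler0n.
      by rewrite (le_trans a1 h12) subrr.
    rewrite ExB// Ei// Ei// -mulrBl ger0_norm ?subr_ge0// ler_wpM2l ?subr_ge0//.
    exact: Ex_wtN_le.
  have [h12|/ltW h12] := leP al al'; first exact: wlog_.
  rewrite (@eq_Ex _ _ _ P _ (fun w => wt h None (X w) * `|(F (Y w) (X w) <= al)%R%:R - (F (Y w) (X w) <= al')%R%:R|)); last first.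
    by move=> w; rewrite /I distrC.
  by rewrite distrC; exact: wlog_.
apply: (mean_dev mZ mZs same_law indep n bf) => //.
- move=> z; apply: (le_trans (fE z)).
  have /andP[i0 i1] := I01 z; have /andP[w0 w1] := wtN01 h z.1.
  rewrite mulrC ler_pM//; [by rewrite addr_ge0|by rewrite mulr_ge0// ltW|lra|].
  by rewrite ler_piMr// ltW.
- apply: (@le_trans _ _ (Ex P (fun w => 2 * bw ^+ 2 * (wt h None (X w) * I (Z w)) +
     2 * bw ^+ 2 * `|al' - al| * wt h None (X w)))).
    apply: le_Ex.
    + by under eq_fun do rewrite expr2; apply: bmfM; exact: (bZ bf).
    + by apply: bmfD; exact: bmfZ.
    + move=> w; have /andP[i0 i1] := I01 (Z w); have /andP[w0 w1] := wtN01 h (X w).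
      rewrite -real_normK ?num_real//.
      apply: (@le_trans _ _ ((bw * wt h None (X w) * (I (Z w) + `|al' - al|)) ^+ 2)).
        have N0 : 0 <= bw * wt h None (X w) * (I (Z w) + `|al' - al|).
          by apply: mulr_ge0; [apply: mulr_ge0 => //; exact: ltW|exact: addr_ge0].
        by have fz := fE (Z w); rewrite lerXn2r// nnegrE.
      exact: square_arith.
  rewrite ExD ?ExZ//; [|exact: bmfZ|exact: bmfZ].
  have e2 := Ex_wtN_le h0 hM.
  have bb : 0 <= 2 * bw ^+ 2 by rewrite mulr_ge0 ?sqr_ge0.
  have e1' := ler_wpM2l bb EI.
  have bbs : 0 <= 2 * bw ^+ 2 * `|al' - al| by rewrite mulr_ge0.
  have e2' := ler_wpM2l bbs e2.
  apply: (le_trans (lerD e1' e2')).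
  by rewrite le_eqVlt; apply/orP; left; apply/eqP; ring.
- apply: mulr_ge0 => //; apply: mulr_ge0; last exact: mulr_ge0.
  by apply: mulr_ge0 => //; exact: sqr_ge0.
Qed.

(** * Bahadur representation *)

(** The objective without its normalization, in the rescaled coefficients. *)
Definition obj h n al b w : R :=
  \sum_(i < n) loss al ((Zs i w).2 - peval (zof h (Zs i w).1) b) * K (zof h (Zs i w).1).

Definition score h n al b w (v : mindex d p) : R :=
  \sum_(i < n) psi h (Some v) b (Zs i w) - al * \sum_(i < n) wt h (Some v) (Zs i w).1.

Lemma loss_subgradient (al y u u' : R) :
  loss al (y - u) + 2 * ((y <= u)%R%:R - al) * (u' - u) <= loss al (y - u').
Proof.
rewrite /loss; have [yu|yu] := leP y u.
  rewrite (ler0_norm (x := y - u)) ?subr_le0//.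
  by have := ler_norm (- (y - u')); rewrite normrN => h; rewrite mulr1n; nra.
rewrite (gtr0_norm (x := y - u)) ?subr_gt0//.
by have := ler_norm (y - u') => h; rewrite mulr0n; nra.
Qed.

(** Since [bh] minimizes a convex function, the slopes at any [b] do not point
    away from [bh]. *)
Lemma score_subgradient h n al b bh w :
  (forall b', obj h n al bh w <= obj h n al b' w) ->
  \sum_v score h n al b w v * (bh v - b v) <= 0.
Proof.
move=> /(_ b); rewrite -subr_ge0 => minb.
have E : \sum_v score h n al b w v * (bh v - b v) =
  \sum_(i < n) K (zof h (Zs i w).1) * (((Zs i w).2 <= peval (zof h (Zs i w).1) b)%R%:R - al) *
    (peval (zof h (Zs i w).1) bh - peval (zof h (Zs i w).1) b).
  under eq_bigr => v _ do rewrite /score mulr_sumr -sumrB mulr_suml.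
  rewrite exchange_big/=; apply: eq_bigr => i _.
  rewrite -pevalB /peval mulr_sumr; apply: eq_bigr => v _.
  by rewrite [X in _ = _ * (_ * X)]ffunE /psi /wt; ring.
rewrite E -(pmulr_rle0 _ (ltr0n R 2)) -oppr_ge0; apply: (le_trans minb).
rewrite /obj -sumrB mulr_sumr -sumrN; apply: ler_sum => i _.
have := loss_subgradient al (Zs i w).2 (peval (zof h (Zs i w).1) b) (peval (zof h (Zs i w).1) bh).
set l1 := loss _ _; set l2 := loss _ _; have := K0 (zof h (Zs i w).1).
by set k := K _; set I := _%:R; nra.
Qed.

Variable Q : R -> 'rV[R]_d -> R.
Hypothesis HQ : forall al x y, alo <= al <= ahi -> box x0 eta x ->
  (F y x <= al) = (y <= Q al x).
Hypothesis f0_ge : forall q, `|q| <= yb -> cf <= f0 q.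
Hypotheses (alo0 : 0 <= alo) (ahi1 : ahi <= 1).

Section core.
Variables (h : R) (n : nat) (w : Omega) (al tau rho Em Es : R) (bT bh : coefs).
Hypotheses (h0 : 0 < h) (hM : h * M <= eta) (hal : alo <= al <= ahi).
Hypotheses (tau0 : 0 <= tau) (tau_rho : 2 * (Pn * tau) <= rho) (rho0 : 0 < rho) (rhoB : rho <= B / 4).
Hypothesis HEm : forall c b b', (forall v, `|b v| <= B) -> (forall v, `|b' v| <= B) ->
  nd b b' <= rho -> `|Dv n (psi h c b) w - Dv n (psi h c b') w| <= Em.
Hypothesis HEs : forall c, `|Dv n (fun z => wt h c z.1) w| <= Es /\
  forall b, (forall v, `|b v| <= B) -> `|Dv n (psi h c b) w| <= Es.
Hypothesis bTB : forall v, `|bT v| <= B / 4.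
Hypothesis QbT : forall x, box x0 (h * M) x -> `|Q al x - peval (zof h x) bT| <= tau.
Hypothesis bh_min : forall b', obj h n al bh w <= obj h n al b' w.

Let N : R := n%:R * h ^+ d.
Let W v : R := Dv n (wv h al (Some v)) w.
Let mu b v : R := n%:R * Ex P (fun w => psi h (Some v) b (Z w)).
Let cb : R := bw * (C0 * Cf * (2 * tau)).

Lemma scoreE b v : score h n al b w v =
  Dv n (psi h (Some v) b) w + mu b v - al * \sum_(i < n) wt h (Some v) (Zs i w).1.
Proof. by rewrite /score /Dv /dev /mu subrK. Qed.

Lemma C0_ge0 : 0 <= C0.
Proof. by rewrite /C0 mulr_ge0// exprn_ge0// (le_trans _ M1). Qed.

Lemma bw_ge0 : 0 <= bw. Proof. exact: le_trans bw1. Qed.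

Lemma N0 : 0 <= N.
Proof. by rewrite /N mulr_ge0// exprn_ge0// ltW. Qed.

Lemma bTB1 v : `|bT v| <= B.
Proof. by apply: (le_trans (bTB v)); have := B0; lra. Qed.

Lemma tauB : 0 <= tau <= B / 4.
Proof.
rewrite tau0; apply: le_trans rhoB; apply: le_trans tau_rho.
have Pt : tau <= Pn * tau by rewrite ler_peMl// Pn1.
by have := tau0; lra.
Qed.

Lemma bT_range : CU * nrm bT + tau <= yb.
Proof.
have nb : nrm bT <= Pn * (B / 4) by exact: nrm_le.
have := ler_wpM2l (ltW CU0) nb; have /andP[_ t4] := tauB.
have cu1 := CU1; have p1 := Pn1.
have e : B / 4 <= CU * (Pn * (B / 4)).
  rewrite -[leLHS]mul1r ler_pM// ?divr_ge0// ?(ltW B0)//.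
  by rewrite ler_peMl// divr_ge0// ltW.
move=> e2; have e3 : CU * (Pn * (B / 4)) = CU * (Pn * B) / 4 by ring.
have e4 : 0 <= CU * (Pn * B) by rewrite mulr_ge0 ?(ltW CU0)// mulr_ge0 ?ler0n// ltW.
rewrite e3 in e e2; move: yB; lra.
Qed.

(** The target polynomial is within tau of the true quantile, so that exchanging
    them in the indicators costs the mass of a bracket of half-width tau. *)
Lemma score_bT_W v : `|score h n al bT w v - W v| <= bw * Em + cb * N.
Proof.
rewrite /W Dv_wv// /score /wv.
have -> : \sum_(i < n) psi h (Some v) bT (Zs i w) - al * \sum_(i < n) wt h (Some v) (Zs i w).1 -
   \sum_(i < n) wt h (Some v) (Zs i w).1 * ((F (Zs i w).2 (Zs i w).1 <= al)%R%:R - al) =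
   \sum_(i < n) wt h (Some v) (Zs i w).1 * (((Zs i w).2 <= peval (zof h (Zs i w).1) bT)%R%:R -
      (F (Zs i w).2 (Zs i w).1 <= al)%R%:R).
  rewrite mulr_sumr -!sumrB; apply: eq_bigr => i _; rewrite /psi; ring.
apply: (le_trans (ler_norm_sum _ _ _)).
apply: (@le_trans _ _ (bw * \sum_(i < n) bracket h bT tau (Zs i w))).
  rewrite mulr_sumr; apply: ler_sum => i _; set z := Zs i w.
  have [xb|xb] := pselect (box x0 (h * M) z.1); last first.
    by rewrite /bracket /psi !wt_out// !mul0r subrr mulr0 normr0.
  have xe : box x0 eta z.1 by move=> j; exact: le_trans (xb j) hM.
  rewrite (HQ _ hal xe) normrM /bracket /psi -mulrBr mulrA.
  apply: ler_pM => //; first exact: wt_le.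
  rewrite !peval_shift0 distrC; apply: indicator_between; exact: QbT.
have br_inB t v' : `|t| <= tau -> `|shift0 bT t v'| <= B.
  move=> tt; rewrite ffunE (le_trans (ler_normD _ _))// normrM.
  have e1 := bTB v'; have /andP[_ e2] := tauB; have e3 := B0.
  have e4 : `|t| * `|(v' == mindex0 d p)%:R| <= tau.
    by case: (v' == _); rewrite ?normr1 ?mulr1// normr0 mulr0.
  apply: (le_trans (lerD e1 e4)); lra.
have nd_br : nd (shift0 bT tau) (shift0 bT (- tau)) <= rho.
  apply: le_trans tau_rho.
  have -> : 2 * (Pn * tau) = Pn * (2 * tau) by ring.
  apply: nd_le => v'; rewrite !ffunE.
  have -> : bT v' + tau * (v' == mindex0 d p)%:R - (bT v' + - tau * (v' == mindex0 d p)%:R) =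
     2 * tau * (v' == mindex0 d p)%:R by ring.
  rewrite normrM ger0_norm ?mulr_ge0//.
  by case: (v' == _); rewrite ?normr1 ?mulr1// normr0 mulr0 mulr_ge0.
have e1 : `|Dv n (bracket h bT tau) w| <= Em.
  rewrite /bracket DvB; [|exact: bmf_psi|exact: bmf_psi].
  by apply: HEm => // v'; apply: br_inB; rewrite ?normrN ger0_norm.
have e2 : \sum_(i < n) bracket h bT tau (Zs i w) <=
    Em + n%:R * (C0 * Cf * (2 * tau) * h ^+ d).
  have -> : \sum_(i < n) bracket h bT tau (Zs i w) = Dv n (bracket h bT tau) w +
     n%:R * Ex P (fun w => bracket h bT tau (Z w)) by rewrite /Dv /dev subrK.
  apply: lerD; first exact: le_trans (ler_norm _) e1.
  by rewrite ler_wpM2l//; apply: Ex_bracket => //; exact: bT_range.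
have -> : bw * Em + cb * N = bw * (Em + n%:R * (C0 * Cf * (2 * tau) * h ^+ d)).
  by rewrite /cb /N; ring.
by rewrite ler_wpM2l// bw_ge0.
Qed.

Lemma score_bT_le v : `|score h n al bT w v| <= 2 * Es + cb * N.
Proof.
rewrite scoreE.
have [Es1 Es2] := HEs (Some v).
have E1 := Es2 bT bTB1.
have al01 : `|al| <= 1.
  move: hal => /andP[h1 h2]; rewrite ger0_norm; last exact: le_trans alo0 h1.
  exact: le_trans h2 ahi1.
set S := \sum_(i < n) _.
have SE : S = Dv n (fun z => wt h (Some v) z.1) w + n%:R * Ex P (fun w => wt h (Some v) (X w)).
  by rewrite /Dv /dev subrK.
have b1 : bmf (fun w => wt h (Some v) (X w)) by exact: (bZ (bmf_wt1 (Some v) h0)).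
have b2 : bmf (fun w => psi h (Some v) bT (Z w)).
  by apply: (bZ (f := psi h (Some v) bT)); exact: bmf_psi.
have b3 : bmf (fun w => wt h (Some v) (X w) * (F (Y w) (X w) <= al)%R%:R).
  by apply: bmfM => //; exact: (bZ (bmf_Fle al)).
have b4 : bmf (fun w => bracket h bT tau (Z w)).
  by apply: (bZ (f := bracket h bT tau)); exact: bmf_bracket.
have M1' : `|mu bT v - al * (n%:R * Ex P (fun w => wt h (Some v) (X w)))| <= cb * N.
  rewrite /mu mulrCA -mulrBr -disV//; last 2 first.
  - exact: bmf_wt.
  - by move=> x; exact: wt_out_eta.
  rewrite -ExB// normrM ger0_norm//.
  have -> : cb * N = n%:R * (bw * (C0 * Cf * (2 * tau) * h ^+ d)) by rewrite /cb /N; ring.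
  rewrite ler_wpM2l// (le_trans (Ex_norm _ _))//; first exact: bmfB.
  apply: (@le_trans _ _ (Ex P (fun w => bw * bracket h bT tau (Z w)))).
    apply: le_Ex; [exact/bmf_norm/bmfB|exact: bmfZ|].
    move=> w'.
    have -> : psi h (Some v) bT (Z w') - wt h (Some v) (X w') * (F (Y w') (X w') <= al)%R%:R =
      wt h (Some v) (X w') * ((Y w' <= peval (zof h (X w')) bT)%R%:R -
         (F (Y w') (X w') <= al)%R%:R) by rewrite mulrBr.
    have [xb|xb] := pselect (box x0 (h * M) (X w')); last first.
      by rewrite /bracket /psi !wt_out// !mul0r subrr mulr0 normr0.
    have xe : box x0 eta (X w') by move=> j; exact: le_trans (xb j) hM.
    rewrite (HQ _ hal xe) normrM /bracket /psi -mulrBr mulrA.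
    apply: ler_pM => //; first exact: wt_le.
    rewrite !peval_shift0 distrC; apply: indicator_between; exact: QbT.
  rewrite ExZ// ler_wpM2l ?bw_ge0//; apply: Ex_bracket => //; exact: bT_range.
rewrite SE; set m2 := n%:R * Ex P _ in M1' *.
set D1 := Dv n _ w in E1 *; set D2 := Dv n _ w in Es1 *.
have -> : D1 + mu bT v - al * (D2 + m2) = D1 - al * D2 + (mu bT v - al * m2) by ring.
apply: (le_trans (ler_normD _ _)); apply: lerD => //.
apply: (le_trans (ler_normB _ _)); rewrite mulr_natl mulr2n; apply: lerD => //.
by rewrite normrM; apply: le_trans Es1; rewrite ler_piMl.
Qed.

(** Monotonicity of the score along the segment from the target to the minimizer
    confines the minimizer to any ball on whose sphere the curvature of the mean
    objective beats the stochastic error. *)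
Lemma rate (c2 : R) : 0 < c2 ->
  (forall b b', (forall v, `|b v| <= B) -> (forall v, `|b' v| <= B) ->
     c2 * N * nd b b' ^+ 2 <= \sum_v (b v - b' v) * (mu b v - mu b' v)) ->
  2 * Es + cb * N + Em < c2 * N * rho -> nd bh bT <= rho.
Proof.
move=> c20 smono small; rewrite leNgt; apply/negP => far.
set s := nd bh bT in far.
have s0 : 0 < s by exact: lt_trans far.
pose t := rho / s.
have t0 : 0 < t by rewrite divr_gt0.
have t1 : t < 1 by rewrite /t ltr_pdivrMr// mul1r.
(* the point of the segment from bT to bh on the sphere of radius rho *)
pose b : coefs := [ffun v => bT v + t * (bh v - bT v)].
have bE v : b v - bT v = t * (bh v - bT v) by rewrite ffunE addrC addKr.
have ndb : nd b bT = rho.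
  have -> : nd b bT = t * s.
    rewrite /nd /s /nd /nrm mulr_sumr; apply: eq_bigr => v _.
    by rewrite ffunE bE normrM gtr0_norm// ffunE.
  by rewrite /t divfK// gt_eqF.
have bB v : `|b v| <= B.
  have := coef_le_nrm [ffun v => b v - bT v] v; rewrite -/(nd b bT) ndb ffunE => e1.
  rewrite -[b v](subrK (bT v)) (le_trans (ler_normD _ _))//.
  by have e2 := bTB v; have e3 := B0; have e4 := rhoB; lra.
have sub := score_subgradient b bh_min.
have sub' : \sum_v score h n al b w v * (b v - bT v) <= 0.
  have E : \sum_v score h n al b w v * (bh v - b v) = (1 - t) / t *
     \sum_v score h n al b w v * (b v - bT v).
    rewrite mulr_sumr; apply: eq_bigr => v _; rewrite bE ffunE.
    by field; rewrite gt_eqF.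
  by move: sub; rewrite E pmulr_rle0// divr_gt0// subr_gt0.
have := smono b bT bB bTB1; rewrite ndb.
have -> : \sum_v (b v - bT v) * (mu b v - mu bT v) =
   \sum_v score h n al b w v * (b v - bT v) +
   \sum_v (b v - bT v) * - (score h n al bT w v +
      (Dv n (psi h (Some v) b) w - Dv n (psi h (Some v) bT) w)).
  by rewrite -big_split/=; apply: eq_bigr => v _; rewrite !scoreE; ring.
have e1 : \sum_v (b v - bT v) * - (score h n al bT w v +
      (Dv n (psi h (Some v) b) w - Dv n (psi h (Some v) bT) w)) <=
      rho * (2 * Es + cb * N + Em).
  rewrite -ndb /nd /nrm mulr_suml; apply: ler_sum => v _.
  rewrite (le_trans (ler_norm _))// normrM normrN [in leRHS]ffunE ler_wpM2l//.
  rewrite (le_trans (ler_normD _ _))// lerD ?score_bT_le//.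
  by apply: HEm => //; [exact: bTB1|rewrite ndb].
move=> e2; have e3 := le_trans e2 (lerD sub' e1).
move: e3; rewrite add0r expr2 mulrA mulrC ler_pM2l//.
by rewrite leNgt small.
Qed.

Hypothesis bh_near : nd bh bT <= rho.

Lemma bhB v : `|bh v| <= B / 2.
Proof.
have := coef_le_nrm [ffun v => bh v - bT v] v; rewrite -/(nd bh bT) ffunE => e1.
rewrite -[bh v](subrK (bT v)) (le_trans (ler_normD _ _))//.
by have e2 := bTB v; have e3 := rhoB; have e4 := bh_near; lra.
Qed.

Let shiftv (b : coefs) u t : coefs := [ffun v => b v + t * (v == u)%:R].

(** The score need not vanish at the minimizer, but along each coordinate line it
    changes sign there, so it is at most its oscillation over a short step. *)
Lemma approx_foc th v : 0 < th -> th <= rho ->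
  `|score h n al bh w v| <= Em + bw * (C0 * Cf * (2 * (CU * th))) * N.
Proof.
move=> th0 thr; set E := _ + _.
have nds t : `|t| <= th -> nd (shiftv bh v t) bh <= th.
  move=> tt; rewrite /nd /nrm (bigD1 v)//= big1 ?addr0; last first.
    by move=> u /negbTE uv; rewrite !ffunE uv mulr0 addr0 subrr normr0.
  by rewrite !ffunE eqxx mulr1 addrAC subrr add0r.
have sB t u : `|t| <= th -> `|shiftv bh v t u| <= B.
  move=> tt; rewrite ffunE (le_trans (ler_normD _ _))// normrM.
  have e1 := bhB u; have e3 := B0; have e5 := rhoB.
  have e4 : `|t| * `|(u == v)%:R| <= th.
    by case: (u == v); rewrite ?normr1 ?mulr1// normr0 mulr0 ltW.
  apply: (le_trans (lerD e1 e4)); lra.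
have bhB1 u : `|bh u| <= B by apply: (le_trans (bhB u)); have := B0; lra.
have osc t : `|t| <= th -> `|score h n al (shiftv bh v t) w v - score h n al bh w v| <= E.
  move=> tt; rewrite !scoreE.
  set D1 := Dv n _ w; set D2 := Dv n _ w; set S := al * _.
  have -> : D1 + mu (shiftv bh v t) v - S - (D2 + mu bh v - S) =
     (D1 - D2) + (mu (shiftv bh v t) v - mu bh v) by ring.
  rewrite (le_trans (ler_normD _ _))// /E lerD//.
    by apply: HEm => //; [move=> u; exact: sB|exact: le_trans (nds t tt) thr].
  rewrite /mu -mulrBr normrM ger0_norm//.
  have -> : bw * (C0 * Cf * (2 * (CU * th))) * N =
     n%:R * (bw * (C0 * Cf * (2 * (CU * th)) * h ^+ d)) by rewrite /N; ring.
  rewrite ler_wpM2l//; apply: Ex_psi_lip => //.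
  - by rewrite mulr_ge0 ?(ltW CU0)// ltW.
  - have nb : nrm bh <= Pn * (B / 2) by apply: nrm_le => u; exact: bhB.
    have := ler_wpM2l (ltW CU0) nb.
    have e1 : th <= Pn * (B / 4).
      apply: (le_trans thr); apply: (le_trans rhoB).
      by rewrite ler_peMl ?Pn1// divr_ge0// ltW.
    have := ler_wpM2l (ltW CU0) e1 => e2 e3.
    have e4 : 0 <= CU * (Pn * B) by rewrite mulr_ge0 ?(ltW CU0)// mulr_ge0 ?ler0n// ltW.
    have e5 : CU * (Pn * (B / 4)) = CU * (Pn * B) / 4 by ring.
    have e6 : CU * (Pn * (B / 2)) = CU * (Pn * B) / 2 by ring.
    rewrite e5 in e2; rewrite e6 in e3; move: yB; lra.
  - move=> y yM; apply: (le_trans (peval_diff_le _ _ yM)).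
    by rewrite ler_wpM2l ?(ltW CU0)//; exact: nds.
have sgn t : t * score h n al (shiftv bh v t) w v >= 0.
  have := score_subgradient (shiftv bh v t) bh_min.
  rewrite (bigD1 v)//= big1 ?addr0; last first.
    by move=> u /negbTE uv; rewrite ffunE uv mulr0 addr0 subrr mulr0.
  rewrite ffunE eqxx mulr1 opprD addrA subrr add0r mulrN oppr_le0.
  by rewrite mulrC.
have p1 : `|th| <= th by rewrite gtr0_norm.
have p2 : `|- th| <= th by rewrite normrN gtr0_norm.
have := osc _ p1; have := osc _ p2; have := sgn th; have := sgn (- th).
rewrite mulNr oppr_ge0 pmulr_rle0// pmulr_rge0// => g1 g2.
rewrite ler_norml => /andP[a1 a2]; rewrite ler_norml => /andP[a3 a4].
by rewrite ler_norml; apply/andP; split; lra.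
Qed.

Lemma mean_score_increment th v : 0 < th -> th <= rho ->
  `|mu bh v - mu bT v + W v| <=
    bw * Em + cb * N + (Em + bw * (C0 * Cf * (2 * (CU * th))) * N) + Em.
Proof.
move=> th0 thr; have e1 := score_bT_W v; have e2 := approx_foc v th0 thr.
have bhB1 u : `|bh u| <= B by apply: (le_trans (bhB u)); have := B0; lra.
have e3 := HEm (Some v) bhB1 bTB1 bh_near.
have E : mu bh v - mu bT v + W v = score h n al bh w v - (score h n al bT w v - W v) -
   (Dv n (psi h (Some v) bh) w - Dv n (psi h (Some v) bT) w).
  by rewrite !scoreE; ring.
rewrite E (le_trans (ler_normB _ _))// lerD// (le_trans (ler_normB _ _))//.
by rewrite addrC lerD.
Qed.

Let sumW : R := \sum_v `|W v|.

(** Strong monotonicity again, now with the increment of the mean score known: the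
    error is controlled by the first order term itself. Multiplied by h, as it
    comes out of [linear_part], this is negligible. *)
Lemma near_le (c2 : R) E3 : 0 < c2 -> 0 <= E3 ->
  (forall b b', (forall v, `|b v| <= B) -> (forall v, `|b' v| <= B) ->
     c2 * N * nd b b' ^+ 2 <= \sum_v (b v - b' v) * (mu b v - mu b' v)) ->
  (forall v, `|mu bh v - mu bT v + W v| <= E3) ->
  c2 * N * nd bh bT <= sumW + E3.
Proof.
move=> c20 E30 smono inc.
have bhB1 u : `|bh u| <= B by apply: (le_trans (bhB u)); have := B0; lra.
have := smono bh bT bhB1 bTB1; set s := nd bh bT => e1.
have s0 : 0 <= s by exact: nrm_ge0.
have W0 : 0 <= sumW by apply: sumr_ge0.
have e2 : \sum_v (bh v - bT v) * (mu bh v - mu bT v) <= s * (sumW + E3).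
  rewrite /s /nd /nrm mulr_suml; apply: ler_sum => v _.
  rewrite (le_trans (ler_norm _))// normrM [in leRHS]ffunE ler_wpM2l//.
  rewrite -[X in `|X|](addrK (W v)) (le_trans (ler_normB _ _))// addrC lerD//.
  by rewrite /sumW (bigD1 v)//= lerDl sumr_ge0.
have [->|sn] := eqVneq s 0; first by rewrite mulr0 addr_ge0.
have sp : 0 < s by rewrite lt_neqAle eq_sym sn.
rewrite -(ler_pM2l sp); apply: le_trans e2; apply: le_trans e1.
by rewrite expr2 le_eqVlt; apply/orP; left; apply/eqP; ring.
Qed.

(** Testing the increment of the mean score against the dual vector isolates the
    intercept. *)
Lemma linear_part (a : coefs) E3 CL : 0 <= CL ->
  (forall y : 'rV[R]_d, (forall i, `|y 0 i| <= M) -> `|peval y bT - Q al x0| <= CL * h) ->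
  (forall b, gram h a b = h ^+ d * b (mindex0 d p)) ->
  (forall v, `|mu bh v - mu bT v + W v| <= E3) ->
  `|f0 (Q al x0) * N * (bh (mindex0 d p) - bT (mindex0 d p)) + \sum_v a v * W v| <=
    nrm a * E3 + KB * (CU * nrm a) * (L1 * (h * M + 2 * (CU * nd bh bT + CL * h)) *
       (CU * nd bh bT)) * C0 * N.
Proof.
move=> CL0 bTq dual inc; set s := nd bh bT; set q := Q al x0.
pose t := CU * s + CL * h.
have s0 : 0 <= s by exact: nrm_ge0.
have tq (y : 'rV[R]_d) : (forall i, `|y 0 i| <= M) -> `|peval y bh - q| <= t.
  move=> yM; rewrite -[X in `|X|](subrKA (peval y bT)) (le_trans (ler_normD _ _))// /t lerD//.
    exact: peval_diff_le.
  exact: bTq.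
have tq' (y : 'rV[R]_d) : (forall i, `|y 0 i| <= M) -> `|peval y bT - q| <= t.
  by move=> yM; apply: (le_trans (bTq y yM)); rewrite lerDr mulr_ge0// (ltW CU0).
have lin := score_linearization a h0 hM tq tq'.
rewrite dual ffunE -/s in lin.
set dl := bh (mindex0 d p) - bT (mindex0 d p) in lin *.
set T := \sum_v a v * (_ - _) in lin.
have TE : n%:R * T = \sum_v a v * (mu bh v - mu bT v).
  by rewrite /T mulr_sumr; apply: eq_bigr => v _; rewrite /mu; ring.
have -> : f0 q * N * dl + \sum_v a v * W v =
   \sum_v a v * (mu bh v - mu bT v + W v) - n%:R * (T - f0 q * (h ^+ d * dl)).
  rewrite [n%:R * (T - _)]mulrBr TE; under [X in _ = X - _]eq_bigr do rewrite mulrDr.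
  by rewrite big_split/= /N; ring.
rewrite (le_trans (ler_normB _ _))// lerD//.
  rewrite (le_trans (ler_norm_sum _ _ _))// /nrm mulr_suml ler_sum// => v _.
  by rewrite normrM ler_wpM2l.
rewrite normrM ger0_norm//; have := ler_wpM2l (ler0n R n) lin.
move=> /le_trans; apply; rewrite le_eqVlt; apply/orP; left; apply/eqP.
by rewrite /t /N; ring.
Qed.

End core.

(** By [rate] the minimizer is within a multiple of r + tau of the target, with
    large probability for all levels at once. At that distance the centred score
    oscillates by n h^d r^(3/2) at most ([modulus]), so that the approximate first
    order condition at the minimizer is one at the target. The linearized mean
    score then gives the intercept. *)
Lemma bahadur (CL Ca : R) : 0 <= CL -> 0 <= Ca -> exists C A0 : R,
  [/\ 0 < C, 0 < A0 & forall (h : R) (n : nat) (r tau : R),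
   0 < h -> h * M <= eta -> h <= 1 -> (3 <= n)%N -> 1 <= ln n%:R :> R ->
   0 < r -> r <= 1 -> n%:R * h ^+ d * r ^+ 2 = ln n%:R -> 0 <= tau -> tau <= 1 ->
   A0 * (r + tau) <= B / 4 ->
   exists A, [/\ measurable A, 1 - C / n%:R <= fine (P A) &
   forall w, A w -> forall al (bT a bh : coefs), alo <= al <= ahi ->
     (forall v, `|bT v| <= B / 4) ->
     (forall x, box x0 (h * M) x -> `|Q al x - peval (zof h x) bT| <= tau) ->
     (forall y : 'rV[R]_d, (forall i, `|y 0 i| <= M) -> `|peval y bT - Q al x0| <= CL * h) ->
     `|Q al x0| <= yb -> nrm a <= Ca ->
     (forall b, gram h a b = h ^+ d * b (mindex0 d p)) ->
     (forall b', obj h n al bh w <= obj h n al b' w) ->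
     `|bh (mindex0 d p) - bT (mindex0 d p) +
        (f0 (Q al x0) * (n%:R * h ^+ d))^-1 * \sum_v a v * Dv n (wv h al (Some v)) w| <=
     C * (r * Num.sqrt r + tau +
          h / (n%:R * h ^+ d) * \sum_v `|Dv n (wv h al (Some v)) w|)]].
Proof.
move=> CL0 Ca0.
have [Cm Cm0 modP] := modulus; have [Cs Cs0 supP] := sup_deviation.
have [c2 c20 smono] := score_strongly_monotone.
have KBg := KB0; have C0g := C0_ge0; have bwg := bw_ge0; have CUg := ltW CU0.
have Pn1' := Pn1.
have [k1 k1E] : exists k : R, k = 2 * bw * (C0 * Cf) by eexists.
have k10 : 0 <= k1 by rewrite k1E; do !apply: mulr_ge0 => //.
have [sB sBE] : exists k : R, k = Num.sqrt (B / 4) by eexists.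
have sB0 : 0 <= sB by rewrite sBE sqrtr_ge0.
(* with this radius the curvature exceeds the stochastic error and the bias *)
have [A0 A0E] : exists k : R, k = (4 * Cs + k1 + Cm * (sB + 1) + 1) / c2 + 2 * Pn + 1 by eexists.
have q0 : 0 <= (4 * Cs + k1 + Cm * (sB + 1) + 1) / c2.
  rewrite divr_ge0 ?(ltW c20)// addr_ge0// addr_ge0//; last by rewrite mulr_ge0 ?(ltW Cm0) ?addr_ge0.
  by rewrite addr_ge0// mulr_ge0// ltW.
have A01 : 1 <= A0 by rewrite A0E; lra.
have A0P : 2 * Pn <= A0 by rewrite A0E; lra.
have A0c : 4 * Cs + k1 + Cm * (sB + 1) + 1 <= c2 * A0.
  by rewrite -ler_pdivrMl// mulrC A0E; lra.
have A00 : 0 < A0 by exact: lt_le_trans A01.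
have [sA sAE] : exists k : R, k = Num.sqrt A0 by eexists.
have sA0 : 0 <= sA by rewrite sAE sqrtr_ge0.
have [Ce CeE] : exists k : R, k = Cm * (2 * sA + 1) by eexists.
have Ce0 : 0 <= Ce by rewrite CeE mulr_ge0 ?(ltW Cm0)// addr_ge0// mulr_ge0.
have [C3 C3E] : exists k : R, k = (bw + 2) * Ce + k1 * (1 + CU) by eexists.
have C30 : 0 <= C3 by rewrite C3E addr_ge0// mulr_ge0// addr_ge0.
have [G GE] : exists k : R, k = KB * (CU * Ca) * L1 * CU * C0 by eexists.
have G0 : 0 <= G by rewrite GE; do !apply: mulr_ge0 => //.
have [g1 g1E] : exists k : R, k = G * (M + 2 * CL) / c2 by eexists.
have Mg : 0 <= M by exact: le_trans M1.
have g10 : 0 <= g1 by rewrite g1E divr_ge0 ?(ltW c20)// mulr_ge0// addr_ge0// mulr_ge0.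
have [g2 g2E] : exists k : R, k = 4 * CU * G * A0 ^+ 2 by eexists.
have g20 : 0 <= g2 by rewrite g2E; do !apply: mulr_ge0 => //; exact: ltW.
pose C := Cm + Cs + (Ca * C3 + g1 * (1 + C3) + g2) / cf.
have Cq0 : 0 <= (Ca * C3 + g1 * (1 + C3) + g2) / cf.
  rewrite divr_ge0 ?(ltW cf0)// addr_ge0// addr_ge0//; first by rewrite mulr_ge0.
  by rewrite mulr_ge0// addr_ge0.
exists C, A0; split=> //; first by rewrite /C ltr_wpDr// addr_gt0.
move=> h n r tau h0 hM h1 n3 l1 r0 r1 Nr tau0 tau1 A0B.
have n0 : (0 < n)%N by exact: leq_trans n3.
have nn : 0 < n%:R :> R by rewrite ltr0n.
set N := n%:R * h ^+ d in Nr *.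
have N0 : 0 < N by rewrite /N mulr_gt0// exprn_gt0.
pose rho := A0 * (r + tau).
have rt0 : 0 < r + tau by rewrite ltr_wpDr.
have rho0 : 0 < rho by rewrite /rho mulr_gt0.
have rhoP : 0 <= rho <= 2 * (Pn * B).
  rewrite (ltW rho0)/=; apply: (le_trans A0B).
  have : B <= Pn * B by rewrite ler_peMl// ltW.
  have := B0; lra.
have [A1 [mA1 PA1 HA1]] := modP h n rho h0 hM h1 n3 l1 rhoP.
have [A2 [mA2 PA2 HA2]] := supP h n h0 hM h1 n3 l1.
exists (A1 `&` A2); split; first exact: measurableI.
  apply: le_trans (probability_setI_ge mA1 mA2 PA1 PA2).
  by rewrite lerD2l lerN2 -mulrDl ler_wpM2r ?invr_ge0// /C lerDl.
move=> w [A1w A2w] al bT a bh hal bTB QbT bTq qyb aCa dual bh_min.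
pose Em := Cm * (N * (r * Num.sqrt rho) + N * r ^+ 2).
pose Es := Cs * (N * r + N * r ^+ 2).
have sq1 : Num.sqrt (n%:R * h ^+ d * rho * ln n%:R) = N * (r * Num.sqrt rho).
  rewrite -Nr -/N.
  have -> : N * rho * (N * r ^+ 2) = (N * r) ^+ 2 * rho by ring.
  rewrite sqrtrM ?sqr_ge0// sqrtr_sqr ger0_norm ?mulrA//.
  by rewrite mulr_ge0 ?ltW.
have sq2 : Num.sqrt (n%:R * h ^+ d * ln n%:R) = N * r.
  rewrite -Nr -/N.
  have -> : N * (N * r ^+ 2) = (N * r) ^+ 2 by ring.
  by rewrite sqrtr_sqr ger0_norm// mulr_ge0 ?ltW.
have HEm c b b' : (forall v, `|b v| <= B) -> (forall v, `|b' v| <= B) ->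
    nd b b' <= rho -> `|Dv n (psi h c b) w - Dv n (psi h c b') w| <= Em.
  by move=> b1 b2 b3; have := HA1 w A1w c b b' b1 b2 b3; rewrite sq1 -Nr.
have HEs c : `|Dv n (fun z => wt h c z.1) w| <= Es /\
    forall b, (forall v, `|b v| <= B) -> `|Dv n (psi h c b) w| <= Es.
  by have := HA2 w A2w c; rewrite sq2 -Nr.
have tau_rho : 2 * (Pn * tau) <= rho.
  rewrite /rho mulrA (le_trans (ler_wpM2r tau0 A0P))// ler_pM2l// lerDr ltW//.
pose mu b v : R := n%:R * Ex P (fun w => psi h (Some v) b (Z w)).
have smonoN b b' : (forall v, `|b v| <= B) -> (forall v, `|b' v| <= B) ->
     c2 * N * nd b b' ^+ 2 <= \sum_v (b v - b' v) * (mu b v - mu b' v).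
  move=> b1 b2; have := ler_wpM2l (ltW nn) (smono h b b' h0 hM b1 b2).
  rewrite mulr_sumr => e; apply: le_trans (le_trans e _).
    by rewrite /N le_eqVlt; apply/orP; left; apply/eqP; ring.
  by apply: ler_sum => v _; rewrite /mu le_eqVlt; apply/orP; left; apply/eqP; ring.
have rr : r ^+ 2 <= r by rewrite expr2 ler_piMr// ltW.
have cbE : bw * (C0 * Cf * (2 * tau)) = k1 * tau by rewrite k1E; ring.
have srho : Num.sqrt rho <= sB by rewrite sBE ler_wsqrtr.
have Nr0 : 0 < N * r by rewrite mulr_gt0.
have small : 2 * Es + bw * (C0 * Cf * (2 * tau)) * N + Em < c2 * N * rho.
  have e1 : Es <= Cs * (2 * (N * r)).
    rewrite /Es ler_wpM2l ?(ltW Cs0)// mulr_natl mulr2n lerD2l.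
    by rewrite ler_wpM2l// ltW.
  have e2 : Em <= Cm * ((sB + 1) * (N * r)).
    rewrite /Em ler_wpM2l ?(ltW Cm0)// mulrDl mul1r lerD//; last by rewrite ler_wpM2l// ltW.
    by rewrite mulrA [leLHS]mulrC ler_wpM2r// ltW.
  rewrite cbE.
  have e3 : (4 * Cs + k1 + Cm * (sB + 1) + 1) * (N * (r + tau)) <= c2 * N * rho.
    have -> : c2 * N * rho = c2 * A0 * (N * (r + tau)) by rewrite /rho; ring.
    by rewrite ler_wpM2r// mulr_ge0// ltW.
  apply: lt_le_trans e3.
  have e4 : 0 <= N * tau by rewrite mulr_ge0// ltW.
  have e5 : (4 * Cs + k1 + Cm * (sB + 1) + 1) * (N * (r + tau)) =
    2 * (Cs * (2 * (N * r))) + k1 * tau * N + Cm * ((sB + 1) * (N * r)) + N * r +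
      (k1 * (N * r) + (4 * Cs + Cm * (sB + 1) + 1) * (N * tau)) by ring.
  rewrite e5.
  have e6 : 0 <= k1 * (N * r) + (4 * Cs + Cm * (sB + 1) + 1) * (N * tau).
    rewrite addr_ge0//; first by rewrite mulr_ge0// ltW.
    rewrite mulr_ge0// addr_ge0// addr_ge0//; first by rewrite mulr_ge0// ltW.
    by rewrite mulr_ge0 ?(ltW Cm0)// addr_ge0.
  apply: (@lt_le_trans _ _ (2 * (Cs * (2 * (N * r))) + k1 * tau * N + Cm * ((sB + 1) * (N * r)) + N * r));
    last by rewrite lerDl.
  apply: (@le_lt_trans _ _ (2 * (Cs * (2 * (N * r))) + k1 * tau * N + Cm * ((sB + 1) * (N * r))));
    last by rewrite ltrDl.
  by rewrite lerD// lerD// ler_wpM2l.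
have near := rate h0 hM hal tau0 tau_rho rho0 A0B HEm HEs bTB QbT bh_min c20 smonoN small.
have th0 : 0 < r ^+ 2 by rewrite exprn_gt0.
have thr : r ^+ 2 <= rho.
  by rewrite /rho (le_trans rr)// -[leLHS]mul1r ler_pM// ?(ltW r0)// lerDl.
have inc0 v := mean_score_increment h0 hM hal tau0 tau_rho A0B HEm bTB QbT bh_min near v th0 thr.
pose kk := r * Num.sqrt r + tau.
have rs : r <= Num.sqrt r.
  by rewrite -{1}(ger0_norm (ltW r0)) -sqrtr_sqr ler_wsqrtr.
have rk : r ^+ 2 <= kk.
  by rewrite /kk expr2 (le_trans (ler_wpM2l (ltW r0) rs))// lerDl.
have tk : tau <= kk by rewrite /kk lerDr mulr_ge0 ?sqrtr_ge0// ltW.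
have kk0 : 0 <= kk by exact: le_trans tk.
have EmE : Em <= Ce * (N * kk).
  have e1 : r * Num.sqrt rho <= 2 * sA * kk.
    have e2 : Num.sqrt rho <= sA * (Num.sqrt r + Num.sqrt tau).
      rewrite /rho sqrtrM ?(ltW A00)// -sAE ler_wpM2l//.
      by apply: sqrtD_le => //; exact: ltW.
    apply: (le_trans (ler_wpM2l (ltW r0) e2)).
    have -> : 2 * sA * kk = sA * (2 * kk) by ring.
    rewrite mulrCA ler_wpM2l// mulrDr.
    have e3 : r * Num.sqrt tau <= kk.
      apply: (le_trans (mulr_le_half_sqr _ _)); rewrite sqr_sqrtr//.
      by rewrite ler_pdivrMr// mulr_natr mulr2n lerD.
    rewrite mulr_natl mulr2n lerD// /kk lerDl//.
  rewrite /Em CeE -mulrA ler_wpM2l ?(ltW Cm0)//.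
  have -> : (2 * sA + 1) * (N * kk) = N * (2 * sA * kk) + N * kk by ring.
  by rewrite lerD// ler_wpM2l// ltW.
have inc v : `|mu bh v - mu bT v + Dv n (wv h al (Some v)) w| <= C3 * (N * kk).
  apply: (le_trans (inc0 v)).
  have -> : bw * (C0 * Cf * (2 * (CU * r ^+ 2))) = k1 * CU * r ^+ 2 by rewrite k1E; ring.
  rewrite cbE -/N.
  have -> : C3 * (N * kk) = (bw * (Ce * (N * kk)) + k1 * kk * N) +
     (Ce * (N * kk) + k1 * CU * kk * N) + Ce * (N * kk) by rewrite C3E; ring.
  rewrite lerD// lerD//; first rewrite lerD//.
  - by rewrite ler_wpM2l.
  - by rewrite ler_wpM2r ?(ltW N0)// ler_wpM2l.
  - by rewrite lerD// ler_wpM2r ?(ltW N0)// ler_wpM2l// mulr_ge0.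
have E30 : 0 <= C3 * (N * kk) by rewrite mulr_ge0// mulr_ge0// ltW.
have nl := near_le A0B bTB near c20 E30 smonoN inc.
have lp := linear_part h0 hM CL0 bTq dual inc.
set sW := \sum_v `|_| in nl *; set s := nd bh bT in nl lp near.
set aW := \sum_v a v * _ in lp *; set fq := f0 _ in lp *.
have fqc : cf <= fq by exact: f0_ge.
have fq0 : 0 < fq by exact: lt_le_trans fqc.
have s0 : 0 <= s by exact: nrm_ge0.
have sW0 : 0 <= sW by apply: sumr_ge0.
set dl := _ - _ in lp *.
have -> : dl + (fq * N)^-1 * aW = (fq * N * dl + aW) / (fq * N).
  by field; rewrite !gt_eqF.
have fN : 0 < fq * N by rewrite mulr_gt0.
rewrite normrM normfV (gtr0_norm fN) ler_pdivrMr//.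
apply: (le_trans lp).
have cN : cf * N <= fq * N by rewrite ler_pM2r.
have bnd : nrm a * (C3 * (N * kk)) + KB * (CU * nrm a) *
    (L1 * (h * M + 2 * (CU * s + CL * h)) * (CU * s)) * C0 * N <=
    (Ca * C3 + g1 * (1 + C3) + g2) * (kk + h / N * sW) * N.
  have e1 : nrm a * (C3 * (N * kk)) <= Ca * (C3 * (N * kk)) by rewrite ler_wpM2r.
  have e2 : KB * (CU * nrm a) * (L1 * (h * M + 2 * (CU * s + CL * h)) * (CU * s)) * C0 * N <=
     G * (h * M + 2 * (CU * s + CL * h)) * s * N.
    have -> : G * (h * M + 2 * (CU * s + CL * h)) * s * N =
      KB * (CU * Ca) * (L1 * (h * M + 2 * (CU * s + CL * h)) * (CU * s)) * C0 * N.
      by rewrite GE; ring.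
    rewrite ler_wpM2r ?(ltW N0)// ler_wpM2r// ler_wpM2r//; last by rewrite ler_wpM2l// ler_wpM2l.
    rewrite mulr_ge0 ?mulr_ge0// addr_ge0//; first by rewrite mulr_ge0// ltW.
    by rewrite mulr_ge0// addr_ge0 ?mulr_ge0// ltW.
  have e3 : G * (h * M + 2 * (CU * s + CL * h)) * s * N =
    G * (M + 2 * CL) / c2 * (h * (c2 * N * s)) + 2 * CU * G * (N * s ^+ 2).
    by field; rewrite gt_eqF.
  have e4 : G * (M + 2 * CL) / c2 * (h * (c2 * N * s)) <= g1 * (h * (sW + C3 * (N * kk))).
    by rewrite -g1E ler_wpM2l// ler_wpM2l// ltW.
  have e5 : 2 * CU * G * (N * s ^+ 2) <= g2 * (N * kk).
    have e6 : s ^+ 2 <= A0 ^+ 2 * (2 * kk).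
      apply: (@le_trans _ _ (rho ^+ 2)); first by rewrite lerXn2r// nnegrE// ltW.
      rewrite /rho exprMn ler_wpM2l ?sqr_ge0//.
      have t2 : tau ^+ 2 <= tau by rewrite expr2 ler_piMr.
      have q1 : r ^+ 2 <= r * Num.sqrt r by rewrite expr2 ler_wpM2l// ltW.
      by apply: (le_trans (sqrrD_le_twice _ _)); rewrite ler_wpM2l// lerD.
    have -> : g2 * (N * kk) = 2 * CU * G * (N * (A0 ^+ 2 * (2 * kk))) by rewrite g2E; ring.
    by rewrite ler_wpM2l ?mulr_ge0// ler_wpM2l// ltW.
  apply: (le_trans (lerD e1 e2)); rewrite e3.
  apply: (le_trans (lerD (lexx _) (lerD e4 e5))).
  have e7 : h / N * sW * N = h * sW by field; rewrite gt_eqF.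
  have hk : h * (C3 * (N * kk)) <= C3 * (N * kk) by rewrite ler_piMl.
  have e8 : 0 <= h * sW by rewrite mulr_ge0// ltW.
  have -> : (Ca * C3 + g1 * (1 + C3) + g2) * (kk + h / N * sW) * N =
    Ca * (C3 * (N * kk)) + (g1 * (h * sW + C3 * (N * kk)) + g2 * (N * kk)) +
    (g1 * (N * kk) + (Ca * C3 + g1 * C3 + g2) * (h * sW)).
    by rewrite -e7; ring.
  apply: ler_wpDr.
    rewrite addr_ge0//; first by rewrite mulr_ge0// mulr_ge0// ltW.
    by rewrite mulr_ge0// addr_ge0// addr_ge0// mulr_ge0.
  by rewrite lerD2l lerD2r ler_wpM2l// mulrDr lerD2l.
apply: (le_trans bnd).
have : 0 <= kk + h / N * sW by rewrite addr_ge0// mulr_ge0// divr_ge0// ltW.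
rewrite -/kk; move: (kk + h / N * sW) => z z0.
apply: (@le_trans _ _ ((Ca * C3 + g1 * (1 + C3) + g2) / cf * z * (cf * N))).
  by rewrite le_eqVlt; apply/orP; left; apply/eqP; field; rewrite gt_eqF.
apply: ler_pM => //.
- by rewrite mulr_ge0.
- by rewrite mulr_ge0// ltW.
- by rewrite ler_wpM2r// /C lerDr addr_ge0// ltW.
Qed.

End coefficient_ball.
End localized.

(** * Conditional distribution functions of a kernel *)

Section pullback.
Context d (T : measurableType d) (R : realType) (k : R.-pker T ~> R).

(** The kernel as a kernel on pairs (x, y), constant in y. Its section over the set
    of (x, y, y') with y' <= y is the distribution function, which is therefore
    jointly measurable. *)
Definition kpullback (z : T * R) : {measure set R -> \bar R} := k z.1.

Let measurable_kpullback U : measurable U ->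
  measurable_fun setT (kpullback ^~ U).
Proof.
move=> mU; apply: (measurableT_comp (measurable_kernel k U mU)).
exact: measurable_fst.
Qed.

HB.instance Definition _ := isKernel.Build _ _ _ _ R kpullback measurable_kpullback.

Let kpullback_prob z : kpullback z setT = 1%E.
Proof. exact: prob_kernel. Qed.

HB.instance Definition _ := Kernel_isProbability.Build _ _ _ _ R kpullback kpullback_prob.

Lemma measurable_kernel_cdf :
  measurable_fun setT (fun z : T * R => fine (k z.1 `]-oo, z.2]%classic)).
Proof.
apply: measurableT_comp => //.
pose C := [set z : (T * R) * R | z.2 <= z.1.2].
have mC : measurable C.
  apply: measurable_le_set; first exact: measurable_snd.
  by apply: measurableT_comp; [exact: measurable_snd|exact: measurable_fst].
have := @measurable_fun_xsection_finite_kernel _ _ _ _ R kpullback C.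
rewrite inE => /(_ mC); congr measurable_fun; apply/funext => z.
rewrite /kpullback; congr (k z.1 _); apply/seteqP; split => y.
  by rewrite /xsection/= inE in_itv.
by rewrite /xsection/= inE in_itv.
Qed.

End pullback.

Section conditional.
Context d d1 (Omega : measurableType d) (T : measurableType d1) (R : realType).
Variables (P : probability Omega R) (X : {mfun Omega >-> T}) (Y : {mfun Omega >-> R}).
Variable k : R.-pker T ~> R.
Hypothesis kP : forall (A : set T) (B : set R), measurable A -> measurable B ->
  P [set w | A (X w) /\ B (Y w)] = (\int[distribution P X]_(x in A) k x B)%E.

Let F y x : R := fine (k x `]-oo, y]%classic).

Lemma kcdf01 y x : 0 <= F y x <= 1.
Proof.
rewrite fine_ge0//= -lee_fin fineK; last exact: finite_kernel_measure.
rewrite -(prob_kernel (s := k) x); apply: le_measure => //; rewrite ?inE//.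
Qed.

Lemma bmf_kcdf (u : T -> R) : measurable_fun setT u -> bmf (fun x => F (u x) x).
Proof.
move=> mu; split.
  apply: (measurableT_comp (measurable_kernel_cdf k) (g := fun x => (x, u x))).
  exact: measurable_fun_pair.
by exists 1 => x; have /andP[h1 h2] := kcdf01 (u x) x; rewrite ger0_norm.
Qed.

Let mle (u : T -> R) : measurable_fun setT u ->
  measurable [set z : T * R | z.2 <= u z.1].
Proof.
move=> mu; apply: measurable_le_set; first exact: measurable_snd.
by apply: measurableT_comp => //; exact: measurable_fst.
Qed.

Lemma disintegration_cdf (om u : T -> R) : bmf om -> measurable_fun setT u ->
  Ex P (fun w => om (X w) * (Y w <= u (X w))%R%:R) =
  Ex P (fun w => om (X w) * F (u (X w)) (X w)).
Proof.
move=> bom mu; have := disintegration kP bom (mle mu).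
set C := [set z | _] => E.
transitivity (Ex P (fun w => om (X w) * \1_C (X w, Y w))).
  apply: eq_Ex => w; rewrite indicE; congr (_ * _%:R).
  by congr nat_of_bool; apply/idP/idP; rewrite /C inE.
rewrite E; apply: eq_Ex => w; congr (_ * _); rewrite /ksec /F; congr fine.
congr (k (X w) _); apply/seteqP; split => y; by rewrite /xsection/= /C inE/= in_itv.
Qed.

(** The probability integral transform F(Y|X) is uniform given X. *)
Lemma disintegration_pit (om : T -> R) (q : T -> R) al : bmf om ->
  (forall x, om x != 0 -> F (q x) x = al /\ forall y, (F y x <= al) = (y <= q x)) ->
  Ex P (fun w => om (X w) * (F (Y w) (X w) <= al)%R%:R) =
  al * Ex P (fun w => om (X w)).
Proof.
move=> bom hq; pose C := [set z : T * R | F z.2 z.1 <= al].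
have mC : measurable C.
  by apply: measurable_le_set => //; exact: (measurable_kernel_cdf k).
transitivity (Ex P (fun w => om (X w) * \1_C (X w, Y w))).
  apply: eq_Ex => w; rewrite indicE; congr (_ * _%:R).
  by congr nat_of_bool; apply/idP/idP; rewrite /C inE.
rewrite (disintegration kP bom mC) -ExZ; last first.
  by apply: (bmf_comp (f := om)) => //; exact: measurable_funPT.
apply: eq_Ex => w; rewrite mulrC.
have [->|om0] := eqVneq (om (X w)) 0; first by rewrite !mulr0.
have [qE hy] := hq _ om0; rewrite -[in RHS]qE; congr (_ * _).
rewrite /ksec /F; congr (fine (k (X w) _)).
apply/seteqP; split => y; by rewrite /xsection/= /C inE/= in_itv/= hy.
Qed.

End conditional.

(** * Local polynomial approximation of the quantile function *)

Section approximation.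
Variables (R : realType) (d p : nat).
Local Notation coefs := {ffun mindex d p -> R}.
Variables (S : set 'rV[R]_d) (alo ahi L sg : R) (Q : R -> 'rV[R]_d -> R) (x0 : 'rV[R]_d).
Hypotheses (d0 : (0 < d)%N) (L0 : 0 < L) (sg0 : 0 < sg) (sgp : (sfloor sg <= p)%N).
Hypotheses (loh : alo <= ahi) (QC : in_C S alo ahi L sg Q) (Sx : interior S x0).
Hypothesis Qmon : forall a a' x, alo <= a -> a <= a' -> a' <= ahi -> S x -> Q a x <= Q a' x.

Lemma in_C_continuous a : alo <= a <= ahi -> exists2 g : 'rV[R]_d -> R,
  {within S, continuous g} & forall x, S x -> g x = Q a x.
Proof.
move=> /QC[b [b0 bc _] _]; exists (b [ffun=> 0%N]).
  by apply: bc; rewrite /mdeg big1// => i _; rewrite ffunE.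
by move=> x Sx'; apply: b0; rewrite inE.
Qed.

(** The quantiles of all orders are locally bounded at once, being between the
    two extreme ones. *)
Lemma Q_locally_bounded : exists e m : R, [/\ 0 < e, 0 <= m,
  box x0 e `<=` interior S &
  forall a x, alo <= a <= ahi -> box x0 e x -> `|Q a x| <= m].
Proof.
have [e1 e10 he1] : exists2 e, 0 < e & box x0 e `<=` interior S.
  by apply: interior_box; have := @open_interior _ S; rewrite openE; exact.
have hlo : alo <= alo <= ahi by rewrite lexx.
have hhi : alo <= ahi <= ahi by rewrite lexx loh.
have [g1 cg1 g1E] := in_C_continuous hlo.
have [g2 cg2 g2E] := in_C_continuous hhi.
have [e2 e20 he2] := within_continuous_box cg1 Sx ltr01.
have [e3 e30 he3] := within_continuous_box cg2 Sx ltr01.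
pose e := Num.min e1 (Num.min e2 e3).
have be e' x : e <= e' -> box x0 e x -> box x0 e' x.
  by move=> ee bx i; exact: le_trans (bx i) ee.
have ee1 : e <= e1 by rewrite ge_min lexx.
have ee2 : e <= e2 by rewrite !ge_min lexx orbT.
have ee3 : e <= e3 by rewrite !ge_min lexx !orbT.
have Sx0 : S x0 by exact: nbhs_singleton.
exists e, (`|Q alo x0| + `|Q ahi x0| + 1); split => //.
- by rewrite !lt_min e10 e20.
- by move=> x /(be _ _ ee1)/he1.
- move=> a x /andP[a1 a2] bx.
  have Sx' : S x by apply: interior_subset; apply: he1; exact: be bx.
  have q1 := Qmon (lexx _) a1 a2 Sx'.
  have q2 := Qmon a1 a2 (lexx _) Sx'.
  have := he2 _ (be _ _ ee2 bx); rewrite g1E// g1E// ltr_distl => /andP[q3 _].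
  have := he3 _ (be _ _ ee3 bx); rewrite g2E// g2E// ltr_distl => /andP[_ q4].
  rewrite ler_norml.
  have := ler_norm (Q ahi x0); have := ler_norm (- Q alo x0); rewrite normrN.
  have := normr_ge0 (Q ahi x0); have := normr_ge0 (Q alo x0).
  by move=> h1 h2 h3 h4; apply/andP; split; lra.
Qed.

(** The coefficients of the Taylor polynomials are bounded uniformly in the order
    of the quantile because, at a fixed scale, they can be recovered from the
    values of the polynomial on a grid. *)
Lemma taylor_coefs (M : R) : 1 <= M -> exists e B CT CL : R,
  [/\ 0 < e, box x0 e `<=` interior S, 0 < B, 0 < CT & 0 <= CL] /\
  (forall a, alo <= a <= ahi -> `|Q a x0| <= B) /\
  forall h a, 0 < h -> h * M <= e -> alo <= a <= ahi -> exists bT : coefs,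
  [/\ forall v, `|bT v| <= B / 4,
      forall x, box x0 (h * M) x ->
        `|Q a x - peval (h^-1 *: (x - x0)) bT| <= CT * h `^ sg &
      forall y : 'rV[R]_d, (forall i, `|y 0 i| <= M) -> `|peval y bT - Q a x0| <= CL * h].
Proof.
move=> M1; have [e [m [e0 m0 eS Qm]]] := Q_locally_bounded.
have M0 : 0 < M by exact: lt_le_trans M1.
have [Cg Cg0 hCg] := @grid_coef_bound R d p d0.
have /andP[sf _] := sfloorP sg0.
pose m' := m + L * (d%:R * e) `^ sg.
have m'0 : 0 <= m' by rewrite addr_ge0// mulr_ge0 ?powR_ge0// ltW.
have dR : 0 < d%:R :> R by rewrite ltr0n.
pose B := 4 * (Cg * m') + m + 1.
have B0 : 0 < B by rewrite /B ltr_wpDl// addr_ge0// mulr_ge0// mulr_ge0// ltW.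
pose CT := L * (d%:R * M) `^ sg.
pose Pn : R := #|{: mindex d p}|%:R.
pose CL := M ^+ p * (Pn * (Cg * m' / e)).
exists e, B, CT, CL; split; [split => //|split].
- by rewrite /CT mulr_gt0// powR_gt0// mulr_gt0.
- rewrite /CL mulr_ge0 ?exprn_ge0 ?(ltW M0)// mulr_ge0 ?ler0n// divr_ge0 ?(ltW e0)//.
  by rewrite mulr_ge0// ltW.
- move=> a ha; apply: (le_trans (Qm a x0 ha _)).
    by move=> i; rewrite subrr normr0 ltW.
  rewrite /B; have := mulr_ge0 (ltW Cg0) m'0; lra.
move=> h a h0 hM ha.
have [b bp bH] := QC ha.
have inS x : box x0 e x -> S x by move=> /eS; exact: interior_subset.
have b0E x : S x -> b [ffun=> 0%N] x = Q a x.
  by case: bp => b0 _ _ Sx'; apply: b0; rewrite inE.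
have [bi hbi] := expand_peval sgp (expand_tay_poly (b ^~ x0) (sfloor sg) [ffun=> 0%N]).
have rem (del : R) (u : 'rV[R]_d) : 0 < del <= e -> (forall l, `|u 0 l| <= del) ->
    `|Q a (x0 + u) - peval u bi| <= L * (d%:R * del) `^ sg.
  move=> hdel hu; rewrite -hbi.
  have bxu : box x0 e (x0 + u).
    move=> i; rewrite mxE (addrC (x0 0 i)) addrK (le_trans (hu i))//.
    by case/andP: hdel.
  rewrite -b0E; last exact: inS.
  have mz : (mdeg [ffun _ : 'I_d => 0%N] + sfloor sg)%N = sfloor sg.
    by rewrite /mdeg big1// => i _; rewrite ffunE.
  apply: (le_trans (taylor_remainder bp bH (ltW L0) sf eS mz hdel hu)).
  have dd : 0 < d%:R * del by rewrite mulr_gt0//; case/andP: hdel.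
  rewrite -mulrA -powR_mulrn ?(ltW dd)// -powRD; last by rewrite (gt_eqF dd) implybT.
  by rewrite subrK.
have he : h <= e by apply: le_trans hM; rewrite ler_peMr// ltW.
pose be := pscale e bi.
have beB v : `|be v| <= Cg * m'.
  apply: hCg => j; rewrite /be -peval_scale.
  have gj l : `|(e *: gridpt R j) 0 l| <= e.
    rewrite !mxE normrM gtr0_norm//; rewrite ler_piMr ?(ltW e0)//.
    have /andP[n1 n2] := @node_bound R d p d0 (j l).
    rewrite ger0_norm// (le_trans n2)// invf_le1 ?mulr_gt0//.
    have : 1 <= d%:R :> R by rewrite ler1n.
    lra.
  have ee : 0 < e <= e by rewrite e0 lexx.
  have r1 := rem e _ ee gj.
  have r2 : `|Q a (x0 + e *: gridpt R j)| <= m.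
    by apply: Qm => // i; rewrite mxE (addrC (x0 0 i)) addrK.
  rewrite -[X in `|X|](subrK (Q a (x0 + e *: gridpt R j))).
  rewrite (le_trans (ler_normD _ _))// addrC /m' lerD//.
  by rewrite distrC.
pose bT := pscale h bi.
have bTE v : bT v = (h / e) ^+ (\sum_(i < d) val v i)%N * be v.
  rewrite /bT /be !ffunE mulrA -exprMn mulfVK ?gt_eqF//.
have q01 : 0 <= h / e <= 1.
  by rewrite divr_ge0 ?(ltW h0) ?(ltW e0)//= ler_pdivrMr// mul1r.
have bTz : bT (mindex0 d p) = Q a x0.
  have Sx0 : S x0 by exact: nbhs_singleton.
  by rewrite /bT pscale0 -peval0 -hbi tay_poly0 b0E.
exists bT; split.
- move=> v; rewrite bTE normrM ger0_norm ?exprn_ge0//; last by case/andP: q01.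
  apply: (@le_trans _ _ (Cg * m')); last first.
    by rewrite /B; lra.
  by rewrite (le_trans (ler_piMl _ _))// exprn_ile1//; case/andP: q01.
- move=> x bx; rewrite /bT -peval_scale scalerA mulfV ?gt_eqF// scale1r.
  have hMe : 0 < h * M <= e by rewrite mulr_gt0.
  have hu l : `|(x - x0) 0 l| <= h * M by rewrite !mxE; exact: bx.
  have := rem _ _ hMe hu; rewrite [x0 + _]addrC subrK => /le_trans; apply.
  rewrite /CT -mulrA ler_wpM2l ?(ltW L0)// -powRM ?(ltW h0)//.
    by rewrite -mulrA (mulrC M).
  by rewrite mulr_ge0 ?(ltW dR) ?(ltW M0).
- move=> y yM; rewrite -bTz -peval0 /peval -sumrB.
  apply: (le_trans (ler_norm_sum _ _ _)).
  apply: (@le_trans _ _ (\sum_(v : mindex d p) M ^+ p * (Cg * m' / e) * h)); last first.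
    rewrite sumr_const -[leLHS]mulr_natl /CL -/Pn le_eqVlt; apply/orP; left.
    by apply/eqP; ring.
  apply: ler_sum => v _; rewrite -mulrBl normrM.
  have [->|v0] := eqVneq v (mindex0 d p).
    have E z : monomials p z (mindex0 d p) = 1 :> R.
      rewrite monomialsE /wfact !big1 ?divr1//.
        by move=> i _; rewrite /= ffunE fact0.
      by move=> i _; rewrite /= ffunE expr0.
    rewrite !E subrr normr0 mul0r mulr_ge0 ?(ltW h0)// mulr_ge0//.
      by rewrite exprn_ge0// ltW.
    by rewrite divr_ge0 ?(ltW e0)// mulr_ge0// ltW.
  have [i vi] : exists i, val v i != ord0.
    apply/existsP; rewrite -negb_forall; apply: contra v0 => /forallP hh.
    by apply/eqP/val_inj/ffunP => i; rewrite ffunE; exact/eqP.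
  have v1 : (0 < \sum_(i < d) val v i)%N.
    by rewrite (bigD1 i)//= addn_gt0 lt0n vi.
  have -> : monomials p (0 : 'rV[R]_d) v = 0.
    by rewrite monomialsE (bigD1 i)//= mxE expr0n -val_eqE/= in vi *; rewrite (negbTE vi) !mul0r.
  have mon : `|monomials p y v| <= M ^+ p.
    rewrite monomialsE normrM normr_prod.
    apply: (@le_trans _ _ (\prod_(i < d) M ^+ val v i)).
      apply: (@le_trans _ _ (\prod_(i < d) `|y 0 i ^+ val v i|)).
        rewrite ler_piMr// ?prodr_ge0// ger0_norm ?invr_ge0// invf_le1 ?ltr0n ?wfact_gt0//.
        by rewrite ler1n wfact_gt0.
      by apply: ler_prod => l _; rewrite normr_ge0 normrX lerXn2r ?nnegrE// ltW.
    rewrite -expr_sum ler_weXn2l//; exact: (valP v).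
  rewrite subr0 -mulrA ler_pM// bTE normrM ger0_norm ?exprn_ge0//; last by case/andP: q01.
  have -> : Cg * m' / e * h = h / e * (Cg * m') by ring.
  apply: ler_pM => //; first by rewrite exprn_ge0//; case/andP: q01.
  case/andP: q01 => q1 q2.
  by case: (\sum_(i < d) _)%N v1 => // n _; rewrite exprS ler_piMr// exprn_ile1.
Qed.

End approximation.

(** * Smoothness in the quantile level *)

Lemma is_derive_within_itv (R : realType) (a b t D : R) (g : R -> R) : a < t < b ->
  (g u - g t) / (u - t) @[u --> within `[a, b]%classic t^'] --> D ->
  is_derive t (1 : R) g D.
Proof.
move=> /andP[at_ tb] gD.
have h : (fun h => h^-1 *: ((g \o shift t) (h *: (1 : R)) - g t)) @ 0^' --> D.
  apply/cvgrPdist_le => e e0.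
  have /cvgrPdist_le/(_ _ e0) := gD; rewrite near_withinE => H.
  have := H; rewrite /dnbhs near_withinE => /nbhs_ballP[r /= r0 hr].
  pose r' := Num.min r (Num.min (t - a) (b - t)).
  have r'0 : 0 < r' by rewrite !lt_min r0 !subr_gt0 at_ tb.
  rewrite near_withinE; apply/nbhs_ballP; exists r' => //= u.
  rewrite /ball/= sub0r normrN => ur u0.
  have ut : u *: (1 : R) = u by rewrite /GRing.scale/= mulr1.
  rewrite ut /=.
  have [u1 u2 u3] : [/\ `|u| < r, `|u| < t - a & `|u| < b - t].
    by move: ur; rewrite !lt_min => /and3P[].
  have := hr (u + t); rewrite /ball/= opprD addrCA subrr addr0 normrN => /(_ u1).
  have -> : (u + t == t) = (u == 0) by rewrite -{2}[t]add0r (inj_eq (addIr t)).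
  move=> /(_ u0); rewrite /= in_itv/=.
  have := ler_norm u; have := ler_norm (- u); rewrite normrN => v1 v2.
  have hb : a <= u + t <= b by apply/andP; split; lra.
  by move=> /(_ hb); rewrite addrK /GRing.scale/= mulrC.
by apply: DeriveDef; [exact: cvgP h|exact/cvg_lim].
Qed.

Section univariate_taylor.
Variables (R : realType) (a b L s : R) (m : nat) (DD : nat -> R -> R) (al : R).
Hypotheses (alb : a < al < b) (L0 : 0 <= L) (ms : m%:R <= s).
Hypothesis DDd : forall j t, (j <= m)%N -> a < t < b ->
  is_derive t (1 : R) (DD j) (DD j.+1 t).
Hypothesis DDH : forall t t', a <= t <= b -> a <= t' <= b ->
  `|DD m.+1 t - DD m.+1 t'| <= L * `|t - t'| `^ (s - m%:R).

Let tp (j k : nat) (t : R) : R := \sum_(i < k.+1) DD (j + i) al * t ^+ i / i`!%:R.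

Let tp0 j k : tp j k 0 = DD j al.
Proof.
rewrite /tp big_ord_recl/= expr0 fact0 addn0 mulr1 divr1 big1 ?addr0// => i _.
by rewrite expr0n/= mulr0 mul0r.
Qed.

Let is_derive_tp j k t : is_derive t (1 : R) (tp j k.+1) (tp j.+1 k t).
Proof.
have -> : tp j k.+1 = \sum_(i < k.+2) ((DD (j + i) al / i`!%:R) \*: (fun t : R => t ^+ i)).
  apply/funext => u; rewrite fct_sumE; apply: eq_bigr => i _ /=.
  by rewrite /GRing.scale/=; ring.
have H (i : 'I_k.+2) : is_derive t (1 : R)
    ((DD (j + i) al / i`!%:R) \*: (fun t : R => t ^+ i))
    ((DD (j + i) al / i`!%:R) *: (i%:R * t ^+ i.-1)).
  apply: is_deriveZ.
  have -> : (fun t : R => t ^+ i) = (id : R -> R) ^+ i by apply/funext => u; rewrite exprfctE.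
  have := is_deriveX i (is_derive_id t (1 : R)).
  by rewrite /GRing.scale/= mulr1.
apply: (is_derive_eq (is_derive_sum H)).
rewrite big_ord_recl/= mul0r scaler0 add0r /tp; apply: eq_bigr => i _.
rewrite /GRing.scale/= /bump/= add1n factS natrM addnS addSn.
have i0 : i.+1%:R != 0 :> R by rewrite pnatr_eq0.
have f0 : i`!%:R != 0 :> R by rewrite pnatr_eq0 -lt0n fact_gt0.
rewrite add0n; move: (i.+1%:R : R) (i`!%:R : R) i0 f0 => y z y0 z0.
by field; rewrite y0 z0.
Qed.

Let e : R := Num.min (al - a) (b - al).

Let in_ab t : `|t| < e -> a < al + t < b.
Proof.
rewrite lt_min => /andP[t1 t2].
have := ler_norm t; have := ler_norm (- t); rewrite normrN => v1 v2.
by apply/andP; split; lra.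
Qed.

(** The derivative of a remainder is the remainder of the derivative, one order
    lower; the Hoelder bound enters at the top order. *)
Lemma univariate_taylor_aux k j t : (j + k)%N = m.+1 -> `|t| < e ->
  `|DD j (al + t) - tp j k t| <= L * `|t| `^ (s - m%:R) * `|t| ^+ k.
Proof.
elim: k j t => [|k IH] j t jk te.
  rewrite addn0 in jk; rewrite jk expr0 mulr1.
  have -> : tp m.+1 0 t = DD m.+1 al.
    by rewrite /tp big_ord1/= expr0 fact0 addn0 mulr1 divr1.
  have /andP[/ltW h1 /ltW h2] := in_ab te; case/andP: (alb) => /ltW h3 /ltW h4.
  have := @DDH (al + t) al; rewrite h1 h2 h3 h4 => /(_ erefl erefl).
  by rewrite addrAC subrr add0r.
have jm : (j <= m)%N by rewrite -ltnS -jk addnS ltnS leq_addr.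
have jk' : (j.+1 + k)%N = m.+1 by rewrite addSnnS.
pose f u := DD j (al + u) - tp j k.+1 u.
have ut u : Num.min 0 t <= u <= Num.max 0 t -> `|u| <= `|t|.
  move=> /andP[]; rewrite ge_min le_max ler_norml.
  have := ler_norm t; have := ler_norm (- t); rewrite normrN.
  have := normr_ge0 t.
  move=> v0 v1 v2 /orP[] h1 /orP[] h2; apply/andP; split; lra.
have := @bounded_derivative R f (fun u => DD j.+1 (al + u) - tp j.+1 k u) t
  (L * `|t| `^ (s - m%:R) * `|t| ^+ k).
rewrite /f addr0 tp0 subrr subr0 exprSr mulrA; apply.
- move=> u /ut hu; have ue : `|u| < e by exact: le_lt_trans te.
  apply: is_deriveB; last exact: is_derive_tp.
  have H := @is_derive_line R R (DD j) al 1 u (DD j.+1 (al + u)).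
  have E v : al + v *: (1 : R) = al + v by rewrite /GRing.scale/= mulr1.
  rewrite E in H; have := H (DDd jm (in_ab ue)).
  by congr (is_derive _ _ _ _); apply/funext => v; rewrite E.
- move=> u /ut hu; apply: (le_trans (IH _ _ jk' _)); first exact: le_lt_trans te.
  apply: ler_pM; rewrite ?exprn_ge0//.
  + by rewrite mulr_ge0 ?powR_ge0.
  + by rewrite ler_wpM2l// ge0_ler_powR// ?nnegrE// subr_ge0.
  + by rewrite lerXn2r// ?nnegrE.
Qed.

Lemma univariate_taylor t : `|t| < e ->
  `|DD 0 (al + t) - \sum_(i < m.+2) DD i al / i`!%:R * t ^+ i| <= L * `|t| `^ (s + 1).
Proof.
move=> te; have := univariate_taylor_aux (add0n m.+1) te.
rewrite /tp (eq_bigr (fun i : 'I_m.+2 => DD i al / i`!%:R * t ^+ i)); last first.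
  by move=> i _; rewrite add0n mulrAC.
move=> /le_trans; apply; have [->|t0] := eqVneq t 0.
  by rewrite normr0 expr0n/= mulr0 mulr_ge0// powR_ge0.
rewrite -mulrA -powR_mulrn// -powRD; last by rewrite normr_eq0 t0 implybT.
rewrite le_eqVlt; apply/orP; left; apply/eqP; congr (_ * _ `^ _).
by rewrite -natr1; ring.
Qed.

End univariate_taylor.

(** * Local consequences of the model assumptions *)

Lemma coord_le_norm (R : realType) (d : nat) (v : 'rV[R]_d) i : `|v 0 i| <= `|v| :> R.
Proof.
rewrite [leRHS]mx_normrE.
exact: (le_bigmax _ (fun ij : 'I_1 * 'I_d => `|v ij.1 ij.2|) (0, i)).
Qed.

Lemma enorm_abs_le (R : realType) (d : nat) (v : 'rV[R]_d) : enorm v <= d%:R * `|v|.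
Proof.
by apply: enorm_box => // i; exact: coord_le_norm.
Qed.

Lemma sqrtr_sumsq_le (R : realType) (a b : R) : 0 <= a -> 0 <= b ->
  Num.sqrt (a ^+ 2 + b ^+ 2) <= a + b.
Proof.
move=> a0 b0; rewrite -[leRHS]ger0_norm ?addr_ge0// -sqrtr_sqr ler_wsqrtr//.
by rewrite sqrrD lerD2r lerDl mulrn_wge0// mulr_ge0.
Qed.

Section kernel.
Variables (R : realType) (d : nat) (K : 'rV[R]_d -> R) (hlo hhi : nat -> R).
Hypothesis aK : assumption_K K hlo hhi.

Lemma kernel_continuous : continuous K.
Proof.
case: aK => -[_ [C hC]] _ _ _ _ z.
apply/(@cvgrPdist_lt _ _ _ (nbhs z) (nbhs_filter z)) => e e0.
pose C' := `|C| * d%:R + 1.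
have C'0 : 0 < C' by rewrite ltr_wpDl// mulr_ge0.
apply/nbhs_ballP; exists (e / C'); first exact: divr_gt0.
move=> u [_ zu].
have zu' : enorm (z - u) <= d%:R * (e / C').
  apply: enorm_box => [|i]; first by rewrite divr_ge0// ltW.
  by have := zu 0 i; rewrite /ball/= !mxE => /ltW.
apply: (le_lt_trans (hC z u)); apply: (@le_lt_trans _ _ (`|C| * d%:R * (e / C'))).
  rewrite -mulrA (le_trans (ler_norm _))// normrM ler_wpM2l// ger0_norm//.
  exact: enorm_ge0.
apply: (@lt_le_trans _ _ (C' * (e / C'))).
  by rewrite ltr_pM2r ?divr_gt0// ltrDl.
by rewrite mulrC divfK// gt_eqF.
Qed.

Lemma kernel_bounds : exists M KB Klo : R, [/\ 1 <= M, 0 < Klo,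
  forall z, K z <= KB, forall z, K z != 0 -> forall i, `|z 0 i| <= M &
  forall z, enorm z <= 1 -> Klo <= K z].
Proof.
case: (aK) => -[K0 [C hC]] cK _ [Klo Klo0 hKlo] _.
have /compact_bounded[M0 [_ hM0]] := cK.
pose M := `|M0| + 1.
have M1 : 1 <= M by rewrite lerDr.
have suppK z : K z != 0 -> `|z| <= M.
  move=> Kz; apply: (hM0 M); first by rewrite /M ltr_pwDr// ler_norm.
  exact: subset_closure.
exists M, (K 0 + `|C| * (d%:R * M)), Klo; split => //.
- move=> z; have [->|Kz] := eqVneq (K z) 0.
    by rewrite addr_ge0// mulr_ge0// mulr_ge0// (le_trans _ M1).
  rewrite -lerBlDl (le_trans (ler_norm _))// (le_trans (hC _ _))//.
  rewrite (le_trans (ler_norm _))// normrM ler_wpM2l// ger0_norm ?enorm_ge0//.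
  by rewrite subr0 (le_trans (enorm_abs_le _))// ler_wpM2l// suppK.
- by move=> z /suppK zM i; exact: le_trans (coord_le_norm z i) zM.
- by move=> z z1; have := hKlo z; rewrite indicE mem_set// mulr1.
Qed.

End kernel.

Section covariate.
Context (R : realType) (d : nat) (disp : measure_display).
Context (Omega : measurableType disp) (P : probability Omega R).
Variables (X : {RV P >-> borel_rV R d}) (fX : borel_rV R d -> R) (X0 : set 'rV[R]_d).
Let S := law_support (distribution P X).
Hypothesis aX : assumption_X X fX X0.
Variable x0 : 'rV[R]_d.
Hypothesis Sx : interior S x0.

Lemma covariate_bounds : exists e CX cX : R, [/\ 0 < e, 0 <= CX, 0 < cX,
  forall e', 0 <= e' <= e -> fine (P [set w | box x0 e' (X w)]) <= CX * e' ^+ d &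
  forall x1 e', 0 <= e' -> box x1 e' `<=` box x0 e ->
    cX * e' ^+ d <= fine (P [set w | box x1 e' (X w)])].
Proof.
case: aX => _ [mf f0 fP] [fpos [b [b0 bc _]]] _ _.
have cb : {within S, continuous (b [ffun=> 0%N])}.
  by apply: bc; rewrite /mdeg big1// => i _; rewrite ffunE.
have bE x : S x -> b [ffun=> 0%N] x = fX x by move=> xS; apply: b0; rewrite inE.
have Sx0 : S x0 by exact: nbhs_singleton.
have fx0 : 0 < fX x0 by exact: fpos.
have [e1 e10 he1] := within_continuous_box cb Sx (divr_gt0 fx0 (ltr0Sn R 1)).
have [e2 e20 he2] := interior_box Sx.
pose e := Num.min e1 e2.
have fe x : box x0 e x -> fX x0 / 2 <= fX x <= 2 * fX x0.
  move=> bx; have x1 : box x0 e1 x by move=> i; rewrite (le_trans (bx i))// ge_min lexx.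
  have x2 : box x0 e2 x by move=> i; rewrite (le_trans (bx i))// ge_min lexx orbT.
  have := he1 _ x1; rewrite bE ?bE//; last exact: he2.
  by rewrite ltr_distl => /andP[h1 h2]; apply/andP; split; lra.
have PE (A : set (borel_rV R d)) : measurable A -> (P [set w | A (X w)] \is a fin_num)%E.
  move=> mA; apply: fin_num_measure; rewrite -[X in measurable X]setTI.
  exact: (measurable_funPT X).
exists e, (2 * fX x0 * 2 ^+ d), (fX x0 / 2 * 2 ^+ d); split => //.
- by rewrite lt_min e10.
- by rewrite mulr_ge0 ?exprn_ge0// mulr_ge0// ltW.
- by rewrite mulr_gt0 ?exprn_gt0// divr_gt0.
- move=> e' /andP[e'0 e'e]; rewrite -lee_fin fineK; last by apply: PE; exact: measurable_box.
  rewrite -mulrA -exprMn; apply: (law_box_le mf f0 fP) => //.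
    by rewrite mulr_ge0// ltW.
  by move=> v bv; have /andP[] := fe v (fun i => le_trans (bv i) e'e).
- move=> x1 e' e'0 sub; rewrite -lee_fin fineK; last by apply: PE; exact: measurable_box.
  rewrite -[leLHS]/((fX x0 / 2 * 2 ^+ d * e' ^+ d)%:E) -(mulrA (fX x0 / 2)) -exprMn; apply: (law_box_ge mf fP) => //.
    by rewrite divr_ge0// ltW.
  by move=> v bv; have /andP[] := fe v (sub _ bv).
Qed.

End covariate.

Section conditional_law.
Context (R : realType) (d : nat) (k : R.-pker (borel_rV R d) ~> R).
Let F := cond_cdf k.
Let Q := cond_quantile F.
Variables (S : set 'rV[R]_d) (f : R -> 'rV[R]_d -> R).
Hypothesis aF : assumption_F S F f.
Variable x0 : 'rV[R]_d.
Hypothesis Sx : interior S x0.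
Let Sx0 : S x0. Proof. exact: nbhs_singleton. Qed.

Let fpos y x : S x -> 0 < f y x.
Proof. by case: aF => _ [_ h] _ _; exact: h. Qed.

Let FE x y : S x -> (F y x)%:E = (\int[lebesgue_measure]_(u in `]-oo, y]) (f u x)%:E)%E.
Proof. by case: aF => h _ _ _; exact: h. Qed.

Lemma density_lipschitz : exists2 L0 : R, 0 < L0 &
  forall y y' x x', S x -> S x' ->
    `|f y x - f y' x'| <= L0 * (enorm (x - x') + `|y - y'|).
Proof.
case: aF => _ _ _ [L0 L00 hL]; exists L0 => // y y' x x' xS x'S.
apply: (le_trans (hL _ _ _ _ xS x'S)); rewrite ler_wpM2l ?(ltW L00)//.
rewrite -[(y - y') ^+ 2]real_normK ?num_real//; apply: sqrtr_sumsq_le => //.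
exact: enorm_ge0.
Qed.

Let fL x L0 : 0 < L0 -> (forall y y' x x', S x -> S x' ->
    `|f y x - f y' x'| <= L0 * (enorm (x - x') + `|y - y'|)) -> S x ->
  forall y y', `|f y x - f y' x| <= L0 * `|y - y'|.
Proof.
move=> L00 hL xS y y'; apply: (le_trans (hL _ _ _ _ xS xS)).
rewrite subrr (_ : enorm 0 = 0) ?add0r//.
by rewrite /enorm big1 ?sqrtr0// => i _; rewrite mxE expr0n.
Qed.

Lemma cond_quantile_leP al x y : 0 < al < 1 -> S x -> (F y x <= al) = (y <= Q al x).
Proof.
move=> al01 xS; have [L0 L00 hL] := density_lipschitz.
apply/esym; apply: (quantile_leP (g := f ^~ x) L00) => //.
- by move=> u; exact: fpos.
- exact: fL L00 hL xS.
- by move=> u; exact: FE.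
- exact: kernel_cdf_lo.
- exact: kernel_cdf_hi.
Qed.

Lemma cond_cdf_quantile al x : 0 < al < 1 -> S x -> F (Q al x) x = al.
Proof.
move=> al01 xS; have [L0 L00 hL] := density_lipschitz.
apply: (cdf_quantile (g := f ^~ x) (G := F ^~ x) L00) => //.
- by move=> u; exact: fpos.
- exact: fL L00 hL xS.
- by move=> u; exact: FE.
- exact: kernel_cdf_lo.
- exact: kernel_cdf_hi.
Qed.

Lemma cond_quantile_le a a' x : 0 < a -> a <= a' -> a' < 1 -> S x -> Q a x <= Q a' x.
Proof.
move=> a0 aa' a1 xS.
have h1 : 0 < a < 1 by rewrite a0 (le_lt_trans aa').
have h2 : 0 < a' < 1 by rewrite a1 (lt_le_trans a0).
by rewrite -cond_quantile_leP// cond_cdf_quantile.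
Qed.

Lemma cond_quantile_derive (al : R) x : 0 < al < 1 -> S x ->
  is_derive al (1 : R) (Q ^~ x) (f (Q al x) x)^-1.
Proof.
move=> al01 xS; have [L0 L00 hL] := density_lipschitz.
apply: (quantile_derivable (g := f ^~ x) L00 (G := F ^~ x)) => //.
- by move=> u; exact: fpos.
- exact: fL L00 hL xS.
- by move=> u; exact: FE.
- exact: kernel_cdf_lo.
- exact: kernel_cdf_hi.
Qed.

(** The density at (y, x) differs from the density at (y, x0) by the Lipschitz bound
    only, and the latter has a positive minimum over a bounded range of y. *)
Lemma cond_cdf_bounds e0 yb : 0 < e0 -> box x0 e0 `<=` S -> 0 < yb ->
  exists e Cf cf L1 : R, [/\ 0 < e <= e0, 0 <= Cf, 0 < cf & 0 <= L1] /\
  [/\ forall x y y', box x0 e x -> - yb <= y -> y <= y' -> y' <= yb ->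
        0 <= F y' x - F y x <= Cf * (y' - y),
      forall x y y', box x0 e x -> - yb <= y -> y <= y' -> y' <= yb ->
        cf * (y' - y) <= F y' x - F y x,
      forall e' x y y' q, 0 <= e' <= e -> box x0 e' x ->
        `|F y' x - F y x - f q x0 * (y' - y)| <= L1 * (e' + `|y - q| + `|y' - q|) * `|y' - y| &
      forall q, `|q| <= yb -> cf <= f q x0].
Proof.
move=> e00 e0S yb0; have [L0 L00 hL] := density_lipschitz.
have cfx : continuous (f ^~ x0).
  by apply: (lipschitz_continuous L00); exact: fL.
have [c [cin cmin]] : exists c : R, c \in `[- yb, yb] /\ forall q : R, q \in `[- yb, yb] -> f c x0 <= f q x0.
  have ybyb : - yb <= yb by rewrite ge0_cp// ltW.
  have [c cin hc] := @EVT_min R (f ^~ x0) (- yb) yb ybyb (continuous_subspaceT cfx).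
  by exists c.
have m0 : 0 < f c x0 by exact: fpos.
set m := f c x0 in m0 cmin.
pose D : R := L0 * d%:R.
have D0 : 0 <= D by rewrite mulr_ge0// ltW.
pose e := Num.min e0 (m / (2 * (D + 1))).
have e_gt0 : 0 < e by rewrite lt_min e00/= divr_gt0// mulr_gt0// ltr_wpDl.
have ee0 : e <= e0 by rewrite ge_min lexx.
have De : D * e <= m / 2.
  apply: (@le_trans _ _ ((D + 1) * e)); first by rewrite ler_wpM2r ?(ltW e_gt0)// lerDl.
  have D1 : 0 < D + 1 by rewrite ltr_wpDl.
  rewrite mulrC -ler_pdivlMr// (_ : m / 2 / (D + 1) = m / (2 * (D + 1))).
    by rewrite ge_min lexx orbT.
  by field; rewrite gt_eqF.
have inS e' x : e' <= e -> box x0 e' x -> S x.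
  by move=> e'e bx; apply: e0S => i; rewrite (le_trans (bx i))// (le_trans e'e).
have near e' x u q : 0 <= e' <= e -> box x0 e' x ->
    `|f u x - f q x0| <= D * e' + L0 * `|u - q|.
  move=> /andP[e'0 e'e] bx; apply: (le_trans (hL _ _ _ _ (inS _ _ e'e bx) Sx0)).
  rewrite mulrDr lerD2r /D -mulrA ler_wpM2l ?(ltW L00)//.
  by apply: enorm_box => // i; rewrite !mxE; exact: bx.
have ee : 0 <= e <= e by rewrite lexx ltW.
have fE x u : box x0 e x -> (F u x)%:E = (\int[lebesgue_measure]_(v in `]-oo, u]) (f v x)%:E)%E.
  by move=> bx; apply: FE; exact: inS bx.
have fP x u : box x0 e x -> 0 < f u x by move=> bx; apply: fpos; exact: inS bx.
pose Cf := f 0 x0 + D * e + L0 * yb.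
have yu y y' u : - yb <= y -> y' <= yb -> y <= u <= y' -> `|u| <= yb.
  by move=> h1 h2 /andP[h3 h4]; rewrite ler_norml (le_trans h1 h3) (le_trans h4 h2).
have fLx x : box x0 e x -> forall y y', `|f y x - f y' x| <= L0 * `|y - y'|.
  by move=> bx; apply: fL => //; exact: inS bx.
have low x u : box x0 e x -> `|u| <= yb -> m / 2 <= f u x.
  move=> bx uy; have := near e x u u ee bx; rewrite subrr normr0 mulr0 addr0.
  rewrite ler_distl => /andP[h1 _]; have : m <= f u x0.
    by apply: cmin; rewrite in_itv/= -ler_norml.
  move=> h2; lra.
exists e, Cf, (m / 2), (D + L0); split.
  split; rewrite ?e_gt0//.
  - have v1 : 0 <= f 0 x0 by apply: ltW; exact: fpos.
    have v2 : 0 <= D * e by rewrite mulr_ge0// ltW.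
    have v3 : 0 <= L0 * yb by rewrite mulr_ge0// ltW.
    by rewrite /Cf addr_ge0// addr_ge0.
  - by rewrite divr_gt0.
  - by rewrite addr_ge0// ltW.
split.
- move=> x y y' bx h1 h2 h3; apply/andP; split.
    rewrite subr_ge0; apply: (cdf_le (g := f ^~ x) (G := F ^~ x) L00) => //.
    + by move=> u; exact: fP.
    + exact: fLx.
    + by move=> u; exact: fE.
  apply: (cdf_incr_le (g := f ^~ x) (G := F ^~ x) L00) => //.
  + by move=> u; exact: fP.
  + exact: fLx.
  + by move=> u; exact: fE.
  + move=> u uyy; have uy := yu _ _ _ h1 h3 uyy.
    have := near e x u 0 ee bx; rewrite subr0 ler_distl => /andP[_ h4].
    apply: (le_trans h4); rewrite /Cf -addrA lerD2l lerD2l ler_wpM2l// ltW//.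
- move=> x y y' bx h1 h2 h3.
  apply: (cdf_incr_ge (g := f ^~ x) (G := F ^~ x) L00) => //.
  + by move=> u; exact: fP.
  + exact: fLx.
  + by move=> u; exact: fE.
  + by move=> u uyy; apply: low => //; exact: yu uyy.
- move=> e' x y y' q he' bx; have [e'0 e'e] := andP he'.
  have bxe : box x0 e x by move=> i; exact: le_trans (bx i) e'e.
  apply: (cdf_expand (g := f ^~ x) (G := F ^~ x) L00) => //.
  + by move=> u; exact: fP.
  + exact: fLx.
  + by move=> u; exact: fE.
  + by rewrite mulr_ge0 ?addr_ge0// ltW.
  + by apply: ltW; exact: fpos.
  + move=> u hu; apply: (le_trans (near _ _ u q he' bx)).
    have uq : `|u - q| <= `|y - q| + `|y' - q|.
      move: hu; rewrite ge_min le_max ler_norml.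
      have := ler_norm (y - q); have := ler_norm (- (y - q)); rewrite normrN.
      have := ler_norm (y' - q); have := ler_norm (- (y' - q)); rewrite normrN.
      have := normr_ge0 (y - q); have := normr_ge0 (y' - q).
      by move=> a1 a2 a3 a4 a5 a6 /andP[/orP[] b1 /orP[] b2]; apply/andP; split; lra.
    have v1 : L0 * `|u - q| <= L0 * (`|y - q| + `|y' - q|) by rewrite ler_wpM2l ?(ltW L00).
    have v2 : 0 <= L0 * e' by rewrite mulr_ge0 ?(ltW L00).
    have v3 : 0 <= D * (`|y - q| + `|y' - q|) by rewrite mulr_ge0 ?addr_ge0.
    have -> : (D + L0) * (e' + `|y - q| + `|y' - q|) = D * e' + L0 * (`|y - q| + `|y' - q|) +
        (L0 * e' + D * (`|y - q| + `|y' - q|)) by ring.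
    by rewrite ler_wpDr ?addr_ge0// lerD2l.
- move=> q hq; have : m <= f q x0 by apply: cmin; rewrite in_itv/= -ler_norml.
  lra.
Qed.

End conditional_law.

(** * Integration against a compactly supported charge *)

Section fubini.
Context d1 d2 (T1 : measurableType d1) (T2 : measurableType d2) (R : realType).
Variables (m1 : {finite_measure set T1 -> \bar R}) (m2 : {finite_measure set T2 -> \bar R}).
Variable f : T1 * T2 -> R.
Hypotheses (bf : bmf f) (f0 : forall z, 0 <= f z).

Let bsec1 x : bmf (fun y => f (x, y)).
Proof. by apply: (bmf_comp (f := f)) => //; exact: measurable_fun_pair. Qed.

Let bsec2 y : bmf (fun x => f (x, y)).
Proof. by apply: (bmf_comp (f := f)) => //; exact: measurable_fun_pair. Qed.

Let mf : measurable_fun setT (EFin \o f).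
Proof. by apply/measurable_EFinP; case: bf. Qed.

Let ExE d (T : measurableType d) (m : {finite_measure set T -> \bar R}) (g : T -> R) :
  bmf g -> (\int[m]_x (g x)%:E)%E = (Ex m g)%:E.
Proof.
move=> bg; rewrite /Ex /Rintegral fineK//.
exact/integrable_fin_num/bmf_integrable.
Qed.

Lemma bmf_Ex_section : bmf (fun x => Ex m2 (fun y => f (x, y))).
Proof.
split.
  apply/measurable_EFinP.
  have := measurable_fun_fubini_tonelli_F (m2 := m2) (EFin \o f) mf.
  have e0 z : (0 <= (EFin \o f) z)%E by rewrite lee_fin.
  move=> /(_ e0); congr measurable_fun; apply/funext => x /=.
  by rewrite /fubini_F -ExE.
case: bf => _ [b fb]; exists (b * fine (m2 setT)) => x.
apply: (le_trans (Ex_norm m2 (bsec1 x))); rewrite -Ex_cst.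
by apply: le_Ex => //; [exact/bmf_norm/bsec1|exact: bmf_cst].
Qed.

Lemma Ex_fubini : Ex m1 (fun x => Ex m2 (fun y => f (x, y))) =
  Ex m2 (fun y => Ex m1 (fun x => f (x, y))).
Proof.
have e0 z : (0 <= (EFin \o f) z)%E by rewrite lee_fin.
have := fubini_tonelli (m1 := m1) (m2 := m2) (EFin \o f) mf e0.
under eq_integral do rewrite ExE//.
under [X in _ = X]eq_integral do rewrite ExE//.
by rewrite /Ex /Rintegral => ->.
Qed.

End fubini.

Section charge_bound.
Context (R : realType) (nu : {charge set R -> \bar R}) (T : R).
Hypothesis nuT : charge_tv nu (~` `[- T, T]) = 0%E.

Let nup := jordan_pos (hahn nu).
Let num := jordan_neg (hahn nu).
Let I : R -> R := \1_(`[- T, T]%classic).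

Lemma measurable_itvT : measurable (`[- T, T]%classic : set R).
Proof. exact: measurable_itv. Qed.

Definition tv_integral (f : R -> R) : R := Ex nup f + Ex num f.

Let null0 : nup (~` `[- T, T]%classic) = 0%E /\ num (~` `[- T, T]%classic) = 0%E.
Proof.
have := nuT; rewrite /charge_tv /charge_variation /=.
move/eqP; rewrite padde_eq0//.
  by move=> /andP[/eqP e1 /eqP e2]; split.
Qed.

Let Ex_cut (mu : {finite_measure set R -> \bar R}) f : mu (~` `[- T, T]%classic) = 0%E ->
  measurable_fun setT f -> Ex mu f = Ex mu (fun t => f t * I t).
Proof.
move=> mu0 mf; rewrite /Ex /Rintegral; congr fine.
have mI : measurable_fun setT I by apply: measurable_indic; exact: measurable_itvT.
apply: ae_eq_integral => //=.
- exact/measurable_EFinP.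
- by apply/measurable_EFinP; exact: measurable_funM.
exists (~` `[- T, T]%classic); split => //.
  by apply: measurableC; exact: measurable_itvT.
move=> t /= h tT; apply: h => _; rewrite /I indicE mem_set// mulr1//.
Qed.

Lemma charge_integral_cut f : measurable_fun setT f ->
  charge_integral nu f = Ex nup (fun t => f t * I t) - Ex num (fun t => f t * I t).
Proof.
move=> mf; case: null0 => n1 n2.
by rewrite /charge_integral -(Ex_cut n1 mf) -(Ex_cut n2 mf).
Qed.

Let bcut (f : R -> R) (b : R) : measurable_fun setT f -> (forall t, `|t| <= T -> `|f t| <= b) ->
  bmf (fun t => f t * I t).
Proof.
move=> mf hb; split.
  by apply: measurable_funM => //; apply: measurable_indic; exact: measurable_itvT.
exists (Num.max 0 b) => t; rewrite /I indicE.
case: (boolP (t \in _)) => [|_]; last by rewrite mulr0 normr0 le_max lexx.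
by rewrite inE/= in_itv/= -ler_norml mulr1 le_max => /hb ->; rewrite orbT.
Qed.

(** Of a polynomial only the linear coefficient survives, because the other moments
    vanish. *)
Lemma charge_linear_coef (m : nat) (phi E : R -> R) (c : nat -> R) :
  charge_integral nu (cst 1) = 0 -> charge_integral nu id = 1 ->
  (forall j, (2 <= j <= m.+1)%N -> charge_integral nu (fun t => t ^+ j) = 0) ->
  measurable_fun setT phi -> bmf E ->
  (forall t, `|t| <= T -> `|phi t - \sum_(i < m.+2) c i * t ^+ i| <= E t) ->
  (forall t, 0 <= E t) ->
  `|charge_integral nu phi - c 1%N| <= tv_integral E.
Proof.
move=> nu0 nu1 nuj mphi bE hphi E0.
pose mono (i : nat) (t : R) := t ^+ i.
have mmono i : measurable_fun setT (mono i) by exact: exprn_measurable.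
have bmono i : bmf (fun t => mono i t * I t).
  apply: (bcut (b := `|T| ^+ i)) => // t tT; rewrite /mono normrX lerXn2r ?nnegrE//.
  by rewrite (le_trans tT)// ler_norm.
have mom i : (i < m.+2)%N -> Ex nup (fun t => mono i t * I t) - Ex num (fun t => mono i t * I t) =
    (i == 1%N)%:R.
  move=> im; rewrite -charge_integral_cut//.
  case: i im => [_|[_|i im]].
  - by rewrite -[RHS]nu0; congr charge_integral; apply/funext => t; rewrite /mono expr0.
  - by rewrite -[RHS]nu1; congr charge_integral; apply/funext => t; rewrite /mono expr1.
  - by apply: nuj; rewrite -ltnS.
pose G t := \sum_(i < m.+2) c i * t ^+ i.
have GE t : G t * I t = \sum_(i < m.+2) c i * (mono i t * I t).
  by rewrite /G mulr_suml; apply: eq_bigr => i _; rewrite mulrA.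
have bG : bmf (fun t => G t * I t).
  under eq_fun do rewrite GE; apply: bmf_sum => i; exact: bmfZ.
have EG (mu : {finite_measure set R -> \bar R}) :
    Ex mu (fun t => G t * I t) = \sum_(i < m.+2) c i * Ex mu (fun t => mono i t * I t).
  under eq_Ex do rewrite GE; rewrite Ex_sum; last by move=> i; exact: bmfZ.
  by apply: eq_bigr => i _; rewrite ExZ.
have cG : Ex nup (fun t => G t * I t) - Ex num (fun t => G t * I t) = c 1%N.
  rewrite !EG -sumrB (eq_bigr (fun i : 'I_m.+2 => c i * (i == 1%N :> nat)%:R)); last first.
    by move=> i _; rewrite -mulrBr mom.
  rewrite (bigD1 (lift ord0 ord0))//= mulr1 big1 ?addr0// => i.
  by rewrite -val_eqE/= => /negbTE; rewrite /bump/= addn0 => ->; rewrite mulr0.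
have I01 t : 0 <= I t <= 1 by rewrite /I indicE; case: (_ \in _); rewrite /= ?lexx ler01.
have D t : `|phi t * I t - G t * I t| <= E t.
  rewrite -mulrBl normrM /I indicE; case: (boolP (t \in _)) => [|_].
    rewrite inE/= in_itv/= -ler_norml normr1 mulr1; exact: hphi.
  by rewrite normr0 mulr0.
have bphi : bmf (fun t => phi t * I t).
  case: bE => mE [b1 hb1]; case: (bG) => _ [b2 hb2].
  split; first by apply: measurable_funM => //; apply: measurable_indic; exact: measurable_itvT.
  exists (b1 + b2) => t; rewrite -[X in `|X|](subrK (G t * I t)).
  rewrite (le_trans (ler_normD _ _))// lerD// (le_trans (D t))//.
  by rewrite (le_trans (ler_norm _)).
rewrite charge_integral_cut// -cG.
set a := Ex nup _; set b := Ex num _; set a' := Ex nup _; set b' := Ex num _.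
have -> : a - b - (a' - b') = (a - a') - (b - b') by ring.
rewrite (le_trans (ler_normB _ _))// /tv_integral lerD//.
- rewrite /a /a' -ExB// (le_trans (Ex_norm _ _))//; first exact: bmfB.
  by apply: le_Ex => //; exact/bmf_norm/bmfB.
- rewrite /b /b' -ExB// (le_trans (Ex_norm _ _))//; first exact: bmfB.
  by apply: le_Ex => //; exact/bmf_norm/bmfB.
Qed.

End charge_bound.

(** * The local polynomial quantile estimator *)

Lemma sqrtr_sqrM (R : realType) (a b : R) : 0 <= a ->
  Num.sqrt (a ^+ 2 * b) = a * Num.sqrt b.
Proof. by move=> a0; rewrite sqrtrM ?sqr_ge0// sqrtr_sqr ger0_norm. Qed.

Lemma five_terms (R : realFieldType) (a b c e g : R) :
  0 <= a -> 0 <= b -> 0 <= c -> 0 <= e -> 0 <= g ->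
  [/\ 0 < a + b + c + (e + g) + 1, a + b <= a + b + c + (e + g) + 1,
      c <= a + b + c + (e + g) + 1, e <= a + b + c + (e + g) + 1 &
      g <= a + b + c + (e + g) + 1].
Proof. by move=> *; split; lra. Qed.

Lemma radius_le (R : realFieldType) (A0 r y CT B : R) :
  0 <= A0 -> 0 <= r -> 0 <= y -> 0 <= CT -> 0 < B ->
  4 * A0 * (1 + CT) / B * (r + y) <= 1 -> A0 * (r + CT * y) <= B / 4.
Proof.
move=> A00 r0 y0 CT0 B0; rewrite mulrAC ler_pdivrMr// mul1r => h.
have h' : A0 * (r + CT * y) <= A0 * ((1 + CT) * (r + y)).
  by rewrite ler_wpM2l//; have := mulr_ge0 CT0 r0; lra.
by apply: (le_trans h'); lra.
Qed.

Lemma moment_le (R : realFieldType) (b c x : R) : 0 <= b -> 0 <= c -> 1 <= x ->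
  b * (c * x) + 2 * b <= (2 * b * c + 4 * b) * x.
Proof.
move=> b0 c0 x1; have x0 : 0 <= x by exact: le_trans x1.
have v1 : 0 <= b * (c * x) by rewrite !mulr_ge0.
have v2 : b <= b * x by rewrite ler_peMr.
lra.
Qed.

Lemma increment_le (R : realFieldType) (b c x : R) : 0 <= b -> 0 <= c -> 0 <= x ->
  2 * b * (c * x) + 4 * b <= (2 * b * c + 4 * b) * (x + 1).
Proof.
move=> b0 c0 x0.
have := mulr_ge0 b0 x0; have := mulr_ge0 b0 c0; lra.
Qed.

Section model.
Context (R : realType) (d p : nat) (disp : measure_display).
Context (Omega : measurableType disp) (P : probability Omega R).
Local Notation Rd := (borel_rV R d).
Local Notation coefs := {ffun mindex d p -> R}.
Variables (X : {RV P >-> Rd}) (Y : {RV P >-> R}).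
Variables (Xs : nat -> {RV P >-> Rd}) (Ys : nat -> {RV P >-> R}).
Variables (fX : Rd -> R) (X0 : set 'rV[R]_d).
Variables (k : R.-pker Rd ~> R) (f : R -> 'rV[R]_d -> R).
Variables (K : 'rV[R]_d -> R) (hlo hhi : nat -> R) (alo ahi L s : R).
Let S := law_support (distribution P X).
Let F := cond_cdf k.
Let Q := cond_quantile F.
Hypotheses (d0 : (0 < d)%N) (alo0 : 0 < alo) (ahi1 : ahi < 1) (L0 : 0 < L) (s0 : 0 < s).
Hypothesis iid : iid_copies X Y Xs Ys.
Hypothesis kP : cond_law X Y k.
Hypothesis QC : in_C S alo ahi L (s + 1) Q.
Hypothesis sp : (sfloor (s + 1) <= p)%N.
Hypotheses (aX : assumption_X X fX X0) (aF : assumption_F S F f) (aK : assumption_K K hlo hhi).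
Variable x0 : 'rV[R]_d.
Hypotheses (X0x : X0 x0) (loh : alo <= ahi).

Lemma interior_support : interior S x0.
Proof. by case: aX => _ _ _ _; exact. Qed.

Let Zs i w : Rd * R := (Xs i w, Ys i w).

Let mZs i : measurable_fun setT (Zs i).
Proof. by apply: measurable_fun_pair; exact: measurable_funPT. Qed.

Definition clamp (al : R) : R := Num.max alo (Num.min ahi al).

Lemma clamp_in al : alo <= clamp al <= ahi.
Proof. by rewrite /clamp le_max lexx/= ge_max loh ge_min lexx. Qed.

Lemma clamp_id al : alo <= al <= ahi -> clamp al = al.
Proof. by move=> /andP[h1 h2]; rewrite /clamp (min_idPr h2) (max_idPr h1). Qed.

Lemma measurable_clamp : measurable_fun setT clamp.
Proof. by apply: measurable_maxr => //; apply: measurable_minr. Qed.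

(** The transformed observations F(Y|X) are uniform given X. Clamping the level
    makes the process bounded without changing it on the range of interest. *)
Definition pit_score M h n (v : mindex d p) (z : R * Omega) : R :=
  \sum_(i < n) wv x0 K F M h (clamp z.1) (Some v) (Zs i z.2).

Lemma objectiveE n (al h : R) (b : coefs) w : 0 < h ->
  objective K n (Xs ^~ w) (Ys ^~ w) al h x0 b =
  (n%:R * h ^+ d)^-1 * obj x0 K Zs h n al (pscale h b) w.
Proof.
move=> h0; rewrite /objective /obj; congr (_ * _); apply: eq_bigr => i _.
by rewrite -peval_scale /zof scalerA mulfV ?gt_eqF// scale1r.
Qed.

Lemma obj_minimizer n (al h : R) (b : coefs) w : 0 < h -> (0 < n)%N ->
  (forall b' : coefs, objective K n (Xs ^~ w) (Ys ^~ w) al h x0 b <=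
              objective K n (Xs ^~ w) (Ys ^~ w) al h x0 b') ->
  forall b' : coefs, obj x0 K Zs h n al (pscale h b) w <= obj x0 K Zs h n al b' w.
Proof.
move=> h0 n0 bmin b'; have := bmin (pscale h^-1 b'); rewrite !objectiveE//.
rewrite ler_pM2l; last by rewrite invr_gt0 mulr_gt0 ?exprn_gt0// ltr0n.
congr (_ <= obj _ _ _ _ _ _ _ _); apply/ffunP => v.
by rewrite !ffunE mulrA -exprMn mulfV ?gt_eqF// expr1n mul1r.
Qed.

(** [bahadur] for the model: [W] is the first order term, [sW] the sum that enters
    the remainder with the factor h. As functions of the level and the sample they
    are jointly measurable, which allows to integrate over the level. *)
Lemma local_bahadur : exists C hmax : R, [/\ 0 < C, 0 < hmax &
  forall (h : R) (n : nat) (r : R), 0 < h -> h <= hmax -> (3 <= n)%N -> 1 <= ln n%:R :> R ->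
    0 < r -> r <= 1 -> n%:R * h ^+ d * r ^+ 2 = ln n%:R -> C * (r + h `^ (s + 1)) <= 1 ->
  exists (A : set Omega) (W sW : R * Omega -> R),
  [/\ measurable A, 1 - C / n%:R <= fine (P A), bmf W, bmf sW &
   [/\ forall z, 0 <= sW z,
       forall al, Ex P (fun w => `|W (al, w)|) <= C * Num.sqrt (n%:R * h ^+ d),
       forall al, Ex P (fun w => sW (al, w)) <= C * Num.sqrt (n%:R * h ^+ d),
       forall al al', alo <= al <= ahi -> alo <= al' <= ahi ->
         Ex P (fun w => `|W (al', w) - W (al, w)|) <=
           C * (Num.sqrt (n%:R * h ^+ d * `|al' - al|) + 1) &
       forall w, A w -> forall al (b : coefs), alo <= al <= ahi ->
         (forall b' : coefs, objective K n (Xs ^~ w) (Ys ^~ w) al h x0 b <=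
                     objective K n (Xs ^~ w) (Ys ^~ w) al h x0 b') ->
         `|b (mindex0 d p) - Q al x0 + (f (Q al x0) x0 * (n%:R * h ^+ d))^-1 * W (al, w)| <=
           C * (r * Num.sqrt r + h `^ (s + 1) + h / (n%:R * h ^+ d) * sW (al, w))]]].
Proof.
have Sx := interior_support.
have inS x : interior S x -> S x by exact: interior_subset.
have mX : measurable_fun setT X by exact: measurable_funPT.
have mY : measurable_fun setT Y by exact: measurable_funPT.
case: iid => same_law indep.
have cK := kernel_continuous aK; have K0 : forall z, 0 <= K z by case: aK => -[].
have [M [KB [Klo [M1 Klo0 KBP suppK K_ge]]]] := kernel_bounds aK.
have al01 al : alo <= al <= ahi -> 0 < al < 1.
  by move=> /andP[h1 h2]; rewrite (lt_le_trans alo0 h1) (le_lt_trans h2 ahi1).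
have Qmon a a' x : alo <= a -> a <= a' -> a' <= ahi -> S x -> Q a x <= Q a' x.
  move=> h1 h2 h3; apply: (cond_quantile_le aF) => //; first exact: lt_le_trans h1.
  exact: le_lt_trans ahi1.
have s10 : 0 < s + 1 by rewrite addr_gt0.
have [e1 [B [CT [CL [[e10 e1S B0 CT0 CL0] [QB bTP]]]]]] :=
  taylor_coefs d0 L0 s10 sp loh QC Sx Qmon M1.
have e1S' : box x0 e1 `<=` S by move=> x /e1S; exact: inS.
pose Pn : R := #|{: mindex d p}|%:R.
have Pn1 : 1 <= Pn by rewrite /Pn ler1n card_mindex_gt0.
have CU1' : 1 <= CU p M by exact: CU1.
pose yb := 8 * (CU p M * (Pn * B)).
have PnB : B <= Pn * B by rewrite ler_peMl// ltW.
have PB0 : 0 < Pn * B by exact: lt_le_trans PnB.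
have CUB : Pn * B <= CU p M * (Pn * B) by rewrite ler_peMl// ltW.
have Byb : B <= yb by rewrite /yb; lra.
have yb0 : 0 < yb by exact: lt_le_trans Byb.
have [e2 [Cf [cf [L1 [[/andP[e20 e21] Cf0 cf0 L10] [F_le F_ge F_exp f0_ge]]]]]] :=
  cond_cdf_bounds aF Sx e10 e1S' yb0.
have [e3 [CX [cX [e30 CX0 cX0 X_le X_ge]]]] := covariate_bounds aX Sx.
pose eta := Num.min e2 e3.
have eta0 : 0 < eta by rewrite lt_min e20.
have eta2 : eta <= e2 by rewrite ge_min lexx.
have eta3 : eta <= e3 by rewrite ge_min lexx orbT.
have eta1 : eta <= e1 by exact: le_trans e21.
have bx e e' x : e <= e' -> box x0 e x -> box x0 e' x.
  by move=> ee h i; exact: le_trans (h i) ee.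
have F_le' : forall x y y', box x0 eta x -> - yb <= y -> y <= y' -> y' <= yb ->
  0 <= F y' x - F y x <= Cf * (y' - y) by move=> x y y' /(bx _ _ _ eta2); exact: F_le.
have F_ge' : forall x y y', box x0 eta x -> - yb <= y -> y <= y' -> y' <= yb ->
  cf * (y' - y) <= F y' x - F y x by move=> x y y' /(bx _ _ _ eta2); exact: F_ge.
have F_exp' : forall e x y y' q, 0 <= e <= eta -> box x0 e x ->
  `|F y' x - F y x - f q x0 * (y' - y)| <= L1 * (e + `|y - q| + `|y' - q|) * `|y' - y|.
  move=> e x y y' q /andP[h1 h2]; apply: F_exp; rewrite h1/=; exact: le_trans eta2.
have X_le' : forall e, 0 <= e <= eta -> fine (P [set w | box x0 e (X w)]) <= CX * e ^+ d.
  by move=> e /andP[h1 h2]; apply: X_le; rewrite h1 (le_trans h2).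
have X_ge' : forall x1 e, 0 <= e -> box x1 e `<=` box x0 eta ->
    cX * e ^+ d <= fine (P [set w | box x1 e (X w)]).
  by move=> x1 e h1 h2; apply: X_ge => // x /h2; exact: bx.
have bF : forall u : Rd -> R, measurable_fun setT u -> bmf (fun x : Rd => F (u x) x).
  by move=> u; exact: bmf_kcdf.
have dis := disintegration_cdf kP.
have mF2 : measurable_fun setT (fun z : Rd * R => F z.2 z.1) by exact: (measurable_kernel_cdf k).
have disV : forall (om : Rd -> R) al, bmf om -> (forall x, ~ box x0 eta x -> om x = 0) ->
    alo <= al <= ahi ->
    Ex P (fun w => om (X w) * (F (Y w) (X w) <= al)%R%:R) = al * Ex P (fun w => om (X w)).
  move=> om al bom om0 hal; apply: (disintegration_pit kP (q := Q al)) => // x omx.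
  have xb : box x0 eta x by apply: contrapT => /om0 E; rewrite E eqxx in omx.
  have xS : S x by apply: e1S'; exact: bx xb.
  split; first exact: (cond_cdf_quantile aF (al01 _ hal) xS).
  by move=> y; exact: (cond_quantile_leP aF y (al01 _ hal) xS).
have HQ : forall al x y, alo <= al <= ahi -> box x0 eta x -> (F y x <= al) = (y <= Q al x).
  move=> al x y hal xb; apply: (cond_quantile_leP aF y (al01 _ hal)).
  by apply: e1S'; exact: bx xb.
have [Ca Ca0 dual] := design_dual p mX M1 K0 KBP cK suppK d0 cX0 Klo0 X_ge' K_ge.
have [Cb [A0 [Cb0 A00 bah]]] := bahadur mX mY M1 K0 KBP cK suppK bF dis Cf0 F_le' CX0 X_le'
  B0 (lexx yb) mZs same_law indep d0 cf0 cX0 Klo0 F_ge' X_ge' K_ge L10 F_exp' mF2 disV HQ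
  f0_ge (ltW alo0) (ltW ahi1) CL0 (ltW Ca0).
have M0 : 0 < M by exact: lt_le_trans M1.
have KB0 : 0 <= KB by exact: le_trans (K0 0) (KBP 0).
have bw0 : 0 <= bw p M KB by rewrite /bw addr_ge0// mulr_ge0// (le_trans _ CU1').
have C00 : 0 <= C0 d M CX by rewrite /C0 mulr_ge0// exprn_ge0// ltW.
have [Cm CmE] : exists c : R, c = 2 * expR 2 * (2 * bw p M KB * Num.sqrt (C0 d M CX) + 4 * bw p M KB) by eexists.
have Cm0 : 0 <= Cm by rewrite CmE mulr_ge0 ?mulr_ge0 ?expR_ge0// addr_ge0// !mulr_ge0// sqrtr_ge0.
pose C := Cb * (1 + CT) + CT + 4 * A0 * (1 + CT) / B + (Ca + Pn) * Cm + 1.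
have t1 : 0 <= Cb * (1 + CT) by rewrite mulr_ge0 ?(ltW Cb0)// addr_ge0// ltW.
have t2 : 0 <= 4 * A0 * (1 + CT) / B.
  by rewrite divr_ge0 ?(ltW B0)// mulr_ge0 ?addr_ge0 ?(ltW CT0)// mulr_ge0// ltW.
have t3 : 0 <= Ca * Cm by rewrite mulr_ge0// ltW.
have t4 : 0 <= Pn * Cm by rewrite mulr_ge0// (le_trans _ Pn1).
have CE : C = Cb * (1 + CT) + CT + 4 * A0 * (1 + CT) / B + (Ca * Cm + Pn * Cm) + 1.
  by rewrite /C [(Ca + Pn) * _]mulrDl.
have [C0' CbC A0C CmC CmC'] := five_terms t1 (ltW CT0) t2 t3 t4.
rewrite -CE in C0' CbC A0C CmC CmC'.
have CTC : CT <= C by apply: le_trans CbC; rewrite lerDr.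
exists C, (Num.min 1 (eta / M)); split => //.
  by rewrite lt_min ltr01 divr_gt0.
move=> h n r h0 hmax n3 l1 r0 r1 Nr small.
have h1 : h <= 1 by rewrite (le_trans hmax)// ge_min lexx.
have hM : h * M <= eta by rewrite -ler_pdivlMr// (le_trans hmax)// ge_min lexx orbT.
have hd0 : 0 < h ^+ d by rewrite exprn_gt0.
have n0 : (0 < n)%N by exact: leq_trans n3.
have nn : 0 < n%:R :> R by rewrite ltr0n.
have hs0 : 0 <= h `^ (s + 1) by exact: powR_ge0.
pose tau := CT * h `^ (s + 1).
have tau0 : 0 <= tau by rewrite mulr_ge0// ltW.
have Cl (c : R) : c <= C -> c * (r + h `^ (s + 1)) <= 1.
  by move=> cC; apply: le_trans small; rewrite ler_wpM2r// addr_ge0// ltW.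
have tau1 : tau <= 1.
  apply: le_trans (Cl CT CTC).
  by rewrite /tau ler_wpM2l ?(ltW CT0)// lerDr ltW.
have A0B : A0 * (r + tau) <= B / 4.
  exact: (radius_le (ltW A00) (ltW r0) hs0 (ltW CT0) B0 (Cl _ A0C)).
have [A [mA PA HA]] := bah h n r tau h0 hM h1 n3 l1 r0 r1 Nr tau0 tau1 A0B.
have [a [aCa aP]] := dual h h0 hM.
set N := n%:R * h ^+ d in Nr *.
have N0 : 0 < N by rewrite mulr_gt0.
have N1 : 1 <= N.
  apply: (le_trans l1); rewrite -Nr ler_piMr ?(ltW N0)//.
  by rewrite exprn_ile1// ltW.
have sN1 : 1 <= Num.sqrt N by rewrite -sqrtr1 ler_wsqrtr.
pose V := pit_score M h n.
have VE v al w : V v (al, w) = Dv P X Y Zs n (wv x0 K F M h (clamp al) (Some v)) w.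
  by rewrite (Dv_wv mX mY M1 K0 KBP cK suppK Zs mF2 disV _ _ _ h0 hM (clamp_in al)).
have bV v : bmf (V v).
  apply: bmf_sum => i.
  have mw : measurable_fun [set: R * Omega] (fun z => Xs i z.2 : Rd).
    by apply: measurableT_comp; [exact: measurable_funPT|exact: measurable_snd].
  apply: bmfM.
    by apply: (bmf_comp (f := wt x0 K M h (Some v))) => //; exact: (bmf_wt x0 M1 K0 KBP cK suppK h0).
  have mc : measurable_fun [set: R * Omega] (fun z => clamp z.1).
    by apply: measurableT_comp; [exact: measurable_clamp|exact: measurable_fst].
  apply: bmfB.
    apply: bmf_le => //.
    apply: (measurableT_comp mF2 (g := fun z : R * Omega => Zs i z.2)).
    by apply: measurableT_comp; [exact: mZs|exact: measurable_snd].
  split=> //; exists 1 => z; have /andP[c1 c2] := clamp_in z.1.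
  by rewrite ger0_norm ?(le_trans c2 (ltW ahi1))// (le_trans (ltW alo0)).
have bVw v al : bmf (fun w => V v (al, w)).
  by apply: (bmf_comp (f := V v)) => //; exact: measurable_fun_pair.
pose W z := \sum_v a v * V v z.
pose sW z := \sum_v `|V v z|.
have bW : bmf W by apply: bmf_sum => v; exact: bmfZ.
have bsW : bmf sW by apply: bmf_sum => v; exact: bmf_norm.
have bWw al : bmf (fun w => W (al, w)).
  by apply: (bmf_comp (f := W)) => //; exact: measurable_fun_pair.
have EV v al : Ex P (fun w => `|V v (al, w)|) <= Cm * Num.sqrt N.
  rewrite (@eq_Ex _ _ _ P _ (fun w => `|Dv P X Y Zs n (wv x0 K F M h (clamp al) (Some v)) w|)); last first.
    by move=> w; rewrite VE.
  have /andP[c1 c2] := clamp_in al.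
  have c01 : 0 <= clamp al <= 1 by rewrite (le_trans (ltW alo0))// (le_trans c2)// ltW.
  apply: (le_trans (mean_W mX mY M1 K0 KBP cK suppK CX0 X_le' mZs same_law indep mF2 (Some v) n h0 hM c01)).
  rewrite CmE -(mulrA (2 * expR 2)) ler_wpM2l ?mulr_ge0 ?expR_ge0//.
  have -> : n%:R * (bw p M KB ^+ 2 * (C0 d M CX * h ^+ d)) + 4 * bw p M KB ^+ 2 =
    bw p M KB ^+ 2 * (C0 d M CX * N) + (2 * bw p M KB) ^+ 2 by rewrite /N; ring.
  apply: (le_trans (sqrtD_le _ _)); rewrite ?sqr_ge0//.
    by rewrite mulr_ge0 ?sqr_ge0// mulr_ge0// ltW.
  rewrite sqrtr_sqrM// sqrtr_sqr ger0_norm ?mulr_ge0//.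
  have -> : Num.sqrt (C0 d M CX * N) = Num.sqrt (C0 d M CX) * Num.sqrt N by rewrite sqrtrM.
  by apply: moment_le => //; exact: sqrtr_ge0.
have EV2 v al al' : alo <= al <= ahi -> alo <= al' <= ahi ->
    Ex P (fun w => `|V v (al', w) - V v (al, w)|) <= Cm * (Num.sqrt (N * `|al' - al|) + 1).
  move=> hal hal'.
  rewrite (@eq_Ex _ _ _ P _ (fun w => `|Dv P X Y Zs n (wv x0 K F M h al' (Some v)) w -
      Dv P X Y Zs n (wv x0 K F M h al (Some v)) w|)); last first.
    by move=> w; rewrite !VE !clamp_id.
  apply: (le_trans (mean_W_increment mX mY M1 K0 KBP cK suppK CX0 X_le' mZs same_law indep mF2 disV
    (Some v) n h0 hM hal hal' (ltW alo0) (ltW ahi1))).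
  rewrite CmE -(mulrA (2 * expR 2)) ler_wpM2l ?mulr_ge0 ?expR_ge0//.
  have -> : n%:R * (4 * bw p M KB ^+ 2 * (C0 d M CX * h ^+ d) * `|al' - al|) + 16 * bw p M KB ^+ 2 =
    (2 * bw p M KB) ^+ 2 * (C0 d M CX * (N * `|al' - al|)) + (4 * bw p M KB) ^+ 2 by rewrite /N; ring.
  have b20 : 0 <= 2 * bw p M KB by rewrite mulr_ge0.
  have b40 : 0 <= 4 * bw p M KB by rewrite mulr_ge0.
  set del := N * `|al' - al|.
  have del0 : 0 <= del by rewrite mulr_ge0// ltW.
  have e1' : Num.sqrt ((2 * bw p M KB) ^+ 2 * (C0 d M CX * del)) =
      2 * bw p M KB * (Num.sqrt (C0 d M CX) * Num.sqrt del).
    by rewrite (sqrtr_sqrM _ b20) sqrtrM.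
  have e2' : Num.sqrt ((4 * bw p M KB) ^+ 2) = 4 * bw p M KB.
    by rewrite sqrtr_sqr ger0_norm.
  have e0 : 0 <= (2 * bw p M KB) ^+ 2 * (C0 d M CX * del).
    by apply: mulr_ge0; [exact: sqr_ge0|exact: mulr_ge0].
  apply: (le_trans (sqrtD_le e0 (sqr_ge0 _))); rewrite e1' e2'.
  by apply: increment_le => //; exact: sqrtr_ge0.
exists A, W, sW; split => //.
  apply: le_trans PA; rewrite lerD2l lerN2 ler_wpM2r ?invr_ge0//.
  apply: (le_trans _ CbC); rewrite mulrDr mulr1 -addrA lerDl addr_ge0 ?(ltW CT0)//.
  by rewrite mulr_ge0// ltW.
have sqN0 : 0 <= Num.sqrt N by exact: sqrtr_ge0.
have aP0 : 0 <= nrm a by exact: nrm_ge0.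
split.
- by move=> z; exact: sumr_ge0.
- move=> al; apply: (@le_trans _ _ (Ex P (fun w => \sum_v `|a v| * `|V v (al, w)|))).
    apply: le_Ex.
    + by apply: bmf_norm; exact: bWw.
    + by apply: bmf_sum => v; apply/bmfZ/bmf_norm; exact: bVw.
    + move=> w; rewrite (le_trans (ler_norm_sum _ _ _))//.
      by apply: ler_sum => v _; rewrite normrM.
  rewrite Ex_sum; last by move=> v; apply/bmfZ/bmf_norm; exact: bVw.
  apply: (@le_trans _ _ (nrm a * (Cm * Num.sqrt N))).
    rewrite /nrm mulr_suml; apply: ler_sum => v _.
    by rewrite ExZ ?ler_wpM2l//; apply: bmf_norm; exact: bVw.
  rewrite mulrA ler_wpM2r// (le_trans _ CmC)// ler_wpM2r//.
- move=> al; rewrite Ex_sum; last by move=> v; apply: bmf_norm; exact: bVw.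
  apply: (@le_trans _ _ (\sum_(v : mindex d p) Cm * Num.sqrt N)); first by apply: ler_sum.
  by rewrite sumr_const -[leLHS]mulr_natl mulrA ler_wpM2r.
- move=> al al' hal hal'.
  have s10' : 0 <= Num.sqrt (N * `|al' - al|) + 1 by rewrite addr_ge0// sqrtr_ge0.
  apply: (@le_trans _ _ (Ex P (fun w => \sum_v `|a v| * `|V v (al', w) - V v (al, w)|))).
    apply: le_Ex.
    + by apply: bmf_norm; apply: bmfB; exact: bWw.
    + by apply: bmf_sum => v; apply/bmfZ/bmf_norm/bmfB; exact: bVw.
    + move=> w; rewrite /W -sumrB (le_trans (ler_norm_sum _ _ _))//.
      by apply: ler_sum => v _; rewrite -mulrBr normrM.
  rewrite Ex_sum; last by move=> v; apply/bmfZ/bmf_norm/bmfB; exact: bVw.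
  apply: (@le_trans _ _ (nrm a * (Cm * (Num.sqrt (N * `|al' - al|) + 1)))).
    rewrite /nrm mulr_suml; apply: ler_sum => v _.
    by rewrite ExZ ?ler_wpM2l ?EV2//; apply/bmf_norm/bmfB; exact: bVw.
  rewrite mulrA ler_wpM2r// (le_trans _ CmC)// ler_wpM2r//.
- move=> w Aw al b hal bmin.
  have [bT [bTB QbT bTq]] := bTP h al h0 (le_trans hM eta1) hal.
  have QbT' : forall x, box x0 (h * M) x -> `|Q al x - peval (zof x0 h x) bT| <= tau by exact: QbT.
  have qyb : `|Q al x0| <= yb by exact: le_trans (QB _ hal) Byb.
  have bhmin := obj_minimizer h0 n0 bmin.
  have main := HA w Aw al bT a (pscale h b) hal bTB QbT' bTq qyb aCa aP bhmin.
  have sE : \sum_v a v * Dv P X Y Zs n (wv x0 K F M h al (Some v)) w = W (al, w).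
    by rewrite /W; apply: eq_bigr => v _; rewrite VE clamp_id.
  have sE' : \sum_(v : mindex d p) `|Dv P X Y Zs n (wv x0 K F M h al (Some v)) w| = sW (al, w).
    by rewrite /sW; apply: eq_bigr => v _; rewrite VE clamp_id.
  rewrite sE sE' pscale0 -/N in main.
  have x0b : box x0 (h * M) x0 by move=> i; rewrite subrr normr0 mulr_ge0// ltW.
  have := QbT' _ x0b; rewrite /zof subrr scaler0 peval0 distrC => e.
  set g := (f _ _ * N)^-1 * _ in main *.
  have -> : b (mindex0 d p) - Q al x0 + g =
    (b (mindex0 d p) - bT (mindex0 d p) + g) + (bT (mindex0 d p) - Q al x0) by ring.
  apply: (le_trans (ler_normD _ _)); apply: (le_trans (lerD main e)).
  set rr := r * Num.sqrt r; set y := h / N * _.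
  have rr0 : 0 <= rr by rewrite mulr_ge0 ?sqrtr_ge0// ltW.
  have y0 : 0 <= y.
    by apply: mulr_ge0; [rewrite divr_ge0// ltW|exact: sumr_ge0].
  have s3 : 0 <= rr + h `^ (s + 1) + y by rewrite addr_ge0// addr_ge0.
  apply: le_trans (ler_wpM2r s3 CbC).
  have w1 : 0 <= Cb * CT * (rr + y) by rewrite mulr_ge0 ?addr_ge0// mulr_ge0// ltW.
  have w2 : 0 <= CT * (rr + y) by rewrite mulr_ge0 ?addr_ge0// ltW.
  have w3 : 0 <= Cb * h `^ (s + 1) by rewrite mulr_ge0// ltW.
  have -> : (Cb * (1 + CT) + CT) * (rr + h `^ (s + 1) + y) =
    Cb * (rr + tau + y) + tau + (Cb * CT * (rr + y) + CT * (rr + y) + Cb * h `^ (s + 1)).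
    by rewrite /tau; ring.
  by rewrite lerDl !addr_ge0.
Qed.

End model.

(** * The quantile function as a function of the level *)

Section level.
Context (R : realType) (d : nat) (k : R.-pker (borel_rV R d) ~> R).
Let F := cond_cdf k.
Let Q := cond_quantile F.
Variables (S : set 'rV[R]_d) (f : R -> 'rV[R]_d -> R) (alo ahi L s : R).
Hypotheses (alo0 : 0 < alo) (ahi1 : ahi < 1) (L0 : 0 < L) (s0 : 0 < s).
Hypothesis aF : assumption_F S F f.
Hypothesis QC : in_Cq S alo ahi L s Q.
Variable x0 : 'rV[R]_d.
Hypothesis Sx : interior S x0.
Let Sx0 : S x0. Proof. exact: nbhs_singleton. Qed.

Let al01 al : alo <= al <= ahi -> 0 < al < 1.
Proof. by move=> /andP[h1 h2]; rewrite (lt_le_trans alo0 h1) (le_lt_trans h2 ahi1). Qed.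

Lemma quantile_densityE al : alo <= al <= ahi ->
  quantile_density Q al x0 = (f (Q al x0) x0)^-1.
Proof.
move=> hal; rewrite /quantile_density derive1E.
by have [_ ->] := cond_quantile_derive aF (al01 hal) Sx0.
Qed.

(** Quantiles inherit a Lipschitz constant from a lower bound on the density over
    the range of quantiles; so does the reciprocal of the density there. *)
Lemma inv_density_lipschitz : alo <= ahi -> exists2 C : R, 0 < C &
  forall a a', alo <= a <= ahi -> alo <= a' <= ahi ->
  `|(f (Q a x0) x0)^-1| <= C /\
  `|(f (Q a' x0) x0)^-1 - (f (Q a x0) x0)^-1| <= C * `|a' - a|.
Proof.
move=> loh; have [e0 e00 e0S] := interior_box Sx.
pose yb := `|Q alo x0| + `|Q ahi x0| + 1.
have yb0 : 0 < yb by rewrite ltr_wpDl// addr_ge0.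
have [e [Cf [cf [L1 [[/andP[ep _] _ cf0 _] [_ F_ge _ f_ge]]]]]] := cond_cdf_bounds aF Sx e00 e0S yb0.
have [Lf Lf0 fL] := density_lipschitz aF.
have x0b : box x0 e x0 by move=> i; rewrite subrr normr0 ltW.
have hlo : alo <= alo <= ahi by rewrite lexx loh.
have hhi : alo <= ahi <= ahi by rewrite loh lexx.
have Qm a a' : alo <= a <= ahi -> alo <= a' <= ahi -> a <= a' -> Q a x0 <= Q a' x0.
  move=> /al01/andP[h1 _] /al01/andP[_ h2] aa'.
  exact: (cond_quantile_le aF h1 aa' h2 Sx0).
have Qyb a : alo <= a <= ahi -> - yb <= Q a x0 <= yb.
  move=> ha; have /andP[h1 h2] := ha.
  have q1 := Qm _ _ hlo ha h1; have q2 := Qm _ _ ha hhi h2.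
  have := ler_norm (Q ahi x0); have := ler_norm (- Q alo x0); rewrite normrN.
  have := normr_ge0 (Q ahi x0); have := normr_ge0 (Q alo x0).
  by rewrite /yb => *; apply/andP; split; lra.
have QL a a' : alo <= a <= ahi -> alo <= a' <= ahi -> a <= a' ->
    `|Q a' x0 - Q a x0| <= cf^-1 * `|a' - a|.
  move=> ha ha' aa'; have /andP[y1 y2] := Qyb _ ha; have /andP[y3 y4] := Qyb _ ha'.
  have := F_ge x0 _ _ x0b y1 (Qm _ _ ha ha' aa') y4.
  rewrite (cond_cdf_quantile aF (al01 ha) Sx0) (cond_cdf_quantile aF (al01 ha') Sx0) => h.
  by rewrite ger0_norm ?subr_ge0 ?Qm// ger0_norm ?subr_ge0// ler_pdivlMl.
have QL' a a' : alo <= a <= ahi -> alo <= a' <= ahi ->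
    `|Q a' x0 - Q a x0| <= cf^-1 * `|a' - a|.
  move=> ha ha'; have [aa'|/ltW aa'] := leP a a'; first exact: QL.
  by rewrite distrC (distrC a'); exact: QL.
have fc a : alo <= a <= ahi -> cf <= f (Q a x0) x0.
  by move=> ha; apply: f_ge; rewrite ler_norml Qyb.
have ci0 : 0 < cf^-1 by rewrite invr_gt0.
exists (cf^-1 + cf^-1 * cf^-1 * (Lf * cf^-1)).
  by rewrite addr_gt0// !mulr_gt0.
move=> a a' ha ha'; have f1 := fc _ ha; have f2 := fc _ ha'.
have f10 : 0 < f (Q a x0) x0 by exact: lt_le_trans f1.
have f20 : 0 < f (Q a' x0) x0 by exact: lt_le_trans f2.
split.
  rewrite ger0_norm ?invr_ge0 ?(ltW f10)//; apply: (@le_trans _ _ cf^-1).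
    by rewrite lef_pV2.
  by rewrite lerDl !mulr_ge0// ltW.
have -> : (f (Q a' x0) x0)^-1 - (f (Q a x0) x0)^-1 =
  (f (Q a' x0) x0)^-1 * (f (Q a x0) x0)^-1 * (f (Q a x0) x0 - f (Q a' x0) x0).
  by field; rewrite !gt_eqF.
rewrite normrM ger0_norm; last by rewrite mulr_ge0// invr_ge0 ltW.
apply: (@le_trans _ _ (cf^-1 * cf^-1 * (Lf * (cf^-1 * `|a' - a|)))).
  apply: ler_pM => //; first by rewrite mulr_ge0// invr_ge0 ltW.
    by apply: ler_pM; rewrite ?invr_ge0 ?lef_pV2// ltW.
  apply: (le_trans (fL _ _ _ _ Sx0 Sx0)).
  rewrite ler_wpM2l ?(ltW Lf0)// subrr.
  have -> : enorm (0 : 'rV[R]_d) = 0.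
    by rewrite /enorm big1 ?sqrtr0// => i _; rewrite mxE expr0n.
  by rewrite add0r distrC; exact: QL'.
rewrite [leRHS]mulrDl; apply: ler_wpDl; first by rewrite mulr_ge0// ltW.
by rewrite le_eqVlt; apply/orP; left; apply/eqP; ring.
Qed.

(** The coefficient of t is the quantile density, as it is the derivative of the
    quantile function. *)
Lemma level_taylor al : alo < al < ahi -> exists2 c : nat -> R,
  c 1%N = quantile_density Q al x0 &
  forall t, `|t| < Num.min (al - alo) (ahi - al) ->
    `|Q (al + t) x0 - \sum_(i < (sfloor s).+2) c i * t ^+ i| <= L * `|t| `^ (s + 1).
Proof.
move=> hal; have [_ /(_ _ Sx0)[D [D0 DD] DH]] := QC.
have /andP[ms _] := sfloorP s0.
pose DDs j := if j is j'.+1 then D j' else Q ^~ x0.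
exists (fun i => DDs i al / i`!%:R).
  rewrite (_ : 1`! = 1%N)// divr1; apply: D0.
  by case/andP: hal => /ltW h1 /ltW h2; rewrite in_itv/= h1.
apply: (univariate_taylor (b := ahi) hal (ltW L0) (ltW ms)).
- move=> [|j] t jm ht; have /andP[/ltW h1 /ltW h2] := ht.
    have ht' : alo <= t <= ahi by rewrite h1.
    rewrite /= D0 ?in_itv//= quantile_densityE//.
    exact: (cond_quantile_derive aF (al01 ht') Sx0).
  by apply: (is_derive_within_itv ht); apply: DD; rewrite ?in_itv/= ?h1.
- by move=> t t' h1 h2; apply: DH; rewrite in_itv.
Qed.

End level.

(** * The quantile density estimator *)

Section tv_expectation.
Context disp (Omega : measurableType disp) (R : realType) (P : probability Omega R).
Context (nu : {charge set R -> \bar R}).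
Variable E : R * Omega -> R.
Hypotheses (bE : bmf E) (E0 : forall z, 0 <= E z).

Definition tv_mass : R := tv_integral nu (cst 1).

Lemma tv_mass_ge0 : 0 <= tv_mass.
Proof. by rewrite addr_ge0// Ex_ge0. Qed.

Let E' (z : Omega * R) : R := E (z.2, z.1).

Let bE' : bmf E'.
Proof.
by apply: (bmf_comp (f := E)) => //; apply: measurable_fun_pair;
  [exact: measurable_snd|exact: measurable_fst].
Qed.

Let bEx (mu : {finite_measure set R -> \bar R}) :
  bmf (fun w => Ex mu (fun t => E (t, w))).
Proof. exact: (bmf_Ex_section mu bE' (fun z => E0 (z.2, z.1))). Qed.

Lemma bmf_tv_integral : bmf (fun w => tv_integral nu (fun t => E (t, w))).
Proof.
by apply: bmfD; exact: bEx.
Qed.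

(** Tonelli for both parts of the Jordan decomposition. *)
Lemma tv_expectation m : (forall t, Ex P (fun w => E (t, w)) <= m) ->
  Ex P (fun w => tv_integral nu (fun t => E (t, w))) <= tv_mass * m.
Proof.
move=> hm.
have H (mu : {finite_measure set R -> \bar R}) :
    Ex P (fun w => Ex mu (fun t => E (t, w))) <= m * fine (mu setT).
  rewrite -(Ex_fubini mu P bE E0) -Ex_cst; apply: le_Ex => //; last exact: bmf_cst.
  exact: bmf_Ex_section.
rewrite /tv_integral ExD; [|exact: bEx|exact: bEx].
rewrite /tv_mass /tv_integral !Ex_cst !mul1r mulrDl.
by rewrite lerD// mulrC.
Qed.

End tv_expectation.

Lemma charge_support_le (R : realType) (nu : {charge set R -> \bar R}) (T T' : R) :
  T <= T' -> charge_tv nu (~` `[- T, T]) = 0%E -> charge_tv nu (~` `[- T', T']) = 0%E.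
Proof.
move=> TT'; rewrite /charge_tv /charge_variation /=.
have mT (u : R) : measurable (~` `[- u, u]%classic : set R).
  by apply: measurableC; exact: measurable_itv.
have sub : (~` `[- T', T']%classic : set R) `<=` ~` `[- T, T]%classic.
  move=> t /= h1 h2; apply: h1; move: h2; rewrite !in_itv/= => /andP[h1 h2].
  by rewrite (le_trans h2 TT') (le_trans _ h1)// lerN2.
move/eqP; rewrite padde_eq0// => /andP[/eqP h1 /eqP h2].
have H (mu : {measure set R -> \bar R}) : mu (~` `[- T, T]%classic) = 0%E ->
    mu (~` `[- T', T']%classic) = 0%E.
  move=> mu0; apply/eqP; rewrite eq_le measure_ge0 andbT -mu0.
  by apply: le_measure; rewrite ?inE.
by rewrite (H _ h1) (H _ h2) adde0.
Qed.

(** In order: deterministic error and remainder, bias of the polynomial in t, the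
    term with the factor h, the variation of the density in the first order term,
    and the increments of that term. *)
Lemma error_budget (R : realFieldType) (C1 CG L A1 A2 Ch T sT N sN hq shq h rr hs1 pT hsq : R) :
  0 <= C1 -> 0 <= CG -> 0 <= L -> 0 <= A1 -> 0 <= A2 -> 0 <= Ch -> 0 <= T -> 0 <= sT ->
  0 < sN -> N = sN ^+ 2 -> 0 < shq -> shq <= 1 -> hq = shq ^+ 2 -> 0 <= rr -> 0 <= hsq ->
  h <= Ch * hq -> hs1 <= A1 * (hsq * hq) -> pT <= A2 * (hsq * hq) -> N^-1 <= rr ->
  C1 * (rr + hs1) + L * pT + C1 * (h / N) * (C1 * sN) + CG * (hq * T) / N * (C1 * sN) +
    CG / N * (C1 * (sN * shq * sT + 1)) <=
  hq * ((C1 + C1 * A1 + L * A2 + C1 * C1 * Ch + CG * T * C1 + CG * C1 * sT + CG * C1) *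
    (hsq + (sN * shq)^-1 + rr / hq)).
Proof.
move=> C10 CG0 L0 A10 A20 Ch0 T0 sT0 sN0 NE shq0 shq1 hqE rr0 hsq0 hCh hs1E pTE Nrr.
have hq0 : 0 < hq by rewrite hqE exprn_gt0.
pose y := (sN * shq)^-1.
have y0 : 0 < y by rewrite invr_gt0 mulr_gt0.
pose G := hsq * hq + hq * y + rr.
have G1 : hsq * hq <= G by rewrite /G -addrA lerDl addr_ge0// mulr_ge0// ltW.
have G2 : hq * y <= G by rewrite /G addrAC lerDr addr_ge0// mulr_ge0// ltW.
have G3 : rr <= G by rewrite /G lerDr addr_ge0// mulr_ge0// ltW.
have -> : hq * ((C1 + C1 * A1 + L * A2 + C1 * C1 * Ch + CG * T * C1 + CG * C1 * sT + CG * C1) *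
    (hsq + y + rr / hq)) =
  C1 * G + C1 * (A1 * G) + L * (A2 * G) + C1 * C1 * (Ch * G) + CG * T * C1 * G +
    (CG * C1 * sT * G + CG * C1 * G).
  by rewrite /G; field; rewrite gt_eqF.
have hqs : hq / sN <= hq * y.
  rewrite ler_wpM2l ?(ltW hq0)// /y invfM ler_peMr ?invr_ge0 ?(ltW sN0)//.
  by rewrite invf_ge1.
have p2 : hs1 <= A1 * G by apply: (le_trans hs1E); rewrite ler_wpM2l.
have p3 : pT <= A2 * G by apply: (le_trans pTE); rewrite ler_wpM2l.
rewrite mulrDr; apply: lerD; last first.
  have -> : CG / N * (C1 * (sN * shq * sT + 1)) = CG * C1 * sT * (hq * y) + CG * C1 * N^-1.
    by rewrite NE hqE /y; field; rewrite !gt_eqF.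
  apply: lerD; first by rewrite ler_wpM2l// !mulr_ge0.
  by rewrite ler_wpM2l ?mulr_ge0// (le_trans Nrr).
apply: lerD; last first.
  have -> : CG * (hq * T) / N * (C1 * sN) = CG * T * C1 * (hq / sN).
    by rewrite NE; field; rewrite gt_eqF.
  by rewrite ler_wpM2l ?mulr_ge0// (le_trans hqs).
apply: lerD; last first.
  have -> : C1 * (h / N) * (C1 * sN) = C1 * C1 * (h / sN).
    by rewrite NE; field; rewrite gt_eqF.
  rewrite ler_wpM2l ?mulr_ge0//; apply: (@le_trans _ _ (Ch * (hq / sN))).
    by rewrite mulrA ler_wpM2r// invr_ge0 ltW.
  by rewrite ler_wpM2l// (le_trans hqs).
by rewrite lerD ?lerD ?ler_wpM2l.
Qed.

Section error.
Context (R : realType) (d p : nat) (disp : measure_display).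
Context (Omega : measurableType disp) (P : probability Omega R).
Local Notation Rd := (borel_rV R d).
Local Notation coefs := {ffun mindex d p -> R}.
Variables (X : {RV P >-> Rd}) (Y : {RV P >-> R}).
Variables (Xs : nat -> {RV P >-> Rd}) (Ys : nat -> {RV P >-> R}).
Variables (fX : Rd -> R) (X0 : set 'rV[R]_d).
Variables (k : R.-pker Rd ~> R) (f : R -> 'rV[R]_d -> R).
Variables (K : 'rV[R]_d -> R) (hlo hhi : nat -> R) (alo ahi L s : R).
Variable bhat : nat -> R -> R -> 'rV[R]_d -> Omega -> coefs.
Variable Kq : {charge set R -> \bar R}.
Let S := law_support (distribution P X).
Let F := cond_cdf k.
Let Q := cond_quantile F.
Hypotheses (d0 : (0 < d)%N) (alo0 : 0 < alo) (ahi1 : ahi < 1) (L0 : 0 < L) (s0 : 0 < s).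
Hypothesis iid : iid_copies X Y Xs Ys.
Hypothesis kP : cond_law X Y k.
Hypothesis QC : in_Cq S alo ahi L s Q.
Hypothesis sp : (sfloor (s + 1) <= p)%N.
Hypotheses (aX : assumption_X X fX X0) (aF : assumption_F S F f) (aK : assumption_K K hlo hhi).
Hypothesis aKq : assumption_Kq Kq s.
Hypothesis hb : is_local_polynomial K Xs Ys bhat.
Variables (x0 : 'rV[R]_d) (al : R).
Hypotheses (X0x : X0 x0) (hal : alo < al < ahi).

(** Under the integral against [Kq], the quantile at level al + hq t is a polynomial
    in t up to hq^(s+1), from which [Kq] extracts hq times the quantile density. The
    first order term at al is constant in t and disappears, so that only its
    increments are left; their mean is of the order of sqrt (hq / (n h^d)), and
    Markov's inequality bounds them in probability. *)
Lemma quantile_density_error (Ch : R) : 0 <= Ch -> exists C hm : R, [/\ 0 < C, 0 < hm &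
  forall (h hq : R) (n : nat) (r eps : R), 0 < h -> h <= hm -> 0 < hq -> hq <= hm ->
    h <= Ch * hq -> (3 <= n)%N -> 1 <= ln n%:R :> R ->
    0 < r -> r <= 1 -> n%:R * h ^+ d * r ^+ 2 = ln n%:R -> C * (r + h `^ (s + 1)) <= 1 ->
    0 < eps ->
  exists A : set Omega, [/\ measurable A, 1 - C / n%:R - eps <= fine (P A) &
    forall w, A w -> `|q_hat Kq bhat n h hq al x0 w - quantile_density Q al x0| <=
      C / eps * (hq `^ s + (Num.sqrt (n%:R * h ^+ d) * Num.sqrt hq)^-1 + r * Num.sqrt r / hq)]].
Proof.
move=> Ch0; have Sx := interior_support aX X0x.
have /andP[hal1 hal2] := hal.
have loh : alo <= ahi by exact: ltW (lt_trans hal1 hal2).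
have halw : alo <= al <= ahi by rewrite !ltW.
have [C1 [hmax [C10 hmax0 bah]]] :=
  local_bahadur d0 alo0 ahi1 L0 s0 iid kP (proj1 QC) sp aX aF aK X0x loh.
have [CG CG0 HG] := inv_density_lipschitz alo0 ahi1 aF Sx loh.
have [c c1 Qtay] := level_taylor alo0 ahi1 L0 s0 aF QC Sx hal.
case: aKq => -[T0 nuT0] _ nu0 nu1 nuj.
pose T := `|T0| + 1.
have Tp : 0 < T by rewrite ltr_wpDl.
have nuT : charge_tv Kq (~` `[- T, T]) = 0%E.
  by apply: charge_support_le nuT0; rewrite /T (le_trans (ler_norm _))// lerDl.
pose ea := Num.min (al - alo) (ahi - al).
have ea0 : 0 < ea by rewrite lt_min !subr_gt0 hal1.
pose mass := tv_mass Kq.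
have mass0 : 0 <= mass by exact: tv_mass_ge0.
have A10 : 0 <= Ch `^ (s + 1) by exact: powR_ge0.
have A20 : 0 <= T `^ (s + 1) by exact: powR_ge0.
have sT0 : 0 <= Num.sqrt T by exact: sqrtr_ge0.
pose Cr := C1 + C1 * Ch `^ (s + 1) + L * T `^ (s + 1) + C1 * C1 * Ch + CG * T * C1 +
  CG * C1 * Num.sqrt T + CG * C1.
have Cr0 : 0 <= Cr by rewrite /Cr !addr_ge0 ?mulr_ge0 ?mulr_ge0// ltW.
exists (C1 + (mass + 1) * Cr), (Num.min hmax (Num.min 1 (ea / (2 * T)))).
have mC0 : 0 <= (mass + 1) * Cr by rewrite mulr_ge0// addr_ge0.
split; first by rewrite ltr_wpDr.
  by rewrite !lt_min hmax0 ltr01/= divr_gt0// mulr_gt0.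
move=> h hq n r eps h0 hhm hq0 hqm hCh n3 l1 r0 r1 Nr small eps0.
have h_max : h <= hmax by rewrite (le_trans hhm)// ge_min lexx.
have hq1 : hq <= 1 by rewrite (le_trans hqm)// !ge_min lexx orbT.
have hqT : hq * T < ea.
  apply: (@le_lt_trans _ _ (ea / 2)); last by lra.
  rewrite -ler_pdivlMr// (_ : ea / 2 / T = ea / (2 * T)).
    by rewrite (le_trans hqm)// !ge_min lexx !orbT.
  by field; rewrite gt_eqF.
have small1 : C1 * (r + h `^ (s + 1)) <= 1.
  apply: le_trans small; apply: ler_wpM2r; last by rewrite lerDl.
  by rewrite addr_ge0 ?powR_ge0// ltW.
have [A [W [sW [mA PA bW bsW [sW0 EW EsW EdW HA]]]]] :=
  bah h n r h0 h_max n3 l1 r0 r1 Nr small1.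
have n0 : (0 < n)%N by exact: leq_trans n3.
have nn : 0 < n%:R :> R by rewrite ltr0n.
set N := n%:R * h ^+ d in Nr EW EsW EdW HA *.
have N0 : 0 < N by rewrite mulr_gt0// exprn_gt0.
set sN := Num.sqrt N in EW EsW *.
have sNp : 0 < sN by rewrite sqrtr_gt0.
have NE : N = sN ^+ 2 by rewrite sqr_sqrtr// ltW.
set shq := Num.sqrt hq.
have shq0 : 0 < shq by rewrite sqrtr_gt0.
have hqE : hq = shq ^+ 2 by rewrite sqr_sqrtr// ltW.
have shq1 : shq <= 1 by rewrite -sqrtr1 ler_wsqrtr.
set rr := r * Num.sqrt r in HA *.
have rr0 : 0 < rr by rewrite mulr_gt0// sqrtr_gt0.
have Nrr : N^-1 <= rr.
  have rs : r <= Num.sqrt r.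
    by rewrite -{1}(ger0_norm (ltW r0)) -sqrtr_sqr ler_wsqrtr// expr2 ler_piMr// ltW.
  apply: (@le_trans _ _ (r ^+ 2)); last by rewrite expr2 ler_wpM2l// ltW.
  by rewrite -[leLHS]mul1r ler_pdivrMr// mulrC Nr.
pose G a := (f (Q a x0) x0)^-1.
pose k0 := C1 * (rr + h `^ (s + 1)) + L * (hq * T) `^ (s + 1).
pose k1 := C1 * (h / N).
pose k2 := CG * (hq * T) / N.
pose k3 := CG / N.
have k00 : 0 < k0.
  rewrite /k0 ltr_wpDr ?mulr_ge0 ?powR_ge0 ?(ltW L0)// mulr_gt0// ltr_wpDr//.
  exact: powR_ge0.
have k10 : 0 <= k1 by rewrite /k1 mulr_ge0 ?(ltW C10)// divr_ge0// ltW.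
have k20 : 0 <= k2 by rewrite /k2 divr_ge0 ?(ltW N0)// mulr_ge0 ?(ltW CG0)// mulr_ge0// ltW.
have k30 : 0 <= k3 by rewrite /k3 divr_ge0// ltW.
pose m := k0 + k1 * (C1 * sN) + k2 * (C1 * sN) + k3 * (C1 * (sN * shq * Num.sqrt T + 1)).
have m0 : 0 < m.
  have v1 : 0 <= C1 * sN by rewrite mulr_ge0// ltW.
  have v2 : 0 <= C1 * (sN * shq * Num.sqrt T + 1).
    by rewrite mulr_ge0 ?(ltW C10)// addr_ge0// mulr_ge0// mulr_ge0// ltW.
  have v3 : 0 <= k1 * (C1 * sN) by exact: mulr_ge0.
  have v4 : 0 <= k2 * (C1 * sN) by exact: mulr_ge0.
  have v5 : 0 <= k3 * (C1 * (sN * shq * Num.sqrt T + 1)) by exact: mulr_ge0.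
  exact: (ltr_wpDr v5 (ltr_wpDr v4 (ltr_wpDr v3 k00))).
have hqs1 : hq `^ s * hq = hq `^ (s + 1).
  by rewrite powRD ?powRr1 ?(ltW hq0)// (gt_eqF hq0) implybT.
have budget : m <= hq * (Cr * (hq `^ s + (sN * shq)^-1 + rr / hq)).
  apply: error_budget => //; try exact: ltW.
  - exact: powR_ge0.
  - rewrite hqs1 -powRM ?(ltW hq0)//.
    by apply: ge0_ler_powR; rewrite ?nnegrE ?addr_ge0 ?mulr_ge0// ltW.
  - by rewrite hqs1 -powRM ?(ltW hq0) ?(ltW Tp)// mulrC.
pose I : R -> R := \1_(`[- T, T]%classic).
have mI : measurable_fun setT I by apply: measurable_indic; exact: measurable_itv.
have IE t : `|t| <= T -> I t = 1.
  by move=> tT; rewrite /I indicE mem_set//= in_itv/= -ler_norml.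
have IN t : ~~ (`|t| <= T) -> I t = 0.
  by move=> tT; rewrite /I indicE memNset//= in_itv/= -ler_norml; exact/negP.
have I01 t : 0 <= I t <= 1 by rewrite /I indicE; case: (_ \in _); rewrite /= ?lexx ler01.
pose at_ t := al + hq * t.
have at_in t : `|t| <= T -> `|hq * t| < ea.
  move=> tT; apply: le_lt_trans hqT.
  by rewrite normrM gtr0_norm// ler_wpM2l// ltW.
have at_ab t : `|t| <= T -> alo <= at_ t <= ahi.
  move=> /at_in; rewrite /ea lt_min /at_; have := ler_norm (hq * t); have := ler_norm (- (hq * t)).
  rewrite normrN => u1 u2 /andP[u3 u4]; apply/andP; split; lra.
(* the integrand after removal of the polynomial and of the constant first order term *)
pose E0 z := k0 + k1 * sW (at_ z.1, z.2) + k2 * `|W (at_ z.1, z.2)| +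
  k3 * `|W (at_ z.1, z.2) - W (al, z.2)| : R.
pose E (z : R * Omega) := I z.1 * E0 z.
have E00 z : 0 <= E0 z.
  have k0ge := ltW k00; apply: addr_ge0; last exact: mulr_ge0.
  by apply: addr_ge0; [apply: addr_ge0 => //; exact: mulr_ge0|exact: mulr_ge0].
have Ege0 z : 0 <= E z by rewrite /E mulr_ge0//; have /andP[] := I01 z.1.
have mat : measurable_fun [set: R * Omega] (fun z => (at_ z.1, z.2)).
  apply: measurable_fun_pair; last exact: measurable_snd.
  apply: measurable_funD => //; apply: measurable_funM => //; exact: measurable_fst.
have mal : measurable_fun [set: R * Omega] (fun z => (al, z.2)).
  by apply: measurable_fun_pair => //; exact: measurable_snd.
have bE0 : bmf E0.
  have b1 : bmf (fun z : R * Omega => W (at_ z.1, z.2)) by exact: (bmf_comp (f := W) mat).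
  apply: bmfD; first apply: bmfD; first apply: bmfD.
  - exact: bmf_cst.
  - by apply: bmfZ; exact: (bmf_comp (f := sW) mat).
  - by apply: bmfZ; exact: bmf_norm.
  - by apply: bmfZ; apply: bmf_norm; apply: bmfB => //; exact: (bmf_comp (f := W) mal).
have bE : bmf E.
  apply: bmfM => //; apply: (bmf_comp (f := I) (phi := fst)); first exact: measurable_fst.
  by apply: bmf_indic; exact: measurable_itv.
have msec t : measurable_fun [set: Omega] (fun w => (t, w) : R * Omega).
  exact: measurable_fun_pair.
have bWs t : bmf (fun w => W (t, w)) by exact: (bmf_comp (f := W) (msec t)).
have bsWs t : bmf (fun w => sW (t, w)) by exact: (bmf_comp (f := sW) (msec t)).
have EE t : Ex P (fun w => E (t, w)) <= m.
  rewrite /E/=; case: (boolP (`|t| <= T)) => tT; last first.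
    under eq_Ex do rewrite IN// mul0r.
    by rewrite Ex_cst mul0r ltW.
  under eq_Ex do rewrite IE// mul1r.
  rewrite /E0 /=; have b1 := bWs (at_ t); have b2 := bWs al; have b3 := bsWs (at_ t).
  have n1 := bmf_norm b1; have n2 := bmf_norm (bmfB b1 b2).
  have u0 := @bmf_cst _ Omega R k0; have u1 := bmfZ k1 b3.
  have u2 := bmfZ k2 n1; have u3 := bmfZ k3 n2.
  rewrite (ExD P (bmfD (bmfD u0 u1) u2) u3) (ExD P (bmfD u0 u1) u2) (ExD P u0 u1).
  rewrite Ex1 (ExZ P _ b3) (ExZ P _ n1) (ExZ P _ n2).
  rewrite /m; apply: lerD; first apply: lerD; first apply: lerD => //.
  - by rewrite ler_wpM2l// EsW.
  - by rewrite ler_wpM2l// EW.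
  - rewrite ler_wpM2l//; apply: (le_trans (EdW _ _ halw (at_ab _ tT))).
    rewrite ler_wpM2l ?(ltW C10)// lerD2r -mulrA /sN -!sqrtrM ?(ltW N0) ?(ltW hq0)//.
    rewrite ler_wsqrtr// ler_wpM2l ?(ltW N0)// /at_ addrAC subrr add0r.
    by rewrite normrM gtr0_norm// ler_wpM2l// ltW.
pose V w := tv_integral Kq (fun t => E (t, w)).
have bV : bmf V by exact: bmf_tv_integral.
have V0 w : 0 <= V w by rewrite /V addr_ge0// Ex_ge0.
have EV : Ex P V <= mass * m by exact: tv_expectation.
pose a := (mass + 1) * m / eps.
have m10 : 0 < (mass + 1) * m by rewrite mulr_gt0// ltr_wpDl.
have a0 : 0 < a by rewrite divr_gt0.
have mark := Ex_markov P bV V0 a0.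
have mB : measurable [set w | a <= V w] by apply: measurable_le_set => //; case: bV.
exists (A `&` ~` [set w | a <= V w]); split.
- by apply: measurableI => //; exact: measurableC.
- have PB : 1 - eps <= fine (P (~` [set w | a <= V w])).
    rewrite probability_setC// fineB ?fin_num_measure//= lerD2l lerN2.
    apply: (le_trans mark); rewrite ler_pdivrMr// /a mulrCA divff ?gt_eqF// mulr1.
    by apply: (le_trans EV); rewrite ler_wpM2r ?(ltW m0)// lerDl.
  have PA' : 1 - (C1 + (mass + 1) * Cr) / n%:R <= fine (P A).
    by apply: le_trans PA; rewrite lerD2l lerN2 ler_wpM2r ?invr_ge0// lerDl.
  have := probability_setI_ge mA (measurableC mB) PA' PB.
  by rewrite opprD addrA.
move=> w [Aw]; rewrite /= => /negP; rewrite -ltNge => Vw.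
pose phi t := Q_hat bhat n h (at_ t) x0 w.
have mphi : measurable_fun setT phi.
  have [_ mb] := hb n x0 w h0.
  apply: (measurableT_comp (mb (mindex0 d p)) (g := at_)).
  by apply: measurable_funD => //; exact: measurable_funM.
pose c' i := if i is i'.+1 then c i * hq ^+ i else c 0%N - G al / N * W (al, w).
have c'E t : \sum_(i < (sfloor s).+2) c' i * t ^+ i =
    \sum_(i < (sfloor s).+2) c i * (hq * t) ^+ i - G al / N * W (al, w).
  rewrite big_ord_recl [in RHS]big_ord_recl /= !expr0 !mulr1 addrAC; congr (_ - _).
  by congr (_ + _); apply: eq_bigr => i _; rewrite exprMn mulrA.
have hphi t : `|t| <= T -> `|phi t - \sum_(i < (sfloor s).+2) c' i * t ^+ i| <= E (t, w).
  move=> tT; rewrite /E /= IE// mul1r c'E.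
  have hat := at_ab _ tT.
  have at01 : 0 < at_ t < 1.
    by have /andP[u1 u2] := hat; rewrite (lt_le_trans alo0 u1) (le_lt_trans u2 ahi1).
  have [bmin _] := hb n x0 w h0.
  have e1 := HA w Aw (at_ t) (bhat n (at_ t) h x0 w) hat (bmin _ at01).
  have e2 := Qtay (hq * t) (at_in _ tT).
  have [G0 Gl] := HG _ _ halw hat.
  rewrite -/(G al) in G0 Gl; rewrite -/(G (at_ t)) in Gl.
  have GN a1 : (f (Q a1 x0) x0 * N)^-1 = G a1 / N by rewrite invfM.
  rewrite GN in e1; set b0 := bhat _ _ _ _ _ _ in e1.
  set Wt := W (at_ t, w) in e1; set qt := \sum_(i < _) _ in e2 *.
  have -> : phi t - (qt - G al / N * W (al, w)) =
     (b0 - Q (at_ t) x0 + G (at_ t) / N * Wt) + (Q (at_ t) x0 - qt) -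
     ((G (at_ t) - G al) / N * Wt + G al / N * (Wt - W (al, w))).
    by rewrite /phi /Q_hat -/b0; ring.
  rewrite (le_trans (ler_normB _ _))// /E0/= -/Wt.
  have -> : k0 + k1 * sW (at_ t, w) + k2 * `|Wt| + k3 * `|Wt - W (al, w)| =
    (C1 * (rr + h `^ (s + 1) + h / N * sW (at_ t, w)) + L * (hq * T) `^ (s + 1)) +
    (k2 * `|Wt| + k3 * `|Wt - W (al, w)|) by rewrite /k0 /k1; ring.
  apply: lerD.
    rewrite (le_trans (ler_normD _ _))// lerD//; apply: (le_trans e2).
    rewrite ler_wpM2l ?(ltW L0)//; apply: ge0_ler_powR.
    + by rewrite addr_ge0// ltW.
    + by rewrite nnegrE.
    + by rewrite nnegrE mulr_ge0// ltW.
    + by rewrite normrM gtr0_norm// ler_wpM2l// ltW.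
  have Ni0 : 0 < N^-1 by rewrite invr_gt0.
  rewrite (le_trans (ler_normD _ _))//; apply: lerD; rewrite !normrM.
    rewrite ler_wpM2r// (gtr0_norm Ni0) /k2 ler_wpM2r ?(ltW Ni0)//.
    apply: (le_trans Gl); rewrite ler_wpM2l ?(ltW CG0)// /at_ addrAC subrr add0r.
    by rewrite normrM gtr0_norm// ler_wpM2l// ltW.
  by rewrite ler_wpM2r// (gtr0_norm Ni0) /k3 ler_wpM2r ?(ltW Ni0).
have bEw : bmf (fun t => E (t, w)).
  by apply: (bmf_comp (f := E) (phi := fun t => (t, w))) => //; exact: measurable_fun_pair.
have main := charge_linear_coef nuT nu0 nu1 nuj mphi bEw hphi (fun t => Ege0 (t, w)).
rewrite /= c1 expr1 in main.
rewrite /q_hat; have -> : hq^-1 * charge_integral Kq (fun t => Q_hat bhat n h (al + hq * t) x0 w) -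
  quantile_density Q al x0 = hq^-1 * (charge_integral Kq phi - quantile_density Q al x0 * hq).
  by rewrite /phi /at_; field; rewrite gt_eqF.
rewrite normrM gtr0_norm ?invr_gt0// ler_pdivrMl//.
apply: (le_trans main); apply: (le_trans (ltW Vw)).
rewrite /a ler_pdivrMr//.
have -> : hq * ((C1 + (mass + 1) * Cr) / eps * (hq `^ s + (sN * shq)^-1 + rr / hq)) * eps =
  (C1 + (mass + 1) * Cr) * (hq * (hq `^ s + (sN * shq)^-1 + rr / hq)).
  by field; rewrite !gt_eqF.
set D := hq * (_ + _ + _).
have D0 : 0 <= D.
  rewrite mulr_ge0 ?(ltW hq0)// !addr_ge0 ?powR_ge0//; last by rewrite divr_ge0// ltW.
  by rewrite invr_ge0 mulr_ge0// ltW.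
apply: (@le_trans _ _ ((mass + 1) * Cr * D)).
  rewrite -(mulrA (mass + 1)); apply: ler_wpM2l; first by rewrite addr_ge0.
  by apply: (le_trans budget); rewrite /D mulrCA.
by rewrite ler_wpM2r// lerDr ltW.
Qed.

End error.

(** The error is shared between the two remainders in proportion to their rates. *)
Lemma OP_split (R : realType) disp (Omega : measurableType disp) (P : probability Omega R)
    (Z : nat -> Omega -> R) (a1 a2 c : nat -> R) :
  (forall n, 0 < a1 n) -> (forall n, 0 <= a2 n) -> (forall n, 0 <= c n) ->
  OP P Z (fun n => a1 n + c n * a2 n) ->
  exists R1 R2, [/\ OP P R1 a1, OP P R2 a2 &
    forall n w, Z n w = R1 n w + c n * R2 n w].
Proof.
move=> a10 a20 c0 HZ.
have t0 n : 0 < a1 n + c n * a2 n by rewrite ltr_pwDl// mulr_ge0.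
exists (fun n w => Z n w / (a1 n + c n * a2 n) * a1 n),
  (fun n w => Z n w / (a1 n + c n * a2 n) * a2 n); split.
- move=> e /HZ[M HM]; exists M; apply: filterS HM => n [A [mA PA HA]].
  exists A; split => // w /HA h; rewrite normrM (gtr0_norm (a10 n)).
  apply: ler_wpM2r; first exact: ltW.
  by rewrite normrM normfV (gtr0_norm (t0 n)) ler_pdivrMr.
- move=> e /HZ[M HM]; exists M; apply: filterS HM => n [A [mA PA HA]].
  exists A; split => // w /HA h; rewrite normrM (ger0_norm (a20 n)).
  apply: ler_wpM2r => //.
  by rewrite normrM normfV (gtr0_norm (t0 n)) ler_pdivrMr.
- move=> n w; have t1 := t0 n; move: (Z n w) => z.
  by rewrite mulrCA -mulrDr divfK// gt_eqF.
Qed.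

(** Both sides are monomials in the fourth roots of l and N and the square root
    of hq. *)
Lemma rate_identity (R : realType) (l N hq : R) : 0 < l -> 0 < N -> 0 < hq ->
  l `^ (3 / 4) / (N * hq ^+ 2) `^ (1 / 4) * ((N * hq) `^ (1 / 2))^-1 =
  Num.sqrt (l / N) * Num.sqrt (Num.sqrt (l / N)) / hq.
Proof.
move=> l0 N0 hq0.
have sq4 (x : R) : 0 < x -> exists2 y, 0 < y & x = y ^+ 4.
  move=> x0; exists (Num.sqrt (Num.sqrt x)); first by rewrite !sqrtr_gt0.
  by rewrite (exprM _ 2 2) !sqr_sqrtr ?sqrtr_ge0// ltW.
have [u u0 uE] := sq4 l l0; have [v v0 vE] := sq4 N N0.
have [z z0 zE] : exists2 z, 0 < z & hq = z ^+ 2.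
  by exists (Num.sqrt hq); rewrite ?sqrtr_gt0// sqr_sqrtr// ltW.
have root (y : R) m (e : R) k : 0 < y -> m%:R * e = k%:R -> (y ^+ m) `^ e = y ^+ k.
  by move=> y0 me; rewrite -!powR_mulrn ?(ltW y0)// -powRrM me.
have -> : l `^ (3 / 4) = u ^+ 3 by rewrite uE; apply: root => //; field.
have -> : (N * hq ^+ 2) `^ (1 / 4) = v * z.
  have -> : N * hq ^+ 2 = (v * z) ^+ 4 by rewrite vE zE; ring.
  by rewrite (root _ _ _ 1%N) ?expr1 ?mulr_gt0//; field.
have -> : (N * hq) `^ (1 / 2) = v ^+ 2 * z.
  have -> : N * hq = (v ^+ 2 * z) ^+ 2 by rewrite vE zE; ring.
  by rewrite (root _ _ _ 1%N) ?expr1 ?mulr_gt0 ?exprn_gt0//; field.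
have -> : l / N = ((u / v) ^+ 2) ^+ 2 by rewrite uE vE; field; rewrite gt_eqF.
have uv0 : 0 < u / v by rewrite divr_gt0.
rewrite sqrtr_sqr ger0_norm ?sqr_ge0// sqrtr_sqr ger0_norm ?(ltW uv0)// zE.
by field; rewrite !gt_eqF.
Qed.

Theorem proposition3 (R : realType) (d p : nat) (disp : measure_display)
    (Omega : measurableType disp) (P : probability Omega R)
    (X : {RV P >-> borel_rV R d}) (Y : {RV P >-> R})
    (Xs : nat -> {RV P >-> borel_rV R d}) (Ys : nat -> {RV P >-> R})
    (fX : borel_rV R d -> R) (X0 : set 'rV[R]_d)
    (k : R.-pker (borel_rV R d) ~> R) (f : R -> 'rV[R]_d -> R)
    (K : 'rV[R]_d -> R) (hlo hhi h hq : nat -> R)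
    (bhat : nat -> R -> R -> 'rV[R]_d -> Omega -> {ffun mindex d p -> R})
    (Kq : {charge set R -> \bar R}) (alo ahi L s : R) :
  let S := law_support (distribution P X) in
  let F := cond_cdf k in
  let Q := cond_quantile F in
  (0 < d)%N ->
  0 < alo -> ahi < 1 ->
  0 < L -> 0 < s ->
  iid_copies X Y Xs Ys ->
  cond_law X Y k ->
  in_Cq S alo ahi L s Q ->
  (sfloor (s + 1) <= p)%N ->
  assumption_X X fX X0 ->
  assumption_F S F f ->
  assumption_K K hlo hhi ->
  (forall n, hlo n <= h n <= hhi n) ->
  (forall n, 0 < h n) -> (forall n, 0 < hq n) ->
  h =O_\oo hq ->
  hq @ \oo --> (0 : R) ->
  (fun n : nat => ln n%:R / (n%:R * h n ^+ d)) @ \oo --> (0 : R) ->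
  assumption_Kq Kq s ->
  is_local_polynomial K Xs Ys bhat ->
  forall x alpha, X0 x -> alo < alpha < ahi ->
  exists R1 R2 : nat -> Omega -> R,
    [/\ OP P R1 (fun n : nat =>
          hq n `^ s + ((n%:R * h n ^+ d * hq n) `^ (1 / 2))^-1),
        OP P R2 (fun n : nat => ((n%:R * hq n * h n ^+ d) `^ (1 / 2))^-1) &
        forall (n : nat) w,
          q_hat Kq bhat n (h n) (hq n) alpha x w =
          quantile_density Q alpha x + R1 n w +
          ln n%:R `^ (3 / 4) / (n%:R * h n ^+ d * hq n ^+ 2) `^ (1 / 4)
            * R2 n w].
Proof.
move=> S F Q d0 alo0 ahi1 L0 s0 iid kP QC sp aX aF aK _ h0 hq0 hO hqc rc aKq hb x al X0x hal.
have /eqO_exP[Ch Ch0 hCh] := hO.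
have [C [hm [C0 hm0 err]]] := quantile_density_error d0 alo0 ahi1 L0 s0 iid kP QC sp aX aF aK
  aKq hb X0x hal (ltW Ch0).
pose Z n w := q_hat Kq bhat n (h n) (hq n) al x w - quantile_density Q al x.
pose a1 n := hq n `^ s + ((n%:R * h n ^+ d * hq n) `^ (1 / 2))^-1.
pose a2 n : R := ((n%:R * hq n * h n ^+ d) `^ (1 / 2))^-1.
pose c n : R := ln n%:R `^ (3 / 4) / (n%:R * h n ^+ d * hq n ^+ 2) `^ (1 / 4).
suff OPZ : OP P Z (fun n => a1 n + c n * a2 n).
  have a10 n : 0 < a1 n by rewrite ltr_pwDl ?powR_gt0// invr_ge0 powR_ge0.
  have a20 n : 0 <= a2 n by rewrite invr_ge0 powR_ge0.
  have c0 n : 0 <= c n by rewrite divr_ge0 ?powR_ge0.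
  have [R1 [R2 [OP1 OP2 ZE]]] := OP_split a10 a20 c0 OPZ.
  by exists R1, R2; split => // n w; rewrite -addrA -ZE /Z addrC subrK.
move=> eps eps0; have e20 : 0 < eps / 2 by rewrite divr_gt0.
exists (C / (eps / 2)).
have C2 : 0 < (2 * C)^-1 by rewrite invr_gt0 mulr_gt0.
pose hmin := Num.min (Num.min hm 1) (2 * C)^-1.
have hmin0 : 0 < hmin by rewrite !lt_min hm0 ltr01.
pose rmin := Num.min 1 (2 * C)^-1.
have rmin0 : 0 < rmin by rewrite !lt_min ltr01.
have nbig (y : R) : \forall n \near \oo, y <= n%:R.
  exists (Num.truncn y).+1 => // n /= yn; apply: (le_trans (ltW (truncnS_gt y))).
  by rewrite ler_nat.
have hq_small (y : R) : 0 < y -> \forall n \near \oo, hq n <= y.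
  move=> y0; have /cvgrPdist_le/(_ _ y0) := hqc; apply: filterS => m.
  by rewrite sub0r normrN ger0_norm// ltW.
have rc_small (y : R) : 0 < y -> \forall n \near \oo, ln n%:R / (n%:R * h n ^+ d) <= y.
  move=> y0; have /cvgrPdist_le/(_ _ y0) := rc; apply: filterS => m.
  by rewrite sub0r normrN => /(le_trans (ler_norm _)).
near=> n.
have hn := h0 n; have hqn := hq0 n.
have n3 : (3 <= n)%N by near: n; exists 3%N.
have nn : 0 < n%:R :> R by rewrite ltr0n (leq_trans _ n3).
have l1 : 1 <= ln n%:R :> R.
  rewrite -[leLHS](expRK (1 : R)) ler_ln ?posrE ?expR_gt0//.
  by near: n; exact: nbig.
have hChn : h n <= Ch * hq n.
  have : `|h n| <= Ch * `|hq n| by near: n.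
  by rewrite !gtr0_norm.
have hqm : hq n <= Num.min hm (hmin / Ch).
  by near: n; apply: hq_small; rewrite lt_min hm0/= divr_gt0.
have hqm1 : hq n <= hm by rewrite (le_trans hqm)// ge_min lexx.
have hnm : h n <= hmin.
  apply: (le_trans hChn); rewrite mulrC -ler_pdivlMr// (le_trans hqm)//.
  by rewrite ge_min lexx orbT.
set N := n%:R * h n ^+ d.
have N0 : 0 < N by rewrite mulr_gt0// exprn_gt0.
pose r := Num.sqrt (ln n%:R / N).
have lN0 : 0 < ln n%:R / N by rewrite divr_gt0// (lt_le_trans _ l1).
have r0 : 0 < r by rewrite sqrtr_gt0.
have rm : r <= rmin.
  have -> : rmin = Num.sqrt (rmin ^+ 2) by rewrite sqrtr_sqr ger0_norm// ltW.
  by rewrite ler_wsqrtr// /N; near: n; apply: rc_small; rewrite exprn_gt0.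
have Nr : N * r ^+ 2 = ln n%:R by rewrite sqr_sqrtr ?(ltW lN0)// mulrCA divff ?mulr1// gt_eqF.
have r1 : r <= 1 by rewrite (le_trans rm)// ge_min lexx.
have hm1 : h n <= hm by rewrite (le_trans hnm)// !ge_min lexx.
have h1 : h n <= 1 by rewrite (le_trans hnm)// !ge_min lexx orbT.
have small : C * (r + h n `^ (s + 1)) <= 1.
  have e1 : r <= (2 * C)^-1 by rewrite (le_trans rm)// ge_min lexx orbT.
  have e2 : h n `^ (s + 1) <= (2 * C)^-1.
    apply: (@le_trans _ _ (h n)); last by rewrite (le_trans hnm)// !ge_min lexx !orbT.
    rewrite -[leRHS]powRr1 ?(ltW hn)//; apply: ger_powR; last by rewrite lerDr ltW.
    by rewrite hn.
  apply: (@le_trans _ _ (C * ((2 * C)^-1 + (2 * C)^-1))); last first.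
    by rewrite le_eqVlt; apply/orP; left; apply/eqP; field; rewrite gt_eqF.
  by rewrite ler_wpM2l ?(ltW C0)// lerD.
have [A [mA PA HA]] := err (h n) (hq n) n r (eps / 2) hn hm1 hqn hqm1 hChn n3 l1 r0 r1 Nr small e20.
exists A; split => //.
- rewrite -[leRHS]fineK ?fin_num_measure// lee_fin; apply: le_trans PA.
  have Cn : C / n%:R <= eps / 2.
    rewrite ler_pdivrMr// mulrC -ler_pdivrMr//; near: n; exact: nbig.
  lra.
- move=> w /HA; rewrite -/(Z n w) => /le_trans; apply.
  rewrite le_eqVlt; apply/orP; left; apply/eqP; congr (_ * _).
  have sE : (Num.sqrt N * Num.sqrt (hq n))^-1 = ((N * hq n) `^ (1 / 2))^-1.
    have Nq0 : 0 <= N * hq n by rewrite mulr_ge0// ltW.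
    by rewrite -sqrtrM ?(ltW N0)// -powR12_sqrt// [1 / 2]div1r.
  rewrite -/N sE /a1 -/N /c /a2 -/N; congr (_ + _).
  have -> : n%:R * hq n * h n ^+ d = N * hq n by rewrite /N; ring.
  by rewrite rate_identity// (lt_le_trans _ l1).
Unshelve. all: by end_near. Qed.
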